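(* Let $\Delta\subset\mathbb{C}$ be a neighborhood of the origin $0$. Let $(M,D)$ be a contact manifold and let $\{Z_t\subset M,\ t\in\Delta\}$ be a holomorphic family of Legendrian subvarieties parametrized by $\Delta$. Assume that $Z_t$ is normal for every $t\in\Delta$. Then for any $x_0\in Z_0$ there exist a neighborhood $\Delta'\subset\Delta$ of $0$ and a holomorphic arc $\{x_t\in Z_t,\ t\in\Delta'\}$ (that is, a holomorphic map $\Delta'\to M$, $t\mapsto x_t$, with $x_t\in Z_t$ for all $t$ and with the given value $x_0$ at $t=0$) such that for each $t\in\Delta'$ the Legendrian singularities $x_0\in Z_0\subset M$ and $x_t\in Z_t\subset M$ are contactomorphic.
   Context: All objects are complex analytic (holomorphic). A contact structure on a complex manifold $M$ of dimension $2m+1$ ($m\ge1$) is a holomorphic subbundle $D\subset T_M$ of rank $2m$ such that the Frobenius bracket homomorphism $\wedge^2 D\to T_M/D$ is nondegenerate at every point; $(M,D)$ is then a contact manifold. A biholomorphic map $\varphi:M_1\to M_2$ between contact manifolds $(M_1,D_1),(M_2,D_2)$ is a contactomorphism if $d\varphi(D_1)=D_2$. A Legendrian subvariety $Z\subset M$ is an analytic (reduced, possibly singular) subvariety of pure dimension $m$ with $T_{Z,z}\subset D_z$ for every nonsingular point $z$ of $Z$. The germ of $Z$ at a point $x\in Z$ is called a Legendrian singularity. Two Legendrian singularities $x_i\in Z_i\subset (M_i,D_i)$, $i=1,2$, are contactomorphic if there are open neighborhoods $U_i\subset M_i$ of $x_i$ and a contactomorphism $\varphi:U_1\to U_2$ with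 $\varphi(x_1)=x_2$ and $\varphi(Z_1\cap U_1)=Z_2\cap U_2$. A holomorphic family of Legendrian subvarieties $\{Z_t\subset M,\ t\in\Delta\}$ is given by a closed analytic subspace $\mathcal{Z}\subset M\times\Delta$, flat over $\Delta$, whose (scheme-theoretic) fiber over each $t\in\Delta$ is the Legendrian subvariety $Z_t\subset M=M\times\{t\}$. *)

(* Defs.v *)
From HB Require Import structures.
From mathcomp Require Import all_boot all_order all_algebra.
From mathcomp Require Import complex.
From mathcomp Require Import all_classical all_reals all_analysis.

Set Implicit Arguments.
Unset Strict Implicit.
Unset Printing Implicit Defensive.

Import Order.TTheory GRing.Theory Num.Theory numFieldNormedType.Exports.

Local Open Scope classical_set_scope.
Local Open Scope ring_scope.

Record ideal (A : comPzRingType) := Ideal {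
  ideal_set :> A -> Prop;
  ideal0 : ideal_set 0;
  idealD : forall x y, ideal_set x -> ideal_set y -> ideal_set (x + y);
  idealM : forall a x, ideal_set x -> ideal_set (a * x) }.

Section Quotient.
Variables (A : comPzRingType) (J : ideal A).

Definition ideal_pred : {pred A} := fun x => `[< J x >].

Lemma ideal_pred_zmod_closed : zmod_closed ideal_pred.
Proof.
split=> [|x y /asboolP Jx /asboolP Jy]; apply/asboolP; first exact: ideal0.
by apply: idealD => //; rewrite -mulN1r; exact: idealM.
Qed.

HB.instance Definition _ :=
  GRing.isZmodClosed.Build A ideal_pred ideal_pred_zmod_closed.

Local Open Scope quotient_scope.

Definition quot := @Quotient.quot A ideal_pred.

HB.instance Definition _ := GRing.Zmodule.on quot.
HB.instance Definition _ := EqQuotient.on quot.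

Definition quot_one : quot := lift_cst quot 1.
Definition quot_mul : quot -> quot -> quot := lift_op2 quot *%R.

Canonical pi_quot_one_morph := PiConst quot_one.

Lemma pi_quot_mul : {morph \pi : x y / x * y >-> quot_mul x y}.
Proof.
move=> x y; unlock quot_mul; apply/eqP.
rewrite -Quotient.idealrBE; apply/asboolP.
set x' := repr _; set y' := repr _.
have /eqP := reprK (\pi_quot x); rewrite -Quotient.idealrBE => /asboolP hx.
have /eqP := reprK (\pi_quot y); rewrite -Quotient.idealrBE => /asboolP hy.
have -> : x * y - x' * y' = - (y * (x' - x) + x' * (y' - y)).
  by rewrite opprD -!mulrN !opprB !mulrBr (mulrC y x) (mulrC y x') addrA
    subrK mulrN.
by rewrite -mulN1r; apply: idealM; apply: idealD; exact: idealM.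
Qed.
Canonical pi_quot_mul_morph := PiMorph2 pi_quot_mul.

Lemma quot_mulA : associative quot_mul.
Proof. by move=> x y z; rewrite -[x]reprK -[y]reprK -[z]reprK !piE mulrA. Qed.

Lemma quot_mulC : commutative quot_mul.
Proof. by move=> x y; rewrite -[x]reprK -[y]reprK !piE mulrC. Qed.

Lemma quot_mul1 : left_id quot_one quot_mul.
Proof. by move=> x; rewrite -[x]reprK !piE mul1r. Qed.

Lemma quot_mulDl : left_distributive quot_mul +%R.
Proof.
move=> x y z; rewrite -[x]reprK -[y]reprK -[z]reprK.
by apply/eqP; rewrite !piE mulrDl Quotient.equivE subrr rpred0.
Qed.

HB.instance Definition _ := GRing.Zmodule_isComPzRing.Build quot
  quot_mulA quot_mulC quot_mul1 quot_mulDl.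

Definition quot_pi (a : A) : quot := \pi a.

Lemma quot_pi_zmod_morphism : zmod_morphism quot_pi.
Proof. by move=> x y; rewrite /quot_pi !piE. Qed.

Lemma quot_pi_monoid_morphism : monoid_morphism quot_pi.
Proof. by split=> [|x y]; rewrite /quot_pi !piE. Qed.

HB.instance Definition _ :=
  GRing.isZmodMorphism.Build A quot quot_pi quot_pi_zmod_morphism.
HB.instance Definition _ :=
  GRing.isMonoidMorphism.Build A quot quot_pi quot_pi_monoid_morphism.

Lemma quot_piP (a b : A) : quot_pi a = quot_pi b <-> J (a - b).
Proof.
split=> [/eqP|h]; first by rewrite -Quotient.idealrBE => /asboolP.
by apply/eqP; rewrite -Quotient.idealrBE; apply/asboolP.
Qed.

Lemma quot_reprK (x : quot) : quot_pi (repr x) = x.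
Proof. exact: reprK. Qed.

End Quotient.

Section Flatness.
Variable A : comPzRingType.

Definition bilinear_map (M N P : lmodType A) (b : M -> N -> P) :=
  (forall y, linear (b^~ y)) /\ (forall x, linear (b x)).

(* b : M x N -> T is a universal bilinear map, i.e. T is the tensor product of
   M and N over A. *)
Definition is_tensor_product (M N T : lmodType A) (b : M -> N -> T) :=
  bilinear_map b /\
  forall (P : lmodType A) (g : M -> N -> P), bilinear_map g ->
    exists! h : T -> P, linear h /\ forall x y, h (b x y) = g x y.

(* Tensoring with M preserves injectivity: h is u (x) id_M. *)
Definition flat_module (M : lmodType A) :=
  forall (N1 N2 : lmodType A) (u : N1 -> N2), linear u -> injective u ->
  forall (T1 T2 : lmodType A) (b1 : N1 -> M -> T1) (b2 : N2 -> M -> T2),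
    is_tensor_product b1 -> is_tensor_product b2 ->
  forall h : T1 -> T2, linear h -> (forall n x, h (b1 n x) = b2 (u n) x) ->
    injective h.

End Flatness.

(* B as an A-module, by restriction of scalars along phi. *)
Definition restriction (A B : comPzRingType) (phi : {rmorphism A -> B}) :
    Type := B.

Section Restriction.
Variables (A B : comPzRingType) (phi : {rmorphism A -> B}).

HB.instance Definition _ := GRing.Zmodule.on (restriction phi).

Definition restriction_scale (a : A) (x : restriction phi) : restriction phi :=
  phi a * (x : B).

Lemma restriction_scaleA a b x :
  restriction_scale a (restriction_scale b x) = restriction_scale (a * b) x.
Proof. by rewrite /restriction_scale rmorphM mulrA. Qed.

Lemma restriction_scale1 : left_id 1 restriction_scale.
Proof. by move=> x; rewrite /restriction_scale rmorph1 mul1r. Qed.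

Lemma restriction_scaleDr : right_distributive restriction_scale +%R.
Proof. by move=> a x y; rewrite /restriction_scale mulrDr. Qed.

Lemma restriction_scaleDl x : {morph restriction_scale^~ x : a b / a + b}.
Proof. by move=> a b; rewrite /restriction_scale rmorphD mulrDl. Qed.

HB.instance Definition _ := GRing.Zmodule_isLmodule.Build A (restriction phi)
  restriction_scaleA restriction_scale1 restriction_scaleDr restriction_scaleDl.

End Restriction.

Definition flat_morphism (A B : comPzRingType) (phi : {rmorphism A -> B}) :=
  flat_module (restriction phi).

(* B is integrally closed in its total ring of fractions: if b is not a zero
   divisor and the fraction a / b is integral over B, then a / b is in B.
   Denominators are cleared in the equation of integral dependence. *)
Definition integrally_closed (B : comPzRingType) :=
  forall a b : B, (forall c, b * c = 0 -> c = 0) ->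
    (exists n (r : 'I_n -> B),
       a ^+ n + \sum_(i < n) r i * a ^+ i * b ^+ (n - i) = 0) ->
    exists c, a = c * b.

(* In this section K plays the role of the field of complex numbers: a function
   between normed spaces is holomorphic when it is K-differentiable (in the
   sense of Frechet) at every point of an open set. *)
Section Manifolds.
Variable K : numFieldType.

(* cmap and cinv are total functions whose values outside cdom, respectively
   outside the image of cdom, are irrelevant. *)
Record chart (X : topologicalType) (V : normedModType K) := Chart {
  cdom : set X;
  cmap :> X -> V;
  cinv : V -> X;
  cdom_open : open cdom;
  cimg_open : open (cmap @` cdom);
  cmapK : forall p, cdom p -> cinv (cmap p) = p;
  cmap_continuous : forall p, cdom p -> {for p, continuous cmap};
  cinv_continuous : forall p, cdom p -> {for cmap p, continuous cinv} }.

(* The Hausdorff and countability axioms are stated separately. *)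
Record manifold (V : normedModType K) := Manifold {
  carrier :> topologicalType;
  atlas : set (chart carrier V);
  atlas_cover : forall p, exists2 c, atlas c & cdom c p;
  atlas_compatible : forall c c' p, atlas c -> atlas c' -> cdom c p ->
    cdom c' p -> differentiable (c' \o cinv c) (c p) }.

Arguments atlas {V} _ _.

Section VectorSpace.
Variable V : normedModType K.

Lemma id_img_open : open (@id V @` setT).
Proof. by rewrite image_id; exact: openT. Qed.

Definition id_chart : chart V V :=
  @Chart V V setT id id openT id_img_open (fun _ _ => erefl)
    (fun _ _ => cvg_id) (fun _ _ => cvg_id).

Lemma id_atlas_cover (p : V) : exists2 c, [set id_chart] c & cdom c p.
Proof. by exists id_chart. Qed.

Lemma id_atlas_compatible c c' (p : V) : [set id_chart] c ->
  [set id_chart] c' -> cdom c p -> cdom c' p ->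
  differentiable (c' \o cinv c) (c p).
Proof.
move=> -> -> _ _; apply: (@linear_differentiable _ _ _ idfun).
by move=> x; exact: cvg_id.
Qed.

Definition vect_manifold : manifold V :=
  Manifold id_atlas_cover id_atlas_compatible.

End VectorSpace.

Section ProductChart.
Variables (V W : normedModType K) (X Y : topologicalType).
Variables (c : chart X V) (d : chart Y W).

Let pmap (p : X * Y) : V * W := (c p.1, d p.2).
Let pinv (v : V * W) : X * Y := (cinv c v.1, cinv d v.2).

Lemma prod_chart_dom_open : open (cdom c `*` cdom d).
Proof.
rewrite openE => -[x y] [/= cx dy]; exists (cdom c, cdom d) => //.
by split; apply: open_nbhs_nbhs; split => //; exact: cdom_open.
Qed.

Lemma prod_chart_img_open : open (pmap @` (cdom c `*` cdom d)).
Proof.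
rewrite openE => _ [[x y] [/= cx dy] <-].
exists (c @` cdom c, d @` cdom d) => /=.
  split; apply: open_nbhs_nbhs; split; [exact: cimg_open|by exists x|
    exact: cimg_open|by exists y].
by move=> [v w] [/= [x' cx' <-] [y' dy' <-]]; exists (x', y').
Qed.

Lemma prod_chartK p : (cdom c `*` cdom d) p -> pinv (pmap p) = p.
Proof. by case: p => x y [/= cx dy]; rewrite /pinv /= !cmapK. Qed.

Lemma prod_chart_continuous p : (cdom c `*` cdom d) p ->
  {for p, continuous pmap}.
Proof.
case: p => x y [/= cx dy]; apply: cvg_pair => /=.
  apply: (@cvg_comp _ _ _ fst); [exact: cvg_fst|exact: cmap_continuous].
apply: (@cvg_comp _ _ _ snd); [exact: cvg_snd|exact: cmap_continuous].
Qed.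

Lemma prod_chart_inv_continuous p : (cdom c `*` cdom d) p ->
  {for pmap p, continuous pinv}.
Proof.
case: p => x y [/= cx dy]; apply: cvg_pair => /=.
  apply: (@cvg_comp _ _ _ fst); [exact: cvg_fst|exact: cinv_continuous].
apply: (@cvg_comp _ _ _ snd); [exact: cvg_snd|exact: cinv_continuous].
Qed.

Definition prod_chart : chart (X * Y)%type (V * W)%type :=
  Chart prod_chart_dom_open prod_chart_img_open prod_chartK
    prod_chart_continuous prod_chart_inv_continuous.

End ProductChart.

Section Product.
Variables (V W : normedModType K) (X : manifold V) (Y : manifold W).

Let prod_atlas : set (chart (X * Y)%type (V * W)%type) :=
  [set e | exists c d, [/\ atlas X c, atlas Y d & e = prod_chart c d]].

Lemma prod_atlas_cover p : exists2 e, prod_atlas e & cdom e p.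
Proof.
case: p => x y; have [c Xc cx] := atlas_cover x.
have [d Yd dy] := atlas_cover y.
by exists (prod_chart c d) => //; exists c, d.
Qed.

Lemma prod_atlas_compatible e e' p : prod_atlas e -> prod_atlas e' ->
  cdom e p -> cdom e' p -> differentiable (e' \o cinv e) (e p).
Proof.
case: p => x y [c [d [Xc Yd ->]]] [c' [d' [Xc' Yd' ->]]].
move=> [/= cx dy] [/= cx' dy'].
apply: (@differentiable_pair _ _ _ _ (fun v : V * W => c' (cinv c v.1))
  (fun v : V * W => d' (cinv d v.2))).
  apply: (@differentiable_comp _ _ _ _ fst (c' \o cinv c)).
    by apply: linear_differentiable => -[? ?]; exact: cvg_fst.
  exact: atlas_compatible.
apply: (@differentiable_comp _ _ _ _ snd (d' \o cinv d)).
  by apply: linear_differentiable => -[? ?]; exact: cvg_snd.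
exact: atlas_compatible.
Qed.

Definition prod_manifold : manifold (V * W)%type :=
  Manifold prod_atlas_cover prod_atlas_compatible.

End Product.

(* These are differentiability conditions at the single point p; holomorphy on
   an open set U is the condition at all points of U. *)
Definition holo_fun (V W : normedModType K) (X : manifold V) (f : X -> W)
    (p : X) :=
  forall c, atlas X c -> cdom c p -> differentiable (f \o cinv c) (c p).

Definition holo_map (V W : normedModType K) (X : manifold V) (Y : manifold W)
    (f : X -> Y) (p : X) :=
  {for p, continuous f} /\
  forall c d, atlas X c -> atlas Y d -> cdom c p -> cdom d (f p) ->
    differentiable (d \o f \o cinv c) (c p).

Section Germs.
Variables (V : normedModType K) (X : manifold V) (p : X).

Definition near_holo : {pred X -> K} :=
  fun f => `[< \forall q \near p, holo_fun f q >].

Record germ_rep := GermRep {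
  germ_fun :> X -> K;
  germ_funP : germ_fun \in near_holo }.

HB.instance Definition _ := [isSub for germ_fun].
HB.instance Definition _ := [Choice of germ_rep by <:].

Lemma near_holo_subring_closed : subring_closed near_holo.
Proof.
split=> [|f g /asboolP nf /asboolP ng|f g /asboolP nf /asboolP ng];
  apply/asboolP.
- apply: filterE => q c _ _; exact: differentiable_cst.
- near=> q => c Xc cq; apply: differentiableB.
    by move: c Xc cq; near: q.
  by move: c Xc cq; near: q.
- near=> q => c Xc cq; apply: differentiableM.
    by move: c Xc cq; near: q.
  by move: c Xc cq; near: q.
Unshelve. all: by end_near.
Qed.

HB.instance Definition _ := GRing.SubChoice_isSubComPzRing.Build
  (X -> K) near_holo germ_rep near_holo_subring_closed.

Definition null_rep (f : germ_rep) : Prop := \forall q \near p, f q = 0.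

Lemma null_rep0 : null_rep 0.
Proof. by apply: filterE => q. Qed.

Lemma null_repD f g : null_rep f -> null_rep g -> null_rep (f + g).
Proof.
by apply: filterS2 => q fq gq; rewrite -[LHS]/(f q + g q) fq gq addr0.
Qed.

Lemma null_repM a f : null_rep f -> null_rep (a * f).
Proof. by apply: filterS => q fq; rewrite -[LHS]/(a q * f q) fq mulr0. Qed.

Definition null_ideal := Ideal null_rep0 null_repD null_repM.

(* The local ring O_{X,p}. *)
Definition germ := quot null_ideal.
HB.instance Definition _ := GRing.ComPzRing.on germ.

(* Meaningful when f is holomorphic near p; otherwise the value is 0. *)
Definition germ_of (f : X -> K) : germ :=
  quot_pi null_ideal (insubd (0 : germ_rep) f).

Definition germ_val (g : germ) : X -> K := germ_fun (repr g).

Lemma germ_val_holo (g : germ) : \forall q \near p, holo_fun (germ_val g) q.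
Proof. by apply/asboolP; exact: (germ_funP (repr g)). Qed.

Lemma germ_valK (g : germ) : germ_of (germ_val g) = g.
Proof. by rewrite /germ_of /germ_val valKd [LHS]quot_reprK. Qed.

Lemma germ_ofP (f g : X -> K) :
  (\forall q \near p, holo_fun f q) -> (\forall q \near p, holo_fun g q) ->
  germ_of f = germ_of g <-> \forall q \near p, f q = g q.
Proof.
move=> /asboolP hf /asboolP hg; rewrite /germ_of.
split=> [/quot_piP|h].
  apply: filterS => q; rewrite -[X in X = _]/(germ_fun _ q - germ_fun _ q).
  by rewrite -2!/(val _) !insubdK // => /eqP; rewrite subr_eq0 => /eqP.
apply/quot_piP; apply: filterS h => q fgq.
rewrite -[LHS]/(germ_fun _ q - germ_fun _ q).
by rewrite -2!/(val _) !insubdK // fgq subrr.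
Qed.

Lemma germ_of_val (f : X -> K) : (\forall q \near p, holo_fun f q) ->
  \forall q \near p, germ_val (germ_of f) q = f q.
Proof.
move=> hf; apply/germ_ofP => //; first exact: germ_val_holo.
exact: germ_valK.
Qed.

Lemma germ_reprK (g : germ) : quot_pi null_ideal (repr g) = g.
Proof. exact: quot_reprK. Qed.

Lemma germ_val_pi (f : germ_rep) (g : germ) : quot_pi null_ideal f = g ->
  \forall q \near p, germ_val g q = f q.
Proof.
rewrite -[g in _ = g]germ_reprK => /quot_piP; apply: filterS => q.
rewrite -[X in X = _]/(f q - germ_val g q) => /eqP.
by rewrite subr_eq0 => /eqP.
Qed.

Lemma germ_val1 : \forall q \near p, germ_val 1 q = 1.
Proof. exact: (germ_val_pi (rmorph1 _)). Qed.

Lemma germ_valB (g h : germ) :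
  \forall q \near p, germ_val (g - h) q = germ_val g q - germ_val h q.
Proof.
have /germ_val_pi : quot_pi null_ideal (repr g - repr h) = g - h.
  by rewrite rmorphB; congr (_ - _); exact: quot_reprK.
exact.
Qed.

Lemma germ_valM (g h : germ) :
  \forall q \near p, germ_val (g * h) q = germ_val g q * germ_val h q.
Proof.
have /germ_val_pi : quot_pi null_ideal (repr g * repr h) = g * h.
  by rewrite rmorphM; congr (_ * _); exact: quot_reprK.
exact.
Qed.

End Germs.

(* Meaningful when f is holomorphic near p. *)
Definition germ_pullback (V W : normedModType K) (X : manifold V)
    (Y : manifold W) (f : X -> Y) (p : X) (g : germ (f p)) : germ p :=
  germ_of p (germ_val g \o f).

Section Projection.
Variables (V W : normedModType K) (X : manifold V) (Y : manifold W).
Variable p : prod_manifold X Y.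

Definition germ_snd (g : germ (snd p)) : germ p := germ_pullback g.

Lemma near_snd (P : set Y) : (\forall y \near snd p, P y) ->
  \forall q \near p, P (snd q).
Proof. by move: p => -[x y] /= hP; exact: (cvg_snd hP). Qed.

Lemma holo_fun_snd (f : Y -> K) (q : prod_manifold X Y) :
  holo_fun f (snd q) -> holo_fun (f \o snd : prod_manifold X Y -> K) q.
Proof.
move=> hf _ [c [d [Xc Yd ->]]] [_ /= dq].
apply: (@differentiable_comp _ _ _ _ snd (f \o cinv d)); last exact: hf.
by apply: linear_differentiable => -[? ?]; exact: cvg_snd.
Qed.

Lemma germ_sndE (g : germ (snd p)) :
  \forall q \near p, germ_val (germ_snd g) q = germ_val g (snd q).
Proof.
apply: germ_of_val.
by apply: (filterS (@holo_fun_snd _)); apply: near_snd; exact: germ_val_holo.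
Qed.

Lemma germ_eqP (V' : normedModType K) (Z : manifold V') (z : Z)
    (g h : germ z) :
  (\forall q \near z, germ_val g q = germ_val h q) -> g = h.
Proof.
move=> gh; rewrite -(germ_valK g) -(germ_valK h).
by apply/germ_ofP => //; exact: germ_val_holo.
Qed.

Lemma germ_snd_zmod_morphism : zmod_morphism germ_snd.
Proof.
move=> g h; apply: germ_eqP.
have := germ_valB (germ_snd g) (germ_snd h).
have := near_snd (germ_valB g h).
have := germ_sndE h; have := germ_sndE g; have := germ_sndE (g - h).
move=> e1 e2 e3 e4 e5; near=> q.
rewrite (near e1 q) // (near e5 q) // (near e4 q) // (near e3 q) //.
by rewrite (near e2 q).
Unshelve. all: by end_near.
Qed.

Lemma germ_snd_monoid_morphism : monoid_morphism germ_snd.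
Proof.
split=> [|g h]; apply: germ_eqP.
  have e1 := germ_sndE 1; have e2 := near_snd (germ_val1 (snd p)).
  have e3 := germ_val1 p; near=> q.
  by rewrite (near e1 q) // (near e2 q) // (near e3 q).
have e1 := germ_sndE (g * h); have e2 := germ_sndE g; have e3 := germ_sndE h.
have e4 := near_snd (germ_valM g h).
have e5 := germ_valM (germ_snd g) (germ_snd h); near=> q.
rewrite (near e1 q) // (near e5 q) // (near e4 q) // (near e3 q) //.
by rewrite (near e2 q).
Unshelve. all: by end_near.
Qed.

HB.instance Definition _ := GRing.isZmodMorphism.Build
  (germ (snd p)) (germ p) germ_snd germ_snd_zmod_morphism.
HB.instance Definition _ := GRing.isMonoidMorphism.Build
  (germ (snd p)) (germ p) germ_snd germ_snd_monoid_morphism.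

End Projection.

Section Subspaces.
Variables (V : normedModType K) (X : manifold V).

Section VanishingIdeal.
Variables (Z : set X) (p : X).

Definition vanishing (g : germ p) : Prop :=
  \forall q \near p, Z q -> germ_val g q = 0.

Lemma vanishing0 : vanishing 0.
Proof.
have := germ_valB (0 : germ p) 0; rewrite subr0; apply: filterS => q -> _.
exact: subrr.
Qed.

Lemma vanishingD g h : vanishing g -> vanishing h -> vanishing (g + h).
Proof.
move=> vg vh; have e := germ_valB (g + h) h; rewrite addrK in e.
apply: filterS3 e vg vh => q eq gq hq Zq; move: eq.
by rewrite gq // hq // subr0 => <-.
Qed.

Lemma vanishingM a g : vanishing g -> vanishing (a * g).
Proof.
by apply: filterS2 (germ_valM a g) => q -> vg /vg ->; rewrite mulr0.
Qed.

Definition vanishing_ideal := Ideal vanishing0 vanishingD vanishingM.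

(* O_{Z,p} for the reduced structure on Z. *)
Definition local_ring := quot vanishing_ideal.

End VanishingIdeal.

Definition normal_subset (Z : set X) :=
  forall p, Z p -> integrally_closed (local_ring Z p).

Definition analytic_subset (Z : set X) :=
  closed Z /\
  forall p, Z p -> exists (U : set X) k (f : 'I_k -> X -> K),
    [/\ open U, U p, forall i q, U q -> holo_fun (f i) q &
      forall q, U q -> (Z q <-> forall i, f i q = 0)].

(* The ideals J p, p in W, are the stalks of an ideal sheaf of finite type on
   the open set W, i.e. they define a closed analytic subspace of W, whose
   local ring at p is quot (J p) and whose support is the set of the p in W
   with 1 not in J p.  The values of J outside W are irrelevant. *)
Definition analytic_subspace (W : set X) (J : forall p : X, ideal (germ p)) :=
  forall p, W p -> exists (U : set X) k (f : 'I_k -> X -> K),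
    [/\ [/\ open U, U p & U `<=` W], forall i q, U q -> holo_fun (f i) q &
      forall q, U q -> forall g : germ q,
        J q g <-> exists a : 'I_k -> germ q,
          g = \sum_(i < k) a i * germ_of q (f i)].

End Subspaces.

Section Families.
Variables (V : normedModType K) (M : manifold V).

Let total := prod_manifold M (vect_manifold K).

(* The ideal at x of the scheme-theoretic fiber over t.  As restriction of
   germs from M x {the parameter line} to the slice M x {t} is surjective, the
   image of the ideal J (x, t) is already an ideal of germ x. *)
Definition fiber_ideal (J : forall p : total, ideal (germ p)) (t : K) (x : M) :
    set (germ x) :=
  [set germ_pullback (f := (fun y => (y, t)) : M -> total) g
    | g in [set g : germ ((x, t) : total) | J (x, t) g]].
Arguments fiber_ideal J t x _ : clear implicits.

(* The subspace of M x Delta defined by J is flat over Delta and its fiber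
   over t is the reduced subspace Z t. *)
Definition holomorphic_family (Delta : set K) (Z : K -> set M) :=
  exists J : forall p : total, ideal (germ p),
  [/\ analytic_subspace [set p : total | Delta p.2] J,
      forall p : total, Delta p.2 -> ~ J p 1 ->
        flat_morphism (quot_pi (J p) \o @germ_snd _ _ _ _ p) &
      forall t (x : M), Delta t ->
        fiber_ideal J t x = [set g : germ x | vanishing (Z t) g]].

End Families.

Section Submanifolds.
Variables (n : nat) (M : manifold 'rV[K]_n).

(* F = 0 are local equations of Z at z with linearly independent differentials;
   the tangent space of Z at z is then the kernel of the differential of F. *)
Definition regular_equations (Z : set M) (z : M) k (F : M -> 'rV[K]_k) :=
  exists U : set M,
    [/\ open U, U z, forall q, U q -> holo_fun F q,
        forall q, U q -> (Z q <-> F q = 0) &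
        forall c, atlas M c -> cdom c z ->
          forall w, exists v, 'd (F \o cinv c) (c z) v = w].

Definition nonsingular_dim (Z : set M) (z : M) (d : nat) :=
  Z z /\ exists k (F : M -> 'rV[K]_k), (d + k = n)%N /\ regular_equations Z z F.

(* The nonsingular points of Z are dense in Z and all have dimension d. *)
Definition pure_dim (Z : set M) (d : nat) :=
  Z `<=` closure [set z | nonsingular_dim Z z d] /\
  forall z e, nonsingular_dim Z z e -> e = d.

End Submanifolds.

Section Contact.

(* D c p is the coordinate expression, in the chart c, of a subspace of the
   tangent space at p; only the values for c in the atlas and p in the domain
   of c are meaningful. *)
Definition distribution n (M : manifold 'rV[K]_n) :=
  chart M 'rV[K]_n -> M -> {vspace 'rV[K]_n}.

Section Distribution.
Variables (n : nat) (M : manifold 'rV[K]_n) (D : distribution M).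

Definition holomorphic_subbundle (r : nat) :=
  (forall c c' p, atlas M c -> atlas M c' -> cdom c p -> cdom c' p ->
     [set` D c' p] = 'd (c' \o cinv c) (c p) @` [set` D c p]) /\
  (forall c p, atlas M c -> cdom c p ->
     exists e : 'I_r -> 'rV[K]_n -> 'rV[K]_n,
       \forall v \near c p,
         [/\ forall i, differentiable (e i) v,
             D c (cinv c v) = <<[seq e i v | i : 'I_r]>>%VS &
             \dim (D c (cinv c v)) = r]).

Definition local_section (c : chart M 'rV[K]_n) (p : M)
    (xi : 'rV[K]_n -> 'rV[K]_n) :=
  \forall v \near c p, differentiable xi v /\ xi v \in D c (cinv c v).

Definition lie_bracket (xi eta : 'rV[K]_n -> 'rV[K]_n) (v : 'rV[K]_n) :
    'rV[K]_n :=
  'd eta v (xi v) - 'd xi v (eta v).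

(* In the chart c, the Frobenius bracket of u, w in D_p is the class of z
   modulo D_p. *)
Definition frobenius (c : chart M 'rV[K]_n) (p : M) (u w z : 'rV[K]_n) :=
  exists xi eta, [/\ local_section c p xi, local_section c p eta,
    xi (c p) = u, eta (c p) = w & z - lie_bracket xi eta (c p) \in D c p].

Definition frobenius_nondegenerate :=
  forall c p, atlas M c -> cdom c p ->
  forall u, u \in D c p ->
    (forall w, w \in D c p -> frobenius c p u w 0) -> u = 0.

End Distribution.

Record contact_manifold (m : nat) := ContactManifold {
  contact_carrier :> manifold 'rV[K]_(m.*2.+1);
  contact_hausdorff : hausdorff_space contact_carrier;
  contact_second_countable : @second_countable contact_carrier;
  contact_D : distribution contact_carrier;
  contact_subbundle : holomorphic_subbundle contact_D m.*2;
  contact_nondegenerate : frobenius_nondegenerate contact_D }.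

(* Z carries its reduced structure, hence is given as a set of points. *)
Definition legendrian m (M : contact_manifold m) (Z : set M) :=
  [/\ analytic_subset Z, pure_dim Z m &
      forall z k (F : M -> 'rV[K]_k), Z z -> regular_equations Z z F ->
      forall c v, atlas M c -> cdom c z ->
        'd (F \o cinv c) (c z) v = 0 -> v \in contact_D c z].

Definition contactomorphism m (M1 M2 : contact_manifold m)
    (U1 : set M1) (U2 : set M2) (phi : M1 -> M2) :=
  (exists psi : M2 -> M1,
    [/\ forall p, U1 p -> holo_map phi p,
        forall q, U2 q -> holo_map psi q,
        forall p, U1 p -> U2 (phi p) /\ psi (phi p) = p &
        forall q, U2 q -> U1 (psi q) /\ phi (psi q) = q]) /\
  forall p c1 c2, U1 p -> atlas M1 c1 -> atlas M2 c2 -> cdom c1 p ->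
    cdom c2 (phi p) ->
    'd (c2 \o phi \o cinv c1) (c1 p) @` [set` contact_D c1 p] =
      [set` contact_D c2 (phi p)].

Definition contactomorphic m (M1 M2 : contact_manifold m)
    (Z1 : set M1) (x1 : M1) (Z2 : set M2) (x2 : M2) :=
  exists (U1 : set M1) (U2 : set M2) (phi : M1 -> M2),
    [/\ open U1 /\ U1 x1, open U2 /\ U2 x2, contactomorphism U1 U2 phi,
        phi x1 = x2 & phi @` (Z1 `&` U1) = Z2 `&` U2].

End Contact.
End Manifolds.

Definition Cplx (R : realType) : numFieldType := R[i].

(* Main.v *)
From HB Require Import structures.
Require Import Defs.
From mathcomp Require Import all_boot all_order all_algebra.
From mathcomp Require Import complex.
From mathcomp Require Import all_classical all_reals all_analysis.
From mathcomp Require Import perm ring lra zify.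

Set Implicit Arguments.
Unset Strict Implicit.
Unset Printing Implicit Defensive.

Import Order.TTheory GRing.Theory Num.Theory numFieldNormedType.Exports.

Local Open Scope classical_set_scope.
Local Open Scope ring_scope.

(** The family is cut out in M x Delta by an ideal J.  At the smooth points of its total space the
contact form theta of M restricts to s dt for some function s, since theta vanishes on the fibers.
The point is that s is holomorphic near (x0, 0).  If dF = B (theta - s dt) modulo J for some F in J,
then s B is the holomorphic function - dF/dt, so that B is a denominator of s.  At a prime of height
one of the local ring of the normal variety Z_0 the Jacobian criterion holds, and by Cramer's rule
the square of a nonvanishing minor of the equations is a denominator outside this prime; hence the
fraction is regular on Z_0.  Flatness (t is not a zero divisor modulo J) lifts this from Z_0 to the
total space, one power of t after the other.

Let X be the contact field with Hamiltonian s.  Differentiating theta = s dt shows that X + d/dt is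
tangent to the total space at a smooth point, because the tangent space of the fiber is a maximal
isotropic subspace of D.  By flatness and the density of smooth points X + d/dt preserves J.  By
uniqueness for linear differential equations, the flow of X therefore maps Z_0 to Z_t, and it
preserves D because the Lie derivative of theta along X is a multiple of theta.  The arc is the
orbit of x0.

Holomorphic functions of several variables are handled without integrals: the Cauchy estimates come
from Riemann sums in the manner of Goursat, and the Weierstrass division theorem from iterated
Hadamard quotients. *)

(** * Norms and derivatives *)

(** No dimension theory of local rings is used. The height of a prime is replaced by the size of a
    Jacobian minor outside it: the size grows strictly along a chain of primes ([minors_increase])
    and drops by one when one generator is discarded. On a normal Noetherian domain the denominators
    of a non-integral fraction lie in a prime P which, modulo the equations and up to a factor
    outside P, is generated by one element; so the equations alone keep a minor outside P. One more
    unit goes to the coordinate t, because only differentials along M are compared with theta.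

    The ideal J is accessible only through its fibers. Statements about J are proved by subtracting
    an element of J with the right restriction to a fiber and dividing the rest by t; the Noetherian
    property turns the endless repetition into membership ([chain_closure]).

    The analysis rests on bounds with explicit constants on balls. They are uniform along a
    sequence, so limits of holomorphic functions are holomorphic, and inverses, flows and
    Weierstrass quotients all arise from contractions by 1/2. *)

(* A reflexive decision procedure: a linear identity in a module is reduced to the ring identities
   between the coefficients of its atoms. *)
Section Linear_identities.
Variables (A : pzRingType) (V : lmodType A).

Inductive lexp :=
  | LVar of nat | LZero | LAdd of lexp & lexp | LOpp of lexp | LScale of A & lexp.

(** With [Nat.eqb], [cbn] evaluates the comparison on numerals, so that only ring expressions remain
    in the goals passed to [ring]. *)
Fixpoint lcoef (t : lexp) (n : nat) : A :=
  match t with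
  | LVar k => (if Nat.eqb k n then 1 else 0)
  | LZero => 0
  | LAdd a b => lcoef a n + lcoef b n
  | LOpp a => - lcoef a n
  | LScale c a => c * lcoef a n
  end.

Fixpoint leval (env : seq V) (t : lexp) : V :=
  match t with
  | LVar k => nth 0 env k
  | LZero => 0
  | LAdd a b => leval env a + leval env b
  | LOpp a => - leval env a
  | LScale c a => c *: leval env a
  end.

Lemma levalE env t : leval env t = \sum_(i < size env) lcoef t i *: env`_i.
Proof.
elim: t => [k||a iha b ihb|a iha|c a iha] /=.
- have [ks|sk] := ltnP k (size env).
    rewrite (bigD1 (Ordinal ks)) //= PeanoNat.Nat.eqb_refl scale1r big1 ?addr0 //.
    move=> i ik; case: (PeanoNat.Nat.eqb_spec k i) => [e|_]; last by rewrite scale0r.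
    by move: ik; rewrite -val_eqE /= e eqxx.
  rewrite nth_default // big1 // => i _.
  case: (PeanoNat.Nat.eqb_spec k i) => [e|_]; last by rewrite scale0r.
  by have := ltn_ord i; rewrite -e ltnNge sk.
- by rewrite big1 // => i _; rewrite scale0r.
- by rewrite iha ihb -big_split; apply: eq_bigr => i _; rewrite scalerDl.
- by rewrite iha -sumrN; apply: eq_bigr => i _; rewrite scaleNr.
- by rewrite iha scaler_sumr; apply: eq_bigr => i _; rewrite scalerA.
Qed.

Fixpoint lall (P : nat -> Prop) (n : nat) : Prop :=
  match n with 0 => True | k.+1 => P k /\ lall P k end.

Lemma lexpP env t1 t2 :
  lall (fun i => lcoef t1 i = lcoef t2 i) (size env) ->
  leval env t1 = leval env t2.
Proof.
move=> h; rewrite !levalE; apply: eq_bigr => i _; congr (_ *: _).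
case: i => i /=; elim: (size env) h => [//|n ih] /= [h1 h2].
by rewrite ltnS leq_eqVlt => /orP[/eqP ->|/(ih h2)].
Qed.
End Linear_identities.

Ltac lfind x env :=
  match env with
  | x :: _ => constr:(0%N)
  | _ :: ?e => let n := lfind x e in constr:(S n)
  end.
Ltac latoms t env :=
  lazymatch t with
  | (?a + ?b)%R => let e := latoms a env in latoms b e
  | (- ?a)%R => latoms a env
  | (?c *: ?a)%R => latoms a env
  | 0%R => env
  | ?x => match env with
     | _ => let n := lfind x env in env
     | _ => constr:(x :: env)
     end
  end.
Ltac lreify A t env :=
  lazymatch t with
  | (?a + ?b)%R => let x := lreify A a env in let y := lreify A b env in
     constr:(LAdd x y)
  | (- ?a)%R => let x := lreify A a env in constr:(LOpp x)
  | (?c *: ?a)%R => let x := lreify A a env in constr:(LScale (c : A) x)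
  | 0%R => constr:(LZero A)
  | ?x => let n := lfind x env in constr:(LVar A n)
  end.
Ltac lmod_by A V tac :=
  lazymatch goal with
  | |- ?l = ?r =>
    let env := latoms l (@nil V) in
    let env := latoms r env in
    let a := lreify A l env in
    let b := lreify A r env in
    change (@leval A V env a = @leval A V env b);
    apply: lexpP; cbn [lall lcoef size Nat.eqb]; repeat split; tac
  end.
Tactic Notation "lmod" constr(A) constr(V) := lmod_by A V ltac:(ring).
Tactic Notation "lmodf" constr(A) constr(V) := lmod_by A V ltac:(by field).

Section Norm.
Variable R : realType.
Notation K := (Cplx R).

(* The norm of a normed space over C takes values in C; nm is the same
   norm, as an element of R. *)
Definition nm (V : normedModType K) (x : V) : R := complex.Re (`|x| : R[i]).

Section NormBasics.
Variable V : normedModType K.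
Implicit Types x y : V.

Lemma nmE x : `|x| = ((nm x)%:C)%C :> K.
Proof.
have : 0 <= `|x| :> K by apply: normr_ge0.
by rewrite /nm; case: (`|x| : K) => a b; rewrite lecE /= => /andP[/eqP -> _].
Qed.

Lemma nm_ge0 x : 0 <= nm x.
Proof.
have : 0 <= `|x| :> K by apply: normr_ge0.
by rewrite nmE lecR.
Qed.

Lemma nm0 : nm (0 : V) = 0.
Proof. by rewrite /nm normr0. Qed.

Lemma nmN x : nm (- x) = nm x.
Proof. by rewrite /nm normrN. Qed.

Lemma nmB x y : nm (x - y) = nm (y - x).
Proof. by rewrite -nmN opprB. Qed.

Lemma nmD x y : nm (x + y) <= nm x + nm y.
Proof.
have := ler_normD x y; rewrite !nmE.
by rewrite -(rmorphD (@real_complex R)) /= lecR.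
Qed.

Lemma nm_eq0 x : nm x = 0 -> x = 0.
Proof. by move=> h; apply/eqP; rewrite -normr_eq0 nmE h. Qed.

Lemma nm_gt0 x : x != 0 -> 0 < nm x.
Proof.
move=> x0; rewrite lt_neqAle nm_ge0 andbT eq_sym.
by apply: contra x0 => /eqP/nm_eq0 ->.
Qed.

Lemma nmZ (a : K) x : nm (a *: x) = nm a * nm x.
Proof.
have := normrZ a x; rewrite !nmE.
by rewrite -(rmorphM (@real_complex R)) => /complexI.
Qed.

Lemma nm_triangle z x y : nm (x - y) <= nm (x - z) + nm (z - y).
Proof. by apply: le_trans (nmD _ _); rewrite addrA subrK. Qed.

Lemma nmDD x y : nm x - nm y <= nm (x + y).
Proof. by rewrite lerBlDr -{1}(addrK y x); apply: le_trans (nmD _ _) _; rewrite nmN. Qed.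

Lemma nm_sum (I : Type) (s : seq I) (P : pred I) (F : I -> V) :
  nm (\sum_(i <- s | P i) F i) <= \sum_(i <- s | P i) nm (F i).
Proof.
elim/big_rec2: _ => [|i y x _ h]; first by rewrite nm0.
by apply: le_trans (nmD _ _) _; rewrite lerD2l.
Qed.

(** The radius supplied by [nbhs_ballP] is a positive element of C, hence real; from here on
    neighborhoods are handled by real radii. *)
Lemma near_nmP (a : V) (P : set V) :
  (\forall x \near a, P x) <->
  exists2 r : R, 0 < r & forall x, nm (x - a) < r -> P x.
Proof.
split.
  move/nbhs_ballP => [e /= e0 h].
  exists (complex.Re (e : R[i])).
    by case: e e0 {h} => u v; rewrite ltcE /= => /andP[].
  move=> x xa; apply: h; rewrite -ball_normE /ball_ /= distrC nmE.
  case: e e0 xa => u v; rewrite ltcE /= => /andP[/eqP -> _] h.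
  by rewrite ltcR.
move=> [r r0 h]; apply/nbhs_ballP; exists (r%:C)%C => /=.
  by rewrite ltcR.
by move=> x; rewrite -ball_normE /ball_ /= distrC nmE ltcR => /h.
Qed.

End NormBasics.

Lemma nmM (a b : K) : nm (a * b) = nm a * nm b.
Proof. exact: nmZ. Qed.

Lemma nm1 : nm (1 : K) = 1.
Proof. by rewrite /nm normr1. Qed.

Lemma nmV (a : K) : nm a^-1 = (nm a)^-1.
Proof.
have [->|a0] := eqVneq a 0; first by rewrite invr0 nm0 invr0.
have h : nm a * nm a^-1 = 1 by rewrite -nmM mulfV // nm1.
have n0 : nm a != 0 by rewrite gt_eqF // nm_gt0.
by apply: (mulfI n0); rewrite h mulfV.
Qed.

Lemma nmX (a : K) n : nm (a ^+ n) = nm a ^+ n.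
Proof. by elim: n => [|n ih]; rewrite ?expr0 ?nm1 // !exprS nmM ih. Qed.

Lemma nm_real (r : R) : nm ((r%:C)%C : K) = `|r|.
Proof. by rewrite /nm normc_def /= expr0n addr0 sqrtr_sqr. Qed.

Lemma nm_nat (n : nat) : nm (n%:R : K) = n%:R.
Proof.
by rewrite -(rmorph_nat (@real_complex R)) nm_real ger0_norm.
Qed.

Lemma ler_nm_Re (a : K) : `|complex.Re a| <= nm a.
Proof. by have := normc_ge_Re a; rewrite /nm -{2}[`|a|]RRe_real ?lecR // realE normr_ge0. Qed.

Lemma ler_nm_Im (a : K) : `|complex.Im a| <= nm a.
Proof.
rewrite /nm normc_def /=; case: a => u v /=.
by rewrite -sqrtr_sqr ler_sqrt ?lerDr ?sqr_ge0 // addr_ge0 // sqr_ge0.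
Qed.

Lemma nm_le_ReIm (a : K) : nm a <= `|complex.Re a| + `|complex.Im a|.
Proof.
have -> : a = ((complex.Re a)%:C)%C + 'i%C * ((complex.Im a)%:C)%C :> K.
  by rewrite {1}[a]complexE.
apply: le_trans (nmD _ _) _; rewrite nmM !nm_real.
have -> : nm ('i%C : K) = 1.
  by rewrite /nm normc_def /= expr0n add0r expr1n sqrtr1.
rewrite mul1r; case: a => u v /=.
by rewrite !(mulr0, mul0r, mulr1, mul1r, addr0, add0r, subr0, oppr0).
Qed.

End Norm.

(** * Derivatives with real estimates *)

Section Differential.
Variable R : realType.
Notation K := (Cplx R).
Variables V W : normedModType K.

(** Frechet differentiability with real tolerances. The bound on [L] stands for its continuity, and
    the remainder is a plain inequality, so no filters are needed to establish it; [hasd_diff] and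
    [hasdP] translate. *)
Definition hasd (f : V -> W) (a : V) (L : V -> W) :=
  [/\ linear L, exists C : R, forall v, nm (L v) <= C * nm v &
    forall e : R, 0 < e -> exists2 d : R, 0 < d &
      forall h, nm h < d -> nm (f (a + h) - f a - L h) <= e * nm h].

Lemma nm_bounded_continuous (L : {linear V -> W}) (C : R) :
  (forall v, nm (L v) <= C * nm v) -> continuous L.
Proof.
move=> h; apply: bounded_linear_continuous; apply/linear_boundedP.
near=> r => x; rewrite !nmE.
have : (C%:C)%C <= r by near: r; apply: nbhs_pinfty_ge; rewrite realE -[0 : K](rmorph0 (@real_complex R)) !lecR; exact: le_total.
move=> Cr; apply: (@le_trans _ _ ((C%:C)%C * ((nm x)%:C)%C)).
  by rewrite -(rmorphM (@real_complex R)) lecR.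
by rewrite ler_wpM2r // lecR nm_ge0.
Unshelve. all: by end_near. Qed.

Lemma hasd_diff f a L : hasd f a L -> differentiable f a /\ 'd f a = L :> (V -> W).
Proof.
move=> [linL [C bL] h].
pose L' := GRing.isLinear.Build _ _ _ _ _ linL.
pose LL : {linear V -> W} := HB.pack L L'.
have cL : continuous LL by apply: (@nm_bounded_continuous LL C).
have o : f \o shift a = cst (f a) + LL +o_ 0 id.
  apply/eqaddoP => e e0.
  have [r r0 er] : exists2 r : R, 0 < r & e = (r%:C)%C :> K.
    exists (complex.Re (e : R[i])); case: e e0 => u v; rewrite ltcE /= => /andP[] //.
    by move=> /eqP ->.
  have [d d0 hd] := h r r0.
  apply/near_nmP; exists d => // x; rewrite subr0 => /hd.
  rewrite !nmE er -(rmorphM (@real_complex R)) lecR /=.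
  by rewrite !fctE /= opprD addrA (addrC x a).
have E := diff_unique cL o.
split; last exact: E.
by apply/diff_locallyP; rewrite E.
Qed.

Lemma hasdP f a : differentiable f a -> hasd f a ('d f a).
Proof.
move=> df; split; first by move=> k x y; rewrite linearP.
  have [k k0 hk] := linear_lipschitz (diff_continuous df).
  exists (complex.Re (k : R[i])) => v; have := hk v.
  rewrite !nmE; case: k k0 {hk} => u w; rewrite ltcE /= => /andP[/eqP -> _].
  by rewrite -(rmorphM (@real_complex R)) lecR.
move=> e e0; have /diff_locallyP [_ /eqaddoP h] := df.
have /h /near_nmP[d d0 hd] : 0 < (e%:C)%C :> K by rewrite ltcR.
exists d => // x xd; have := hd x; rewrite subr0 => /(_ xd).
rewrite !nmE -(rmorphM (@real_complex R)) lecR.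
by rewrite !fctE /= opprD addrA (addrC x a).
Qed.

Lemma differentiable_nm_continuous (f : V -> W) a : differentiable f a ->
  forall e : R, 0 < e -> exists2 d : R, 0 < d &
    forall x, nm (x - a) < d -> nm (f x - f a) < e.
Proof.
move=> /differentiable_continuous cf e e0.
have /near_nmP[d d0 hd] : \forall x \near a, nm (f x - f a) < e.
  have : \forall y \near f a, nm (y - f a) < e by apply/near_nmP; exists e.
  exact: cf.
by exists d.
Qed.

End Differential.

(** * Completeness of C, of matrices and of products *)

Section Complete.
Variable R : realType.
Notation K := (Cplx R).

Definition cvgs (V : normedModType K) (u : nat -> V) (l : V) :=
  forall e : R, 0 < e -> exists N, forall n, (N <= n)%N -> nm (u n - l) < e.

Definition cauchys (V : normedModType K) (u : nat -> V) :=
  forall e : R, 0 < e -> exists N, forall n m, (N <= n)%N -> (N <= m)%N ->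
    nm (u n - u m) < e.

Definition complete_nm (V : normedModType K) :=
  forall u : nat -> V, cauchys u -> exists l, cvgs u l.

Lemma complete_real (u : nat -> R) :
  (forall e : R, 0 < e -> exists N, forall n m, (N <= n)%N -> (N <= m)%N ->
    `|u n - u m| < e) ->
  exists l, forall e : R, 0 < e -> exists N, forall n, (N <= n)%N ->
    `|u n - l| < e.
Proof.
move=> h.
have /cauchy_cvg /cvg_ex [l ul] : cauchy (u @ \oo).
  apply: cauchy_exP => e e0; have [N hN] := h e e0.
  exists (u N), N => // n /= Nn; rewrite -ball_normE /ball_ /=.
  exact: hN.
exists l => e e0; move/cvgrPdist_lt : ul => /(_ e e0) [N _ hN].
by exists N => n Nn; rewrite distrC; exact: hN.
Qed.

Lemma complete_K : complete_nm K.
Proof.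
move=> u cu.
have [|a ha] := @complete_real (fun n => complex.Re (u n : R[i])).
  move=> e /cu [N hN]; exists N => n m Nn Nm.
  by rewrite -raddfB; apply: le_lt_trans (ler_nm_Re _) (hN _ _ _ _).
have [|b hb] := @complete_real (fun n => complex.Im (u n : R[i])).
  move=> e /cu [N hN]; exists N => n m Nn Nm.
  by rewrite -raddfB; apply: le_lt_trans (ler_nm_Im _) (hN _ _ _ _).
exists (Complex a b) => e e0.
have [|N1 h1] := ha (e / 2); first by rewrite divr_gt0.
have [|N2 h2] := hb (e / 2); first by rewrite divr_gt0.
exists (maxn N1 N2) => n; rewrite geq_max => /andP[/h1 {}h1 /h2 {}h2].
apply: le_lt_trans (nm_le_ReIm _) _; rewrite !raddfB /= (splitr e).
exact: ltrD.
Qed.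

Lemma nm_mxP m n (x : 'M[K]_(m, n)) (c : R) : 0 <= c ->
  nm x <= c <-> forall i j, nm (x i j) <= c.
Proof.
move=> c0.
have c0' : 0 <= (c%:C)%C :> K by rewrite lecR.
rewrite -lecR -nmE {1}/Num.norm /= mx_normE.
have -> : ((\big[Num.max/0%:nng]_i `|x i.1 i.2|%:nng)%:num <= (c%:C)%C :> K) <->
  (\big[Num.max/0%:nng]_i `|x i.1 i.2|%:nng <= NngNum c0').
  by rewrite -num_le.
split.
  move/bigmax_leP => [_ h] i j.
  by have := h (i, j) isT; rewrite -num_le /= nmE lecR.
move=> h; apply/bigmax_leP; split; first by rewrite -num_le.
by move=> -[i j] _; rewrite -num_le /= nmE lecR.
Qed.

Lemma nm_entry m n (x : 'M[K]_(m, n)) i j : nm (x i j) <= nm x.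
Proof. by move: i j; apply/nm_mxP => //; exact: nm_ge0. Qed.

Lemma nm_pair (V W : normedModType K) (x : V) (y : W) :
  nm ((x, y) : (V * W)%type) = Num.max (nm x) (nm y).
Proof.
apply: (@complexI R); rewrite -[LHS]nmE prod_normE /= !nmE.
by case: (leP (nm x) (nm y)) => h; [apply: max_r|apply: max_l]; rewrite lecR // ltW.
Qed.

Lemma nm_pairP (V W : normedModType K) (x : (V * W)%type) (c : R) :
  (nm x <= c) = (nm x.1 <= c) && (nm x.2 <= c).
Proof. by case: x => a b; rewrite nm_pair ge_max. Qed.

Lemma nm_pair_ltP (V W : normedModType K) (x : (V * W)%type) (c : R) :
  (nm x < c) = (nm x.1 < c) && (nm x.2 < c).
Proof. by case: x => a b; rewrite nm_pair gt_max. Qed.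

Lemma complete_pair (V W : normedModType K) :
  complete_nm V -> complete_nm W -> complete_nm (V * W)%type.
Proof.
move=> cV cW u cu.
have [|a ha] := cV (fun n => (u n).1).
  move=> e /cu [N hN]; exists N => n m Nn Nm.
  by have := hN n m Nn Nm; rewrite nm_pair_ltP => /andP[].
have [|b hb] := cW (fun n => (u n).2).
  move=> e /cu [N hN]; exists N => n m Nn Nm.
  by have := hN n m Nn Nm; rewrite nm_pair_ltP => /andP[].
exists (a, b) => e e0.
have [N1 h1] := ha e e0; have [N2 h2] := hb e e0.
exists (maxn N1 N2) => n; rewrite geq_max => /andP[/h1 {}h1 /h2 {}h2].
by rewrite nm_pair_ltP h1.
Qed.

Lemma complete_mx m n : complete_nm 'M[K]_(m, n).
Proof.
move=> u cu.
have /choice[l hl] : forall ij : 'I_m * 'I_n,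
  exists l : K, cvgs (fun k => u k ij.1 ij.2 : K) l.
  move=> [i j]; apply: complete_K => e /cu [N hN]; exists N => p q Np Nq.
  apply: le_lt_trans (hN p q Np Nq).
  by have := nm_entry (u p - u q) i j; rewrite !mxE.
exists (\matrix_(i, j) l (i, j)) => e e0.
have /choice[N hN] : forall ij, exists N, forall k, (N <= k)%N ->
  nm (u k ij.1 ij.2 - l ij) < e / 2.
  by move=> ij; apply: hl; rewrite divr_gt0.
exists (\max_ij N ij)%N => k hk.
apply: (@le_lt_trans _ _ (e / 2)); last by lra.
apply/nm_mxP; first by lra.
move=> i j; rewrite !mxE; apply: ltW; apply: (hN (i, j)).
exact: leq_trans (leq_bigmax (i, j)) hk.
Qed.

Lemma cvgs_unique (V : normedModType K) (u : nat -> V) l1 l2 :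
  cvgs u l1 -> cvgs u l2 -> l1 = l2.
Proof.
move=> h1 h2; apply/eqP; rewrite -subr_eq0; apply/eqP/nm_eq0.
apply/eqP; rewrite eq_le nm_ge0 andbT leNgt; apply/negP => p.
have [|N1 k1] := h1 (nm (l1 - l2) / 2); first by rewrite divr_gt0.
have [|N2 k2] := h2 (nm (l1 - l2) / 2); first by rewrite divr_gt0.
have := k1 _ (leq_maxl N1 N2); have := k2 _ (leq_maxr N1 N2).
have := nm_triangle (u (maxn N1 N2)) l1 l2; rewrite (nmB l1 (u _)).
lra.
Qed.

End Complete.

(** * Calculus rules for functions written pointwise *)

Section Pointwise.
Variable K : numFieldType.
Variables V W : normedModType K.
Implicit Types (f g : V -> W) (a b : V -> K) (x : V).

Lemma dif_cst (c : W) x : differentiable (fun _ : V => c) x.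
Proof. exact: differentiable_cst. Qed.
Lemma dif_id x : differentiable (fun y : V => y) x.
Proof. exact: (ex_diff (is_diff_def := is_diff_id x)). Qed.
Lemma dif_add f g x : differentiable f x -> differentiable g x ->
  differentiable (fun y => f y + g y) x.
Proof. exact: differentiableD. Qed.
Lemma dif_sub f g x : differentiable f x -> differentiable g x ->
  differentiable (fun y => f y - g y) x.
Proof. exact: differentiableB. Qed.
Lemma dif_opp f x : differentiable f x -> differentiable (fun y => - f y) x.
Proof. exact: differentiableN. Qed.
Lemma dif_mul a b x : differentiable a x -> differentiable b x ->
  differentiable (fun y => a y * b y) x.
Proof. exact: differentiableM. Qed.
Lemma dif_inv a x : differentiable a x -> a x != 0 ->
  differentiable (fun y => (a y)^-1) x.
Proof. exact: differentiableV. Qed.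
Lemma dif_exp a n x : differentiable a x -> differentiable (fun y => a y ^+ n) x.
Proof.
move=> da; elim: n => [|n ih].
  by under eq_fun do rewrite expr0; exact: differentiable_cst.
by under eq_fun do rewrite exprS; exact: dif_mul.
Qed.
Lemma dif_sum (I : Type) (s : seq I) (P : pred I) (F : I -> V -> W) x :
  (forall i, P i -> differentiable (F i) x) ->
  differentiable (fun y => \sum_(i <- s | P i) F i y) x.
Proof.
move=> h; elim: s => [|i s ih].
  by under eq_fun do rewrite big_nil; exact: dif_cst.
under eq_fun do rewrite big_cons; case: (boolP (P i)) => // Pi.
by apply: dif_add => //; exact: h.
Qed.
End Pointwise.
Lemma dif_comp (K : numFieldType) (U V W : normedModType K) (f : U -> V)
    (g : V -> W) x :
  differentiable f x -> differentiable g (f x) ->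
  differentiable (fun y => g (f y)) x.
Proof. exact: differentiable_comp. Qed.

Section PointwiseDiff.
Variable K : numFieldType.
Variables V W : normedModType K.
Implicit Types (f g : V -> W) (a b : V -> K) (x v : V).

Lemma diff_addE f g x v : differentiable f x -> differentiable g x ->
  'd (fun y => f y + g y) x v = 'd f x v + 'd g x v.
Proof. by move=> df dg; have := congr1 (fun F => F v) (diffD df dg). Qed.
Lemma diff_subE f g x v : differentiable f x -> differentiable g x ->
  'd (fun y => f y - g y) x v = 'd f x v - 'd g x v.
Proof. by move=> df dg; have := congr1 (fun F => F v) (diffB df dg). Qed.
Lemma diff_mulE a b x v : differentiable a x -> differentiable b x ->
  'd (fun y => a y * b y) x v = a x * 'd b x v + b x * 'd a x v.
Proof. by move=> da db; have := congr1 (fun F => F v) (diffM da db). Qed.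
Lemma diff_scaleE (k : K) f x v : differentiable f x ->
  'd (fun y => k *: f y) x v = k *: 'd f x v.
Proof. by move=> df; have := congr1 (fun F => F v) (diffZ k df). Qed.
Lemma diff_cstE (c : W) x v : 'd (fun _ : V => c) x v = 0.
Proof. by have := congr1 (fun F => F v) (@diff_cst _ V W c x). Qed.
Lemma dif_scale (k : K) f x : differentiable f x ->
  differentiable (fun y => k *: f y) x.
Proof. exact: differentiableZ. Qed.
Lemma diff_idE x v : 'd (fun y : V => y) x v = v.
Proof. by rewrite (diff_val (is_diff_def := is_diff_id x)). Qed.
Lemma diff_linE (L : {linear V -> W}) x v : continuous L ->
  'd (fun y => L y) x v = L v.
Proof. by move=> cL; rewrite (diff_lin x cL). Qed.
Lemma diff_sumE (I : Type) (s : seq I) (P : pred I) (F : I -> V -> W) x v :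
  (forall i, P i -> differentiable (F i) x) ->
  'd (fun y => \sum_(i <- s | P i) F i y) x v = \sum_(i <- s | P i) 'd (F i) x v.
Proof.
move=> h; elim: s => [|i s ih].
  by under eq_fun do rewrite big_nil; rewrite diff_cstE big_nil.
under eq_fun do rewrite big_cons; rewrite big_cons; case: ifPn => Pi //.
by rewrite diff_addE; [rewrite ih|exact: h|exact: dif_sum].
Qed.
End PointwiseDiff.

Lemma diff_compE (K : numFieldType) (U V W : normedModType K) (f : U -> V)
    (g : V -> W) x v :
  differentiable f x -> differentiable g (f x) ->
  'd (fun y => g (f y)) x v = 'd g (f x) ('d f x v).
Proof. by move=> df dg; have := congr1 (fun F => F v) (diff_comp df dg). Qed.

Section Geometric.
Variable R : realType.
Notation K := (Cplx R).
Variable V : normedModType K.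

Lemma expr_lt_eps (q c e : R) : 0 <= q < 1 -> 0 < e ->
  exists N, forall n, (N <= n)%N -> c * q ^+ n < e.
Proof.
move=> /andP[q0 q1] e0.
have q1' : `|q| < 1 by rewrite ger0_norm.
have /cvgrPdist_lt /(_ _ e0) [N _ hN] : (fun n => c * q ^+ n) @ \oo --> c * 0.
  by apply: cvgMr; exact: cvg_expr.
exists N => n /hN /=; rewrite mulr0 sub0r normrN; exact: le_lt_trans (ler_norm _).
Qed.

Lemma geom_sum_le (u : nat -> V) (c q : R) : 0 <= q < 1 -> 0 <= c ->
  (forall n, nm (u n.+1 - u n) <= c * q ^+ n) ->
  forall n k, nm (u (n + k)%N - u n) <= c / (1 - q) * q ^+ n.
Proof.
move=> /andP[q0 q1] c0 h n k.
have q1' : 0 < 1 - q by lra.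
apply: (@le_trans _ _ (c / (1 - q) * (q ^+ n - q ^+ (n + k)))); last first.
  apply: ler_wpM2l; first by rewrite divr_ge0 // ltW.
  by rewrite lerBlDr lerDl exprn_ge0.
elim: k => [|k ih]; first by rewrite addn0 subrr nm0 subrr mulr0.
apply: le_trans (nm_triangle (u (n + k)%N) _ _) _.
rewrite addnS; apply: le_trans (lerD (h (n + k)%N) ih) _; rewrite exprS.
rewrite le_eqVlt; apply/orP; left; apply/eqP; field.
by rewrite gt_eqF.
Qed.

Lemma geom_cauchy (u : nat -> V) (c q : R) : complete_nm V ->
  0 <= q < 1 -> 0 <= c ->
  (forall n, nm (u n.+1 - u n) <= c * q ^+ n) ->
  exists2 l, cvgs u l & forall n, nm (u n - l) <= c / (1 - q) * q ^+ n.
Proof.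
move=> cV q01 c0 h; have g := geom_sum_le q01 c0 h.
have [|l hl] := cV u.
  move=> e e0; have [|N hN] := expr_lt_eps (c / (1 - q)) q01 (_ : 0 < e / 2).
    by rewrite divr_gt0.
  exists N => n m Nn Nm; apply: le_lt_trans (nm_triangle (u N) _ _) _.
  rewrite (splitr e); apply: ltrD.
    by rewrite -(subnKC Nn); apply: le_lt_trans (g _ _) (hN _ _).
  by rewrite nmB -(subnKC Nm); apply: le_lt_trans (g _ _) (hN _ _).
exists l => // n; apply/ler_addgt0Pr => e e0; have [N hN] := hl e e0.
apply: le_trans (nm_triangle (u (n + N)%N) _ _) _; apply: lerD.
  by rewrite nmB.
by apply: ltW; apply: hN; rewrite leq_addl.
Qed.

(* Take the supremum of the parameters up to which the bound holds. *)
Lemma lipschitz_segment (g : R -> V) (L : R) : 0 <= L ->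
  (forall s : R, 0 <= s <= 1 -> forall e : R, 0 < e -> exists2 d : R, 0 < d &
     forall s' : R, 0 <= s' <= 1 -> `|s' - s| < d ->
       nm (g s' - g s) <= (L + e) * `|s' - s|) ->
  nm (g 1 - g 0) <= L.
Proof.
move=> L0 h; apply/ler_addgt0Pr => e e0.
pose S := [set x : R | 0 <= x <= 1 /\
  forall y, 0 <= y <= x -> nm (g y - g 0) <= (L + e) * y].
have S0 : S 0.
  split=> [|y /andP[y0 y1]]; first by rewrite lexx ler01.
  have -> : y = 0 by lra.
  by rewrite subrr nm0 mulr0.
have hS : has_sup S.
  by split; [exists 0|exists 1 => x [/andP[]]].
set c := sup S.
have c0 : 0 <= c by apply: ub_le_sup => //; case: hS.
have c1 : c <= 1 by apply: ge_sup; [exists 0|move=> x [/andP[]]].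
have c01 : 0 <= c <= 1 by rewrite c0.
have [d d0 hd] := h c c01 e e0.
have [x Sx cx] := sup_adherent d0 hS; rewrite -/c in cx.
have xc : x <= c by apply: ub_le_sup => //; case: hS.
have [/andP[x0 x1] hx] := Sx.
have gc : nm (g c - g 0) <= (L + e) * c.
  apply: le_trans (nm_triangle (g x) _ _) _.
  have := hx x; rewrite x0 lexx => /(_ isT).
  have : nm (g c - g x) <= (L + e) * (c - x).
    rewrite nmB; have := hd x; rewrite x0 x1 => /(_ isT).
    rewrite ler0_norm; last by lra.
    by rewrite opprB; apply; lra.
  lra.
have key y : 0 <= y <= 1 -> y < c + d -> nm (g y - g 0) <= (L + e) * y.
  move=> /andP[y0 y1] yd.
  have [yc|cy] := leP y c.
    have [[z [_ hz] yz]|nS] := pselect (exists2 z, S z & y <= z).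
      by apply: hz; rewrite y0.
    suff : c <= y by move=> cy; have -> : y = c by lra.
    apply: ge_sup; first by exists 0.
    move=> z Sz; rewrite leNgt; apply/negP => yz.
    by apply: nS; exists z => //; exact: ltW.
  apply: le_trans (nm_triangle (g c) _ _) _.
  have := hd y; rewrite y0 y1 => /(_ isT).
  rewrite ger0_norm; last by lra.
  by move=> /(_ _) h1; have := h1 ltac:(lra); lra.
have [c1'|c1'] := ltP c 1; last first.
  have -> : L + e = (L + e) * 1 by rewrite mulr1.
  by apply: key; lra.
suff : Num.min 1 (c + d / 2) <= c.
  by rewrite ge_min => /orP[]; lra.
apply: ub_le_sup; first by case: hS.
split.
  by rewrite le_min ge_min lexx /= andbT; lra.
move=> y /andP[y0]; rewrite le_min => /andP[y1 yd].
by apply: key; lra.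
Qed.

End Geometric.

(** * Cauchy estimates *)

Section Goursat.
Variable R : realType.
Notation K := (Cplx R).
Local Notation "r %:K" := ((r%:C)%C : K) (at level 2, format "r %:K").
Local Notation I := ('i%C : K).

Lemma realKD (a b : R) : (a + b)%:K = a%:K + b%:K. Proof. exact: rmorphD. Qed.
Lemma realKM (a b : R) : (a * b)%:K = a%:K * b%:K. Proof. exact: rmorphM. Qed.
Lemma realKV (a : R) : (a^-1)%:K = (a%:K)^-1. Proof. exact: fmorphV. Qed.
Lemma sqrI : I * I = -1. Proof. by rewrite -expr2 sqr_i. Qed.
Lemma nmI : nm I = 1.
Proof. by rewrite /nm normc_def /= expr0n add0r expr1n sqrtr1. Qed.
Lemma three_neq0 : (3 : K) != 0. Proof. by rewrite pnatr_eq0. Qed.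
Lemma nm3V : nm (3^-1 : K) = 3^-1. Proof. by rewrite nmV nm_nat. Qed.

(* Riemann sums for the integral of f along the segment [p, p + d] and along the
   boundary of the square with vertices p, p + d, p + d + id, p + id. *)
Fixpoint edge (f : K -> K) k (p d : K) : K :=
  if k is k'.+1 then
    edge f k' p (d * 3^-1) + edge f k' (p + d * 3^-1) (d * 3^-1) +
    edge f k' (p + d * 3^-1 + d * 3^-1) (d * 3^-1)
  else f (p + d * 2^-1) * d.

Definition square f k p d :=
  edge f k p d + edge f k (p + d) (d * I) - edge f k (p + d * I) d -
  edge f k p (d * I).

Lemma halfK : (2^-1 : K) = (2^-1)%:K.
Proof. by rewrite realKV rmorph_nat. Qed.
Lemma thirdK : (3^-1 : K) = (3^-1)%:K.
Proof. by rewrite realKV rmorph_nat. Qed.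

Lemma third0 (p d : K) (s : R) :
  p + d * 3^-1 * s%:K = p + d * (s / 3)%:K.
Proof. by rewrite realKM -thirdK; ring. Qed.
Lemma third1 (p d : K) (s : R) :
  p + d * 3^-1 + d * 3^-1 * s%:K = p + d * (3^-1 + s / 3)%:K.
Proof. by rewrite realKD realKM -thirdK; ring. Qed.
Lemma third2 (p d : K) (s : R) :
  p + d * 3^-1 + d * 3^-1 + d * 3^-1 * s%:K = p + d * (3^-1 + 3^-1 + s / 3)%:K.
Proof. by rewrite !realKD realKM -thirdK; ring. Qed.

Lemma edgeD k (f g : K -> K) p d :
  edge (fun z => f z + g z) k p d = edge f k p d + edge g k p d.
Proof.
elim: k p d => [|k ih] p d /=; first by rewrite mulrDl.
rewrite !ih; ring.
Qed.

Lemma edgeM k (c : K) (f : K -> K) p d :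
  edge (fun z => c * f z) k p d = c * edge f k p d.
Proof.
elim: k p d => [|k ih] p d /=; first by rewrite mulrA.
by rewrite !ih !mulrDr.
Qed.

(** The midpoint rule is exact for affine functions. Hence their sums around a square vanish
    exactly, at every level of refinement. *)
Lemma edge_affine k (a b : K) p d :
  edge (fun z => a * z + b) k p d = (a * (p + d * 2^-1) + b) * d.
Proof.
elim: k p d => [|k ih] p d //=; rewrite !ih.
by field.
Qed.

Lemma edge_le k (f : K -> K) p d (M : R) :
  (forall s : R, 0 <= s <= 1 -> nm (f (p + d * s%:K)) <= M) ->
  nm (edge f k p d) <= M * nm d.
Proof.
elim: k p d => [|k ih] p d h /=.
  by rewrite halfK nmM ler_wpM2r ?nm_ge0 // h //; lra.
have -> : M * nm d = M * nm (d * 3^-1) + M * nm (d * 3^-1) + M * nm (d * 3^-1).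
  rewrite nmM nm3V; lra.
apply: le_trans (nmD _ _) _; apply: lerD; first apply: le_trans (nmD _ _) _; first apply: lerD.
- by apply: ih => s /andP[s0 s1]; rewrite third0; apply: h; lra.
- by apply: ih => s /andP[s0 s1]; rewrite third1; apply: h; lra.
- by apply: ih => s /andP[s0 s1]; rewrite third2; apply: h; lra.
Qed.

Lemma edge_Im_ge k (f : K -> K) p d (c : R) :
  (forall s : R, 0 <= s <= 1 -> c <= complex.Im (f (p + d * s%:K) * d : R[i])) ->
  c <= complex.Im (edge f k p d : R[i]).
Proof.
elim: k p d c => [|k ih] p d c h /=.
  by rewrite halfK; apply: h; lra.
have imr (x y : K) : complex.Im (x * (y * 3^-1) : R[i]) = complex.Im (x * y : R[i]) * 3^-1.
  by rewrite mulrA thirdK; case: (x * y) => a b /=; rewrite mulr0 add0r.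
rewrite !raddfD /=.
have -> : c = c / 3 + c / 3 + c / 3 by lra.
apply: lerD; first apply: lerD.
- apply: ih => s /andP[s0 s1]; rewrite imr ler_wpM2r ?invr_ge0 //.
  by rewrite third0; apply: h; lra.
- apply: ih => s /andP[s0 s1]; rewrite imr ler_wpM2r ?invr_ge0 //.
  by rewrite third1; apply: h; lra.
- apply: ih => s /andP[s0 s1]; rewrite imr ler_wpM2r ?invr_ge0 //.
  by rewrite third2; apply: h; lra.
Qed.

Definition at_square (p d : K) (s t : R) : K := p + d * (s%:K + t%:K * I).
Definition on_boundary (s t : R) := [\/ s = 0, s = 1, t = 0 | t = 1].

Lemma side0 p d s : p + d * s%:K = at_square p d s 0.
Proof. by rewrite /at_square rmorph0; ring. Qed.
Lemma side1 p d s : p + d + d * I * s%:K = at_square p d 1 s.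
Proof. by rewrite /at_square rmorph1; ring. Qed.
Lemma side2 p d s : p + d * I + d * s%:K = at_square p d s 1.
Proof. by rewrite /at_square rmorph1; ring. Qed.
Lemma side3 p d s : p + d * I * s%:K = at_square p d 0 s.
Proof. by rewrite /at_square rmorph0; ring. Qed.

Lemma square_le k (f : K -> K) p d (M : R) :
  (forall s t : R, 0 <= s <= 1 -> 0 <= t <= 1 -> on_boundary s t ->
    nm (f (at_square p d s t)) <= M) ->
  nm (square f k p d) <= 4 * M * nm d.
Proof.
move=> h; rewrite /square.
have -> : 4 * M * nm d = M * nm d + M * nm (d * I) + M * nm d + M * nm (d * I).
  by rewrite nmM nmI; ring.
have z1 : 0 <= (0 : R) <= 1 by lra.
have o1 : 0 <= (1 : R) <= 1 by lra.
apply: le_trans (nmD _ _) _; rewrite nmN; apply: lerD; last first.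
  by apply: edge_le => s s01; rewrite side3; apply: h => //; constructor 1.
apply: le_trans (nmD _ _) _; rewrite nmN; apply: lerD; last first.
  by apply: edge_le => s s01; rewrite side2; apply: h => //; constructor 4.
apply: le_trans (nmD _ _) _; apply: lerD; apply: edge_le => s s01.
  by rewrite side0; apply: h => //; constructor 3.
by rewrite side1; apply: h => //; constructor 2.
Qed.

Lemma squareD k f g p d :
  square (fun z => f z + g z) k p d = square f k p d + square g k p d.
Proof. by rewrite /square !edgeD; ring. Qed.

Lemma squareM k c f p d :
  square (fun z => c * f z) k p d = c * square f k p d.
Proof. by rewrite /square !edgeM; ring. Qed.

Lemma square_affine k a b p d : square (fun z => a * z + b) k p d = 0.
Proof. by rewrite /square !edge_affine; ring. Qed.

Definition corner (p d : K) (i j : nat) := p + d * 3^-1 *+ i + d * 3^-1 * I *+ j.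

(** By definition the sum over an edge at one level is the sum over its three thirds at the level
    below. The contributions of the inner edges of the nine subsquares therefore cancel identically,
    and no limit is involved. *)
Lemma square_split k f p d :
  square f k.+1 p d =
  \sum_(i < 3) \sum_(j < 3) square f k (corner p d i j) (d * 3^-1).
Proof.
rewrite !big_ord_recl !big_ord0 /= /square /corner /= !(mulrAC d I).
rewrite !mulr0n !mulr1n !mulr2n !addr0.
set e := d * 3^-1.
have -> : d = e + e + e by rewrite /e; field.
set u := e * I.
have -> : (e + e + e) * I = u + u + u by rewrite !mulrDl.
by rewrite !addrA !(addrAC _ e u); ring.
Qed.

Lemma corner_at (p d : K) i j (s t : R) :
  at_square (corner p d i j) (d * 3^-1) s t =
  at_square p d ((i%:R + s) / 3) ((j%:R + t) / 3).
Proof.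
rewrite /at_square /corner !realKM !realKD -!thirdK !rmorph_nat.
rewrite -(mulr_natr _ i) -(mulr_natr _ j); ring.
Qed.

(** The argument does not use convergence of the Riemann sums: being bad means exceeding [e] at
    arbitrarily fine levels, and the pigeonhole principle passes this on to one of the nine
    subsquares. *)
Definition square_bad (f : K -> K) p d (e : R) :=
  forall N, exists2 k, (N <= k)%N & e < nm (square f k p d).

Lemma square_bad_split f p d e : 0 < e -> square_bad f p d e ->
  exists ij : 'I_3 * 'I_3,
    square_bad f (corner p d ij.1 ij.2) (d * 3^-1) (e / 9).
Proof.
move=> e0 bad; apply: contrapT => /forallNP nb.
have /choice[N hN] : forall ij : 'I_3 * 'I_3, exists N, forall k, (N <= k)%N ->
    nm (square f k (corner p d ij.1 ij.2) (d * 3^-1)) <= e / 9.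
  move=> ij; have := nb ij; move=> /existsNP[N hN]; exists N => k Nk.
  by rewrite leNgt; apply/negP => h; apply: hN; exists k.
have [[//|k] /= hk] := bad (\max_ij N ij).+1.
rewrite ltNge => /negP; apply; rewrite square_split.
apply: le_trans (nm_sum _ _ _) _.
have -> : e = \sum_(i < 3) \sum_(j < 3) (e / 9).
  by rewrite !big_ord_recl !big_ord0; field.
apply: ler_sum => i _; apply: le_trans (nm_sum _ _ _) _.
apply: ler_sum => j _; apply: (hN (i, j)).
exact: leq_trans (leq_bigmax (i, j)) hk.
Qed.

Lemma nested_intervals (a r : nat -> R) :
  (forall n, a n <= a n.+1) -> (forall n, a n.+1 + r n.+1 <= a n + r n) ->
  (forall n, 0 <= r n) -> exists x, forall n, a n <= x <= a n + r n.
Proof.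
move=> ha hr r0.
have h n k : a n <= a (n + k)%N /\ a (n + k)%N + r (n + k)%N <= a n + r n.
  elim: k => [|k [h1 h2]]; first by rewrite addn0.
  rewrite addnS; split; first exact: le_trans (ha _).
  exact: le_trans (hr _) h2.
have ub n m : a m <= a n + r n.
  have [mn|nm] := leqP m n.
    have [] := h m (n - m)%N; rewrite subnKC // => h1 _.
    by apply: le_trans h1 _; rewrite lerDl.
  have [_] := h n (m - n)%N; rewrite subnKC ?(ltnW nm) //.
  by apply: le_trans; rewrite lerDl.
exists (sup (range a)) => n; apply/andP; split.
  apply: ub_le_sup; last by exists n.
  by exists (a 0 + r 0) => _ [m _ <-]; exact: ub.
by apply: ge_sup; [exists (a 0), 0%N|move=> _ [m _ <-]; exact: ub].
Qed.

(** Nested bad squares shrink to a point [z]. Near [z] the function is affine up to a remainder that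
    is small compared with the distance, and affine functions contribute nothing. *)
Lemma goursat (f : K -> K) p d :
  (forall s t : R, 0 <= s <= 1 -> 0 <= t <= 1 ->
     differentiable f (at_square p d s t)) ->
  forall e : R, 0 < e -> exists N, forall k, (N <= k)%N ->
    nm (square f k p d) <= e.
Proof.
move=> df e e0; apply: contrapT => /forallNP bad0.
have {}bad0 : square_bad f p d e.
  move=> N; have /existsNP[k /not_implyP[Nk /negP]] := bad0 N.
  by rewrite -ltNge => h; exists k.
pose t3 n : R := 3^-1 ^+ n.
have t3S n : t3 n.+1 = t3 n / 3 by rewrite /t3 exprSr.
have t3p n : 0 < t3 n by rewrite exprn_gt0.
pose good n (q : R * R) := [/\ 0 <= q.1 /\ q.1 + t3 n <= 1,
  0 <= q.2 /\ q.2 + t3 n <= 1 &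
  square_bad f (at_square p d q.1 q.2) (d * (t3 n)%:K) (e * (9^-1) ^+ n)].
have step n (q : R * R) : good n q -> exists q', good n.+1 q' /\
    [/\ q.1 <= q'.1, q'.1 + t3 n.+1 <= q.1 + t3 n,
        q.2 <= q'.2 & q'.2 + t3 n.+1 <= q.2 + t3 n].
  move=> [[a0 a1] [b0 b1] bad].
  have [|[i j] /= bad'] := square_bad_split _ bad.
    by rewrite mulr_gt0 // exprn_gt0.
  exists (q.1 + i%:R * t3 n.+1, q.2 + j%:R * t3 n.+1).
  have ib (k : 'I_3) : 0 <= k%:R * t3 n.+1 /\ k%:R * t3 n.+1 + t3 n.+1 <= t3 n.
    have := t3p n; rewrite t3S; case: k => -[|[|[|//]]] /= _; lra.
  have [i0 i1] := ib i; have [j0 j1] := ib j.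
  split=> /=; last by split; lra.
  split=> /=; first by lra.
    lra.
  move=> N; have [k Nk hk] := bad' N; exists k => //.
  rewrite exprSr -/(_ / 9) mulrA; move: hk; congr (_ < nm (square f k _ _)).
    rewrite /corner /at_square t3S !realKD !realKM -thirdK !rmorph_nat.
    rewrite -(mulr_natr _ i) -(mulr_natr _ j); ring.
  by rewrite t3S realKM -thirdK mulrA.
have good0 : good 0 (0, 0).
  split; rewrite /t3 expr0 /=; [lra|lra|].
  by rewrite rmorph1 !mulr1 /at_square rmorph0 mul0r addr0 mulr0 addr0.
(* Dependent choice: the level is stored together with the corner, so that [choice] yields a single
   step function, which is then iterated. *)
have [u [ug u0]] : exists u : nat -> R * R, (forall n, good n (u n)) /\
    forall n, [/\ (u n).1 <= (u n.+1).1, (u n.+1).1 + t3 n.+1 <= (u n).1 + t3 n,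
      (u n).2 <= (u n.+1).2 & (u n.+1).2 + t3 n.+1 <= (u n).2 + t3 n].
  have /choice[F hF] : forall x : {nq : nat * (R * R) | good nq.1 nq.2},
    exists y : {nq : nat * (R * R) | good nq.1 nq.2},
      let q := (sval x).2 in let q' := (sval y).2 in let n := (sval x).1 in
      (sval y).1 = n.+1 /\ [/\ q.1 <= q'.1, q'.1 + t3 n.+1 <= q.1 + t3 n,
        q.2 <= q'.2 & q'.2 + t3 n.+1 <= q.2 + t3 n].
    move=> [[n q] g] /=; have [q' [g' h]] := step n q g.
    by exists (exist _ (n.+1, q') g').
  pose x0 : {nq : nat * (R * R) | good nq.1 nq.2} := exist _ (0%N, (0, 0)) good0.
  have hn n : (sval (iter n F x0)).1 = n.
    by elim: n => [//|n ih] /=; have /= [-> _] := hF (iter n F x0); rewrite ih.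
  exists (fun n => (sval (iter n F x0)).2); split=> n.
    by have := svalP (iter n F x0); rewrite hn.
  by have /= [_] := hF (iter n F x0); rewrite hn.
have [a ha] : exists a, forall n, (u n).1 <= a <= (u n).1 + t3 n.
  apply: nested_intervals => n; first by case: (u0 n).
    by case: (u0 n).
  exact: ltW.
have [b hb] : exists b, forall n, (u n).2 <= b <= (u n).2 + t3 n.
  apply: nested_intervals => n; first by case: (u0 n).
    by case: (u0 n).
  exact: ltW.
have a01 : 0 <= a <= 1.
  by have := ha 0; have [[]] := ug 0; rewrite /t3 expr0; lra.
have b01 : 0 <= b <= 1.
  by have := hb 0; have [_ []] := ug 0; rewrite /t3 expr0; lra.
set z := at_square p d a b.
have [_ _ dz] := hasdP (df a b a01 b01).
rewrite -/z in dz.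
have d0 : 0 < nm d.
  rewrite lt_neqAle nm_ge0 andbT eq_sym; apply/negP => /eqP/nm_eq0 d0.
  have [k _] := bad0 0; rewrite d0; have -> : square f k p 0 = 0.
    apply: nm_eq0; apply/eqP; rewrite eq_le nm_ge0 andbT.
    have -> : 0 = 4 * nm (f p) * nm (0 : K) by rewrite nm0 mulr0.
    by apply: square_le => s t _ _ _; rewrite /at_square mul0r addr0.
  by rewrite nm0; lra.
(* On a square of side [dn] the distance to [z] is at most [2 * nm dn], so the four sides give at
   most [8 * eta * nm dn ^+ 2]. This choice makes it [e * 9^-1 ^+ n], the bound that the bad square
   exceeds. *)
pose eta := e / (8 * nm d ^+ 2).
have eta0 : 0 < eta by rewrite divr_gt0 // mulr_gt0 // exprn_gt0.
have [dl dl0 hdl] := dz eta eta0.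
have q01 : 0 <= (3^-1 : R) < 1 by lra.
have [n hn] := expr_lt_eps (2 * nm d) q01 dl0.
have {}hn := hn n (leqnn _).
have [[ua0 ua1] [ub0 ub1] bad] := ug n.
have [k _] := bad 0.
set q := at_square p d (u n).1 (u n).2.
set dn := d * (t3 n)%:K.
have ndn : nm dn = nm d * t3 n by rewrite /dn nmM nm_real ger0_norm // ltW.
pose D := 'd f z 1.
have dE h : 'd f z h = D * h.
  by rewrite -[h in LHS]mulr1 -[h * 1]/(h *: (1 : K)) linearZ /= mulrC.
have -> : square f k q dn = square (fun w => f w - (D * w + (f z - D * z))) k q dn.
  rewrite [RHS](squareD k f (fun w => - (D * w + (f z - D * z)))).
  have -> : (fun w => - (D * w + (f z - D * z))) =
    (fun w => - D * w + - (f z - D * z)) by apply/funext => w; ring.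
  by rewrite square_affine addr0.
apply/negP; rewrite -leNgt.
apply: (@le_trans _ _ (4 * (eta * (2 * nm dn)) * nm dn)); last first.
  rewrite ndn /eta /t3.
  have -> : (9^-1 : R) ^+ n = (3^-1 ^+ n) ^+ 2.
    rewrite -exprM mulnC exprM; congr (_ ^+ n); rewrite expr2; lra.
  rewrite le_eqVlt; apply/orP; left; apply/eqP; field.
  by rewrite gt_eqF.
apply: square_le => s t s01 t01 _.
have -> : at_square q dn s t = z + (at_square q dn s t - z) by ring.
set h := _ - z.
have hle : nm h <= 2 * nm dn.
  have -> : h = d * ((((u n).1 + t3 n * s - a)%:K) + ((u n).2 + t3 n * t - b)%:K * I).
    by rewrite /h /z /q /dn /at_square !(realKD, rmorphN, realKM); ring.
  rewrite nmM ndn mulrCA ler_wpM2l ?nm_ge0 //.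
  apply: le_trans (nmD _ _) _; rewrite nmM nmI !nm_real mulr1.
  have h1 : `|(u n).1 + t3 n * s - a| <= t3 n.
    by rewrite ler_norml; have := ha n; have := t3p n; nra.
  have h2 : `|(u n).2 + t3 n * t - b| <= t3 n.
    by rewrite ler_norml; have := hb n; have := t3p n; nra.
  lra.
have -> : f (z + h) - (D * (z + h) + (f z - D * z)) = f (z + h) - f z - 'd f z h.
  by rewrite dE; ring.
apply: le_trans (hdl _ _) _; last by rewrite ler_pM2l.
by apply: le_lt_trans hle _; rewrite ndn /t3; lra.
Qed.

(** The square with center [a]. Division into thirds, unlike bisection, leaves the center of the
    square in the center of one part, so an exceptional point at [a] remains central at all
    levels. *)
Definition csquare f k a d := square f k (a - d * 2^-1 * (1 + I)) d.

Lemma at_center (a d : K) (s t : R) :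
  at_square (a - d * 2^-1 * (1 + I)) d s t =
  a + d * ((s - 2^-1)%:K + (t - 2^-1)%:K * I).
Proof. by rewrite /at_square !realKD !rmorphN /= -!halfK; ring. Qed.

(** The eight outer squares avoid the center, so Goursat's theorem applies to each of them with
    tolerance [e / 9]. *)
Lemma csquare_step f a d :
  (forall s t : R, 0 <= s <= 1 -> 0 <= t <= 1 -> (s, t) <> (2^-1, 2^-1) ->
     differentiable f (a + d * ((s - 2^-1)%:K + (t - 2^-1)%:K * I))) ->
  forall e : R, 0 < e -> exists N, forall k, (N <= k)%N ->
    nm (csquare f k.+1 a d - csquare f k a (d * 3^-1)) <= e.
Proof.
move=> df e e0.
pose o1 : 'I_3 := inord 1.
have o1E : nat_of_ord o1 = 1%N by rewrite inordK.
have /choice[N hN] : forall ij : 'I_3 * 'I_3, exists N, forall k, (N <= k)%N ->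
    ij != (o1, o1) ->
    nm (square f k (corner (a - d * 2^-1 * (1 + I)) d ij.1 ij.2) (d * 3^-1)) <= e / 9.
  move=> [i j]; have [->|nij] := eqVneq (i, j) (o1, o1); first by exists 0%N.
  have e9 : 0 < e / 9 by lra.
  have [|N hN] := @goursat f (corner (a - d * 2^-1 * (1 + I)) d i j) (d * 3^-1) _ _ e9.
  - move=> s t s01 t01; rewrite corner_at at_center; apply: df.
    + by case: i {nij} => -[|[|[|//]]] /= _; lra.
    + by case: j {nij} => -[|[|[|//]]] /= _; lra.
    + move=> [h1 h2]; move/eqP: nij; apply; congr pair; apply/val_inj; rewrite /= o1E.
        by case: i h1 => -[|[|[|//]]] //= _ h1; exfalso; lra.
      by case: j h2 => -[|[|[|//]]] //= _ h2; exfalso; lra.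
  by exists N => k Nk _; exact: hN.
exists (\max_ij N ij)%N => k hk.
rewrite /csquare square_split pair_bigA (bigD1 (o1, o1)) //= addrC.
have -> : corner (a - d / 2 * (1 + 'i%C)) d o1 o1 = a - d * 3^-1 / 2 * (1 + I).
  by rewrite o1E /corner !mulr1n; field.
rewrite addrK; apply: le_trans (nm_sum _ _ _) _.
apply: (@le_trans _ _ (\sum_(ij : 'I_3 * 'I_3 | ij != (o1, o1)) e / 9)).
  apply: ler_sum => ij nij; apply: hN => //.
  exact: leq_trans (leq_bigmax ij) hk.
apply: (@le_trans _ _ (\sum_(ij : 'I_3 * 'I_3) e / 9)).
  rewrite [leRHS](bigD1 (o1, o1)) //= lerDr; lra.
by rewrite sumr_const card_prod card_ord -mulr_natr; lra.
Qed.

Lemma boundary_nm (d : K) (s t : R) : 0 <= s <= 1 -> 0 <= t <= 1 ->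
  on_boundary s t ->
  nm d / 2 <= nm (d * ((s - 2^-1)%:K + (t - 2^-1)%:K * I)) <= nm d.
Proof.
move=> s01 t01 b; rewrite nmM; apply/andP; split; last first.
  rewrite ler_piMr ?nm_ge0 //; apply: le_trans (nmD _ _) _.
  rewrite nmM nmI !nm_real mulr1.
  have : `|s - 2^-1| <= 2^-1 by rewrite ler_norml; lra.
  have : `|t - 2^-1| <= 2^-1 by rewrite ler_norml; lra.
  lra.
rewrite ler_wpM2l ?nm_ge0 //.
have [hs|ht] : `|s - 2^-1| = 2^-1 \/ `|t - 2^-1| = 2^-1.
  case: b => ->.
  - by left; rewrite sub0r normrN ger0_norm; lra.
  - by left; rewrite ger0_norm; lra.
  - by right; rewrite sub0r normrN ger0_norm; lra.
  - by right; rewrite ger0_norm; lra.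
- rewrite -[leLHS]hs; apply: le_trans (ler_nm_Re _); rewrite le_eqVlt; apply/orP; left.
  by apply/eqP; congr (`|_|); rewrite /= !mulr0 mul0r subr0 addr0.
- rewrite -[leLHS]ht; apply: le_trans (ler_nm_Im _); rewrite le_eqVlt; apply/orP; left.
  by apply/eqP; congr (`|_|); rewrite /= mulr1 mulr0 addr0 add0r.
Qed.

(** The sums over the middle square after n divisions are of the order of its side times the maximum
    of [f] on its boundary, where the distance to [a] is comparable to the side. As f is o(1 / (z -
    a)), the product is small. *)
Lemma goursat_center f a d : d != 0 ->
  (forall s t : R, 0 <= s <= 1 -> 0 <= t <= 1 -> (s, t) <> (2^-1, 2^-1) ->
     differentiable f (a + d * ((s - 2^-1)%:K + (t - 2^-1)%:K * I))) ->
  (forall e : R, 0 < e -> exists2 dl, 0 < dl &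
     forall z, nm (z - a) < dl -> nm (z - a) * nm (f z) <= e) ->
  forall e : R, 0 < e -> exists N, forall k, (N <= k)%N ->
    nm (csquare f k a d) <= e.
Proof.
move=> d0 df lim e e0.
have steps n : forall e : R, 0 < e -> exists N, forall k, (N <= k)%N ->
    nm (csquare f (k + n)%N a d - csquare f k a (d * 3^-1 ^+ n)) <= e.
  elim: n => [|n ih] e' e'0.
    by exists 0%N => k _; rewrite addn0 expr0 mulr1 subrr nm0 ltW.
  have [|N1 h1] := ih (e' / 2); first by lra.
  have [||N2 h2] := @csquare_step f a (d * 3^-1 ^+ n) _ (e' / 2); [|lra|].
    move=> s t s01 t01 st.
    pose q : R := 3^-1 ^+ n.
    have q1 : 0 < q <= 1.
      by rewrite exprn_gt0 //= exprn_ile1 //; lra.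
    have := df (2^-1 + q * (s - 2^-1)) (2^-1 + q * (t - 2^-1)).
    have -> : 3^-1 ^+ n = q%:K :> K by rewrite /q thirdK rmorphXn.
    have -> : d * q%:K * ((s - 2^-1)%:K + (t - 2^-1)%:K * I) =
      d * ((2^-1 + q * (s - 2^-1) - 2^-1)%:K + (2^-1 + q * (t - 2^-1) - 2^-1)%:K * I).
      rewrite (addrC 2^-1) addrK (addrC 2^-1) addrK !realKM; ring.
    apply; [nra|nra|].
    move=> [/eqP]; rewrite -subr_eq0 addrAC subrr add0r mulf_eq0 => /orP[/eqP|/eqP hs].
      lra.
    move=> /eqP; rewrite -subr_eq0 addrAC subrr add0r mulf_eq0 => /orP[/eqP|/eqP ht].
      lra.
    by apply: st; congr pair; lra.
  exists (maxn N1 N2) => k; rewrite geq_max => /andP[k1 k2].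
  rewrite addnS -addSn exprSr mulrA.
  apply: le_trans (nm_triangle (csquare f k.+1 a (d * 3^-1 ^+ n)) _ _) _.
  have := h1 k.+1 (leqW k1); have := h2 k k2; lra.
have [|dl dl0 hdl] := lim (e / 16); first lra.
have q01 : 0 <= (3^-1 : R) < 1 by lra.
have [n hn] := expr_lt_eps (nm d) q01 dl0.
have {}hn := hn n (leqnn _).
have [|N hN] := steps n (e / 2); first lra.
exists (N + n)%N => k kN.
have kn : (n <= k)%N by apply: leq_trans kN; exact: leq_addl.
have := hN (k - n)%N; rewrite subnK // => /(_ _) h.
have {}h := h ltac:(by rewrite leq_subRL // addnC).
set dn := d * 3^-1 ^+ n.
have dn0 : 0 < nm dn by rewrite nm_gt0 // mulf_neq0 // expf_neq0 // invr_eq0 three_neq0.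
have ndn : nm dn = nm d * 3^-1 ^+ n by rewrite /dn nmM nmX nm3V.
suff h2 : nm (csquare f (k - n) a dn) <= e / 2.
  have := nmD (csquare f k a d - csquare f (k - n) a dn) (csquare f (k - n) a dn).
  by rewrite subrK -/dn in h *; lra.
(* On the boundary the distance to [a] is at least [nm dn / 2], so the bound [e / 16] on the product
   gives [nm (f z) <= e / (8 * nm dn)]. *)
have -> : e / 2 = 4 * (e / (8 * nm dn)) * nm dn.
  by field; rewrite gt_eqF.
apply: square_le => s t s01 t01 b; rewrite at_center.
have /andP[b1 b2] := boundary_nm dn s01 t01 b.
set z := a + _.
have za : z - a = dn * ((s - 2^-1)%:K + (t - 2^-1)%:K * I) by rewrite /z addrAC subrr add0r.
have := hdl z; rewrite za => /(_ _) h3.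
have {}h3 := h3 ltac:(lra).
rewrite ler_pdivlMr; last by lra.
have := nm_ge0 (f z); nra.
Qed.

(** The integral is 2 pi i, each side contributing pi / 2 to the imaginary part. For the sums the
    following suffices: after scaling by the side the integrand is the inverse of u - i/2 with |u|
    at most 1/2, whose imaginary part (1/2) / (u^2 + 1/4) is at least 1. *)
Lemma kernel_ge k a (d : K) : d != 0 ->
  4 <= nm (csquare (fun z => (z - a)^-1) k a d).
Proof.
move=> d0; apply: le_trans (ler_nm_Im _); apply: le_trans (ler_norm _).
have key (c : K) (u : R) : `|u| <= 2^-1 -> c != 0 ->
   1 <= complex.Im ((c * (u%:K - I * 2^-1))^-1 * c : R[i]).
  move=> hu c0.
  have -> : (c * (u%:K - I * 2^-1))^-1 * c = (u%:K - I * 2^-1)^-1.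
    by rewrite invfM mulrAC mulVf // mul1r.
  pose v : R := u ^+ 2 + 4^-1.
  have v0 : 0 < v by rewrite /v; nra.
  have -> : (u%:K - I * 2^-1)^-1 = ((u / v)%:K + ((2^-1 / v)%:K) * I).
    have h : (u%:K - I * 2^-1) * ((u / v)%:K + ((2^-1 / v)%:K) * I) = 1.
      have -> : (u%:K - I * 2^-1) * ((u / v)%:K + ((2^-1 / v)%:K) * I) =
        (u%:K ^+ 2 - I * I * 2^-1 ^+ 2) * (v^-1)%:K.
        by rewrite !realKM -halfK; ring.
      rewrite sqrI halfK -!rmorphXn /= mulN1r opprK -realKD -realKM.
      have -> : (u ^+ 2 + 2^-1 ^+ 2) * v^-1 = 1.
        have -> : (2^-1 : R) ^+ 2 = 4^-1 by rewrite expr2; lra.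
        by rewrite mulfV // gt_eqF.
      by [].
    have nz : u%:K - I * 2^-1 != 0.
      by apply/eqP => z; move: h; rewrite z mul0r => /eqP; rewrite eq_sym oner_eq0.
    by apply: (mulfI nz); rewrite h mulfV.
  rewrite /= mulr1 mulr0 addr0 add0r ler_pdivlMr // mul1r /v.
  by move: hu; rewrite ler_norml; nra.
have I0 : I != 0 by apply/eqP => I0; have := nmI; rewrite I0 nm0; lra.
have nE (f : K -> K) p d' : - edge f k p d' = edge (fun z => -1 * f z) k p d'.
  by rewrite edgeM mulN1r.
rewrite /csquare /square !nE !raddfD /=.
have -> : (4 : R) = 1 + 1 + 1 + 1 by lra.
have E (x y c : K) : x = y -> 1 <= complex.Im (x^-1 * c : R[i]) ->
   1 <= complex.Im (y^-1 * c : R[i]) by move=> ->.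
have II : I ^+ 2 = -1 by exact: sqr_i.
apply: lerD; first apply: lerD; first apply: lerD;
  apply: edge_Im_ge => s /andP[s0 s1].
- apply: E (key d (s - 2^-1) _ d0); last by rewrite ler_norml; lra.
  by rewrite realKD rmorphN /= -halfK; field: II.
- apply: E (key (d * I) (s - 2^-1) _ _); [|by rewrite ler_norml; lra|exact: mulf_neq0].
  by rewrite realKD rmorphN /= -halfK; field: II.
- rewrite mulN1r mulNr -mulrN.
  apply: E (key (- d) (2^-1 - s) _ _); [|by rewrite ler_norml; lra|by rewrite oppr_eq0].
  by rewrite realKD rmorphN /= -halfK; field: II.
- rewrite mulN1r mulNr -mulrN.
  apply: E (key (- (d * I)) (2^-1 - s) _ _); [|by rewrite ler_norml; lra|by rewrite oppr_eq0 mulf_neq0].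
  by rewrite realKD rmorphN /= -halfK; field: II.
Qed.

(* Goursat's theorem for [(f z - f a - f' a (z - a)) / (z - a)^2], which is
   [o(1 / (z - a))] at the exceptional point [a]. *)
Lemma cauchy_estimate (f : K -> K) (a : K) (r M : R) : 0 < r ->
  (forall z, nm (z - a) < r -> differentiable f z) ->
  (forall z, nm (z - a) < r -> nm (f z) <= M) ->
  nm ('d f a 1) <= 16 * M / r.
Proof.
move=> r0 df fM.
pose d : K := (r / 2)%:K.
have nd : nm d = r / 2 by rewrite nm_real ger0_norm //; lra.
have d0 : d != 0 by apply/eqP => d0; move: nd; rewrite d0 nm0; lra.
set c := 'd f a 1.
have aa : nm (a - a) < r by rewrite subrr nm0.
have M0 : 0 <= M by apply: le_trans (nm_ge0 _) (fM a aa).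
pose H z := ((z - a)^-1) ^+ 2 * (f z - f a - c * (z - a)).
have HE : H = fun z => (((z - a)^-1) ^+ 2 * (f z - f a)) + (- c) * (z - a)^-1.
  apply/funext => z; rewrite /H; have [->|za] := eqVneq (z - a) 0.
    by rewrite invr0 expr0n !mul0r mulr0 addr0.
  by field.
have in_r (s t : R) : 0 <= s <= 1 -> 0 <= t <= 1 ->
   nm (d * ((s - 2^-1)%:K + (t - 2^-1)%:K * I)) < r.
  move=> s01 t01; rewrite nmM nd.
  have : nm ((s - 2^-1)%:K + (t - 2^-1)%:K * I) <= 1.
    apply: le_trans (nmD _ _) _; rewrite nmM nmI !nm_real mulr1.
    have : `|s - 2^-1| <= 2^-1 by rewrite ler_norml; lra.
    have : `|t - 2^-1| <= 2^-1 by rewrite ler_norml; lra.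
    lra.
  by have := nm_ge0 ((s - 2^-1)%:K + (t - 2^-1)%:K * I); nra.
have small : forall e : R, 0 < e -> exists N, forall k, (N <= k)%N ->
    nm (csquare H k a d) <= e.
  apply: goursat_center; [exact: d0| |].
    move=> s t s01 t01 st.
    set h := d * _; set z := a + h.
    have zh : z - a = h by rewrite /z addrAC subrr add0r.
    have za : z - a != 0.
      rewrite zh mulf_neq0 //; apply/eqP => h0; apply: st.
      have := congr1 (fun x : R[i] => complex.Re x) h0.
      have := congr1 (fun x : R[i] => complex.Im x) h0.
      rewrite /= ?(mulr0, mulr1, mul0r, addr0, add0r, subr0) => h1 h2.
      by congr pair; lra.
    have dz : differentiable f z by apply: df; rewrite zh; exact: in_r.
    have dza : differentiable (fun z : K => z - a) z.
      by apply: dif_sub; [exact: dif_id|exact: dif_cst].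
    apply: dif_mul; first exact/dif_exp/dif_inv.
    apply: dif_sub; first by apply: dif_sub => //; exact: dif_cst.
    by apply: dif_mul => //; exact: dif_cst.
  move=> e e0; have [_ _ /(_ e e0) [dl dl0 hdl]] := hasdP (df a aa).
  exists dl => // z za; rewrite /H nmM nmX nmV.
  have [->|n0] := eqVneq (z - a) 0; first by rewrite nm0 mul0r ltW.
  have n0' : 0 < nm (z - a) by exact: nm_gt0.
  have := hdl _ za; rewrite (addrC a) subrK => h.
  have cE : 'd f a (z - a) = c * (z - a).
    by rewrite -[z - a in LHS]mulr1 -[(z - a) * 1]/((z - a) *: (1 : K)) linearZ /= mulrC.
  rewrite cE in h.
  have -> : nm (z - a) * ((nm (z - a))^-1 ^+ 2 * nm (f z - f a - c * (z - a))) =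
    nm (f z - f a - c * (z - a)) / nm (z - a).
    by field; rewrite gt_eqF.
  by rewrite ler_pdivrMr.
suff : 4 * nm c <= 4 * (16 * M / r) by rewrite ler_pM2l.
apply/ler_addgt0Pr => e e0; have [N hN] := small e e0.
have {hN} := hN N (leqnn _).
(* The sums of (f z - f a) / (z - a)^2 and of c / (z - a) nearly agree. The second is at least
   [4 * nm c]; the first is at most 4 times (4 / r)^2 times 2 M times r / 2, since the distance to
   [a] is at least r / 4 on the boundary. This is the origin of the constant 16. *)
rewrite HE /csquare squareD squareM -/(csquare _ _ _ _) -/(csquare _ _ _ _).
set X := csquare _ _ _ _; set k := csquare _ _ _ _ => h.
have hk : 4 <= nm k by exact: kernel_ge.
have hX : nm X <= 4 * (16 * M / r).
  have -> : 4 * (16 * M / r) = 4 * ((4 / r) ^+ 2 * (M + M)) * nm d.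
    by rewrite nd; field; rewrite gt_eqF.
  apply: square_le => s t s01 t01 b; rewrite at_center.
  have /andP[b1 b2] := boundary_nm d s01 t01 b.
  set h' := d * _ in b1 b2 *; set z := a + h'.
  have zh : z - a = h' by rewrite /z addrAC subrr add0r.
  rewrite nmM; apply: ler_pM; rewrite ?nm_ge0 //.
    rewrite nmX nmV zh; apply: lerXn2r; rewrite ?nnegrE ?invr_ge0 ?nm_ge0 //.
      by rewrite divr_ge0 // ltW.
    have hp : 0 < nm h' by lra.
    by rewrite -[leRHS]invf_div lef_pV2 ?posrE //; lra.
  apply: le_trans (nmD _ _) _; rewrite nmN; apply: lerD; apply: fM => //.
  by rewrite zh; lra.
have := nmDD (- c * k) X; rewrite (addrC (- c * k)) nmM nmN.
have := nm_ge0 c; nra.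
Qed.

End Goursat.

(** * Consequences of the Cauchy estimate: Lipschitz bounds, limits, second derivatives *)

Section Estimates.
Variable R : realType.
Notation K := (Cplx R).
Local Notation "r %:K" := ((r%:C)%C : K) (at level 2, format "r %:K").

Definition cauchy_bounded (W : normedModType K) :=
  forall (f : K -> W) (a : K) (r M : R), 0 < r ->
    (forall z, nm (z - a) < r -> differentiable f z) ->
    (forall z, nm (z - a) < r -> nm (f z) <= M) ->
    nm ('d f a 1) <= 16 * M / r.

(** All that is asked of a target space: limits exist and the Cauchy estimate holds. Both pass from
    C to matrices entrywise and to products componentwise, which covers the spaces in use. *)
Definition nice (W : normedModType K) := complete_nm W /\ cauchy_bounded W.

Lemma dif_fst (V W : normedModType K) (x : (V * W)%type) :
  differentiable (fst : V * W -> V) x.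
Proof. by apply: (@linear_differentiable K (V * W)%type V fst x) => -[? ?]; exact: cvg_fst. Qed.

Lemma dif_snd (V W : normedModType K) (x : (V * W)%type) :
  differentiable (snd : V * W -> W) x.
Proof. by apply: (@linear_differentiable K (V * W)%type W snd x) => -[? ?]; exact: cvg_snd. Qed.

Lemma diff_fst (V W : normedModType K) (x : (V * W)%type) :
  'd (fst : V * W -> V) x = fst :> (V * W -> V).
Proof. by apply: (@diff_lin K (V * W)%type V fst x) => -[? ?]; exact: cvg_fst. Qed.

Lemma diff_snd (V W : normedModType K) (x : (V * W)%type) :
  'd (snd : V * W -> W) x = snd :> (V * W -> W).
Proof. by apply: (@diff_lin K (V * W)%type W snd x) => -[? ?]; exact: cvg_snd. Qed.

Lemma diff_coord (m n : nat) (M : 'M[K]_(m, n)) i j v :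
  'd (fun N : 'M[K]_(m, n) => N i j : K) M v = v i j.
Proof.
have @f : {linear 'M[K]_(m, n) -> K}.
  by exists (fun N : 'M[K]_(_, _) => N i j); do 2![eexists]; do ?[constructor];
     rewrite ?mxE// => ? *; rewrite ?mxE//; move=> ?; rewrite !mxE.
rewrite (_ : (fun _ => _) = f) // diff_lin //; exact/coord_continuous.
Qed.

Lemma nice_K : nice K.
Proof. by split; [exact: complete_K|move=> f a r M; exact: cauchy_estimate]. Qed.

Lemma nice_mx m n : nice 'M[K]_(m, n).
Proof.
split; first exact: complete_mx.
move=> f a r M r0 df fM.
have M0 : 0 <= M.
  by apply: le_trans (fM a _); [exact: nm_ge0|rewrite subrr nm0].
have df' z i j : nm (z - a) < r -> differentiable (fun z => f z i j : K) z.
  move=> za; apply: (dif_comp (g := fun N : 'M[K]_(m, n) => N i j : K)); first exact: df.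
  exact: differentiable_coord.
apply/nm_mxP; first by rewrite divr_ge0 ?mulr_ge0 // ltW.
move=> i j.
have -> : ('d f a 1) i j = 'd (fun z => f z i j : K) a 1.
  have da : differentiable f a by apply: df; rewrite subrr nm0.
  by rewrite (diff_compE _ da (@differentiable_coord K m n (f a) i j)) diff_coord.
apply: (cauchy_estimate r0) => [z za|z za]; first exact: df'.
exact: le_trans (nm_entry _ _ _) (fM z za).
Qed.

Lemma nice_pair (V W : normedModType K) : nice V -> nice W -> nice (V * W)%type.
Proof.
move=> [cV eV] [cW eW]; split; first exact: complete_pair.
move=> f a r M r0 df fM; rewrite nm_pairP.
have da : differentiable f a by apply: df; rewrite subrr nm0.
have -> : ('d f a 1).1 = 'd (fun z => (f z).1) a 1.
  by rewrite (diff_compE _ da (dif_fst (f a))) diff_fst.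
have -> : ('d f a 1).2 = 'd (fun z => (f z).2) a 1.
  by rewrite (diff_compE _ da (dif_snd (f a))) diff_snd.
apply/andP; split.
  apply: (eV _ _ _ _ r0) => z za.
    by apply: (dif_comp (g := fst : V * W -> V)); [exact: df|exact: dif_fst].
  by have := fM z za; rewrite nm_pairP => /andP[].
apply: (eW _ _ _ _ r0) => z za.
  by apply: (dif_comp (g := snd : V * W -> W)); [exact: df|exact: dif_snd].
by have := fM z za; rewrite nm_pairP => /andP[].
Qed.

Section MeanValue.
Variables V W : normedModType K.

Lemma mean_value (f : V -> W) (a b : V) (L : R) : 0 <= L ->
  (forall s : R, 0 <= s <= 1 -> differentiable f (a + s%:K *: (b - a)) /\
     nm ('d f (a + s%:K *: (b - a)) (b - a)) <= L) ->
  nm (f b - f a) <= L.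
Proof.
move=> L0 h.
pose g (s : R) := f (a + s%:K *: (b - a)).
have -> : f b = g 1 by rewrite /g rmorph1 scale1r addrC subrK.
have -> : f a = g 0 by rewrite /g rmorph0 scale0r addr0.
apply: lipschitz_segment => // s s01 e e0.
have [df dL] := h s s01.
have [_ _ hd] := hasdP df.
pose N := nm (b - a) + 1.
have N0 : 0 < N by rewrite ltr_wpDl ?nm_ge0.
have [|d d0 hd'] := hd (e / N); first by rewrite divr_gt0.
exists (d / N); first by rewrite divr_gt0.
move=> s' s'01 s's.
have E : a + s'%:K *: (b - a) = a + s%:K *: (b - a) + (s' - s)%:K *: (b - a).
  by rewrite rmorphB scalerBl -addrA subrKC.
have hN : nm ((s' - s)%:K *: (b - a)) <= N * `|s' - s|.
  by rewrite nmZ nm_real mulrC ler_wpM2r // /N; lra.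
have hlt : nm ((s' - s)%:K *: (b - a)) < d.
  apply: le_lt_trans hN _.
  by rewrite mulrC -ltr_pdivlMr.
have := hd' _ hlt; rewrite -E -/(g s') -/(g s) linearZ /= => h1.
have h2 : nm ((s' - s)%:K *: 'd f (a + s%:K *: (b - a)) (b - a)) <= L * `|s' - s|.
  by rewrite nmZ nm_real mulrC ler_wpM2r.
rewrite -(subrK ((s' - s)%:K *: 'd f (a + s%:K *: (b - a)) (b - a)) (g s' - g s)).
apply: le_trans (nmD _ _) _; rewrite mulrDl addrC; apply: lerD => //.
apply: le_trans h1 _; apply: (@le_trans _ _ (e / N * (N * `|s' - s|))).
  by rewrite ler_wpM2l // divr_ge0 // ltW.
by rewrite mulrA divfK // gt_eqF.
Qed.

Lemma ball_segment (a c d : V) (r s : R) : nm (c - a) < r -> nm (d - a) < r ->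
  0 <= s <= 1 -> nm (c + s%:K *: (d - c) - a) < r.
Proof.
move=> ca da /andP[s0 s1].
have -> : c + s%:K *: (d - c) - a = (1 - s)%:K *: (c - a) + s%:K *: (d - a).
  have -> : d - c = (d - a) - (c - a) by rewrite opprB addrA subrK.
  by rewrite rmorphB rmorph1 scalerBl scale1r scalerBr addrAC addrA [RHS]addrAC.
apply: le_lt_trans (nmD _ _) _; rewrite !nmZ !nm_real !ger0_norm //; last lra.
have [->|/eqP s1'] := eqVneq s 1; first by rewrite subrr mul0r add0r mul1r.
have : (1 - s) * nm (c - a) < (1 - s) * r by rewrite ltr_pM2l //; lra.
have : s * nm (d - a) <= s * r by apply: ler_wpM2l => //; exact: ltW.
lra.
Qed.

Lemma lipschitz_ball (f : V -> W) (a : V) (r L : R) : 0 <= L ->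
  (forall x, nm (x - a) < r -> differentiable f x) ->
  (forall x v, nm (x - a) < r -> nm ('d f x v) <= L * nm v) ->
  forall x y, nm (x - a) < r -> nm (y - a) < r ->
  nm (f x - f y) <= L * nm (x - y).
Proof.
move=> L0 df fL x y xa ya; apply: mean_value; first by rewrite mulr_ge0 ?nm_ge0.
by move=> s s01; split; [apply: df|apply: fL]; exact: ball_segment.
Qed.

End MeanValue.

Lemma line_hasd (V : normedModType K) (a v : V) z :
  hasd (fun z : K => a + z *: v) z (fun z => z *: v).
Proof.
split=> [k x y||e e0].
- by rewrite scalerDl -scalerA.
- by exists (nm v) => x; rewrite nmZ mulrC.
exists 1 => // h _.
have -> : a + (z + h) *: v - (a + z *: v) - h *: v = 0 by lmod (Cplx R) V.
rewrite nm0.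
by rewrite mulr_ge0 ?nm_ge0 // ltW.
Qed.

Lemma diff_translate (V W : normedModType K) (f : V -> W) (c x v : V) :
  differentiable f (x + c) -> 'd (fun y => f (y + c)) x v = 'd f (x + c) v.
Proof.
move=> df.
have h : hasd (fun y : V => y + c) x id.
  split=> //; first by exists 1 => w; rewrite mul1r.
  move=> e e0; exists 1 => // h _.
  have -> : x + h + c - (x + c) - h = 0 by lmod (Cplx R) V.
  rewrite nm0.
  by rewrite mulr_ge0 ?nm_ge0 // ltW.
have [d1 d2] := hasd_diff h.
by apply: etrans (diff_compE _ d1 df) _; rewrite d2.
Qed.

Section Derivative.
Variables V W : normedModType K.
Hypothesis niceW : nice W.

(** The Cauchy estimate on the complex line through [a] in the direction [v], in the disc of radius
    [r / nm v]. *)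
Lemma deriv_le (f : V -> W) (a : V) (r M : R) : 0 < r ->
  (forall x, nm (x - a) < r -> differentiable f x) ->
  (forall x, nm (x - a) < r -> nm (f x) <= M) ->
  forall v, nm ('d f a v) <= 16 * M / r * nm v.
Proof.
move=> r0 df fM v.
have [->|v0] := eqVneq v 0; first by rewrite linear0 !nm0 mulr0.
have nv := nm_gt0 v0.
have aa : nm (a - a) < r by rewrite subrr nm0.
pose g (z : K) := f (a + z *: v).
have [dl Dl] := hasd_diff (line_hasd a v 0).
have dlz z : differentiable (fun z : K => a + z *: v) z by case: (hasd_diff (line_hasd a v z)).
have in_r (z : K) : nm (z - 0) < r / nm v -> nm (a + z *: v - a) < r.
  by rewrite subr0 (addrC a) addrK nmZ ltr_pdivlMr.
have -> : 'd f a v = 'd g 0 1.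
  have da : differentiable f (a + 0 *: v) by rewrite scale0r addr0; exact: df.
  have := diff_comp dl da.
  by move/(congr1 (fun h : K -> W => h 1)) => /= ->; rewrite Dl scale0r addr0 scale1r.
have [_ eW] := niceW.
have -> : 16 * M / r * nm v = 16 * M / (r / nm v).
  by field; rewrite !gt_eqF.
apply: eW => [|z za|z za]; first by rewrite divr_gt0.
  by apply: dif_comp; [exact: dlz|apply: df; exact: in_r].
by apply: fM; exact: in_r.
Qed.

Lemma bound_ge0 (f : V -> W) (a : V) (r M : R) : 0 < r ->
  (forall x, nm (x - a) < r -> nm (f x) <= M) -> 0 <= M.
Proof.
by move=> r0 /(_ a); rewrite subrr nm0 => /(_ r0); apply: le_trans; exact: nm_ge0.
Qed.

Lemma deriv_le_in (f : V -> W) (a : V) (r M : R) : 0 < r ->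
  (forall x, nm (x - a) < r -> differentiable f x) ->
  (forall x, nm (x - a) < r -> nm (f x) <= M) ->
  forall x v, nm (x - a) < r / 2 -> nm ('d f x v) <= 32 * M / r * nm v.
Proof.
move=> r0 df fM x v xa.
have -> : 32 * M / r = 16 * M / (r / 2) by field; rewrite gt_eqF.
have h y : nm (y - x) < r / 2 -> nm (y - a) < r.
  by move=> yx; apply: le_lt_trans (nm_triangle x _ _) _; lra.
apply: deriv_le; first by lra.
  by move=> y /h; exact: df.
by move=> y /h; exact: fM.
Qed.

Lemma lipschitz_half (f : V -> W) (a : V) (r M : R) : 0 < r ->
  (forall x, nm (x - a) < r -> differentiable f x) ->
  (forall x, nm (x - a) < r -> nm (f x) <= M) ->
  forall x y, nm (x - a) < r / 2 -> nm (y - a) < r / 2 ->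
  nm (f x - f y) <= 32 * M / r * nm (x - y).
Proof.
move=> r0 df fM; apply: lipschitz_ball.
- by rewrite divr_ge0 ?mulr_ge0 ?(bound_ge0 r0 fM) // ltW.
- by move=> x xa; apply: df; lra.
- by move=> x v; exact: deriv_le_in.
Qed.

(** The Lipschitz bound is used twice: for [f] with radius r, which bounds the translation
    difference by [32 * M / r * nm w], and for this difference with radius r / 4. The constant is 32
    * 32 * 4 = 16^3. *)
Lemma second_difference (f : V -> W) (a : V) (r M : R) : 0 < r ->
  (forall x, nm (x - a) < r -> differentiable f x) ->
  (forall x, nm (x - a) < r -> nm (f x) <= M) ->
  forall x y w, nm (x - a) < r / 8 -> nm (y - a) < r / 8 -> nm w < r / 4 ->
  nm (f (x + w) - f x - (f (y + w) - f y)) <= (16 * 16 * 16) * M / r ^+ 2 * nm w * nm (x - y).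
Proof.
move=> r0 df fM x y w xa ya wr.
pose D z := f (z + w) - f z.
have M0 := bound_ge0 r0 fM.
have zw z : nm (z - a) < r / 4 -> nm (z + w - a) < r / 2.
  by move=> za; rewrite addrAC; apply: le_lt_trans (nmD _ _) _; lra.
have -> : (16 * 16 * 16) * M / r ^+ 2 * nm w * nm (x - y) =
   32 * (32 * M / r * nm w) / (r / 4) * nm (x - y).
  by field; rewrite gt_eqF.
apply: (@lipschitz_half D a (r / 4)).
- by lra.
- move=> z za; have := zw z za => zwa.
  apply: dif_sub; last by apply: df; lra.
  apply: dif_comp; first by apply: dif_add; [exact: dif_id|exact: dif_cst].
  by apply: df; lra.
- move=> z za; rewrite /D.
  have -> : nm w = nm (z + w - z) by rewrite addrAC subrr add0r.
  by apply: (lipschitz_half r0 df fM); [exact: zw|lra].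
- lra.
- lra.
Qed.

Lemma deriv_cvg_scale (f : V -> W) (a v : V) : differentiable f a ->
  forall e : R, 0 < e -> exists2 d : R, 0 < d & forall t : K, t != 0 -> nm t < d ->
    nm (t^-1 *: (f (a + t *: v) - f a) - 'd f a v) <= e.
Proof.
move=> da e e0; have [_ _ h] := hasdP da.
pose N := nm v + 1.
have N0 : 0 < N by rewrite ltr_wpDl ?nm_ge0.
have [|d d0 hd] := h (e / N); first by rewrite divr_gt0.
exists (d / N) => [|t t0 td]; first by rewrite divr_gt0.
have nt := nm_gt0 t0.
have tv : nm (t *: v) < d.
  rewrite nmZ; move: td; rewrite ltr_pdivlMr //.
  by apply: le_lt_trans; rewrite ler_wpM2l ?nm_ge0 // /N; lra.
have := hd _ tv; rewrite linearZ /= => h1.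
have -> : t^-1 *: (f (a + t *: v) - f a) - 'd f a v =
   t^-1 *: (f (a + t *: v) - f a - t *: 'd f a v).
  by rewrite [in RHS]scalerBr scalerA mulVf // scale1r.
rewrite nmZ nmV mulrC ler_pdivrMr //; apply: le_trans h1 _.
rewrite nmZ mulrCA mulrA mulrAC -mulrA [leRHS]mulrC ler_wpM2l ?nm_ge0 //.
by rewrite mulrC -mulrA ler_piMr ?(ltW e0) // mulrC ler_pdivrMr // mul1r /N lerDl.
Qed.

(** The limit of [second_difference] for w = t v, divided by t. *)
Lemma deriv_lipschitz (f : V -> W) (a : V) (r M : R) : 0 < r ->
  (forall x, nm (x - a) < r -> differentiable f x) ->
  (forall x, nm (x - a) < r -> nm (f x) <= M) ->
  forall x y v, nm (x - a) < r / 8 -> nm (y - a) < r / 8 ->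
  nm ('d f x v - 'd f y v) <= (16 * 16 * 16) * M / r ^+ 2 * nm v * nm (x - y).
Proof.
move=> r0 df fM x y v xa ya; apply/ler_addgt0Pr => e e0.
have dx : differentiable f x by apply: df; lra.
have dy : differentiable f y by apply: df; lra.
have e2 : 0 < e / 2 by lra.
have [d1 d10 h1] := deriv_cvg_scale v dx e2.
have [d2 d20 h2] := deriv_cvg_scale v dy e2.
pose N := nm v + 1.
have N0 : 0 < N by rewrite ltr_wpDl ?nm_ge0.
pose t := Num.min (Num.min (d1 / 2) (d2 / 2)) (r / 8 / N).
have t0 : 0 < t by rewrite !lt_min !divr_gt0.
have [td1 td2 td3] : [/\ t < d1, t < d2 & t * N <= r / 8].
  have a1 : t <= d1 / 2 by rewrite !ge_min lexx.
  have a2 : t <= d2 / 2 by rewrite !ge_min lexx orbT.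
  have a3 : t <= r / 8 / N by rewrite !ge_min lexx orbT.
  by split; [lra|lra|rewrite -ler_pdivlMr].
have tK : t%:K != 0 by rewrite -(rmorph0 (@real_complex R)) (inj_eq (@complexI R)) gt_eqF.
have nt : nm t%:K = t by rewrite nm_real gtr0_norm.
have tv : nm (t%:K *: v) < r / 4.
  rewrite nmZ nt; have : t * nm v <= t * N by rewrite ler_pM2l // /N; lra.
  lra.
have := second_difference r0 df fM xa ya tv.
have := h1 _ tK; rewrite nt => /(_ td1).
have := h2 _ tK; rewrite nt => /(_ td2).
set A := f _ - f y; set B := f _ - f x => hA hB hAB.
have -> : 'd f x v - 'd f y v = (t%:K^-1 *: A - 'd f y v) - (t%:K^-1 *: B - 'd f x v) + t%:K^-1 *: (B - A).
  lmod (Cplx R) W.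
apply: le_trans (nmD _ _) _; rewrite addrC; apply: lerD.
  rewrite nmZ nmV nt mulrC ler_pdivrMr //; apply: le_trans hAB _.
  rewrite nmZ nt le_eqVlt; apply/orP; left; apply/eqP; ring.
by apply: le_trans (nmD _ _) _; rewrite nmN; lra.
Qed.

Lemma taylor2 (f : V -> W) (a : V) (r M : R) : 0 < r ->
  (forall x, nm (x - a) < r -> differentiable f x) ->
  (forall x, nm (x - a) < r -> nm (f x) <= M) ->
  forall h, nm h < r / 8 ->
  nm (f (a + h) - f a - 'd f a h) <= (16 * 16 * 16) * M / r ^+ 2 * nm h ^+ 2.
Proof.
move=> r0 df fM h hr.
have da : differentiable f a by apply: df; rewrite subrr nm0.
have M0 := bound_ge0 r0 fM.
pose g x := f x - 'd f a x.
have dlin x : differentiable ('d f a) x by apply: linear_differentiable; exact: diff_continuous.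
have dg x : nm (x - a) < r -> differentiable g x.
  by move=> xa; apply: dif_sub; [exact: df|exact: dlin].
have -> : f (a + h) - f a - 'd f a h = g (a + h) - g a.
  by rewrite /g linearD /=; lmod (Cplx R) W.
apply: mean_value.
  by rewrite mulr_ge0 ?exprn_ge0 ?nm_ge0 // divr_ge0 ?exprn_ge0 ?(ltW r0) // mulr_ge0.
have -> : a + h - a = h by rewrite addrC addKr.
move=> s /andP[s0 s1].
have sh : nm (s%:K *: h) <= nm h.
  by rewrite nmZ nm_real ger0_norm // ler_piMl ?nm_ge0.
have xa : nm (a + s%:K *: h - a) < r / 8 by rewrite addrC addKr; apply: le_lt_trans hr.
split; first by apply: dg; lra.
have -> : 'd g (a + s%:K *: h) h = 'd f (a + s%:K *: h) h - 'd f a h.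
  have dx : differentiable f (a + s%:K *: h) by apply: df; lra.
  apply: etrans (diff_subE _ dx (dlin _)) _; congr (_ - _).
  by apply: diff_linE; exact: diff_continuous.
apply: le_trans (deriv_lipschitz r0 df fM _ xa _) _.
  by rewrite subrr nm0; lra.
rewrite (addrC a) addrK expr2 mulrA ler_wpM2l //.
by rewrite mulr_ge0 ?nm_ge0 // divr_ge0 ?mulr_ge0 ?(ltW r0).
Qed.

Lemma cvgs_le (X : normedModType K) (u : nat -> X) (l : X) (M : R) :
  cvgs u l -> (exists N, forall n, (N <= n)%N -> nm (u n) <= M) -> nm l <= M.
Proof.
move=> ul [N hN]; apply/ler_addgt0Pr => e e0; have [N' hN'] := ul e e0.
have := hN _ (leq_maxl N N'); have := hN' _ (leq_maxr N N').
set n := maxn _ _ => h1 h2.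
rewrite -(subKr (u n) l); apply: le_trans (nmD _ _) _; rewrite nmN; lra.
Qed.

Lemma cvgsD (X : normedModType K) (u w : nat -> X) (k l : X) :
  cvgs u k -> cvgs w l -> cvgs (fun n => u n + w n) (k + l).
Proof.
move=> uk wl e e0; have [|N1 h1] := uk (e / 2); first by lra.
have [|N2 h2] := wl (e / 2); first by lra.
exists (maxn N1 N2) => n; rewrite geq_max => /andP[/h1 {}h1 /h2 {}h2].
by rewrite opprD addrACA; apply: le_lt_trans (nmD _ _) _; lra.
Qed.

Lemma cvgsZ (X : normedModType K) (u : nat -> X) (l : X) (c : K) :
  cvgs u l -> cvgs (fun n => c *: u n) (c *: l).
Proof.
move=> ul e e0; have N0 : 0 < nm c + 1 by rewrite ltr_wpDl ?nm_ge0.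
have [|N hN] := ul (e / (nm c + 1)); first by rewrite divr_gt0.
exists N => n /hN; rewrite ltr_pdivlMr // -scalerBr nmZ mulrC; apply: le_lt_trans.
by rewrite ler_wpM2r ?nm_ge0 // lerDl.
Qed.

Lemma cvgsB (X : normedModType K) (u w : nat -> X) (k l : X) :
  cvgs u k -> cvgs w l -> cvgs (fun n => u n - w n) (k - l).
Proof.
move=> uk wl; have h : cvgs (fun n => -1 *: w n) (-1 *: l) by exact: cvgsZ.
by have := cvgsD uk h; rewrite scaleN1r; under eq_fun do rewrite scaleN1r.
Qed.

Lemma cvgs_cauchy (X : normedModType K) (u : nat -> X) (l : X) :
  cvgs u l -> cauchys u.
Proof.
move=> ul e e0; have [|N hN] := ul (e / 2); first by lra.
exists N => n m Nn Nm; apply: le_lt_trans (nm_triangle l _ _) _.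
by have := hN n Nn; have := hN m Nm; rewrite (nmB l); lra.
Qed.

Lemma scaled_lt (t e : R) (p q p' q' : W) : 0 < t ->
  p' = t%:K *: p -> q' = t%:K *: q -> nm (p' - q') < t * e -> nm (p - q) < e.
Proof.
move=> t0 -> ->; have -> : t%:K *: p - t%:K *: q = t%:K *: (p - q) by rewrite scalerBr.
by rewrite nmZ nm_real gtr0_norm // ltr_pM2l.
Qed.

Lemma four_point (an am bn bm dn dm : W) (x e : R) :
  nm (bn - an - dn) <= x -> nm (bm - am - dm) <= x -> x <= e / 4 ->
  nm (bn - bm) < e / 8 -> nm (an - am) < e / 8 -> nm (dn - dm) < e.
Proof.
move=> h1 h2 hx h3 h4.
have -> : dn - dm = (bm - am - dm) - (bn - an - dn) + (bn - bm) - (an - am).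
  by lmod (Cplx R) W.
apply: le_lt_trans (nmD _ _) _; rewrite nmN.
have := nmD (bm - am - dm - (bn - an - dn)) (bn - bm).
have := nmD (bm - am - dm) (- (bn - an - dn)); rewrite nmN.
have := nm_ge0 (bn - bm); lra.
Qed.

Lemma cauchy_scale_le (C t v N e : R) : 0 <= C -> 0 < t -> 0 <= v -> v <= N ->
  t * (4 * (C + 1) * N ^+ 2) <= e -> C * (t ^+ 2 * v ^+ 2) <= t * e / 4.
Proof.
move=> C0 t0 v0 vN te.
have h : v ^+ 2 <= N ^+ 2 by rewrite !expr2; nra.
have h0 := sqr_ge0 v.
have h1 : C * v ^+ 2 <= (C + 1) * N ^+ 2 by nra.
have h2 : t * (C * v ^+ 2) <= e / 4 by nra.
have -> : C * (t ^+ 2 * v ^+ 2) = t * (t * (C * v ^+ 2)) by ring.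
by rewrite -mulrA ler_pM2l.
Qed.

(** The second order Taylor bound is uniform along the sequence. So for a small fixed step the
    difference quotients of [F k], which converge, approximate the derivatives uniformly in [k];
    hence the derivatives form a Cauchy sequence, and the Taylor bound passes to the limit. *)
Lemma limit_holomorphic (F : nat -> V -> W) (f : V -> W) (a : V) (r M : R) : 0 < r ->
  (forall k x, nm (x - a) < r -> differentiable (F k) x) ->
  (forall k x, nm (x - a) < r -> nm (F k x) <= M) ->
  (forall x, nm (x - a) < r -> cvgs (F^~ x) (f x)) ->
  differentiable f a /\ forall v, cvgs (fun k => 'd (F k) a v) ('d f a v).
Proof.
move=> r0 dF FM lim.
have M0 := bound_ge0 r0 (FM 0%N).
have [C [C0 T]] : exists C : R, 0 <= C /\ forall k h, nm h < r / 8 ->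
    nm (F k (a + h) - F k a - 'd (F k) a h) <= C * nm h ^+ 2.
  exists ((16 * 16 * 16) * M / r ^+ 2); split.
    by rewrite divr_ge0 ?exprn_ge0 ?mulr_ge0 // ltW.
  by move=> k h hr; apply: (taylor2 r0 (dF k) (FM k)).
have in_r h : nm h < r / 8 -> nm (a + h - a) < r.
  by rewrite (addrC a) addrK => ?; lra.
have aa : nm (a - a) < r by rewrite subrr nm0.
have /choice[L hL] : forall v, exists l, cvgs (fun k => 'd (F k) a v) l.
  move=> v; have [cW _] := niceW; apply: cW => e e0.
  pose N := nm v + 1.
  have N0 : 0 < N by rewrite ltr_wpDl ?nm_ge0.
  (* The first term keeps t v inside the Taylor radius; the second makes the Taylor error at most t
     e / 4, a quarter of the tolerance after division by t. *)
  pose t := Num.min (r / 16 / N) (e / (4 * (C + 1) * N ^+ 2)).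
  have t0 : 0 < t.
    by rewrite lt_min !divr_gt0 ?mulr_gt0 ?exprn_gt0 // ltr_wpDl.
  have t1 : t * N <= r / 16 by rewrite -ler_pdivlMr // ge_min lexx.
  have t2 : t * (4 * (C + 1) * N ^+ 2) <= e.
    rewrite -ler_pdivlMr; first by rewrite ge_min lexx orbT.
    by rewrite !mulr_gt0 ?exprn_gt0 // ltr_wpDl.
  have nt : nm t%:K = t by rewrite nm_real gtr0_norm.
  have tv : nm (t%:K *: v) < r / 8.
    rewrite nmZ nt; have : t * nm v <= t * N by rewrite ler_pM2l // /N; lra.
    lra.
  have [|N1 h1] := cvgs_cauchy (lim _ (in_r _ tv)) (_ : 0 < t * e / 8).
    by rewrite divr_gt0 ?mulr_gt0.
  have [|N2 h2] := cvgs_cauchy (lim _ aa) (_ : 0 < t * e / 8).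
    by rewrite divr_gt0 ?mulr_gt0.
  exists (maxn N1 N2) => n m; rewrite !geq_max => /andP[n1 n2] /andP[m1 m2].
  have Tn := T n _ tv; have Tm := T m _ tv.
  have hb : C * nm (t%:K *: v) ^+ 2 <= t * e / 4.
    by rewrite nmZ nt exprMn; apply: (@cauchy_scale_le _ _ _ N); rewrite ?nm_ge0 // /N lerDl.
  have Zn : 'd (F n) a (t%:K *: v) = t%:K *: 'd (F n) a v by exact: linearZ.
  have Zm : 'd (F m) a (t%:K *: v) = t%:K *: 'd (F m) a v by exact: linearZ.
  apply: (scaled_lt t0 Zn Zm); clear Zn Zm.
  exact: (four_point Tn Tm hb (h1 n m n1 m1) (h2 n m n2 m2)).
have L_lin : linear L.
  move=> k x y; apply: (cvgs_unique (hL _)).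
  by under eq_fun do rewrite linearP; apply: cvgsD => //; exact: cvgsZ.
have hasL : hasd f a L.
  split=> //.
    exists (16 * M / r) => v; apply: (cvgs_le (hL v)); exists 0%N => k _.
    by apply: deriv_le => //; [exact: dF|exact: FM].
  move=> e e0; pose d := Num.min (r / 8) (e / (C + 1)).
  have d0 : 0 < d by rewrite lt_min !divr_gt0 // ltr_wpDl.
  exists d => // h hd.
  have hr : nm h < r / 8 by apply: lt_le_trans hd _; rewrite ge_min lexx.
  have he : nm h * (C + 1) <= e.
    rewrite -ler_pdivlMr; last by rewrite ltr_wpDl.
    by apply: ltW; apply: lt_le_trans hd _; rewrite ge_min lexx orbT.
  apply: (@le_trans _ _ (C * nm h ^+ 2)).
    apply: (@cvgs_le _ (fun k => F k (a + h) - F k a - 'd (F k) a h)).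
      by apply: cvgsB => //; apply: cvgsB; apply: lim => //; exact: in_r.
    by exists 0%N => k _; exact: T.
  have := nm_ge0 h; rewrite expr2 mulrA => h0; apply: ler_wpM2r => //.
  by move: he; lra.
have [df dfL] := hasd_diff hasL.
have E v : L v = 'd f a v by rewrite -dfL.
by split; [exact: df|move=> v; have := hL v; rewrite E].
Qed.

Lemma inv_nat_cvg : forall e : R, 0 < e -> exists N, forall n, (N <= n)%N ->
  (n.+1%:R)^-1 < e.
Proof.
move=> e e0; have [N _ hN] : \forall n \near \oo, (n.+1%:R)^-1 < e.
  by near=> n; rewrite -[ltLHS]/(harmonic n); near: n; exact: near_infty_natSinv_lt (PosNum e0).
by exists N => n Nn; apply: hN.
Unshelve. all: by end_near. Qed.

(** Difference quotients with a fixed step are holomorphic and bounded by the Lipschitz constant, so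
    [limit_holomorphic] applies to them. The steps are returned because the convergence of the
    derivatives of these quotients yields the symmetry of second derivatives. *)
Lemma deriv_holomorphic_aux (f : V -> W) (a v : V) (r M : R) : 0 < r ->
  (forall x, nm (x - a) < r -> differentiable f x) ->
  (forall x, nm (x - a) < r -> nm (f x) <= M) ->
  differentiable (fun x => 'd f x v) a /\
  exists t : nat -> K, [/\ forall k, t k != 0, cvgs t 0 & forall w,
    cvgs (fun k => (t k)^-1 *: ('d f (a + t k *: v) w - 'd f a w))
      ('d (fun x => 'd f x v) a w)].
Proof.
move=> r0 df fM.
have M0 := bound_ge0 r0 fM.
pose N := nm v + 1.
have N0 : 0 < N by rewrite ltr_wpDl ?nm_ge0.
pose t0 := r / 4 / N.
have t00 : 0 < t0 by rewrite !divr_gt0.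
have t0N : t0 * nm v <= r / 4.
  by rewrite /t0 -mulrA ler_piMr ?divr_ge0 ?(ltW r0) // mulrC ler_pdivrMr // mul1r /N lerDl.
pose t (k : nat) : K := (t0 / k.+1%:R)%:K.
have tk0 k : 0 < t0 / k.+1%:R by rewrite divr_gt0.
have nt k : nm (t k) = t0 / k.+1%:R by rewrite nm_real gtr0_norm.
have tn0 k : t k != 0.
  by rewrite -(rmorph0 (@real_complex R)) (inj_eq (@complexI R)) gt_eqF.
have tle k : nm (t k) <= t0.
  by rewrite nt ler_pdivrMr // ler_peMr ?(ltW t00) // ler1n.
have tv k : nm (t k *: v) <= r / 4.
  by rewrite nmZ; apply: le_trans t0N; rewrite ler_wpM2r ?nm_ge0.
have lim x : nm (x - a) < r -> cvgs (fun k => (t k)^-1 *: (f (x + t k *: v) - f x)) ('d f x v).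
  move=> xa e e0; have [|d d0 hd] := deriv_cvg_scale v (df x xa) (_ : 0 < e / 2).
    by lra.
  have [|N' hN] := inv_nat_cvg (_ : 0 < d / t0); first by rewrite divr_gt0.
  exists N' => k Nk; apply: (@le_lt_trans _ _ (e / 2)); last by lra.
  by apply: hd => //; rewrite nt mulrC -ltr_pdivlMr //; exact: hN.
have shift x k : nm (x - a) < r / 4 -> nm (x + t k *: v - a) < r / 2.
  by move=> xa; rewrite addrAC; apply: le_lt_trans (nmD _ _) _; have := tv k; lra.
have dsh k x : differentiable (fun x => x + t k *: v) x.
  by apply: dif_add; [exact: dif_id|exact: dif_cst].
have dQ k x : nm (x - a) < r / 4 ->
    differentiable (fun x => f (x + t k *: v) - f x) x.
  move=> xa; apply: dif_sub; last by apply: df; lra.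
  by apply: (dif_comp (dsh k x)); apply: df; have := shift x k xa; lra.
have dk k w : 'd (fun x => (t k)^-1 *: (f (x + t k *: v) - f x)) a w =
    (t k)^-1 *: ('d f (a + t k *: v) w - 'd f a w).
  have aa : nm (a - a) < r / 4 by rewrite subrr nm0; lra.
  have d1 : differentiable f (a + t k *: v).
    by apply: df; have := shift a k aa; lra.
  have d2 : differentiable f a by apply: df; lra.
  apply: etrans (diff_scaleE _ _ (dQ k a aa)) _; congr (_ *: _).
  apply: etrans (diff_subE _ (dif_comp (dsh k a) d1) d2) _; congr (_ - _).
  exact: diff_translate.
have := @limit_holomorphic (fun k x => (t k)^-1 *: (f (x + t k *: v) - f x))
  (fun x => 'd f x v) a (r / 4) (32 * M / r * nm v).
case.
- by lra.
- by move=> k x xa; apply: dif_scale; exact: dQ.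
- move=> k x xa; rewrite nmZ nmV mulrC ler_pdivrMr ?nm_gt0 //.
  have -> : 32 * M / r * nm v * nm (t k) = 32 * M / r * nm (x + t k *: v - x).
    by rewrite (addrC x) addrK nmZ; ring.
  by apply: (lipschitz_half r0 df fM); [exact: shift|lra].
- by move=> x xa; apply: lim; lra.
move=> dv cv; split; first exact: dv.
exists t; split; first exact: tn0.
  move=> e e0; have [|N' hN] := inv_nat_cvg (_ : 0 < e / t0); first by rewrite divr_gt0.
  by exists N' => k Nk; rewrite subr0 nt mulrC -ltr_pdivlMr //; exact: hN.
by move=> w; under eq_fun do rewrite -dk; exact: cv.
Qed.

Lemma locally_bounded (f : V -> W) (a : V) : differentiable f a ->
  exists2 r : R, 0 < r & forall x, nm (x - a) < r -> nm (f x) <= nm (f a) + 1.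
Proof.
move=> da; have [r r0 h] := differentiable_nm_continuous da ltr01.
exists r => // x /h xa; rewrite -[f x](subrK (f a)); apply: le_trans (nmD _ _) _; lra.
Qed.

Definition holo_at (f : V -> W) (a : V) := \forall x \near a, differentiable f x.

Lemma holo_at_ball (f : V -> W) (a : V) : holo_at f a ->
  exists r M : R, [/\ 0 < r,
    forall x, nm (x - a) < r -> differentiable f x &
    forall x, nm (x - a) < r -> nm (f x) <= M].
Proof.
move=> /near_nmP[r1 r10 h1].
have da : differentiable f a by apply: h1; rewrite subrr nm0.
have [r2 r20 h2] := locally_bounded da.
exists (Num.min r1 r2), (nm (f a) + 1); split; first by rewrite lt_min r10.
  by move=> x; rewrite lt_min => /andP[/h1].
by move=> x; rewrite lt_min => /andP[_ /h2].
Qed.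

Lemma holo_at_near (f : V -> W) (a : V) : holo_at f a ->
  \forall x \near a, holo_at f x.
Proof. exact: near_join. Qed.

Lemma holo_deriv (f : V -> W) (a v : V) : holo_at f a ->
  holo_at (fun x => 'd f x v) a.
Proof.
move=> /holo_at_near; apply: filterS => x /holo_at_ball[r [M [r0 df fM]]].
by have [] := deriv_holomorphic_aux v r0 df fM.
Qed.

(** Along the steps of [deriv_holomorphic_aux] the left side is the limit of the quotients of
    ['d f (a + t v) w - 'd f a w] by t, and these are also the difference quotients whose limit is
    the right side. *)
Lemma deriv_sym (f : V -> W) (a v w : V) : holo_at f a ->
  'd (fun x => 'd f x v) a w = 'd (fun x => 'd f x w) a v.
Proof.
move=> ha; have [r [M [r0 df fM]]] := holo_at_ball ha.
have [_ [t [tn0 t0 ct]]] := deriv_holomorphic_aux v r0 df fM.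
apply: (cvgs_unique (ct w)) => e e0.
have da : differentiable (fun x => 'd f x w) a.
  by have /near_nmP[d d0 hd] := holo_deriv w ha; apply: hd; rewrite subrr nm0.
have [|d d0 hd] := deriv_cvg_scale v da (_ : 0 < e / 2); first by lra.
have [N hN] := t0 d d0.
exists N => k /hN; rewrite subr0 => kd; apply: (@le_lt_trans _ _ (e / 2)); last by lra.
exact: hd.
Qed.

End Derivative.
End Estimates.

(** The derivative as an ordinary function of point and direction, locked so that rewriting meets an
    opaque term instead of the bundled linear map ['d f a]. *)
HB.lock Definition dd (K : numFieldType) (V W : normedModType K) (f : V -> W)
  (a v : V) : W := 'd f a v.

Lemma ddE (K : numFieldType) (V W : normedModType K) (f : V -> W) x v :
  dd f x v = 'd f x v.
Proof. by rewrite dd.unlock. Qed.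

Section DD.
Variable K : numFieldType.
Variables U V W : normedModType K.
Implicit Types (f g : V -> W) (a b : V -> K) (x v : V).

Lemma dd_ext f g x v : f = g -> dd f x v = dd g x v. Proof. by move=> ->. Qed.
Lemma dd_add f g x v : differentiable f x -> differentiable g x ->
  dd (fun y => f y + g y) x v = dd f x v + dd g x v.
Proof. by rewrite !ddE; exact: diff_addE. Qed.
Lemma dd_sub f g x v : differentiable f x -> differentiable g x ->
  dd (fun y => f y - g y) x v = dd f x v - dd g x v.
Proof. by rewrite !ddE; exact: diff_subE. Qed.
Lemma dd_mul a b x v : differentiable a x -> differentiable b x ->
  dd (fun y => a y * b y) x v = a x * dd b x v + b x * dd a x v.
Proof. by rewrite !ddE; exact: diff_mulE. Qed.
Lemma dd_scale (k : K) f x v : differentiable f x ->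
  dd (fun y => k *: f y) x v = k *: dd f x v.
Proof. by rewrite !ddE; exact: diff_scaleE. Qed.
Lemma dd_cst (c : W) x v : dd (fun _ : V => c) x v = 0.
Proof. by rewrite ddE; exact: diff_cstE. Qed.
Lemma dd_id x v : dd (fun y : V => y) x v = v.
Proof. by rewrite ddE; exact: diff_idE. Qed.
Lemma dd_sum (I : Type) (s : seq I) (P : pred I) (F : I -> V -> W) x v :
  (forall i, P i -> differentiable (F i) x) ->
  dd (fun y => \sum_(i <- s | P i) F i y) x v = \sum_(i <- s | P i) dd (F i) x v.
Proof.
move=> h; rewrite ddE diff_sumE //; apply: eq_bigr => i _; by rewrite ddE.
Qed.
Lemma dd_comp (f : U -> V) (g : V -> W) (x v : U) :
  differentiable f x -> differentiable g (f x) ->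
  dd (fun y => g (f y)) x v = dd g (f x) (dd f x v).
Proof. by rewrite !ddE; exact: diff_compE. Qed.
Lemma dd_addr f x u v : dd f x (u + v) = dd f x u + dd f x v.
Proof. by rewrite !ddE linearD. Qed.
Lemma dd_scaler f x (k : K) v : dd f x (k *: v) = k *: dd f x v.
Proof. by rewrite !ddE linearZ. Qed.
Lemma dd_zeror f x : dd f x 0 = 0. Proof. by rewrite ddE linear0. Qed.
Lemma dd_oppr f x v : dd f x (- v) = - dd f x v.
Proof. by rewrite !ddE linearN. Qed.
Lemma dd_sumr f x (I : Type) (s : seq I) (P : pred I) (F : I -> V) :
  dd f x (\sum_(i <- s | P i) F i) = \sum_(i <- s | P i) dd f x (F i).
Proof.
elim/big_rec2: _ => [|i y1 y2 _ <-]; first exact: dd_zeror.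
by rewrite dd_addr.
Qed.
End DD.

Section Hol.
Variable R : realType.
Notation K := (Cplx R).
Local Notation "r %:K" := ((r%:C)%C : K) (at level 2, format "r %:K").

Definition hol (V W : normedModType K) (f : V -> W) (a : V) :=
  \forall x \near a, differentiable f x.

Lemma hasd_dd (V W : normedModType K) (f : V -> W) x (L : V -> W) : hasd f x L ->
  differentiable f x /\ forall v, dd f x v = L v.
Proof. by move=> /hasd_diff[df E]; split=> // v; rewrite ddE E. Qed.

Lemma hol_dif (V W : normedModType K) (f : V -> W) x : hol f x -> differentiable f x.
Proof. exact: nbhs_singleton. Qed.
Lemma hol_near (V W : normedModType K) (f : V -> W) x :
  hol f x -> \forall y \near x, hol f y.
Proof. exact: near_join. Qed.

Section HolRules.
Variables V W : normedModType K.
Implicit Types (f g : V -> W) (a b : V -> K) (x v : V).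

Lemma hol_cst (c : W) x : hol (fun _ : V => c) x.
Proof. by apply: filterE => y; exact: dif_cst. Qed.
Lemma hol_id x : hol (fun y : V => y) x.
Proof. by apply: filterE => y; exact: dif_id. Qed.
Lemma hol_add f g x : hol f x -> hol g x -> hol (fun y => f y + g y) x.
Proof. by apply: filterS2 => y; exact: dif_add. Qed.
Lemma hol_sub f g x : hol f x -> hol g x -> hol (fun y => f y - g y) x.
Proof. by apply: filterS2 => y; exact: dif_sub. Qed.
Lemma hol_opp f x : hol f x -> hol (fun y => - f y) x.
Proof. by apply: filterS => y; exact: dif_opp. Qed.
Lemma hol_scale (k : K) f x : hol f x -> hol (fun y => k *: f y) x.
Proof. by apply: filterS => y; exact: dif_scale. Qed.
Lemma hol_mul a b x : hol a x -> hol b x -> hol (fun y => a y * b y) x.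
Proof. by apply: filterS2 => y; exact: dif_mul. Qed.
Lemma hol_exp a n x : hol a x -> hol (fun y => a y ^+ n) x.
Proof. by apply: filterS => y; exact: dif_exp. Qed.
Lemma hol_sum (I : Type) (s : seq I) (P : pred I) (F : I -> V -> W) x :
  (forall i, P i -> hol (F i) x) -> hol (fun y => \sum_(i <- s | P i) F i y) x.
Proof.
move=> h; elim: s => [|i s ih].
  by under eq_fun do rewrite big_nil; exact: hol_cst.
under eq_fun do rewrite big_cons; case: (boolP (P i)) => // Pi.
by apply: hol_add => //; exact: h.
Qed.
Lemma hol_prod (I : Type) (s : seq I) (P : pred I) (F : I -> V -> K) x :
  (forall i, P i -> hol (F i) x) -> hol (fun y => \prod_(i <- s | P i) F i y) x.
Proof.
move=> h; elim: s => [|i s ih].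
  by under eq_fun do rewrite big_nil; exact: filterE (fun y => differentiable_cst _ _).
under eq_fun do rewrite big_cons; case: (boolP (P i)) => // Pi.
by apply: hol_mul => //; exact: h.
Qed.
Lemma dif_near_eq f g x : (\forall y \near x, f y = g y) -> differentiable f x ->
  differentiable g x /\ forall v, dd g x v = dd f x v.
Proof.
move=> e df; have [|dg E] := @hasd_dd V W g x ('d f x).
  have [l b o] := hasdP df; split=> // e0 e00.
  have [d d0 hd] := o e0 e00.
  have /near_nmP[d' d'0 hd'] := e.
  exists (Num.min d d'); first by rewrite lt_min d0.
  move=> k; rewrite lt_min => /andP[kd kd'].
  rewrite -(hd' (x + k)) ?(addrC x) ?addrK // -(hd' x) ?subrr ?nm0 //.
  by rewrite (addrC k); exact: hd.
by split=> [|v]; [exact: dg|rewrite E ddE].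
Qed.
Lemma dd_near_eq f g x v : (\forall y \near x, f y = g y) -> differentiable f x ->
  dd g x v = dd f x v.
Proof. by move=> e df; have [_] := dif_near_eq e df. Qed.
Lemma hol_eq f g x : (\forall y \near x, f y = g y) -> hol f x -> hol g x.
Proof.
move=> /near_join e /near_join h; near=> y.
have ey : \forall z \near y, f z = g z by near: y.
have hy : \forall z \near y, differentiable f z by near: y; exact: h.
have dy := nbhs_singleton hy.
have [dg _] := dif_near_eq ey dy.
exact: dg.
Unshelve. all: by end_near. Qed.
Lemma hol_ball f x : hol f x -> exists r M : R, [/\ 0 < r,
    forall y, nm (y - x) < r -> differentiable f y &
    forall y, nm (y - x) < r -> nm (f y) <= M].
Proof. exact: holo_at_ball. Qed.
Lemma ball_near (P : set V) x (r : R) : (forall y, nm (y - x) < r -> P y) ->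
  forall y, nm (y - x) < r -> \forall z \near y, P z.
Proof.
move=> h y yx; apply/near_nmP; exists (r - nm (y - x)); first by lra.
by move=> z zy; apply: h; apply: le_lt_trans (nm_triangle y _ _) _; lra.
Qed.
Hypothesis niceW : nice W.
Lemma hol_dd f x v : hol f x -> hol (fun y => dd f y v) x.
Proof.
by under [fun y => _]eq_fun do rewrite ddE; exact: holo_deriv.
Qed.
Lemma dd_sym f x v w : hol f x ->
  dd (fun y => dd f y v) x w = dd (fun y => dd f y w) x v.
Proof.
move=> hf; rewrite !ddE.
have -> : (fun y => dd f y v) = (fun y => 'd f y v) by apply/funext => y; rewrite ddE.
have -> : (fun y => dd f y w) = (fun y => 'd f y w) by apply/funext => y; rewrite ddE.
exact: deriv_sym.
Qed.
Lemma dd_le f x (r M : R) : 0 < r ->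
  (forall y, nm (y - x) < r -> differentiable f y) ->
  (forall y, nm (y - x) < r -> nm (f y) <= M) ->
  forall v, nm (dd f x v) <= 16 * M / r * nm v.
Proof. by move=> r0 df fM v; rewrite ddE; exact: deriv_le. Qed.
Lemma dd_taylor f x (r M : R) : 0 < r ->
  (forall y, nm (y - x) < r -> differentiable f y) ->
  (forall y, nm (y - x) < r -> nm (f y) <= M) ->
  forall h, nm h < r / 8 ->
  nm (f (x + h) - f x - dd f x h) <= (16 * 16 * 16) * M / r ^+ 2 * nm h ^+ 2.
Proof. by move=> r0 df fM v; rewrite ddE; exact: taylor2. Qed.
Lemma limit_hol (F : nat -> V -> W) f x (r M : R) : 0 < r ->
  (forall k y, nm (y - x) < r -> differentiable (F k) y) ->
  (forall k y, nm (y - x) < r -> nm (F k y) <= M) ->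
  (forall y, nm (y - x) < r -> cvgs (F^~ y) (f y)) ->
  differentiable f x /\ forall v, cvgs (fun k => dd (F k) x v) (dd f x v).
Proof.
move=> r0 dF FM lim; have [df h] := limit_holomorphic niceW r0 dF FM lim.
split=> [|v]; first exact: df.
have E : (fun k => dd (F k) x v) = (fun k => 'd (F k) x v).
  by apply/funext => k; rewrite ddE.
by rewrite E ddE.
Qed.
End HolRules.

Lemma hol_inv (V : normedModType K) (a : V -> K) x : hol a x -> a x != 0 -> hol (fun y => (a y)^-1) x.
Proof.
move=> ha ax.
have : \forall y \near x, a y != 0.
  have [r r0 h] := differentiable_nm_continuous (hol_dif ha) (nm_gt0 ax).
  apply/near_nmP; exists r => // y /h h1; apply/eqP => ay.
  by move: h1; rewrite ay sub0r nmN ltxx.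
by apply: filterS2 ha => y dy ay; exact: dif_inv.
Qed.
Lemma hol_comp (U V W : normedModType K) (f : U -> V) (g : V -> W) x :
  hol f x -> hol g (f x) -> hol (fun y => g (f y)) x.
Proof.
move=> hf hg; have cf := differentiable_continuous (hol_dif hf).
have : \forall y \near x, differentiable g (f y) := cf _ hg.
by apply: filterS2 hf => y dfy dgy; exact: dif_comp.
Qed.
Lemma hol_pair (U V W : normedModType K) (f : U -> V) (g : U -> W) x :
  hol f x -> hol g x -> hol (fun y => (f y, g y)) x.
Proof. by apply: filterS2 => y; exact: differentiable_pair. Qed.
Lemma dd_pair (U V W : normedModType K) (f : U -> V) (g : U -> W) x v :
  differentiable f x -> differentiable g x ->
  dd (fun y => (f y, g y)) x v = (dd f x v, dd g x v).
Proof.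
move=> df dg; have := congr1 (fun F => F v) (diff_pair df dg).
by rewrite !ddE.
Qed.
Lemma hol_fst (V W : normedModType K) (x : (V * W)%type) : hol (fst : V * W -> V) x.
Proof. by apply: filterE => y; exact: dif_fst. Qed.
Lemma hol_snd (V W : normedModType K) (x : (V * W)%type) : hol (snd : V * W -> W) x.
Proof. by apply: filterE => y; exact: dif_snd. Qed.
Lemma dd_fst (V W : normedModType K) (x v : (V * W)%type) : dd (fst : V * W -> V) x v = v.1.
Proof. by rewrite ddE diff_fst. Qed.
Lemma dd_snd (V W : normedModType K) (x v : (V * W)%type) : dd (snd : V * W -> W) x v = v.2.
Proof. by rewrite ddE diff_snd. Qed.
Lemma hol_coord m n (x : 'M[K]_(m, n)) i j : hol (fun y : 'M[K]_(m, n) => y i j : K) x.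
Proof. by apply: filterE => y; exact: differentiable_coord. Qed.
Lemma dd_coord m n (x v : 'M[K]_(m, n)) i j :
  dd (fun y : 'M[K]_(m, n) => y i j : K) x v = v i j.
Proof. by rewrite ddE; exact: diff_coord. Qed.
Lemma dd_translate (V W : normedModType K) (f : V -> W) (c x v : V) :
  differentiable f (x + c) -> dd (fun y => f (y + c)) x v = dd f (x + c) v.
Proof. by rewrite !ddE; exact: diff_translate. Qed.
End Hol.

(** * Averages and Hadamard quotients *)

Section Averages.
Variable R : realType.
Notation K := (Cplx R).
Local Notation "r %:K" := ((r%:C)%C : K) (at level 2, format "r %:K").

Lemma dif_scalev (V W : normedModType K) (k : V -> K) (F : V -> W) x :
  differentiable k x -> differentiable F x ->
  differentiable (fun y => k y *: F y) x /\
  forall v, dd (fun y => k y *: F y) x v = k x *: dd F x v + dd k x v *: F x.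
Proof.
move=> dk dF; apply: hasd_dd.
have [_ [C1 b1] o1] := hasdP dk; have [_ [C2 b2] o2] := hasdP dF.
have Dk h : 'd k x h = dd k x h by rewrite ddE.
have DF h : 'd F x h = dd F x h by rewrite ddE.
split.
- move=> c u w; rewrite !dd_addr !dd_scaler.
  have -> : c *: dd k x u = c * dd k x u by [].
  lmod (Cplx R) W.
- exists (nm (k x) * C2 + C1 * nm (F x)) => u; apply: le_trans (nmD _ _) _.
  have := b1 u; have := b2 u; rewrite Dk DF => h1 h2.
  rewrite !nmZ mulrDl; apply: lerD; first by rewrite -mulrA ler_wpM2l ?nm_ge0.
  by rewrite mulrAC ler_wpM2r ?nm_ge0.
move=> e e0.
pose A := nm (k x) + 1; pose B := nm (F x) + 1; pose C := `|C2| + 1.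
have A0 : 0 < A by rewrite ltr_wpDl ?nm_ge0.
have B0 : 0 < B by rewrite ltr_wpDl ?nm_ge0.
have C0 : 0 < C by rewrite ltr_wpDl.
have [|d1 d10 h1] := o1 (e / 3 / B); first by rewrite !divr_gt0.
have [|d2 d20 h2] := o2 (e / 3 / A); first by rewrite !divr_gt0.
have [|d3 d30 h3] := differentiable_nm_continuous dk (_ : 0 < Num.min 1 (e / 3 / C)).
  by rewrite lt_min !divr_gt0 //= ltr01.
exists (Num.min (Num.min d1 d2) d3) => [|h]; first by rewrite !lt_min d10 d20.
rewrite !lt_min => /andP[/andP[hd1 hd2] hd3].
have := h1 h hd1; have := h2 h hd2; have := h3 (x + h).
rewrite (addrC x) addrK => /(_ hd3); rewrite lt_min => /andP[k1 k2]; rewrite Dk DF.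
set p := F (h + x); set q := k (h + x) in k1 k2 *.
set dp := dd F x h; set dq := dd k x h => e2 e1.
have -> : q *: p - k x *: F x - (k x *: dp + dq *: F x) =
  q *: (p - F x - dp) + (q - k x) *: dp + (q - k x - dq) *: F x.
  by lmod (Cplx R) W.
have hdp : nm dp <= C * nm h.
  rewrite /dp -DF; apply: le_trans (b2 h) _; rewrite ler_wpM2r ?nm_ge0 //.
  by rewrite /C; have := ler_norm C2; lra.
have hq : nm q <= A.
  by rewrite -[q](subrK (k x)); apply: le_trans (nmD _ _) _; rewrite /A addrC; lra.
have t1 : nm (q *: (p - F x - dp)) <= e / 3 * nm h.
  rewrite nmZ; apply: (@le_trans _ _ (A * (e / 3 / A * nm h))).
    by apply: ler_pM; rewrite ?nm_ge0.
  by rewrite mulrA mulrCA mulfV ?mulr1 ?gt_eqF.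
have t2 : nm ((q - k x) *: dp) <= e / 3 * nm h.
  rewrite nmZ; apply: (@le_trans _ _ (e / 3 / C * (C * nm h))).
    by apply: ler_pM; rewrite ?nm_ge0 // ltW.
  by rewrite mulrA divfK ?gt_eqF.
have t3 : nm ((q - k x - dq) *: F x) <= e / 3 * nm h.
  rewrite nmZ; apply: (@le_trans _ _ (e / 3 / B * nm h * B)).
    by apply: ler_pM; rewrite ?nm_ge0 // /B lerDl.
  by rewrite mulrAC divfK ?gt_eqF.
apply: le_trans (nmD _ _) _; have := nmD (q *: (p - F x - dp)) ((q - k x) *: dp).
lra.
Qed.

Lemma hol_scalev (V W : normedModType K) (k : V -> K) (F : V -> W) x :
  hol k x -> hol F x -> hol (fun y => k y *: F y) x.
Proof. by apply: filterS2 => y dk dF; case: (dif_scalev dk dF). Qed.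

Lemma hol_mx (V : normedModType K) m n (F : V -> 'M[K]_(m, n)) x :
  (forall i j, hol (fun y => F y i j : K) x) -> hol F x.
Proof.
move=> h; have -> : F = fun y => \sum_i \sum_j (F y i j) *: delta_mx i j.
  by apply/funext => y; exact: matrix_sum_delta.
apply: hol_sum => i _; apply: hol_sum => j _; apply: hol_scalev => //.
exact: hol_cst.
Qed.

Lemma bounded_linear_hol (V W : normedModType K) (L : V -> W) (C : R) x :
  linear L -> (forall y, nm (L y) <= C * nm y) ->
  hol L x /\ forall w, dd L x w = L w.
Proof.
move=> lin bd.
have h y : hasd L y L.
  split=> //; first by exists C.
  move=> e e0; exists 1 => // k _.
  have -> : L (y + k) = L y + L k by have := lin 1 y k; rewrite !scale1r.
  have -> : L y + L k - L y - L k = 0 by lmod (Cplx R) W.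
  by rewrite nm0 mulr_ge0 ?nm_ge0 // ltW.
split; last by case: (hasd_dd (h x)).
by apply: filterE => y; case: (hasd_dd (h y)).
Qed.

Section Operator.
Variables V W : normedModType K.
Hypothesis niceW : nice W.
Variables (v : V) (ell : V -> K) (Bl : R).
Hypothesis ell_lin : forall (c : K) x y, ell (c *: x + y) = c * ell x + ell y.
Hypothesis ell_le : forall x, nm (ell x) <= Bl * nm x.
Hypothesis Bl_ge0 : 0 <= Bl.
Hypothesis ell_v : ell v = 1.

Lemma ellD x y : ell (x + y) = ell x + ell y.
Proof. by have := ell_lin 1 x y; rewrite scale1r mul1r. Qed.
Lemma ell0 : ell 0 = 0.
Proof. by have := ellD 0 0; rewrite addr0 => /eqP; rewrite -subr_eq subrr => /eqP. Qed.
Lemma ellZ c x : ell (c *: x) = c * ell x.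
Proof. by have := ell_lin c x 0; rewrite !addr0 ell0 addr0. Qed.
Lemma ellN x : ell (- x) = - ell x.
Proof. by rewrite -scaleN1r ellZ mulN1r. Qed.
Lemma ellB x y : ell (x - y) = ell x - ell y.
Proof. by rewrite ellD ellN. Qed.

Lemma hol_ell x : hol ell x.
Proof. by case: (@bounded_linear_hol V K ell Bl x ell_lin ell_le). Qed.
Lemma dd_ell x w : dd ell x w = ell w.
Proof. by case: (@bounded_linear_hol V K ell Bl x ell_lin ell_le). Qed.

(* For s from 0 to 1, slide x s runs through the segment from the projection of
   x to the kernel of ell along v to x. *)
Definition slide (x : V) (s : R) : V := x - ((1 - s)%:K * ell x) *: v.

Definition slideB := 1 + Bl * nm v.
Lemma slideB_gt0 : 0 < slideB.
Proof. by rewrite ltr_pwDl ?ltr01 // mulr_ge0 ?nm_ge0. Qed.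

Lemma slide_le x s : 0 <= s <= 1 -> nm (slide x s) <= slideB * nm x.
Proof.
move=> /andP[s0 s1]; apply: le_trans (nmD _ _) _; rewrite nmN nmZ nmM nm_real.
have -> : slideB * nm x = nm x + Bl * nm x * nm v by rewrite /slideB; ring.
rewrite ger0_norm ?subr_ge0 // lerD2l.
apply: ler_wpM2r; first exact: nm_ge0.
apply: le_trans (ell_le x); rewrite ler_piMl ?nm_ge0 //; lra.
Qed.

Lemma slide_lin s : linear (slide ^~ s).
Proof. by move=> c x y; rewrite /slide ell_lin; lmod (Cplx R) V. Qed.

Lemma slide_hol s x : 0 <= s <= 1 ->
  hol (slide ^~ s) x /\ forall w, dd (slide^~ s) x w = slide w s.
Proof.
by move=> s01; apply: (@bounded_linear_hol V V _ slideB);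
  [exact: slide_lin|move=> y; exact: slide_le].
Qed.

Lemma slide_v s : slide v s = s%:K *: v.
Proof. by rewrite /slide ell_v realKD rmorphN rmorph1; lmod (Cplx R) V. Qed.

Lemma slide1 x : slide x 1 = x.
Proof. by rewrite /slide subrr mul0r scale0r subr0. Qed.

Lemma slide_sub x s t : slide x s - slide x t = ((s - t)%:K * ell x) *: v.
Proof.
rewrite /slide !realKD !rmorphN rmorph1; lmod (Cplx R) V.
Qed.

(** One radius and one bound serve for the whole segment from the projection of [x] to [x]; the
    estimates for the Riemann sums are expressed by them. *)
Definition tube (g : V -> W) (x : V) (d M : R) :=
  forall s, 0 <= s <= 1 -> forall y, nm (y - slide x s) < d ->
    differentiable g y /\ nm (g y) <= M.

Lemma tube_near g x d M y : 0 < d -> tube g x d M ->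
  nm (y - x) < d / 2 / slideB -> tube g y (d / 2) M.
Proof.
move=> d0 tx yx s s01 z zy; apply: (tx s s01).
apply: le_lt_trans (nm_triangle (slide y s) _ _) _.
have -> : slide y s - slide x s = slide (y - x) s.
  by rewrite /slide ellB; lmod (Cplx R) V.
have := slide_le (y - x) s01; have := slideB_gt0.
move: yx; rewrite ltr_pdivlMr ?slideB_gt0 // mulrC; lra.
Qed.

Lemma tube_M_ge0 g x d M : 0 < d -> tube g x d M -> 0 <= M.
Proof.
move=> d0 t; have [||_] := t 1 _ (slide x 1).
- by rewrite ler01 lexx.
- by rewrite subrr nm0.
by apply: le_trans; exact: nm_ge0.
Qed.

Lemma tube_lipschitz g x d M s t : 0 < d -> tube g x d M ->
  0 <= s <= 1 -> 0 <= t <= 1 ->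
  nm (g (slide x s) - g (slide x t)) <=
    16 * M / d * (nm (ell x) * nm v) * `|s - t|.
Proof.
move=> d0 tu s01 t01; have M0 := tube_M_ge0 d0 tu.
have L0 : 0 <= 16 * M / d by rewrite divr_ge0 ?mulr_ge0 // ltW.
apply: mean_value; first by rewrite mulr_ge0 // mulr_ge0 // mulr_ge0 ?nm_ge0.
move=> r r01.
have -> : slide x t + r%:K *: (slide x s - slide x t) = slide x (t + r * (s - t)).
  by rewrite slide_sub /slide !(realKD, realKM, rmorphN, rmorph1) /=; lmod (Cplx R) V.
have q01 : 0 <= t + r * (s - t) <= 1 by nra.
have dy y : nm (y - slide x (t + r * (s - t))) < d -> differentiable g y.
  by move=> /(tu _ q01)[].
split; first by apply: dy; rewrite subrr nm0.
rewrite -ddE slide_sub.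
have gM y : nm (y - slide x (t + r * (s - t))) < d -> nm (g y) <= M.
  by move=> /(tu _ q01)[].
apply: le_trans (dd_le niceW d0 dy gM _) _.
by rewrite nmZ nmM nm_real le_eqVlt; apply/orP; left; apply/eqP; ring.
Qed.

Definition grid k (j : nat) : R := j%:R / 2 ^+ k.

Lemma grid01 k j : (j <= 2 ^ k)%N -> 0 <= grid k j <= 1.
Proof.
move=> h; rewrite divr_ge0 ?exprn_ge0 //= ler_pdivrMr ?exprn_gt0 // mul1r.
by rewrite -natrX ler_nat.
Qed.

Lemma gridS k j : grid k.+1 j.*2 = grid k j.
Proof. by rewrite /grid exprS -muln2 natrM; field; rewrite expf_neq0. Qed.

Lemma grid_step k j : grid k j.+1 - grid k j = (2 ^+ k)^-1.
Proof. by rewrite /grid -mulrBl -natrB // subSn // subnn mul1r. Qed.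

(** Riemann sum of [g] over the segment. The nodes are dyadic, so that each sum refines the
    preceding one and consecutive differences decrease geometrically. *)
Definition average k (g : V -> W) x : W :=
  ((2 ^+ k)^-1 : R)%:K *: \sum_(0 <= j < 2 ^ k) g (slide x (grid k j)).

Lemma sum_double (u : nat -> W) n :
  \sum_(0 <= j < n.*2) u j = \sum_(0 <= j < n) (u j.*2 + u j.*2.+1).
Proof.
elim: n => [|n ih]; first by rewrite !big_geq.
by rewrite doubleS !big_nat_recr //= ih !addrA.
Qed.

Lemma pow2_gt0 k : 0 < (2 ^+ k : R). Proof. exact: exprn_gt0. Qed.

Lemma sum_pow2 k (c : R) : \sum_(0 <= j < 2 ^ k) c = c * 2 ^+ k.
Proof. by rewrite sumr_const_nat subn0 -natrX mulr_natr. Qed.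

Lemma average_step g x d M k : 0 < d -> tube g x d M ->
  nm (average k.+1 g x - average k g x) <=
    16 * M / d * (nm (ell x) * nm v) * (2^-1) ^+ k.
Proof.
move=> d0 tu; set L := 16 * M / d * _.
have L0 : 0 <= L by rewrite !mulr_ge0 ?nm_ge0 ?invr_ge0 ?(tube_M_ge0 d0 tu) // ltW.
rewrite /average expnS mul2n sum_double.
have -> : \sum_(0 <= j < 2 ^ k) (g (slide x (grid k.+1 j.*2)) + g (slide x (grid k.+1 j.*2.+1))) =
   \sum_(0 <= j < 2 ^ k) (g (slide x (grid k j)) + g (slide x (grid k j))) +
   \sum_(0 <= j < 2 ^ k) (g (slide x (grid k.+1 j.*2.+1)) - g (slide x (grid k.+1 j.*2))).
  by rewrite -big_split; apply: eq_bigr => j _ /=; rewrite gridS; lmod (Cplx R) W.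
rewrite big_split /=.
set S := \sum_(0 <= j < 2 ^ k) g (slide x (grid k j)).
set D := \sum_(0 <= j < _) (_ - _).
have -> : ((2 ^+ k.+1)^-1)%:K *: (S + S + D) - ((2 ^+ k)^-1)%:K *: S = ((2 ^+ k.+1)^-1)%:K *: D.
  have -> : ((2 ^+ k)^-1)%:K = ((2 ^+ k.+1)^-1)%:K + ((2 ^+ k.+1)^-1)%:K.
    rewrite -realKD; congr (_%:C)%C; rewrite exprS.
    by field; rewrite expf_neq0.
  lmod (Cplx R) W.
rewrite nmZ nm_real gtr0_norm ?invr_gt0 ?pow2_gt0 //.
have hD : nm D <= \sum_(0 <= j < 2 ^ k) L / 2 ^+ k.+1.
  apply: le_trans (nm_sum _ _ _) _; rewrite [leLHS]big_nat [leRHS]big_nat.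
  apply: ler_sum => j /andP[_ jk].
  have j1 : (j.*2.+1 <= 2 ^ k.+1)%N by rewrite expnS mul2n ltn_double.
  apply: le_trans (tube_lipschitz d0 tu _ _) _; rewrite ?grid01 //; first exact: ltnW.
  by rewrite grid_step ger0_norm // invr_ge0 exprn_ge0.
have E : \sum_(0 <= j < 2 ^ k) L / 2 ^+ k.+1 = L * (2 ^+ k / 2 ^+ k.+1).
  by rewrite sum_pow2; ring.
rewrite {}E in hD.
rewrite mulrC ler_pdivrMr ?pow2_gt0 //; apply: le_trans hD _.
rewrite exprVn exprS; have p := pow2_gt0 k.
have -> : L * (2 ^+ k / (2 * 2 ^+ k)) = L / 2 by field; rewrite gt_eqF.
have -> : L / 2 ^+ k * (2 * 2 ^+ k) = 2 * L by field; rewrite gt_eqF.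
lra.
Qed.

(** The integral of g (slide x s) over s in [0, 1]; being chosen by [get], it has this meaning under
    the condition [tube]. *)
Definition mean (g : V -> W) x : W := get (fun l => cvgs (fun k => average k g x) l).

Lemma half_lt1 : 0 <= (2^-1 : R) < 1. Proof. lra. Qed.

Lemma mean_cvg g x d M : 0 < d -> tube g x d M ->
  cvgs (fun k => average k g x) (mean g x).
Proof.
move=> d0 tu; have [cW _] := niceW.
have [|l ul _] := geom_cauchy cW half_lt1 _ (fun k => average_step k d0 tu).
  by rewrite !mulr_ge0 ?nm_ge0 ?invr_ge0 ?(tube_M_ge0 d0 tu) // ltW.
by apply: (@getPex _ (fun l => cvgs (fun k => average k g x) l)); exists l.
Qed.

Lemma average_le g x d M k : 0 < d -> tube g x d M -> nm (average k g x) <= M.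
Proof.
move=> d0 tu; rewrite nmZ nm_real gtr0_norm ?invr_gt0 ?pow2_gt0 //.
rewrite mulrC ler_pdivrMr ?pow2_gt0 //; apply: le_trans (nm_sum _ _ _) _.
apply: (@le_trans _ _ (\sum_(0 <= j < 2 ^ k) M)).
  rewrite [leLHS]big_nat [leRHS]big_nat; apply: ler_sum => j /andP[_ jk].
  by case: (tu _ (grid01 (ltnW jk)) (slide x (grid k j))) => //; rewrite subrr nm0.
by rewrite sum_pow2.
Qed.

Lemma average_dif g x d M k : 0 < d -> tube g x d M ->
  differentiable (average k g) x /\
  forall w, dd (average k g) x w = ((2 ^+ k)^-1 : R)%:K *:
    \sum_(0 <= j < 2 ^ k) dd g (slide x (grid k j)) (slide w (grid k j)).
Proof.
move=> d0 tu.
have dg j : (j < 2 ^ k)%N -> differentiable g (slide x (grid k j)).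
  by move=> jk; case: (tu _ (grid01 (ltnW jk)) (slide x (grid k j))) => //; rewrite subrr nm0.
have ds j : (j < 2 ^ k)%N -> differentiable (fun y => g (slide y (grid k j))) x.
  move=> jk; apply: (dif_comp (f := slide^~ (grid k j))); last exact: dg.
  by apply: hol_dif; case: (slide_hol x (grid01 (ltnW jk))).
have E : average k g = fun y => ((2 ^+ k)^-1 : R)%:K *:
    \sum_(j < 2 ^ k) g (slide y (grid k j)).
  by apply/funext => y; rewrite /average big_mkord.
have dsum : differentiable (fun y => \sum_(j < 2 ^ k) g (slide y (grid k j))) x.
  by apply: dif_sum => j _; exact: ds.
rewrite E; split=> [|w]; first exact: dif_scale.
rewrite dd_scale // dd_sum; last by move=> j _; exact: ds.
congr (_ *: _); rewrite big_mkord; apply: eq_bigr => j _.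
have [hs ds'] := slide_hol x (grid01 (ltnW (ltn_ord j))).
by rewrite (dd_comp (f := slide^~ (grid k j)) _ (hol_dif hs)) ?ds' //; exact: dg.
Qed.

Lemma mean_hol g x d M : 0 < d -> tube g x d M ->
  hol (mean g) x /\ nm (mean g x) <= M.
Proof.
move=> d0 tu; split; last first.
  apply: (cvgs_le (mean_cvg d0 tu)); exists 0%N => k _; exact: average_le tu.
apply/near_nmP; exists (d / 2 / slideB); first by rewrite !divr_gt0 ?slideB_gt0.
move=> y yx; have {}tu := tube_near d0 tu yx.
have d2 : 0 < d / 2 by lra.
have r0 : 0 < d / 2 / 2 / slideB by rewrite !divr_gt0 ?slideB_gt0.
have d4 : 0 < d / 2 / 2 by lra.
case: (@limit_hol R V W niceW (average^~ g) (mean g) y _ M r0) => //.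
- by move=> k z zy; case: (average_dif k d4 (tube_near d2 tu zy)).
- by move=> k z zy; exact: average_le (tube_near d2 tu zy).
- by move=> z zy; exact: mean_cvg (tube_near d2 tu zy).
Qed.

Lemma near_inf_eps (C e : R) : 0 < e -> exists N, forall k, (N <= k)%N ->
  C / 2 ^+ k < e.
Proof.
move=> e0; have [N hN] := expr_lt_eps C half_lt1 e0.
by exists N => k /hN; rewrite exprVn.
Qed.

Lemma tube_taylor g x d M k j : 0 < d -> tube g x d M -> (j < 2 ^ k)%N ->
  nm (ell x) * nm v / 2 ^+ k < d / 8 ->
  nm (g (slide x (grid k j.+1)) - g (slide x (grid k j)) -
      (((2 ^+ k)^-1)%:K * ell x) *: dd g (slide x (grid k j)) v) <=
  (16 * 16 * 16) * M / d ^+ 2 * (nm (ell x) * nm v / 2 ^+ k) ^+ 2.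
Proof.
move=> d0 tu jk hk.
have -> : slide x (grid k j.+1) = slide x (grid k j) + (((2 ^+ k)^-1)%:K * ell x) *: v.
  by rewrite -(grid_step k j) -slide_sub addrC subrK.
rewrite -dd_scaler.
have E : nm ((((2 ^+ k)^-1)%:K * ell x) *: v) = nm (ell x) * nm v / 2 ^+ k.
  rewrite nmZ nmM nm_real gtr0_norm ?invr_gt0 ?pow2_gt0 //; ring.
have t01 := grid01 (ltnW jk).
rewrite -E; apply: (dd_taylor niceW d0); last by rewrite E.
  by move=> y /(tu _ t01)[].
by move=> y /(tu _ t01)[].
Qed.

(** The fundamental theorem of calculus on the segment: the increments of [f] between nodes
    telescope, and Taylor's bound compares each of them with the derivative along [v]. It identifies
    Hadamard quotients with integrals, whence their holomorphy. *)
Lemma mean_deriv (f : V -> W) x d M M' : 0 < d -> tube f x d M' ->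
  tube (fun y => dd f y v) x d M ->
  ell x *: mean (fun y => dd f y v) x = f x - f (slide x 0).
Proof.
move=> d0 tf tg; apply: (cvgs_unique (cvgsZ (ell x) (mean_cvg d0 tg))) => e e0.
pose C := (16 * 16 * 16) * M' / d ^+ 2 * (nm (ell x) * nm v) ^+ 2.
have [N1 h1] := near_inf_eps C e0.
have [|N2 h2] := near_inf_eps (nm (ell x) * nm v) (_ : 0 < d / 8); first by lra.
exists (maxn N1 N2) => k; rewrite geq_max => /andP[/h1 {}h1 /h2 {}h2].
apply: le_lt_trans h1.
have -> : f x - f (slide x 0) = \sum_(0 <= j < 2 ^ k)
    (f (slide x (grid k j.+1)) - f (slide x (grid k j))).
  by rewrite telescope_sumr // /grid mul0r natrX divff ?slide1 ?gt_eqF ?pow2_gt0.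
rewrite nmB /average scalerA scaler_sumr -sumrB.
apply: le_trans (nm_sum _ _ _) _.
apply: (@le_trans _ _ (\sum_(0 <= j < 2 ^ k) C / 2 ^+ k / 2 ^+ k)).
  rewrite [leLHS]big_nat [leRHS]big_nat; apply: ler_sum => j /andP[_ jk].
  rewrite (mulrC (ell x)); apply: le_trans (tube_taylor d0 tf jk h2) _.
  rewrite /C le_eqVlt; apply/orP; left; apply/eqP; field.
  by rewrite !gt_eqF ?pow2_gt0.
by rewrite sum_pow2 divfK // gt_eqF ?pow2_gt0.
Qed.

Lemma abel_sum (u : nat -> W) n :
  \sum_(0 <= j < n) (u j + j%:R *: (u j.+1 - u j) : W) = (n%:R - 1 : K) *: u n + u 0%N.
Proof.
elim: n => [|n ih]; first by rewrite big_geq // sub0r; lmod (Cplx R) W.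
rewrite big_nat_recr //= ih -[n.+1%:R]natr1; lmod (Cplx R) W.
Qed.

(** The other half of the fundamental theorem; it turns fixed points of integral operators into
    solutions of differential equations. When [x] moves along [v], node number j moves with speed j
    / 2^k, so the derivative of a Riemann sum contains a sum of j times an increment, which Abel
    summation evaluates. *)
Lemma primitive_deriv g x d M : 0 < d -> tube g x d M ->
  dd (fun y => ell y *: mean g y) x v = g x.
Proof.
move=> d0 tu.
have M0 := tube_M_ge0 d0 tu.
pose r := d / 2 / slideB; have r0 : 0 < r by rewrite !divr_gt0 ?slideB_gt0.
have d2 : 0 < d / 2 by lra.
have dell y : differentiable ell y by apply: hol_dif; exact: hol_ell.
pose B := Bl * (nm x + r) * M.
case: (@limit_hol R V W niceW (fun k y => ell y *: average k g y)
  (fun y => ell y *: mean g y) x r B r0).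
- move=> k y yx; have [da _] := average_dif k d2 (tube_near d0 tu yx).
  by case: (dif_scalev (dell y) da).
- move=> k y yx; rewrite nmZ; apply: ler_pM; rewrite ?nm_ge0 //.
    apply: le_trans (ell_le y) _; apply: ler_wpM2l => //.
    by have := nmDD y (- x); rewrite nmN; lra.
  exact: average_le (tube_near d0 tu yx).
- by move=> y yx; apply: cvgsZ; exact: mean_cvg (tube_near d0 tu yx).
move=> _ /(_ v) h; apply: (cvgs_unique h) => e e0 {h}.
pose E0 := (16 * 16 * 16) * M / d ^+ 2 * (nm (ell x) * nm v) ^+ 2.
pose C := nm (g (slide x 0) - g x) + E0.
have [N1 h1] := near_inf_eps C e0.
have [|N2 h2] := near_inf_eps (nm (ell x) * nm v) (_ : 0 < d / 8); first by lra.
exists (maxn N1 N2) => k; rewrite geq_max => /andP[/h1 {}h1 /h2 {}h2].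
apply: le_lt_trans h1.
have [da dav] := average_dif k d0 tu.
have [_ ->] := dif_scalev (dell x) da.
rewrite dd_ell ell_v scale1r dav.
pose u j := g (slide x (grid k j)).
pose n := (2 ^+ k : R).
have n0 : 0 < n by exact: pow2_gt0.
have nn : (2 ^ k)%N%:R = n%:K :> K by rewrite /n !natrX rmorphXn rmorph_nat.
(* The Taylor error of one increment. It is quadratic in the step, so even with the weights j, at
   most 2^k, the total stays bounded, and the factor 2^-k in front makes it tend to 0. *)
pose ee j := u j.+1 - u j - ((n^-1)%:K * ell x) *: dd g (slide x (grid k j)) v.
have -> : ell x *: ((n^-1)%:K *: \sum_(0 <= j < 2 ^ k)
      dd g (slide x (grid k j)) (slide v (grid k j))) + average k g x =
   (n^-1)%:K *: (\sum_(0 <= j < 2 ^ k) (u j + j%:R *: (u j.+1 - u j))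
      - \sum_(0 <= j < 2 ^ k) j%:R *: ee j).
  rewrite /average -/n scalerA mulrC -scalerA -scalerDr; congr (_ *: _).
  rewrite scaler_sumr -big_split -sumrB; apply: eq_bigr => j _ /=.
  rewrite slide_v dd_scaler /ee /grid -/n realKM rmorph_nat /u /grid -/n.
  lmod (Cplx R) W.
rewrite abel_sum nn.
have un : u (2 ^ k)%N = g x by rewrite /u /grid natrX divff ?slide1 // gt_eqF.
have u0 : u 0%N = g (slide x 0) by rewrite /u /grid mul0r.
rewrite un u0; set S := \sum_(_ <= _ < _) _.
have -> : (n^-1)%:K *: ((n%:K - 1) *: g x + g (slide x 0) - S) - g x =
   (n^-1)%:K *: ((g (slide x 0) - g x) - S).
  have nK : n%:K != 0 by rewrite -(rmorph0 (@real_complex R)) (inj_eq (@complexI R)) gt_eqF.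
  by rewrite realKV; lmodf (Cplx R) W.
rewrite nmZ nm_real gtr0_norm ?invr_gt0 // mulrC ler_wpM2r ?invr_ge0 ?(ltW n0) //.
apply: le_trans (nmD _ _) _; rewrite nmN /C lerD2l.
apply: le_trans (nm_sum _ _ _) _.
apply: (@le_trans _ _ (\sum_(0 <= j < 2 ^ k) E0 / n)).
  rewrite [leLHS]big_nat [leRHS]big_nat; apply: ler_sum => j /andP[_ jk].
  rewrite nmZ nm_nat; apply: (@le_trans _ _ (n * (E0 / n / n))); last first.
    by rewrite le_eqVlt; apply/orP; left; apply/eqP; field; rewrite gt_eqF.
  apply: ler_pM; rewrite ?nm_ge0 //.
    by rewrite /n -natrX ler_nat ltnW.
  apply: le_trans (tube_taylor d0 tu jk h2) _.
  rewrite /E0 -/n le_eqVlt; apply/orP; left; apply/eqP; field.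
  by rewrite !gt_eqF.
rewrite sum_pow2 divfK //.
by rewrite gt_eqF.
Qed.

End Operator.
End Averages.

(** * Inverse functions and flows *)

Section FixedPoints.
Variable R : realType.
Notation K := (Cplx R).
Local Notation "r %:K" := ((r%:C)%C : K) (at level 2, format "r %:K").

Definition nmopen (V : normedModType K) (D : set V) :=
  forall x, D x -> exists2 d : R, 0 < d & forall y, nm (y - x) < d -> D y.

Lemma nmopen_ball (V : normedModType K) (a : V) (r : R) :
  nmopen [set x | nm (x - a) < r].
Proof.
move=> x /= xa; exists (r - nm (x - a)); first by lra.
by move=> y yx; apply: le_lt_trans (nm_triangle x _ _) _; lra.
Qed.

Lemma nmopen_hol (V W : normedModType K) (D : set V) (f : V -> W) : nmopen D ->
  (forall x, D x -> differentiable f x) -> forall x, D x -> hol f x.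
Proof.
move=> oD df x /oD[d d0 hd]; apply/near_nmP; exists d => // y /hd; exact: df.
Qed.

(** The common frame of the iterations for inverse functions, flows and Weierstrass division:
    geometric increments give a limit, which is holomorphic because the bound [M] is uniform. *)
Lemma geometric_limit (V W : normedModType K) (D : set V) (F : nat -> V -> W)
    (c q M : R) : nice W -> nmopen D -> 0 <= q < 1 -> 0 <= c ->
  (forall k x, D x -> differentiable (F k) x) ->
  (forall k x, D x -> nm (F k x) <= M) ->
  (forall k x, D x -> nm (F k.+1 x - F k x) <= c * q ^+ k) ->
  exists f : V -> W, forall x, D x -> [/\ differentiable f x, nm (f x) <= M &
    forall k, nm (F k x - f x) <= c / (1 - q) * q ^+ k].
Proof.
move=> nW oD q01 c0 dF FM Fq; have [cW _] := nW.
have /choice[f hf] : forall x, exists l, D x -> cvgs (F^~ x) l /\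
    forall k, nm (F k x - l) <= c / (1 - q) * q ^+ k.
  move=> x; have [Dx|nDx] := pselect (D x); last by exists 0.
  have [l ul hl] := geom_cauchy cW q01 c0 (fun k => Fq k x Dx).
  by exists l.
exists f => x Dx; have [cx hx] := hf x Dx; split=> //.
  have [d d0 hd] := oD x Dx.
  case: (@limit_hol R V W nW F f x d M d0) => //.
  - by move=> k y /hd; exact: dF.
  - by move=> k y /hd; exact: FM.
  - by move=> y /hd /hf[].
by apply: (cvgs_le cx); exists 0%N => k _; exact: FM.
Qed.

Lemma small_eq0 (V : normedModType K) (x : V) (c q : R) : 0 <= q < 1 ->
  (forall k, nm x <= c * q ^+ k) -> x = 0.
Proof.
move=> q01 h; apply: nm_eq0; apply/eqP; rewrite eq_le nm_ge0 andbT.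
apply/ler_addgt0Pr => e e0; rewrite add0r; have [N hN] := expr_lt_eps c q01 e0.
exact: le_trans (h N) (ltW (hN N (leqnn N))).
Qed.

Lemma half_complement (c : R) : c / (1 - 2^-1) = c * 2.
Proof.
have -> : (1 - 2^-1 : R) = 2^-1 by rewrite {1}(splitr 1) mul1r addrK.
by rewrite invrK.
Qed.

(* The iteration y - h (.) converges to the inverse of x + h x. *)
Lemma inverse_function (V : normedModType K) (h : V -> V) (a : V) (r : R) :
  nice V -> 0 < r ->
  (forall x, nm (x - a) < r -> differentiable h x) ->
  (forall x y, nm (x - a) < r -> nm (y - a) < r ->
     nm (h x - h y) <= 2^-1 * nm (x - y)) ->
  exists g : V -> V,
    [/\ forall y, nm (y - (a + h a)) < r / 4 -> hol g y,
        forall y, nm (y - (a + h a)) < r / 4 ->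
          nm (g y - a) <= 2 * nm (y - (a + h a)) /\ g y + h (g y) = y &
        forall x y, nm (x - a) < r -> nm (y - a) < r ->
          x + h x = y + h y -> x = y].
Proof.
move=> nV r0 dh lh.
set b := a + h a.
have inj x y : nm (x - a) < r -> nm (y - a) < r -> x + h x = y + h y -> x = y.
  move=> xa ya E; apply/eqP; rewrite -subr_eq0; apply/eqP/nm_eq0.
  have := lh x y xa ya.
  have -> : h x - h y = - (x - y).
    apply/eqP; rewrite -subr_eq0; apply/eqP.
    have -> : h x - h y - - (x - y) = x + h x - (y + h y) by lmod (Cplx R) V.
    by rewrite E subrr.
  by rewrite nmN; have := nm_ge0 (x - y); lra.
pose F := fix F k y := if k is k'.+1 then y - h (F k' y) else a.
pose D := [set y | nm (y - b) < r / 4].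
have oD : nmopen D by exact: nmopen_ball.
have step k y : D y -> nm (F k y - a) <= 2 * (1 - (2^-1) ^+ k) * nm (y - b) /\
    nm (F k.+1 y - F k y) <= (2^-1) ^+ k * nm (y - b).
  move=> Dy; elim: k => [|k [ih1 ih2]].
    split; first by rewrite /= subrr nm0 expr0 subrr mulr0 mul0r.
    rewrite expr0 mul1r /=.
    rewrite le_eqVlt; apply/orP; left; apply/eqP; congr nm.
    by rewrite /b; lmod (Cplx R) V.
  have p0 : 0 <= (2^-1 : R) ^+ k by rewrite exprn_ge0 // invr_ge0.
  have p1 : (2^-1 : R) ^+ k <= 1 by rewrite exprn_ile1 //; lra.
  have yb0 := nm_ge0 (y - b).
  have h1 : nm (F k.+1 y - a) <= 2 * (1 - (2^-1) ^+ k.+1) * nm (y - b).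
    apply: le_trans (nm_triangle (F k y) _ _) _; rewrite exprS; nra.
  split=> //.
  have -> : F k.+2 y - F k.+1 y = - (h (F k.+1 y) - h (F k y)).
    by rewrite /=; lmod (Cplx R) V.
  rewrite nmN; apply: le_trans (lh _ _ _ _) _.
  - apply: le_lt_trans h1 _; move: Dy; rewrite /D /= exprS; nra.
  - apply: le_lt_trans ih1 _; move: Dy; rewrite /D /=; nra.
  by rewrite exprS -mulrA ler_wpM2l // invr_ge0.
have inr k y : D y -> nm (F k y - a) < r.
  move=> Dy; have [h1 _] := step k y Dy; apply: le_lt_trans h1 _.
  have p0 : 0 <= (2^-1 : R) ^+ k by rewrite exprn_ge0 // invr_ge0.
  by have := nm_ge0 (y - b); move: Dy; rewrite /D /=; nra.
have dF k y : D y -> differentiable (F k) y.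
  elim: k y => [|k ih] y Dy; first exact: dif_cst.
  apply: dif_sub; first exact: dif_id.
  by apply: dif_comp; [exact: ih|apply: dh; exact: inr].
have [|||g hg] := @geometric_limit V V D F (r / 4) 2^-1 (nm a + r) nV oD (half_lt1 R) _ dF.
- by lra.
- move=> k y Dy; rewrite -[F k y](subrK a); apply: le_trans (nmD _ _) _.
  by have := inr k y Dy; lra.
- move=> k y Dy; have [_] := step k y Dy; move/le_trans; apply.
  by rewrite mulrC ler_wpM2r ?exprn_ge0 ?invr_ge0 // ltW.
exists g; split=> //.
  by move=> y Dy; apply: (nmopen_hol oD) => // z /hg[].
move=> y Dy; have [_ _ gk] := hg y Dy.
have ga : nm (g y - a) <= 2 * nm (y - b).
  apply/ler_addgt0Pr => e e0.
  have [N hN] := expr_lt_eps (r / 4 / (1 - 2^-1)) (half_lt1 R) e0.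
  apply: le_trans (nm_triangle (F N y) _ _) _; rewrite addrC; apply: lerD.
    have [h1 _] := step N y Dy; apply: le_trans h1 _.
    have p0 : 0 <= (2^-1 : R) ^+ N by rewrite exprn_ge0 // invr_ge0.
    by have := nm_ge0 (y - b); nra.
  by rewrite nmB; apply: le_trans (gk N) (ltW (hN _ _)).
have gr : nm (g y - a) < r by apply: le_lt_trans ga _; move: Dy; rewrite /D /=; lra.
split=> //; apply/eqP; rewrite -subr_eq0; apply/eqP.
apply: (@small_eq0 _ _ (r / 2 + r / 4) 2^-1 (half_lt1 R)) => k.
have -> : g y + h (g y) - y = (h (g y) - h (F k y)) - (F k.+1 y - g y).
  by rewrite /=; lmod (Cplx R) V.
apply: le_trans (nmD _ _) _; rewrite nmN mulrDl; apply: lerD.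
  apply: le_trans (lh _ _ gr (inr k y Dy)) _; rewrite (nmB (g y)).
  have := gk k; rewrite half_complement.
  have : 0 <= r * (2^-1 : R) ^+ k by rewrite mulr_ge0 ?exprn_ge0 ?invr_ge0 // ltW.
  set p := (2^-1 : R) ^+ k => rp gk'; lra.
have := gk k.+1; rewrite half_complement exprS; set p := (2^-1 : R) ^+ k => gk'; lra.
Qed.

(** * Existence of flows *)

Section Flow.
Variable E : normedModType K.
Hypothesis niceE : nice E.

Local Notation EK := (E * K)%type.
Let tdir : EK := (0, 1).
Let tcoord (p : EK) : K := p.2.

Lemma tcoord_lin (c : K) (x y : EK) : tcoord (c *: x + y) = c * tcoord x + tcoord y.
Proof. by []. Qed.
Lemma tcoord_le (x : EK) : nm (tcoord x) <= 1 * nm x.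
Proof. by rewrite mul1r; case: x => a b; rewrite nm_pair /tcoord le_max lexx orbT. Qed.

Let slideE (x : E) (t : K) (s : R) : slide tdir tcoord (x, t) s = (x, s%:K * t) :> EK.
Proof.
rewrite /slide /tdir /tcoord realKD rmorphN rmorph1.
apply: injective_projections => /=; first by rewrite scaler0 subr0.
by rewrite -[X in _ - X]/((1 - s%:K) * t * 1); ring.
Qed.

Lemma mean_sub_le (V W : normedModType K) (v : V) (ell : V -> K) (g g' : V -> W) x (d M M' e : R) :
  nice W -> 0 < d -> tube v ell g x d M -> tube v ell g' x d M' ->
  (forall s, 0 <= s <= 1 -> nm (g (slide v ell x s) - g' (slide v ell x s)) <= e) ->
  nm (mean v ell g x - mean v ell g' x) <= e.
Proof.
move=> nW d0 t t' h.
have c := cvgsB (mean_cvg nW d0 t) (mean_cvg nW d0 t').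
apply: (cvgs_le c); exists 0%N => k _.
rewrite /average -scalerBr -sumrB nmZ nm_real gtr0_norm ?invr_gt0 ?pow2_gt0 //.
rewrite mulrC ler_pdivrMr ?pow2_gt0 //; apply: le_trans (nm_sum _ _ _) _.
rewrite -(sum_pow2 k e) [leLHS]big_nat [leRHS]big_nat.
by apply: ler_sum => j /andP[_ jk]; apply: h; exact: grid01 (ltnW jk).
Qed.

(** Picard iteration for f (x, t) = x + t m, where m is the mean of X (f, t) over the segment from
    (x, 0) to (x, t). Means taken in the space of pairs make every iterate holomorphic in position
    and time together; [primitive_deriv] turns the fixed point into the differential equation. *)
Lemma flow_exists (X : EK -> E) (x0 : E) : hol X (x0, 0) ->
  exists (phi : EK -> E) (r : R), 0 < r /\
    forall x t, nm (x - x0) < r -> nm t < r ->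
      [/\ hol phi (x, t), phi (x, 0) = x &
          dd phi (x, t) (0, 1) = X (phi (x, t), t)].
Proof.
move=> /hol_ball[r [M [r0 dX XM]]].
have M0 : 0 <= M by apply: le_trans (XM (x0, 0) _); [exact: nm_ge0|rewrite subrr nm0].
have in_ball (x : E) (t : K) (q : R) : nm (x - x0) < q -> nm t < q ->
    nm ((x, t) - (x0, 0) : EK) < q.
  by move=> h1 h2; rewrite nm_pair_ltP /= h1 subr0.
pose L := 32 * M / r.
have L0 : 0 <= L by rewrite divr_ge0 ?mulr_ge0 // ltW.
have lipX x y t : nm (x - x0) < r / 2 -> nm (y - x0) < r / 2 -> nm t < r / 2 ->
    nm (X (x, t) - X (y, t)) <= L * nm (x - y).
  move=> xr yr tr.
  have -> : nm (x - y) = nm ((x, t) - (y, t) : EK).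
    by rewrite nm_pair /= subrr nm0; apply/esym/max_l; exact: nm_ge0.
  by apply: (lipschitz_half niceE r0 dX XM); exact: in_ball.
pose rho := r / 8.
(* Three requirements on the time: the domain lies in the ball where [X] is controlled, orbits move
   by at most [rho], and the iteration contracts by 1 / 2 since [L] is a Lipschitz constant of
   [X]. *)
pose tau := Num.min rho (Num.min (rho / (M + 1)) (2^-1 / (L + 1))).
have rho0 : 0 < rho by rewrite divr_gt0.
have M1 : 0 < M + 1 by lra.
have L1 : 0 < L + 1 by lra.
have tau0 : 0 < tau by rewrite !lt_min rho0 !divr_gt0.
have tau1 : tau <= rho by rewrite ge_min lexx.
have tau2 : tau * (M + 1) <= rho by rewrite -ler_pdivlMr // !ge_min lexx orbT.
have tau3 : tau * (L + 1) <= 2^-1 by rewrite -ler_pdivlMr // !ge_min lexx !orbT.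
pose D : set EK := [set p | nm (p.1 - x0) < rho /\ nm p.2 < tau].
have oD : nmopen D.
  move=> [x t] [/= xr tr]; exists (Num.min (rho - nm (x - x0)) (tau - nm t)).
    by rewrite lt_min; apply/andP; split; lra.
  move=> [y s]; rewrite nm_pair_ltP /= !lt_min => /andP[/andP[y1 _] /andP[_ s2]].
  split=> /=; first by have := nm_triangle x y x0; lra.
  by have := nm_triangle t s 0; rewrite !subr0; lra.
pose good (f : EK -> E) := forall p, D p -> differentiable f p /\
  nm (f p - x0) <= rho + tau * M.
have goodr f p : good f -> D p -> nm (f p - x0) < r / 2.
  move=> gf /gf[_ h]; apply: le_lt_trans h _; rewrite /rho in tau2 *; lra.
pose G (f : EK -> E) (p : EK) := X (f p, p.2).
have GD f p : good f -> D p -> differentiable (G f) p /\ nm (G f p) <= M.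
  move=> gf Dp; have [df _] := gf p Dp; have fr := goodr f p gf Dp.
  have inb : nm ((f p, p.2) - (x0, 0) : EK) < r.
    by apply: in_ball; [lra|case: Dp => _; rewrite /rho in tau1; lra].
  split; last exact: XM.
  apply: (dif_comp (f := fun p : EK => (f p, p.2))); last exact: dX.
  by apply: differentiable_pair => //; exact: dif_snd.
have tubeG f p : good f -> D p -> exists2 d : R, 0 < d & tube tdir tcoord (G f) p d M.
  move=> gf [/= pr tr]; pose d := Num.min (rho - nm (p.1 - x0)) (tau - nm p.2).
  exists d; first by rewrite lt_min; apply/andP; split; lra.
  move=> s /andP[s0 s1] y; rewrite [p]surjective_pairing slideE => yp.
  apply: GD => //; move: yp; rewrite nm_pair_ltP /= !lt_min => /andP[/andP[y1 _] /andP[_ y2]].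
  split=> /=; first by have := nm_triangle p.1 y.1 x0; lra.
  have := nm_triangle (s%:K * p.2) y.2 0; rewrite !subr0 nmM nm_real ger0_norm //.
  by have := nm_ge0 p.2; nra.
pose P f (p : EK) := p.1 + p.2 *: mean tdir tcoord (G f) p.
have goodP f : good f -> good (P f).
  move=> gf p Dp; have [d d0 tu] := tubeG f p gf Dp.
  have [hm mM] := mean_hol niceE tcoord_lin tcoord_le ler01 d0 tu.
  split.
    apply: dif_add; first exact: dif_fst.
    by have [] := dif_scalev (dif_snd p) (hol_dif hm).
  case: Dp => pr tr; rewrite /P addrAC; apply: le_trans (nmD _ _) _; rewrite nmZ.
  by have := nm_ge0 p.2; have := nm_ge0 (mean tdir tcoord (G f) p); nra.
have Psub f f' (c : R) : good f -> good f' ->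
    (forall p, D p -> nm (f p - f' p) <= c) ->
    forall p, D p -> nm (P f p - P f' p) <= 2^-1 * c.
  move=> gf gf' h p Dp.
  have [d d0 tu] := tubeG f p gf Dp; have [d' d'0 tu'] := tubeG f' p gf' Dp.
  have c0 : 0 <= c by apply: le_trans (h p Dp); exact: nm_ge0.
  have Ds s : 0 <= s <= 1 -> D (slide tdir tcoord p s).
    move=> /andP[s0 s1]; rewrite [p]surjective_pairing slideE; case: Dp => p1 p2; split=> //=.
    by rewrite nmM nm_real ger0_norm //; have := nm_ge0 p.2; nra.
  have dm : 0 < Num.min d d' by rewrite lt_min d0.
  have : nm (mean tdir tcoord (G f) p - mean tdir tcoord (G f') p) <= L * c.
    have tu1 : tube tdir tcoord (G f) p (Num.min d d') M.
      by move=> s s01 y; rewrite lt_min => /andP[h1 _]; exact: tu s s01 y h1.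
    have tu2 : tube tdir tcoord (G f') p (Num.min d d') M.
      by move=> s s01 y; rewrite lt_min => /andP[_ h2]; exact: tu' s s01 y h2.
    apply: (mean_sub_le niceE dm tu1 tu2) => s s01; have Dsl := Ds s s01.
    apply: le_trans (lipX _ _ _ (goodr _ _ gf Dsl) (goodr _ _ gf' Dsl) _) _.
      by case: Dsl => _; rewrite /rho in tau1; lra.
    by apply: ler_wpM2l => //; exact: h.
  rewrite /P; set m := mean _ _ _ _; set m' := mean _ _ _ _ => hm.
  have -> : p.1 + p.2 *: m - (p.1 + p.2 *: m') = p.2 *: (m - m') by lmod (Cplx R) E.
  rewrite nmZ; case: Dp => _ p2; have := nm_ge0 p.2; have := nm_ge0 (m - m').
  move=> u0 w0; apply: (@le_trans _ _ (tau * (L * c))); first by apply: ler_pM => //; exact: ltW.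
  have : (tau * L) * c <= 2^-1 * c by apply: ler_wpM2r => //; lra.
  lra.
pose F k := iter k P (fun p : EK => p.1).
have gF k : good (F k).
  elim: k => [|k ih]; last exact: goodP.
  move=> p [p1 p2]; split; first exact: dif_fst.
  have : 0 <= tau * M by rewrite mulr_ge0 // ltW.
  lra.
have Fstep k p : D p -> nm (F k.+1 p - F k p) <= rho * 2^-1 ^+ k.
  elim: k p => [|k ih] p Dp.
    rewrite expr0 mulr1 /F /= /P addrC addKr nmZ.
    have [d d0 tu] := tubeG _ p (gF 0) Dp.
    have [_ mM] := mean_hol niceE tcoord_lin tcoord_le ler01 d0 tu.
    case: Dp => _ p2; have := nm_ge0 p.2.
    have := nm_ge0 (mean tdir tcoord (G (F 0)) p); rewrite /F /= in mM *; nra.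
  have -> : rho * 2^-1 ^+ k.+1 = 2^-1 * (rho * 2^-1 ^+ k) by rewrite exprS; ring.
  exact: (Psub _ _ _ (gF k.+1) (gF k)).
have [|||f hf] := @geometric_limit EK E D F rho 2^-1 (nm x0 + r) niceE oD (half_lt1 R) (ltW rho0).
- by move=> k p /(gF k)[].
- move=> k p Dp; rewrite -[F k p](subrK x0); apply: le_trans (nmD _ _) _.
  by have := goodr _ _ (gF k) Dp; lra.
- exact: Fstep.
have gf : good f.
  move=> p Dp; have [df _ fk] := hf p Dp; split=> //.
  apply/ler_addgt0Pr => e e0.
  have [N hN] := expr_lt_eps (rho / (1 - 2^-1)) (half_lt1 R) e0.
  apply: le_trans (nm_triangle (F N p) _ _) _; rewrite addrC; apply: lerD.
    by case: (gF N p Dp).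
  by rewrite nmB; apply: le_trans (fk N) (ltW (hN _ _)).
have fix_f p : D p -> f p = P f p.
  move=> Dp; apply/eqP; rewrite -subr_eq0; apply/eqP.
  apply: (@small_eq0 _ _ (2 * rho) 2^-1 (half_lt1 R)) => k.
  rewrite -nmN opprB; apply: le_trans (nm_triangle (F k.+1 p) _ _) _.
  have [_ _ fk] := hf p Dp.
  have h1 : nm (P f p - F k.+1 p) <= 2^-1 * (rho / (1 - 2^-1) * 2^-1 ^+ k).
    apply: (Psub _ _ _ gf (gF k)) => // q Dq; rewrite nmB; by case: (hf q Dq).
  have := fk k.+1; rewrite half_complement in h1 *; rewrite exprS; set z := (2^-1 : R) ^+ k in h1 *.
  have z0 : 0 <= z by rewrite exprn_ge0 // invr_ge0.
  by rewrite nmB in fk *; have := mulr_ge0 (ltW rho0) z0; lra.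
exists f, tau; split=> // x t xr tr.
have Dxt : D (x, t) by split=> //=; lra.
have Dx0 : D (x, 0) by split=> /=; [lra|rewrite nm0].
split.
- by apply: (nmopen_hol oD) => // p /gf[].
- by rewrite fix_f // /P /= scale0r addr0.
have [d d0 tu] := tubeG f _ gf Dxt.
have [hm _] := mean_hol niceE tcoord_lin tcoord_le ler01 d0 tu.
have [ds _] := dif_scalev (dif_snd (x, t)) (hol_dif hm).
rewrite (@dd_near_eq _ _ _ (P f) f (x, t)).
- rewrite /P dd_add; [|exact: dif_fst|exact: ds].
  rewrite dd_fst add0r; have := primitive_deriv niceE tcoord_lin tcoord_le ler01 _ d0 tu.
  by move=> ->.
- have [e e0 he] := oD _ Dxt; apply/near_nmP; exists e => // p /he Dp.
  by rewrite fix_f.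
- by apply: dif_add; [exact: dif_fst|exact: ds].
Qed.

End Flow.
End FixedPoints.

(** * Weierstrass division *)

Section Weierstrass.
Variable R : realType.
Notation K := (Cplx R).
Local Notation "r %:K" := ((r%:C)%C : K) (at level 2, format "r %:K").
Variables (V : normedModType K) (v : V) (ell : V -> K) (Bl : R).
Hypothesis ell_lin : forall (c : K) x y, ell (c *: x + y) = c * ell x + ell y.
Hypothesis ell_le : forall x, nm (ell x) <= Bl * nm x.
Hypothesis Bl_ge0 : 0 <= Bl.
Hypothesis ell_v : ell v = 1.

Definition proj (x : V) : V := x - ell x *: v.

Lemma proj_slide x : proj x = slide v ell x 0.
Proof. by rewrite /proj /slide subr0 rmorph1 mul1r. Qed.
Lemma ell_proj x : ell (proj x) = 0.
Proof. by rewrite /proj (ellB ell_lin) (ellZ ell_lin) ell_v mulr1 subrr. Qed.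
Lemma proj_id x : ell x = 0 -> proj x = x.
Proof. by move=> e; rewrite /proj e scale0r subr0. Qed.
Lemma projK x : proj (proj x) = proj x.
Proof. by rewrite proj_id // ell_proj. Qed.
Lemma proj_le x : nm (proj x) <= slideB v Bl * nm x.
Proof. by rewrite proj_slide; apply: slide_le => //; rewrite lexx ler01. Qed.
Lemma proj_hol x : hol proj x.
Proof.
have -> : proj = slide v ell ^~ 0 by apply/funext => y; exact: proj_slide.
have h01 : 0 <= (0 : R) <= 1 by rewrite lexx ler01.
by case: (slide_hol v ell_lin ell_le x h01).
Qed.
Lemma proj0 : proj 0 = 0.
Proof. by rewrite /proj (ell0 ell_lin) scale0r subr0. Qed.
Lemma proj_v x (z : K) : proj (x + z *: v) = proj x.
Proof. by rewrite /proj (ellD ell_lin) (ellZ ell_lin) ell_v mulr1; lmod (Cplx R) V. Qed.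
Lemma projE x : x = proj x + ell x *: v.
Proof. by rewrite subrK. Qed.
Lemma hol_ell' x : hol ell x. Proof. exact: (hol_ell ell_lin ell_le). Qed.
Lemma dd_ell' x w : dd ell x w = ell w. Proof. exact: (dd_ell ell_lin ell_le). Qed.

(* The Hadamard quotient of f along v. *)
Definition hq (f : V -> K) (x : V) : K :=
  if ell x == 0 then dd f x v else (f x - f (proj x)) / ell x.

Lemma hqE f x : f x = f (proj x) + ell x * hq f x.
Proof.
rewrite /hq; have [e|e] := eqVneq (ell x) 0.
  by rewrite e mul0r addr0 proj_id.
by rewrite mulrC divfK // addrC subrK.
Qed.

Section Domain.
Variables (eps rho : R).
Hypothesis eps0 : 0 < eps.
Hypothesis rho0 : 0 < rho.

(** A ball in the kernel of [ell] times a disc along [v], with independent radii: the division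
    theorem shrinks [eps] while [rho], on which the bound for [hq] depends, stays fixed. *)
Definition dom := [set x : V | nm (proj x) < eps /\ nm (ell x) < rho].

Lemma dom_open : nmopen dom.
Proof.
move=> x [/= x1 x2].
pose B := slideB v Bl + Bl.
have B0 : 0 < B by rewrite ltr_pwDl // slideB_gt0.
exists (Num.min (eps - nm (proj x)) (rho - nm (ell x)) / B).
  by rewrite divr_gt0 // lt_min; apply/andP; split; lra.
move=> y; rewrite ltr_pdivlMr // lt_min => /andP[y1 y2].
have h1 : nm (proj y - proj x) <= nm (y - x) * B.
  have -> : proj y - proj x = proj (y - x).
    by rewrite /proj (ellB ell_lin); lmod (Cplx R) V.
  apply: le_trans (proj_le _) _; rewrite mulrC; apply: ler_wpM2l; first exact: nm_ge0.
  by rewrite /B lerDl.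
have h2 : nm (ell y - ell x) <= nm (y - x) * B.
  rewrite -(ellB ell_lin); apply: le_trans (ell_le _) _.
  rewrite mulrC; apply: ler_wpM2l; first exact: nm_ge0.
  by rewrite /B lerDr ltW // slideB_gt0.
split=> /=.
  by rewrite -[proj y](subrK (proj x)); apply: le_lt_trans (nmD _ _) _; lra.
by rewrite -[ell y](subrK (ell x)); apply: le_lt_trans (nmD _ _) _; lra.
Qed.

Lemma dom_proj x : dom x -> dom (proj x).
Proof. by move=> [x1 x2]; split; rewrite /= ?projK // ell_proj nm0. Qed.

Definition good (f : V -> K) (M : R) :=
  forall x, dom x -> differentiable f x /\ nm (f x) <= M.

Lemma dom_line x (z : K) : dom x -> nm z < rho -> dom (proj x + z *: v).
Proof.
move=> [x1 x2] zr; split=> /=; first by rewrite proj_v projK.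
by rewrite (ellD ell_lin) (ellZ ell_lin) ell_v mulr1 ell_proj add0r.
Qed.

(** Away from the kernel of [ell] the quotient is visibly holomorphic; near the kernel it is the
    mean of the derivative along [v]. The bound comes from one-variable estimates on the disc of
    radius [rho], so it does not involve [eps]. *)
Lemma good_hq f M : good f M -> good (hq f) (32 * M / rho).
Proof.
move=> gf.
have M0 : 0 <= M.
  have D0 : dom 0 by split=> /=; rewrite ?proj0 ?(ell0 ell_lin) nm0.
  by have [_] := gf _ D0; apply: le_trans; exact: nm_ge0.
move=> x Dx; split; last first.
  pose g (z : K) := f (proj x + z *: v).
  have dg z : nm (z - 0) < rho -> differentiable g z.
    rewrite subr0 => zr; have [dl _] := hasd_diff (line_hasd (proj x) v z).
    by apply: (dif_comp dl); case: (gf _ (dom_line Dx zr)).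
  have gM z : nm (z - 0) < rho -> nm (g z) <= M.
    by rewrite subr0 => zr; case: (gf _ (dom_line Dx zr)).
  have xE : x = proj x + ell x *: v by exact: projE.
  have fx : f x = g (ell x) by rewrite {1}xE.
  have fp : f (proj x) = g 0 by rewrite /g scale0r addr0.
  have [Dx1 Dx2] := Dx.
  rewrite /hq; have [e|e] := eqVneq (ell x) 0.
    have gx : forall z, g z = f (x + z *: v) by move=> z; rewrite /g proj_id.
    have [dl Dl] := hasd_dd (line_hasd x v 0).
    have dfx : differentiable f (x + 0 *: v) by rewrite scale0r addr0; case: (gf x Dx).
    have -> : dd f x v = dd g 0 1.
      rewrite (dd_ext (g := fun z : K => f (x + z *: v))); last exact/funext.
      by rewrite (dd_comp _ dl dfx) Dl scale1r scale0r addr0.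
    apply: le_trans (dd_le (nice_K R) rho0 dg gM 1) _.
    by rewrite nm1 mulr1 -!mulrA ler_wpM2r ?mulr_ge0 ?invr_ge0 ?(ltW rho0) // ler_nat.
  rewrite fx fp nmM nmV; have ep := nm_gt0 e; rewrite ler_pdivrMr //.
  have [h|h] := ltP (nm (ell x)) (rho / 2).
    have := lipschitz_half (nice_K R) rho0 dg gM (x := ell x) (y := 0).
    by rewrite !subr0 => /(_ h); apply; rewrite nm0 divr_gt0.
  apply: (@le_trans _ _ (M + M)).
    apply: le_trans (nmD _ _) _; rewrite nmN; apply: lerD; apply: gM; rewrite subr0 ?nm0 //.
  apply: (@le_trans _ _ (32 * M / rho * (rho / 2))); last first.
    by apply: ler_wpM2l => //; rewrite divr_ge0 ?mulr_ge0 // ltW.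
  have -> : 32 * M / rho * (rho / 2) = 16 * M by field; rewrite gt_eqF.
  lra.
have [e|e] := eqVneq (ell x) 0; last first.
  have [dx _] := gf x Dx; have [dp _] := gf _ (dom_proj Dx).
  have de : differentiable ell x by apply: hol_dif; exact: hol_ell'.
  have ne : \forall y \near x, (f y - f (proj y)) / ell y = hq f y.
    have [r r0 h] := differentiable_nm_continuous de (nm_gt0 e).
    apply/near_nmP; exists r => // y /h h1; rewrite /hq; case: eqP => // ey.
    by move: h1; rewrite ey sub0r nmN ltxx.
  have d : differentiable (fun y => (f y - f (proj y)) / ell y) x.
    apply: dif_mul; last exact: dif_inv.
    apply: dif_sub; first exact: dx.
    by apply: (dif_comp (f := proj)); [apply: hol_dif; exact: proj_hol|exact: dp].
  by case: (dif_near_eq ne d).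
have [d d0 hd] := dom_open Dx.
have sx s : slide v ell x s = x by rewrite /slide e mulr0 scale0r subr0.
have hfd y : nm (y - x) < d / 2 -> differentiable (fun y => dd f y v) y /\
    nm (dd f y v) <= 32 * M / d * nm v.
  move=> yx; have hy z : nm (z - y) < d / 2 -> dom z.
    by move=> zy; apply: hd; apply: le_lt_trans (nm_triangle y _ _) _; lra.
  split.
    apply: hol_dif; apply: (hol_dd (nice_K R)); apply/near_nmP; exists (d / 2); first by lra.
    by move=> z /hy/gf[].
  have -> : 32 * M / d = 16 * M / (d / 2) by field; rewrite gt_eqF.
  apply: (dd_le (nice_K R)) => [|z /hy/gf[]//|z /hy/gf[]//]; lra.
have d2 : 0 < d / 2 by lra.
have t1 : tube v ell f x (d / 2) M.
  by move=> s _ y; rewrite sx => yx; apply: gf; apply: hd; lra.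
have t2 : tube v ell (fun y => dd f y v) x (d / 2) (32 * M / d * nm v).
  by move=> s _ y; rewrite sx; exact: hfd.
have [hm _] := mean_hol (nice_K R) ell_lin ell_le Bl_ge0 d2 t2.
have ne : \forall y \near x, mean v ell (fun y => dd f y v) y = hq f y.
  apply/near_nmP; exists (d / 2 / 2 / slideB v Bl); first by rewrite !divr_gt0 ?slideB_gt0.
  move=> y yx.
  have u1 := tube_near ell_lin ell_le Bl_ge0 d2 t1 yx.
  have u2 := tube_near ell_lin ell_le Bl_ge0 d2 t2 yx.
  have d4 : 0 < d / 2 / 2 by lra.
  have := mean_deriv (nice_K R) d4 u1 u2.
  rewrite -proj_slide /hq => E; have [ey|ey] := eqVneq (ell y) 0.
    apply: (cvgs_unique (mean_cvg (nice_K R) d4 u2)) => e1 e10; exists 0%N => k _.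
    have sy s : slide v ell y s = y by rewrite /slide ey mulr0 scale0r subr0.
    rewrite /average; under eq_bigr do rewrite sy.
    rewrite sumr_const_nat subn0 -[X in _ *: X]mulr_natl -[_ *: _]/(_ * _) mulrA natrX.
    have -> : ((2 ^+ k)^-1)%:K * 2 ^+ k = 1 :> K.
      by rewrite realKV rmorphXn rmorph_nat mulVf // expf_neq0 // pnatr_eq0.
    by rewrite mul1r subrr nm0.
  by rewrite -E -[_ *: _]/(_ * _) mulrAC divff // mul1r.
by case: (dif_near_eq ne (hol_dif hm)).
Qed.

Lemma good_iter d f M : good f M -> good (iter d hq f) ((32 / rho) ^+ d * M).
Proof.
move=> gf; elim: d => [|d ih] /=; first by rewrite expr0 mul1r.
by have := good_hq ih; rewrite exprS; congr (good _ _); ring.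
Qed.

Lemma hq_ext f g : {in dom, f =1 g} -> (exists M, good f M) -> {in dom, hq f =1 hq g}.
Proof.
move=> fg [M gf] x; rewrite inE => Dx.
rewrite /hq fg ?inE // fg ?inE; last exact: dom_proj.
case: eqP => // _; apply/esym; have [df _] := gf x Dx.
have [d d0 hd] := dom_open Dx.
apply: (dd_near_eq _ _ df); apply/near_nmP; exists d => // y /hd Dy.
by apply: fg; rewrite inE.
Qed.

Lemma hq_sub f g x : (exists M, good f M) -> (exists M, good g M) -> dom x ->
  hq (fun y => f y - g y) x = hq f x - hq g x.
Proof.
move=> [M gf] [N gg] Dx; rewrite /hq; case: eqP => _; last by ring.
by have [? _] := gf x Dx; have [? _] := gg x Dx; rewrite dd_sub.
Qed.

Lemma good_sub f g M N : good f M -> good g N -> good (fun y => f y - g y) (M + N).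
Proof.
move=> gf gg x Dx; have [d1 m1] := gf x Dx; have [d2 m2] := gg x Dx.
split; first exact: dif_sub.
by apply: le_trans (nmD _ _) _; rewrite nmN; apply: lerD.
Qed.

Lemma iter_sub d f g : (exists M, good f M) -> (exists M, good g M) ->
  {in dom, iter d hq (fun y => f y - g y) =1 (fun y => iter d hq f y - iter d hq g y)}.
Proof.
move=> [M gf] [N gg]; elim: d => [|d ih] // x Dx /=.
have gfd := good_iter d gf; have ggd := good_iter d gg.
rewrite (hq_ext ih _ Dx); last by eexists; exact: good_iter (good_sub gf gg).
by move: Dx; rewrite inE => Dx; rewrite hq_sub //; eexists; eassumption.
Qed.

Lemma good_mul f g M N : 0 <= M -> 0 <= N -> good f M -> good g N ->
  good (fun y => f y * g y) (M * N).
Proof.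
move=> M0 N0 gf gg x Dx; have [d1 m1] := gf x Dx; have [d2 m2] := gg x Dx.
split; first exact: dif_mul.
by rewrite nmM; apply: ler_pM; rewrite ?nm_ge0.
Qed.

Lemma good_ell d : good (fun y => ell y ^+ d) (rho ^+ d).
Proof.
move=> x Dx; split; first by apply: dif_exp; apply: hol_dif; exact: hol_ell'.
rewrite nmX; apply: lerXn2r; rewrite ?nnegrE ?nm_ge0 ?(ltW rho0) // ltW //; by case: Dx.
Qed.

Lemma dom0 : dom 0.
Proof. by split; rewrite /= ?proj0 ?(ell0 ell_lin) nm0. Qed.

Lemma good_ge0 f M : good f M -> 0 <= M.
Proof. by move=> gf; have [_] := gf 0 dom0; apply: le_trans; exact: nm_ge0. Qed.

Lemma iter_ext d f g : {in dom, f =1 g} -> (exists M, good f M) ->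
  {in dom, iter d hq f =1 iter d hq g}.
Proof.
move=> fg [M gf]; elim: d => [|d ih] //=; apply: hq_ext => //.
by eexists; exact: good_iter gf.
Qed.

Lemma hq_mul w M : good w M -> {in dom, hq (fun y => ell y * w y) =1 w}.
Proof.
move=> gw x; rewrite inE => Dx; rewrite /hq; case: eqP => [e|/eqP e].
  have [dw _] := gw x Dx.
  have de : differentiable ell x by apply: hol_dif; exact: hol_ell'.
  by rewrite (dd_mul v de dw) dd_ell' e ell_v; ring.
by rewrite ell_proj mul0r subr0 mulrAC divff // mul1r.
Qed.

Lemma iter_mul d w M : good w M ->
  {in dom, iter d hq (fun y => ell y ^+ d * w y) =1 w}.
Proof.
move=> gw; elim: d => [|d ih] x Dx; first by rewrite /= expr0 mul1r.
rewrite iterSr -(ih x Dx).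
have gd : good (fun y => ell y ^+ d * w y) (rho ^+ d * M).
  apply: (good_mul _ _ (good_ell _) gw); [exact: exprn_ge0 (ltW rho0)|exact: good_ge0 gw].
have gd1 : good (fun y => ell y ^+ d.+1 * w y) (rho ^+ d.+1 * M).
  apply: (good_mul _ _ (good_ell _) gw); [exact: exprn_ge0 (ltW rho0)|exact: good_ge0 gw].
apply: iter_ext Dx; last by eexists; exact: good_hq gd1.
move=> y Dy; rewrite -(hq_mul gd Dy); congr (hq _ y).
by apply/funext => z; rewrite exprS mulrA.
Qed.

Lemma iter_line f M : good f M -> (forall z : K, nm z < rho -> f (z *: v) = 0) ->
  forall k (z : K), nm z < rho -> iter k hq f (z *: v) = 0.
Proof.
move=> gf f0; elim=> [|k ih] z zr; first exact: f0.
have gk := good_iter k gf.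
have pv : proj (z *: v) = 0 by have := proj_v 0 z; rewrite add0r proj0.
have r0 : nm (0 : K) < rho by rewrite nm0.
have i0 : iter k hq f 0 = 0 by have := ih 0 r0; rewrite scale0r.
rewrite /= /hq pv i0 ih // (ellZ ell_lin) ell_v mulr1; case: eqP => [->|_]; last by rewrite subrr mul0r.
rewrite scale0r.
have [dl Dl] := hasd_dd (line_hasd (0 : V) v 0).
have [dk _] := gk 0 dom0.
have dk' : differentiable (iter k hq f) (0 + 0 *: v) by rewrite scale0r addr0.
transitivity (dd (fun z : K => iter k hq f (0 + z *: v)) 0 1).
  by rewrite (dd_comp _ dl dk') Dl scale1r scale0r addr0.
rewrite (dd_near_eq (f := fun=> 0 : K)) ?dd_cst //.
apply/near_nmP; exists rho => // y; rewrite subr0 => yr.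
by rewrite add0r ih.
Qed.
End Domain.

Lemma hq_expand f d x :
  f x = \sum_(k < d) iter k hq f (proj x) * ell x ^+ k + ell x ^+ d * iter d hq f x.
Proof.
elim: d => [|d ih]; first by rewrite big_ord0 add0r expr0 mul1r.
rewrite big_ord_recr /= {1}ih [X in _ + _ * X = _](hqE (iter d hq f) x) exprS; ring.
Qed.

Lemma dom_ballE (r : R) x : 0 < r -> dom (r / (1 + nm v)) (r / (1 + nm v)) x -> nm x < r.
Proof.
move=> r0; have v0 := nm_ge0 v; move=> [x1 x2]; rewrite [x]projE; apply: le_lt_trans (nmD _ _) _; rewrite nmZ.
have : nm (ell x) * nm v <= r / (1 + nm v) * nm v by apply: ler_wpM2r => //; exact: ltW.
have e : r = r / (1 + nm v) + r / (1 + nm v) * nm v by field; lra.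
rewrite [X in _ -> _ < X]e; move: x1; lra.
Qed.

Lemma dom_ball (r : R) : 0 < r -> exists2 e, 0 < e & forall x, dom e e x -> nm x < r.
Proof.
move=> r0; have v0 := nm_ge0 v; exists (r / (1 + nm v)); first by rewrite divr_gt0 //; lra.
by move=> x; exact: dom_ballE.
Qed.

Lemma dom_le e e' r r' x : e <= e' -> r <= r' -> dom e r x -> dom e' r' x.
Proof. by move=> ee rr [x1 x2]; split; [apply: lt_le_trans ee|apply: lt_le_trans rr]. Qed.

Lemma hol_dom f : hol f 0 -> exists e M, 0 < e /\ good e e f M.
Proof.
move=> hf; have [r [M [r0 df Mf]]] := hol_ball hf.
have [e e0 he] := dom_ball r0; exists e, M; split=> // x /he xr.
by split; [apply: df|apply: Mf]; rewrite subr0.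
Qed.

(** When all quotients vanish at 0, [hq_expand] leaves only the remainder, bounded by (e / 64)^k (32
    / e)^k M = M / 2^k: the number 64 outweighs the factor 32 / e lost with each quotient. *)
Lemma order_line g e M : 0 < e -> good e e g M -> (forall k, iter k hq g 0 = 0) ->
  forall z : K, nm z < e / 64 -> g (z *: v) = 0.
Proof.
move=> e0 ge h0 z ze.
have pv : proj (z *: v) = 0 by have := proj_v 0 z; rewrite add0r proj0.
have ev : ell (z *: v) = z by rewrite (ellZ ell_lin) ell_v mulr1.
have Dz : dom e e (z *: v) by split; rewrite /= ?pv ?ev ?nm0 //; have := nm_ge0 z; lra.
apply: (small_eq0 (c := M) (half_lt1 R)) => k.
rewrite (hq_expand g k) pv ev big1 ?add0r => [|i _]; last by rewrite h0 mul0r.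
rewrite nmM nmX.
have [_ gk] := good_iter e0 e0 k ge Dz.
apply: (@le_trans _ _ ((e / 64) ^+ k * ((32 / e) ^+ k * M))).
  apply: ler_pM; rewrite ?exprn_ge0 ?nm_ge0 //.
  by apply: lerXn2r; rewrite ?nnegrE ?nm_ge0 // ?ltW // divr_gt0.
rewrite mulrA -exprMn mulrC.
by have -> : e / 64 * (32 / e) = 2^-1 by field; rewrite gt_eqF.
Qed.

(** With [T] the d-th iterate of [hq] and u = T g, [hq_expand] gives g = h + ell^d u, where the
    coefficients of [h] vanish at 0. If w = T f - T (w h / u) and q = w / u, then T (f - q g) = T f
    - T (w h / u) - T (ell^d w) = 0, because T (ell^d w) = w; so [hq_expand] exhibits f - q g as a
    polynomial in [ell] of degree less than d. The equation for [w] is solved by iteration. *)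
Theorem weierstrass g : hol g 0 -> (exists k, iter k hq g 0 != 0) ->
  exists d, iter d hq g 0 != 0 /\ forall f, hol f 0 -> exists (q : V -> K) (r : nat -> V -> K),
    [/\ hol q 0 /\ q 0 * iter d hq g 0 = iter d hq f 0, forall k, (k < d)%N -> hol (r k) 0, forall k x, r k (proj x) = r k x &
     \forall x \near 0, f x = q x * g x + \sum_(k < d) r k x * ell x ^+ k].
Proof.
move=> hg nz; case: (ex_minnP nz) => d gd0 dmin.
have gk0 k : (k < d)%N -> iter k hq g 0 = 0.
  by move=> kd; apply/eqP; apply: contraLR kd => k0; rewrite -leqNgt; exact: dmin.
exists d; split=> // f hf; pose T := iter d hq; pose u := T g.
have [e1 [Mg [e10 gg]]] := hol_dom hg; have [e2 [Mf [e20 gf]]] := hol_dom hf.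
pose e3 := Num.min e1 e2.
have e30 : 0 < e3 by rewrite lt_min e10.
have e31 : e3 <= e1 by rewrite ge_min lexx.
have e32 : e3 <= e2 by rewrite ge_min lexx orbT.
pose c := nm (u 0) / 2; have c0 : 0 < c by rewrite divr_gt0 // nm_gt0.
have du : differentiable u 0.
  by case: (good_iter e10 e10 d gg (dom0 e10 e10)).
have [r1 r10 hr1] := differentiable_nm_continuous du c0.
have [e4 e40 he4] := dom_ball r10.
pose rho := Num.min e3 e4; have rho0 : 0 < rho by rewrite lt_min e30.
have rho3 : rho <= e3 by rewrite ge_min lexx.
have rho4 : rho <= e4 by rewrite ge_min lexx orbT.
have uc x : dom rho rho x -> c <= nm (u x).
  move=> /(dom_le rho4 rho4)/he4 xr; have := hr1 x; rewrite subr0 => /(_ xr) h.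
  have := nmD (u x) (u 0 - u x); rewrite addrC subrK nmB /c => h2; move: h; rewrite /c; lra.
pose C := (32 / rho) ^+ d; have C0 : 0 < C by rewrite exprn_gt0 // divr_gt0.
pose S := \sum_(k < d) rho ^+ k.
have S0 : 0 <= S by apply: sumr_ge0 => k _; rewrite exprn_ge0 // ltW.
(* [T] multiplies bounds by at most [C], and 1 / u is bounded by 1 / c; with this bound on [h] the
   map sending w to T (w h / u) halves bounds. It is reached by shrinking [eps] alone, since [C]
   depends only on [rho] and d. *)
pose eta := c / 2 / C; have eta0 : 0 < eta by exact: (divr_gt0 (divr_gt0 c0 (ltr0Sn _ 1)) C0).
pose del := eta / (S + 1); have del0 : 0 < del by rewrite divr_gt0 //; lra.
have [r2 r20 hr2] : exists2 r2 : R, 0 < r2 & forall y, nm (y - 0) < r2 ->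
    forall k : 'I_d, nm (iter k hq g y) < del.
  apply/near_nmP; apply: filter_forall => k; apply/near_nmP.
  have [dk _] := good_iter e10 e10 k gg (dom0 e10 e10).
  have [r r0 hr] := differentiable_nm_continuous dk del0; exists r => // y /hr.
  by rewrite gk0 // subr0.
pose eps := Num.min rho r2; have eps0 : 0 < eps by rewrite lt_min rho0.
have eps_rho : eps <= rho by rewrite ge_min lexx.
have eps2 : eps <= r2 by rewrite ge_min lexx orbT.
pose G := good eps rho.
have Gg : G g Mg.
  by move=> x Dx; apply: gg; apply: (dom_le _ _ Dx); apply: le_trans e31; rewrite // (le_trans eps_rho).
have Gf : G f Mf.
  by move=> x Dx; apply: gf; apply: (dom_le _ _ Dx); apply: le_trans e32; rewrite // (le_trans eps_rho).
have GT F M : G F M -> G (T F) (C * M) by move=> GF; exact: good_iter.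
have ucD x : dom eps rho x -> c <= nm (u x) by move=> Dx; apply: uc; apply: dom_le Dx.
have u0 x : dom eps rho x -> u x != 0.
  by move=> /ucD cu; apply: contraTneq cu => ->; rewrite nm0 -ltNge.
have Gui : G (fun x => (u x)^-1) c^-1.
  move=> x Dx; have [dux _] := GT _ _ Gg x Dx; split; first by apply: dif_inv => //; exact: u0.
  by rewrite nmV lef_pV2 ?ucD // posrE // (lt_le_trans c0) // ucD.
pose h x := \sum_(k < d) iter k hq g (proj x) * ell x ^+ k.
have gh x : g x = h x + ell x ^+ d * u x by exact: hq_expand.
have Gh : G h eta.
  move=> x Dx; split.
    apply: dif_sum => k _; apply: dif_mul; last by case: (good_ell rho0 k Dx).
    apply: (dif_comp (f := proj)); first by apply: hol_dif; exact: proj_hol.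
    by case: (good_iter eps0 rho0 k Gg (dom_proj rho0 Dx)).
  apply: le_trans (nm_sum _ _ _) _.
  apply: (@le_trans _ _ (\sum_(k < d) del * rho ^+ k)).
    apply: ler_sum => k _; rewrite nmM; apply: ler_pM; rewrite ?nm_ge0 //.
      by apply/ltW/hr2; rewrite subr0; case: Dx => /= x1 _; exact: lt_le_trans eps2.
    by case: (good_ell rho0 k Dx).
  rewrite -mulr_sumr -/S /del -mulrA ler_piMr ?(ltW eta0) //.
  by rewrite mulrC ler_pdivrMr; lra.
pose hu x := h x / u x.
have Ghu : G hu (eta / c) by apply: (good_mul _ _ Gh Gui); rewrite // ?invr_ge0 ltW.
have Gstep F M : G F M -> G (T (fun x => F x * hu x)) (M * 2^-1).
  move=> GF; have M0 := good_ge0 eps0 rho0 GF.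
  have -> : M * 2^-1 = C * (M * (eta / c)).
    by rewrite /eta; field; rewrite ?gt_eqF.
  by apply: GT; apply: (good_mul _ _ GF Ghu) => //; rewrite divr_ge0 ?ltW.
have Tsub F1 F2 M1 M2 : G F1 M1 -> G F2 M2 -> {in dom eps rho,
    T (fun y => F1 y - F2 y) =1 (fun y => T F1 y - T F2 y)}.
  by move=> G1 G2; apply: (iter_sub eps0 rho0); eexists; eassumption.
pose step w x := T f x - T (fun y => w y * hu y) x.
pose F k := iter k step (T f).
have GF k : G (F k) (C * Mf * 2).
  elim: k => [|k ih] /=.
    move=> x /(GT _ _ Gf)[dx bx]; split=> //; apply: le_trans bx _.
    by rewrite ler_peMr ?mulr_ge0 ?(ltW C0) ?(good_ge0 eps0 rho0 Gf) // ler1n.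
  have := good_sub (GT _ _ Gf) (Gstep _ _ ih); rewrite /G.
  by have -> : C * Mf + C * Mf * 2 / 2 = C * Mf * 2 by field.
have stepB w1 w2 M1 M2 M : G w1 M1 -> G w2 M2 -> G (fun x => w1 x - w2 x) M ->
    forall x, dom eps rho x -> nm (step w1 x - step w2 x) <= M * 2^-1.
  move=> G1 G2 G12 x Dx; rewrite /step.
  have E : T f x - T (fun y => w1 y * hu y) x - (T f x - T (fun y => w2 y * hu y) x)
     = - T (fun y => (w1 y - w2 y) * hu y) x.
    have -> : (fun y => (w1 y - w2 y) * hu y) = (fun y => w1 y * hu y - w2 y * hu y).
      by apply/funext => y; rewrite mulrBl.
    have P w M0 : G w M0 -> G (fun y => w y * hu y) (M0 * (eta / c)).
      move=> Gw; apply: (good_mul (good_ge0 eps0 rho0 Gw) (good_ge0 eps0 rho0 Ghu) Gw Ghu).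
    by rewrite (Tsub _ _ _ _ (P _ _ G1) (P _ _ G2)) ?inE //; ring.
  by rewrite E nmN; case: (Gstep _ _ G12 x Dx).
have Fk k : G (fun x => F k.+1 x - F k x) (C * Mf * 2^-1 ^+ k).
  elim: k => [|k ih] x Dx.
    have [d1 _] := GF 1%N x Dx; have [d2 _] := GF 0%N x Dx.
    split; first exact: dif_sub.
    have -> : F 1%N x - F 0%N x = - T (fun y => F 0%N y * hu y) x.
      by rewrite /F /= /step addrAC subrr add0r.
    rewrite nmN; have [_] := Gstep _ _ (GF 0%N) x Dx.
    by have -> : C * Mf * 2 / 2 = C * Mf * 2^-1 ^+ 0 by rewrite expr0; field.
  have [d1 _] := GF k.+2 x Dx; have [d2 _] := GF k.+1 x Dx.
  split; first exact: dif_sub.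
  rewrite exprSr mulrA.
  exact: (stepB (F k.+1) (F k) _ _ _ (GF k.+1) (GF k) ih x Dx).
have CM0 : 0 <= C * Mf by rewrite mulr_ge0 ?(ltW C0) // (good_ge0 eps0 rho0 Gf).
have DO : nmopen (dom eps rho) by exact: dom_open.
have [w hw] := geometric_limit (nice_K R) DO (half_lt1 R) CM0
  (fun k x Dx => (GF k x Dx).1) (fun k x Dx => (GF k x Dx).2) (fun k x Dx => (Fk k x Dx).2).
have Gw : G w (C * Mf * 2) by move=> x /hw[].
have wE x : dom eps rho x -> w x = step w x.
  move=> Dx; apply/eqP; rewrite -subr_eq0; apply/eqP.
  pose N := C * Mf / (1 - 2^-1).
  apply: (small_eq0 (c := N * 2) (half_lt1 R)) => k.
  have GwF : G (fun y => F k y - w y) (N * 2^-1 ^+ k).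
    move=> y Dy; have [dw _ wk] := hw y Dy; split; last exact: wk.
    by apply: dif_sub => //; case: (GF k y Dy).
  have h1 := stepB _ _ _ _ _ (GF k) Gw GwF x Dx.
  have [_ _ /(_ k.+1) h2] := hw x Dx.
  have -> : w x - step w x = (step (F k) x - step w x) - (F k.+1 x - w x).
    by rewrite /F /=; ring.
  apply: le_trans (nmD _ _) _; rewrite nmN.
  apply: le_trans (lerD h1 h2) _; rewrite -/N exprS.
  have n0 : 0 <= N * 2^-1 ^+ k.
    by rewrite mulr_ge0 ?exprn_ge0 ?invr_ge0 // divr_ge0 // subr_ge0 invf_le1 ?ler1n.
  move: n0; lra.
pose q x := w x / u x.
pose ff x := f x - q x * g x.
have Gq : G q (C * Mf * 2 * c^-1).
  by exact: (good_mul (good_ge0 eps0 rho0 Gw) (good_ge0 eps0 rho0 Gui) Gw Gui).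
have Gff : exists M, G ff M.
  eexists; apply: good_sub Gf _; apply: (good_mul _ _ Gq Gg); last exact: good_ge0 Gg.
  exact: good_ge0 Gq.
have Tff : {in dom eps rho, T ff =1 fun=> 0}.
  move=> x Dx; have Dx' := Dx; rewrite inE in Dx'.
  have Gwh : G (fun y => w y * hu y) (C * Mf * 2 * (eta / c)).
    by apply: (good_mul (good_ge0 eps0 rho0 Gw) (good_ge0 eps0 rho0 Ghu) Gw Ghu).
  have Gew : G (fun y => ell y ^+ d * w y) (rho ^+ d * (C * Mf * 2)).
    apply: (good_mul _ _ (good_ell rho0 d) Gw); last by rewrite mulr_ge0.
    by rewrite exprn_ge0 // ltW.
  have e1' : {in dom eps rho, ff =1 fun y => (f y - w y * hu y) - ell y ^+ d * w y}.
    move=> y; rewrite inE => Dy; rewrite /ff /q /hu gh; have := u0 y Dy => uy.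
    by field.
  have [M GM] := Gff.
  rewrite /T (iter_ext eps0 rho0 d e1' (ex_intro _ M GM) Dx).
  apply: (etrans (Tsub _ _ _ _ (good_sub Gf Gwh) Gew x Dx)).
  have -> : T (fun y => ell y ^+ d * w y) x = w x by apply: (iter_mul eps0 rho0 d Gw Dx).
  by rewrite [X in _ - X](wE x Dx') [X in X - _](Tsub _ _ _ _ Gf Gwh x Dx) subrr.
have Dn P : (forall x, dom eps rho x -> P x) -> \forall x \near (0 : V), P x.
  move=> hP; have [r0 r00 hr0] := DO 0 (dom0 eps0 rho0).
  by apply/near_nmP; exists r0 => // y /hr0/hP.
exists q, (fun k x => iter k hq ff (proj x)); split.
- split; first by apply: Dn => x /Gq[].
  have D0 := dom0 eps0 rho0.
  rewrite /q -/(T g 0) -/u divfK ?u0 // (wE 0 D0) /step.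
  have Gwh : G (fun y => w y * hu y) (C * Mf * 2 * (eta / c)).
    by apply: (good_mul (good_ge0 eps0 rho0 Gw) (good_ge0 eps0 rho0 Ghu) Gw Ghu).
  (* On the line through 0 along [v] the coefficients of [h] take their values at 0, which are zero.
     So the correction term vanishes on this line together with its quotients, and w 0 = T f 0. *)
  have h0 (z : K) : nm z < rho -> w (z *: v) * hu (z *: v) = 0.
    move=> _; rewrite /hu /h big1 ?mul0r ?mulr0 // => k _.
    have := proj_v 0 z; rewrite add0r proj0 => ->.
    by rewrite gk0 // mul0r.
  have r0 : nm (0 : K) < rho by rewrite nm0.
  have -> : T (fun y => w y * hu y) 0 = 0 by have := iter_line eps0 rho0 Gwh h0 d r0; rewrite scale0r.
  by rewrite subr0.
- move=> k kd; apply: (hol_comp (f := proj)); first exact: proj_hol.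
  by rewrite proj0; have [M GM] := Gff; apply: Dn => x /(good_iter eps0 rho0 k GM)[].
- by move=> k x; rewrite projK.
- apply: Dn => x Dx; have := hq_expand ff d x; rewrite -/(T ff x) Tff ?inE // mulr0 addr0.
  by rewrite {1}/ff => <-; rewrite addrC subrK.
Qed.

(** The preparation theorem: in the division of ell^d by [g] the value of the quotient at 0 times T
    g 0 equals T (ell^d) 0 = 1, so the quotient is a unit. *)
Corollary weierstrass_unit g : hol g 0 -> (exists k, iter k hq g 0 != 0) ->
  exists d, (exists (q : V -> K) (r : nat -> V -> K),
    [/\ hol q 0 /\ q 0 != 0, forall k, (k < d)%N -> hol (r k) 0, forall k x, r k (proj x) = r k x &
     \forall x \near 0, ell x ^+ d = q x * g x + \sum_(k < d) r k x * ell x ^+ k]) /\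
  forall f, hol f 0 -> exists (q : V -> K) (r : nat -> V -> K),
    [/\ hol q 0, forall k, (k < d)%N -> hol (r k) 0, forall k x, r k (proj x) = r k x &
     \forall x \near 0, f x = q x * g x + \sum_(k < d) r k x * ell x ^+ k].
Proof.
move=> hg nz; have [d [d0 hd]] := weierstrass hg nz; exists d; split; last first.
  by move=> f /hd[q [r [[hq _] ? ? ?]]]; exists q, r.
have hl : hol (fun x => ell x ^+ d) 0 by apply: hol_exp; exact: hol_ell'.
have [q [r [[hq q0] h1 h2 h3]]] := hd _ hl; exists q, r; split=> //; split=> //.
apply/eqP => q00; move: q0; rewrite q00 mul0r.
have [e [M [e0 ge]]] : exists e M, 0 < e /\ good e e (fun=> 1 : K) M.
  by exists 1, 1; split=> // x _; split; [exact: dif_cst|rewrite nm1].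
have := iter_mul e0 e0 d ge (x := 0); rewrite inE => /(_ (dom0 e0 e0)).
have -> : (fun y => ell y ^+ d * 1) = (fun y => ell y ^+ d) by apply/funext => y; rewrite mulr1.
by move=> -> /eqP; rewrite eq_sym oner_eq0.
Qed.
End Weierstrass.

(** * Noetherian rings and the Jacobian criterion *)

Section Algebra.
Variable O : comPzRingType.
Implicit Types (S I P Q X Y : set O).

(** Subrings and ideals are sets in one ambient ring, so that the rings of a tower and their ideals
    can be intersected without embeddings. Positive integers are invertible, as the separability
    arguments demand. *)
Definition subring S := [/\ S 1, forall x y, S x -> S y -> S (x - y),
  forall x y, S x -> S y -> S (x * y) &
  forall n, exists2 y, S y & n.+1%:R * y = 1].

Definition isideal S I := [/\ I `<=` S, I 0,
  forall x y, I x -> I y -> I (x + y) & forall a x, S a -> I x -> I (a * x)].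

Definition isprime S P := [/\ isideal S P, ~ P 1 &
  forall x y, S x -> S y -> P (x * y) -> P x \/ P y].

Definition isder (d : O -> O) :=
  (forall x y, d (x + y) = d x + d y) /\ (forall x y, d (x * y) = x * d y + y * d x).

Section SubringRules.
Variables (S : set O) (hS : subring S).
Lemma sub1 : S 1. Proof. by case: hS. Qed.
Lemma subB x y : S x -> S y -> S (x - y). Proof. by case: hS => _ h _ _; exact: h. Qed.
Lemma subM x y : S x -> S y -> S (x * y). Proof. by case: hS => _ _ h _; exact: h. Qed.
Lemma sub0 : S 0. Proof. by rewrite -(subrr 1); apply: subB; exact: sub1. Qed.
Lemma subN x : S x -> S (- x). Proof. by rewrite -sub0r; apply: subB; exact: sub0. Qed.
Lemma subD x y : S x -> S y -> S (x + y).
Proof. by move=> Sx Sy; rewrite -[y]opprK; apply: subB => //; exact: subN. Qed.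
Lemma subX x n : S x -> S (x ^+ n).
Proof. by move=> Sx; elim: n => [|n ih]; [exact: sub1|rewrite exprS; exact: subM]. Qed.
Lemma subn n : S n%:R.
Proof. by elim: n => [|n ih]; [exact: sub0|rewrite -addn1 natrD; apply: subD => //; exact: sub1]. Qed.
Lemma sub_sum (T : Type) (s : seq T) (A : pred T) F : (forall i, A i -> S (F i)) ->
  S (\sum_(i <- s | A i) F i).
Proof. by move=> h; apply: (big_ind S) => //; [exact: sub0|exact: subD]. Qed.
Lemma sub_prod (T : Type) (s : seq T) (A : pred T) F : (forall i, A i -> S (F i)) ->
  S (\prod_(i <- s | A i) F i).
Proof. by move=> h; apply: (big_ind S) => //; [exact: sub1|exact: subM]. Qed.
Lemma sub_det k (M : 'M[O]_k) : (forall i j, S (M i j)) -> S (\det M).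
Proof.
move=> h; apply: sub_sum => s _; apply: subM; last exact: sub_prod.
by apply: subX; apply: subN; exact: sub1.
Qed.
Lemma sub_cofactor k (M : 'M[O]_k) i j : (forall i j, S (M i j)) -> S (cofactor M i j).
Proof.
move=> h; apply: subM; first by apply: subX; apply: subN; exact: sub1.
by apply: sub_det => a b; rewrite !mxE.
Qed.

Section IdealRules.
Variables (I : set O) (hI : isideal S I).
Lemma idS x : I x -> S x. Proof. by case: hI => h _ _ _; exact: h. Qed.
Lemma id0 : I 0. Proof. by case: hI. Qed.
Lemma idD x y : I x -> I y -> I (x + y). Proof. by case: hI => _ _ h _; exact: h. Qed.
Lemma idM a x : S a -> I x -> I (a * x). Proof. by case: hI => _ _ _ h; exact: h. Qed.
Lemma idMr a x : S a -> I x -> I (x * a). Proof. by rewrite mulrC; exact: idM. Qed.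
Lemma idN x : I x -> I (- x).
Proof. by rewrite -mulN1r; apply: idM; apply: subN; exact: sub1. Qed.
Lemma idB x y : I x -> I y -> I (x - y). Proof. by move=> Ix Iy; apply: idD => //; exact: idN. Qed.
Lemma id_sum (T : Type) (s : seq T) (A : pred T) F : (forall i, A i -> I (F i)) ->
  I (\sum_(i <- s | A i) F i).
Proof. by move=> h; apply: (big_ind I) => //; [exact: id0|exact: idD]. Qed.
Lemma idDr x y : I y -> I (x + y) -> I x.
Proof. by move=> Iy Ixy; rewrite -(addrK y x); exact: idB. Qed.
Lemma idDl x y : I x -> I (x + y) -> I y.
Proof. by rewrite addrC; exact: idDr. Qed.
Lemma idBr x y : I y -> I (x - y) -> I x.
Proof. by move=> Iy; apply: idDr; exact: idN. Qed.
End IdealRules.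
Lemma prime_id P : isprime S P -> isideal S P. Proof. by case. Qed.
Lemma primeX P x n : isprime S P -> S x -> P (x ^+ n) -> P x.
Proof.
move=> [_ P1 PM] Sx; elim: n => [|n ih]; first by rewrite expr0 => /P1.
by rewrite exprS => h; case: (PM _ _ Sx (subX n Sx) h).
Qed.
Lemma prime_nat P n x : isprime S P -> S x -> P (n.+1%:R * x) -> P x.
Proof.
move=> hP Sx Pnx; have [_ _ _ /(_ n)[y Sy ny]] := hS.
rewrite -[x]mul1r -ny [_ * y]mulrC -mulrA; apply: idM Pnx => //; exact: prime_id.
Qed.
End SubringRules.

Fixpoint span S (s : seq O) (x : O) : Prop :=
  if s is a :: s' then exists2 c, S c & span S s' (x - c * a) else x = 0.

Lemma span_id S I s x : subring S -> isideal S I -> {in s, forall y, I y} -> span S s x -> I x.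
Proof.
move=> hS hI; elim: s x => [|a s ih] x hs; first by move=> /= ->; exact: (id0 hI).
move=> [c Sc /ih]; rewrite -[X in _ -> I X](subrK (c * a)) => h.
apply: (idD hI); first by apply: h => y ys; apply: hs; rewrite inE ys orbT.
by apply: (idM hI) => //; apply: hs; rewrite inE eqxx.
Qed.

Lemma span_mono S S' s x : S' `<=` S -> span S' s x -> span S s x.
Proof. by move=> SS; elim: s x => [|a s ih] x //= [c Sc /ih h]; exists c => //; exact: SS. Qed.

Lemma span_cat S s1 s2 x y : span S s1 x -> span S s2 y -> span S (s1 ++ s2) (x + y).
Proof.
elim: s1 x => [|a s ih] x /=; first by move=> ->; rewrite add0r.
by move=> [c Sc /ih h] /h h'; exists c => //; rewrite addrAC.
Qed.

Definition noeth S := forall I, isideal S I ->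
  exists2 s : seq O, {in s, forall y, I y} & forall x, I x -> span S s x.

(* [D] plays the role of the constant vector fields; [W] is the Weierstrass polynomial of [g]. *)
Fixpoint wtower (D : set (O -> O)) n S : Prop :=
  subring S /\ (forall d x, D d -> S x -> S (d x)) /\
  if n is n'.+1 then
    forall g, S g -> g != 0 -> exists S' z delta d (rho : nat -> O),
      [/\ wtower D n' S', S' `<=` S, S z, D delta &
      [/\ delta z = 1, forall x, S' x -> delta x = 0, forall i, S' (rho i),
       exists2 q, S q & z ^+ d - \sum_(i < d) rho i * z ^+ i = q * g &
       forall F, S F -> exists q (r : nat -> O), [/\ S q, forall i, S' (r i) &
         F = q * (z ^+ d - \sum_(i < d) rho i * z ^+ i) + \sum_(i < d) r i * z ^+ i]]]
  else forall x, S x -> x != 0 -> exists2 y, S y & y * x = 1.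

Lemma wtower_sub D n S : wtower D n S -> subring S. Proof. by case: n => [|n] []. Qed.
Lemma wtower_der D n S d x : wtower D n S -> D d -> S x -> S (d x).
Proof. by case: n => [|n] [_ [h _]]; exact: h. Qed.

(** To be read with [L c y] as: y has leading coefficient c. This is the step of Hilbert's basis
    theorem in which lifts of the generators of the leading coefficients remove the leading term of
    x. *)
Lemma lift_generators S (L : O -> O -> Prop) (cs : seq O) :
  (forall r x a c y, S a -> L r x -> L c y -> L (r - a * c) (x - a * y)) ->
  {in cs, forall c, exists y, L c y} ->
  exists2 ys : seq O, {in ys, forall y, exists c, L c y} &
    forall r x, span S cs r -> L r x -> exists2 x', L 0 x' & span S ys (x - x').
Proof.
move=> hL; elim: cs => [|c cs ih] hc.
  by exists [::] => // r x /= -> Lx; exists x; rewrite ?subrr.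
have [y Ly] := hc c (mem_head _ _).
have [|ys hys h] := ih; first by move=> c' c's; apply: hc; rewrite inE c's orbT.
exists (y :: ys) => [y'|r x [a Sa sp] Lx].
  by rewrite inE => /orP[/eqP ->|/hys//]; exists c.
have [x' L0 sx] := h _ _ sp (hL _ _ _ _ _ Sa Lx Ly).
by exists x' => //=; exists a => //; rewrite addrAC.
Qed.

Section Filtration.
Variables (S' : set O) (hS' : subring S') (z : O).

Definition pol e x := exists2 r : nat -> O, (forall i, S' (r i)) & x = \sum_(i < e) r i * z ^+ i.

Lemma pol_comb e x y a : S' a -> pol e x -> pol e y -> pol e (x - a * y).
Proof.
move=> Sa [r Sr ->] [q Sq ->]; exists (fun i => r i - a * q i).
  by move=> i; apply: (subB hS') => //; exact: (subM hS').
by rewrite mulr_sumr -sumrB; apply: eq_bigr => i _; rewrite mulrBl mulrA.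
Qed.

(** Induction on the degree bound [e] as in Hilbert's basis theorem. [N] is any submodule over S',
    not only an ideal, as the integrality argument of [contract_lt] requires. *)
Lemma pol_noeth e (N : set O) : noeth S' ->
  (forall x y a, S' a -> N x -> N y -> N (x - a * y)) -> N 0 ->
  exists2 s : seq O, {in s, forall y, N y} & forall x, N x -> pol e x -> span S' s x.
Proof.
move=> nS hN N0; elim: e => [|e [s sN hs]].
  by exists [::] => // x _ [r _ ->]; rewrite big_ord0.
pose L c x := [/\ N x, S' c & pol e (x - c * z ^+ e)].
have hL r x a c y : S' a -> L r x -> L c y -> L (r - a * c) (x - a * y).
  move=> Sa [Nx Sr px] [Ny Sc py]; split; first exact: hN.
    by apply: (subB hS') => //; exact: (subM hS').
  have -> : x - a * y - (r - a * c) * z ^+ e = (x - r * z ^+ e) - a * (y - c * z ^+ e) by ring.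
  exact: pol_comb.
have L00 : L 0 0.
  split=> //; first exact: (sub0 hS').
  exists (fun=> 0); first by move=> _; exact: (sub0 hS').
  by rewrite big1 => [|i _]; rewrite mul0r ?subr0.
have iL : isideal S' [set c | exists x, L c x].
  split=> [c [x []]//| |c c' [x Lx] [x' Lx']|a c Sa [x Lx]]; first by exists 0.
    have := hL _ _ _ _ _ (subN hS' (sub1 hS')) Lx Lx'.
    by rewrite !mulN1r !opprK => ?; exists (x + x').
  have := hL _ _ _ _ _ (subN hS' Sa) L00 Lx.
  by rewrite !sub0r !mulNr !opprK => ?; exists (a * x).
have [cs csL hcs] := nS _ iL.
have [ys ysL hys] := lift_generators hL csL.
exists (ys ++ s) => [y|x Nx [r Sr xE]].
  by rewrite mem_cat => /orP[/ysL[c []]//|/sN].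
have Lx : L (r e) x.
  split=> //; exists r => //.
  by rewrite xE big_ord_recr /= addrK.
have [x' [Nx' _ px'] sx] := hys _ _ (hcs _ (ex_intro _ x Lx)) Lx.
rewrite -(subrK x' x); apply: span_cat => //; apply: hs => //.
by move: px'; rewrite mul0r subr0.
Qed.
End Filtration.

(** Rueckert's basis theorem: an ideal with a nonzero element contains a Weierstrass polynomial, and
    modulo the latter every element is a polynomial of degree less than d in [z] over the smaller
    ring. *)
Lemma wtower_noeth D n S : wtower D n S -> noeth S.
Proof.
elim: n S => [|n ih] S hT I hI.
  have hS := wtower_sub hT.
  have [[x Ix x0]|h] := pselect (exists2 x, I x & x != 0).
    have [_ [_ h]] := hT; have [y Sy yx] := h x (idS hI Ix) x0.
    exists [:: x] => [w|w Iw]; first by rewrite inE => /eqP ->.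
    exists (w * y); first by apply: (subM hS) => //; exact: (idS hI).
    by rewrite /= -mulrA yx mulr1 subrr.
  exists [::] => // x Ix /=; apply/eqP; apply: contrapT => /negP x0; apply: h; by exists x.
have hS := wtower_sub hT.
have [[g Ig g0]|h] := pselect (exists2 x, I x & x != 0); last first.
  exists [::] => // x Ix /=; apply/eqP; apply: contrapT => /negP x0; apply: h; by exists x.
have [_ [_ /(_ g (idS hI Ig) g0)]] := hT.
move=> [S' [z [delta [d [rho [hT' SS' Sz _ [_ _ Srho [q0 Sq0 hW] hF]]]]]]].
set W := z ^+ d - _ in hW hF.
have IW : I W by rewrite hW; exact: (idM hI).
have [|s sI hs] := pol_noeth (wtower_sub hT') z d (N := I) (ih _ hT') _ (id0 hI).
  by move=> x y a Sa Ix Iy; apply: (idB hS hI) => //; apply: (idM hI) => //; exact: SS'.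
exists (W :: s) => [y|x Ix].
  by rewrite inE => /orP[/eqP ->|/sI].
have [q [r [Sq Sr xE]]] := hF x (idS hI Ix).
exists q => //; apply: (span_mono SS'); apply: hs.
  by apply: (idB hS hI) => //; exact: (idM hI).
by exists r => //; rewrite xE addrC addKr.
Qed.

(** * Jacobian minors along chains of primes *)

Section Minors.
Variable D : set (O -> O).
Hypothesis hD : forall d, D d -> isder d.

Definition grad k (d : 'I_k -> O -> O) (x : O) : 'rV[O]_k := \row_j d j x.

(** For Y = Q prime the largest such k takes the place of the height of [Q]; in general it is the
    rank of the Jacobian matrix of [Y] along the zero set of [Q]. *)
Definition minors Y Q k := exists (F : 'I_k -> O) (d : 'I_k -> O -> O),
  [/\ forall i, Y (F i), forall j, D (d j) & ~ Q (\det (\matrix_(i, j) d j (F i)))].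

(** Combinations of rows in [A] up to entries in [Q], in the inductive form that lets determinants
    be treated one term at a time. *)
Inductive comb S Q k (A : set 'rV[O]_k) : 'rV[O]_k -> Prop :=
| comb0 (r : 'rV[O]_k) : (forall j, Q (r 0 j)) -> comb S Q A r
| combD c r r' : S c -> A r -> comb S Q A r' -> comb S Q A (c *: r + r').

Section Drop.
Variables (S Q : set O) (hS : subring S) (hQ : isprime S Q).

Lemma comb_add k (A : set 'rV[O]_k) r r' : comb S Q A r -> comb S Q A r' -> comb S Q A (r + r').
Proof.
elim=> [{}r Qr|c {}r r1 Sc Ar _ ih] h; last by rewrite -addrA; apply: combD => //; exact: ih.
elim: h => [{}r' Qr'|c r0 r1 Sc Ar _ ih]; last by rewrite addrCA; apply: combD.
by apply: comb0 => j; rewrite mxE; apply: (idD (prime_id hQ)).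
Qed.

Lemma comb_scale k (A : set 'rV[O]_k) r a : S a -> comb S Q A r -> comb S Q A (a *: r).
Proof.
move=> Sa; elim=> [{}r Qr|c {}r r1 Sc Ar _ ih].
  by apply: comb0 => j; rewrite mxE; apply: (idM (prime_id hQ)).
by rewrite scalerDr scalerA; apply: combD => //; exact: (subM hS).
Qed.

Lemma comb_mem k (A : set 'rV[O]_k) r : A r -> comb S Q A r.
Proof.
move=> Ar; rewrite -[r]addr0 -[r]scale1r; apply: combD => //; first exact: (sub1 hS).
by apply: comb0 => j; rewrite mxE; exact: (id0 (prime_id hQ)).
Qed.

Definition setrow k (M : 'M[O]_k) (i0 : 'I_k) (r : 'rV[O]_k) : 'M[O]_k :=
  \matrix_(i, j) if i == i0 then r 0 j else M i j.

Lemma det_setrowD k (M : 'M[O]_k) i0 c r r' :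
  \det (setrow M i0 (c *: r + r')) = c * \det (setrow M i0 r) + \det (setrow M i0 r').
Proof.
rewrite -[X in _ = _ + X]mul1r; apply: (determinant_multilinear (i0 := i0)).
- by apply/rowP => j; rewrite !mxE eqxx mul1r.
- by apply/matrixP => i j; rewrite !mxE eq_sym (negPf (neq_lift _ _)).
- by apply/matrixP => i j; rewrite !mxE eq_sym (negPf (neq_lift _ _)).
Qed.

Lemma choose_row k (M : 'M[O]_k) i0 (A : set 'rV[O]_k) r : (forall i j, S (M i j)) ->
  (forall r j, A r -> S (r 0 j)) ->
  comb S Q A r -> ~ Q (\det (setrow M i0 r)) ->
  exists2 r', A r' & ~ Q (\det (setrow M i0 r')).
Proof.
move=> SM SA; elim=> [{}r Qr|c {}r r1 Sc Ar _ ih]; last first.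
  rewrite det_setrowD => h.
  have [q|q] := pselect (Q (\det (setrow M i0 r))); last by exists r.
  by apply: ih => q1; apply: h; apply: (idD (prime_id hQ)) => //; apply: (idM (prime_id hQ)).
case; rewrite (expand_det_row _ i0); apply: (id_sum (prime_id hQ)) => j _.
apply: (idMr (prime_id hQ)); last by rewrite mxE eqxx.
rewrite (_ : cofactor _ _ _ = cofactor M i0 j); first exact: (sub_cofactor hS).
congr (_ * \det _); apply/matrixP => a b; rewrite !mxE.
by rewrite eq_sym (negPf (neq_lift _ _)).
Qed.

(** Determinants are multilinear, so if a combination of rows gives a determinant outside the prime
    [Q], one of its terms does. The rows are exchanged one after another; primality absorbs the
    multipliers [a] outside [Q]. *)
Lemma choose_rows k (M : 'M[O]_k) (A : set 'rV[O]_k) : (forall i j, S (M i j)) ->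
  (forall r j, A r -> S (r 0 j)) ->
  (forall i, exists2 a, S a /\ ~ Q a & comb S Q A (a *: row i M)) -> ~ Q (\det M) ->
  exists2 M' : 'M[O]_k, (forall i, A (row i M')) & ~ Q (\det M').
Proof.
move=> SM SA hc nq.
suff h n : (n <= k)%N -> exists2 M' : 'M[O]_k, (forall i : 'I_k, if (i < n)%N then A (row i M')
    else row i M' = row i M) & ~ Q (\det M').
  have [M' h1 h2] := h k (leqnn k); exists M' => // i.
  by have := h1 i; rewrite ltn_ord.
elim: n => [|n ih] nk; first by exists M.
have [M' h1 h2] := ih (ltnW nk); pose i0 := Ordinal nk.
have SM' i j : S (M' i j).
  have := h1 i; case: ifP => _; first by move=> /(fun h => SA _ j h); rewrite mxE.
  by move=> /rowP/(_ j); rewrite !mxE => ->.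
have [a [Sa Qa] ca] := hc i0.
have e0 : row i0 M' = row i0 M by have := h1 i0; rewrite ltnn.
have nq' : ~ Q (\det (setrow M' i0 (a *: row i0 M))).
  rewrite -[_ *: _]addr0 det_setrowD.
  have -> : setrow M' i0 (row i0 M) = M'.
    by apply/matrixP => i j; rewrite mxE; case: eqP => // ->; rewrite -e0 mxE.
  have -> : \det (setrow M' i0 0) = 0.
    rewrite (expand_det_row _ i0) big1 // => j _; by rewrite !mxE eqxx mul0r.
  rewrite addr0; have [_ _ hM] := hQ => /hM; case=> //; exact: (sub_det hS).
have [r Ar hr] := choose_row SM' SA ca nq'.
exists (setrow M' i0 r) => // i; rewrite ltnS leq_eqVlt.
have [e|ne] := eqVneq i i0.
  rewrite e /= eqxx /=; rewrite (_ : row i0 _ = r) //.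
  by apply/rowP => j; rewrite !mxE eqxx.
have ne' : (i == n :> nat) = false by apply/negP => /eqP e; case/eqP: ne; exact: val_inj.
have -> : row i (setrow M' i0 r) = row i M' by apply/rowP => j; rewrite !mxE (negPf ne).
by rewrite ne' /=; exact: h1.
Qed.

Lemma comb_sub k (A B : set 'rV[O]_k) r : A `<=` B -> comb S Q A r -> comb S Q B r.
Proof.
by move=> AB; elim=> [{}r h|c {}r r1 Sc /AB Br _ ih]; [exact: comb0|exact: combD].
Qed.

(** After the exchange the special row [h] occurs at most once, since otherwise two rows coincide;
    expansion along it leaves a minor made of rows from [X]. *)
Lemma matrix_drop k (M : 'M[O]_k.+1) (X : set 'rV[O]_k.+1) (h : 'rV[O]_k.+1) :
  (forall i j, S (M i j)) -> (forall (r : 'rV[O]_k.+1) j, X r -> S (r 0 j)) -> (forall j, S (h 0 j)) ->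
  (forall i, exists2 a, S a /\ ~ Q a & comb S Q [set r | r = h \/ X r] (a *: row i M)) ->
  ~ Q (\det M) ->
  exists (j : 'I_k.+1) (N : 'M[O]_k), (forall i, exists2 r, X r & row i N = col' j r) /\ ~ Q (\det N).
Proof.
move=> SM SX Sh hM nq; pose A := [set r | r = h \/ X r].
have SA r j : A r -> S (r 0 j) by case=> [->|/SX].
have [M' AM' nq'] := choose_rows SM SA hM nq.
have SM' i j : S (M' i j) by have := SA _ j (AM' i); rewrite mxE.
have [i0 hi0] : exists i0, forall i, i != i0 -> X (row i M').
  have [[i0 hi0]|ne] := pselect (exists i0, row i0 M' = h).
    exists i0 => i ii0; have [hx|//] := AM' i.
    case: nq'; rewrite (determinant_alternate ii0); first exact: (id0 (prime_id hQ)).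
    move=> j; have := congr1 (fun r : 'rV_k.+1 => r 0 j) hx.
    by have := congr1 (fun r : 'rV_k.+1 => r 0 j) hi0; rewrite !mxE => -> ->.
  exists ord0 => i _; have [hx|//] := AM' i.
  by case: ne; exists i.
have [j nj] : exists j, ~ Q (cofactor M' i0 j).
  apply/not_existsP => hj; apply: nq'; rewrite (expand_det_row _ i0).
  apply: (id_sum (prime_id hQ)) => j _; apply: (idM (prime_id hQ)) => //.
  by apply: contrapT; exact: hj.
exists j, (row' i0 (col' j M')); split=> [i|q].
  exists (row (lift i0 i) M'); first by apply: hi0; rewrite eq_sym neq_lift.
  by apply/rowP => c; rewrite !mxE.
apply: nj; apply: (idM (prime_id hQ)) => //.
by apply: (subX hS); apply: (subN hS); exact: (sub1 hS).
Qed.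

(** When the gradients of [Y] are, locally at [Q], combinations of those of [X] and of one more
    element [h], passing from [Y] to [X] costs one row. *)
Lemma minor_drop X Y h k :
  (forall x, X x -> S x) -> S h -> (forall x, Y x -> S x) ->
  (forall d x, D d -> S x -> S (d x)) ->
  (forall F, Y F -> exists2 a, S a /\ ~ Q a & forall k (d : 'I_k -> O -> O),
     (forall j, D (d j)) ->
     comb S Q [set r | exists2 x, x = h \/ X x & r = grad d x] (a *: grad d F)) ->
  minors Y Q k.+1 -> minors X Q k.
Proof.
move=> XS Sh YS SD hY [F [d [YF Dd nq]]].
set M := \matrix_(i, j) _ in nq.
pose A := [set r | exists2 x, X x & r = grad d x].
have SM i j : S (M i j) by rewrite mxE; apply: SD => //; exact: YS.
have [| | |j [N [hN nN]]] := @matrix_drop k M A (grad d h) SM _ _ _ nq.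
- by move=> r j [x /XS Sx ->]; rewrite mxE; apply: SD.
- by move=> j; rewrite mxE; apply: SD.
- move=> i; have [a Sa ca] := hY _ (YF i); exists a => //.
  rewrite (_ : row i M = grad d (F i)); last by apply/rowP => j; rewrite !mxE.
  by apply: comb_sub (ca _ _ Dd) => r [x [->|Xx] ->]; [left|right; exists x].
have /choice[G hG] : forall i, exists x, X x /\ row i N = col' j (grad d x).
  by move=> i; have [_ [x Xx ->] e] := hN i; exists x.
exists G, (fun l => d (lift j l)); split=> [i|//|]; first by case: (hG i).
rewrite (_ : \matrix_(i, l) _ = N) //; apply/matrixP => a b; have [_] := hG a.
by move=> /rowP/(_ b); rewrite !mxE => ->.
Qed.

(** The transposed statement: passing to the derivations in [Dx], from which those in [D] differ by
    multiples of the single derivation [delta], costs one column. *)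
Lemma minors_cols (Dx : set (O -> O)) delta Y k : (forall x, Y x -> S x) ->
  (forall d x, D d -> S x -> S (d x)) -> (forall d x, Dx d -> S x -> S (d x)) ->
  (forall x, S x -> S (delta x)) ->
  (forall d, D d -> exists d1 c, [/\ Dx d1, S c & forall x, d x = d1 x + c * delta x]) ->
  minors Y Q k.+1 -> exists (F : 'I_k -> O) (d : 'I_k -> O -> O),
  [/\ forall i, Y (F i), forall j, Dx (d j) & ~ Q (\det (\matrix_(i, j) d j (F i)))].
Proof.
move=> YS SD SDx Sdelta hD1 [F [d [YF Dd nq]]].
set M := \matrix_(i, j) _ in nq.
pose A := [set r | exists2 d1, Dx d1 & r = \row_i d1 (F i)].
have SM i j : S (M^T i j) by rewrite !mxE; apply: SD => //; exact: YS.
rewrite -det_tr in nq.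
have [| | |j [N [hN nN]]] := @matrix_drop k M^T A (\row_i delta (F i)) SM _ _ _ nq.
- by move=> r j [d1 Dd1 ->]; rewrite mxE; apply: SDx => //; exact: YS.
- by move=> j; rewrite mxE; apply: Sdelta; exact: YS.
- move=> i; have [d1 [c [Dd1 Sc dE]]] := hD1 _ (Dd i); exists 1.
    by split; [exact: (sub1 hS)|case: hQ].
  rewrite (_ : 1 *: _ = c *: (\row_i delta (F i)) + \row_i d1 (F i)); last first.
    by apply/rowP => l; rewrite !mxE mul1r dE addrC.
  apply: combD => //; first by left.
  by apply: comb_mem; right; exists d1.
have /choice[G hG] : forall i, exists d1, Dx d1 /\ row i N = col' j (\row_i d1 (F i)).
  by move=> i; have [_ [d1 Dd1 ->] e] := hN i; exists d1.
exists (fun l => F (lift j l)), G; split=> [//|i|]; first by case: (hG i).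
rewrite (_ : \matrix_(i, l) _ = N^T) ?det_tr //; apply/matrixP => a b; have [_] := hG b.
by move=> /rowP/(_ a); rewrite !mxE => ->.
Qed.
End Drop.

Lemma der0 d : D d -> d 0 = 0.
Proof. by move=> /hD[da _]; have := da 0 0; rewrite addr0 => /(congr1 (fun x => x - d 0)); rewrite subrr addrK. Qed.
Lemma derN d x : D d -> d (- x) = - d x.
Proof. by move=> Dd; have [da _] := hD Dd; apply/eqP; rewrite -subr_eq0 opprK -da addNr der0. Qed.
Lemma derB d x y : D d -> d (x - y) = d x - d y.
Proof. by move=> Dd; have [da _] := hD Dd; rewrite da derN. Qed.
Lemma der1 d : D d -> d 1 = 0.
Proof. by move=> Dd; have [_ /(_ 1 1)] := hD Dd; rewrite !mul1r => /(congr1 (fun x => x - d 1)); rewrite subrr addrK. Qed.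
Lemma der_sum d (T : Type) (s : seq T) (A : pred T) F : D d ->
  d (\sum_(i <- s | A i) F i) = \sum_(i <- s | A i) d (F i).
Proof. by move=> Dd; apply: (big_morph d) => [x y|]; [case: (hD Dd)|exact: der0]. Qed.
Lemma derX d z n : D d -> d (z ^+ n.+1) = n.+1%:R * z ^+ n * d z.
Proof.
move=> Dd; have [_ dm] := hD Dd; elim: n => [|n ih]; first by rewrite !expr1 expr0 !mul1r.
rewrite exprS dm ih -[in RHS]addn1 natrD [z ^+ n.+1]exprS; ring.
Qed.

Section Step.
Variables (S S' : set O) (hS : subring S) (hS' : subring S') (SS' : S' `<=` S).
Hypothesis SD : forall d x, D d -> S x -> S (d x).
Hypothesis SD' : forall d x, D d -> S' x -> S' (d x).
Variables (z : O) (delta : O -> O) (d : nat) (rho : nat -> O).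
Hypotheses (Sz : S z) (Ddelta : D delta) (dz : delta z = 1).
Hypothesis dS' : forall x, S' x -> delta x = 0.
Hypothesis Srho : forall i, S' (rho i).
Let W := z ^+ d - \sum_(i < d) rho i * z ^+ i.
Hypothesis divW : forall F, S F -> exists q (r : nat -> O), [/\ S q, forall i, S' (r i) &
         F = q * W + \sum_(i < d) r i * z ^+ i].

(** A polynomial in [z] of degree e with leading coefficient invertible at [P]. The element of [P]
    of least such degree acts as the minimal polynomial of [z] at [P]. *)
Definition lead P e h := exists c (r : nat -> O), [/\ S' c, ~ P c, forall i, S' (r i) &
   h = \sum_(i < e) r i * z ^+ i + c * z ^+ e].

Lemma min_lead P : isprime S P -> P W -> exists e h, [/\ P h, lead P e h &
  forall e' h', (e' < e)%N -> P h' -> ~ lead P e' h'].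
Proof.
move=> hP PW.
pose ok e := `[< exists2 h, P h & lead P e h >].
have ex : exists e, ok e.
  exists d; apply/asboolP; exists W => //; exists 1, (fun i => - rho i).
  have [_ P1 _] := hP; split=> //; first exact: (sub1 hS').
    by move=> i; apply: (subN hS').
  by rewrite mul1r addrC /W -sumrN; congr (_ + _); apply: eq_bigr => i _; rewrite mulNr.
case: (ex_minnP ex) => e /asboolP[h Ph lh] emin; exists e, h; split=> // e' h' ee Ph' lh'.
by move: ee; rewrite ltnNge emin //; apply/asboolP; exists h'.
Qed.

Lemma delta_pol (r : nat -> O) e : (forall i, S' (r i)) ->
  delta (\sum_(i < e.+1) r i * z ^+ i) = \sum_(i < e) (i.+1%:R * r i.+1) * z ^+ i.
Proof.
move=> Sr; have [_ dm] := hD Ddelta.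
rewrite (der_sum _ _ _ Ddelta) big_ord_recl dm expr0 (der1 Ddelta) (dS' (Sr _)) !mulr0 addr0 add0r.
apply: eq_bigr => i _; rewrite dm (dS' (Sr _)) mulr0 addr0 derX // dz.
rewrite -[nat_of_ord (lift _ _)]/(i.+1); ring.
Qed.

(** Separability: [delta] is differentiation with respect to [z], and the derivative of the minimal
    polynomial has smaller degree and a leading coefficient that is a positive integer times the old
    one, still outside [P]. By minimality the derivative is not in [P]. *)
Lemma delta_out P : isprime S P -> P W -> exists2 h, P h & ~ P (delta h).
Proof.
move=> hP PW; have [e [h [Ph [c [r [Sc Pc Sr hE]]] hmin]]] := min_lead hP PW.
exists h => // Pd; case: e => [|e] in hE hmin.
  by apply: Pc; move: Ph; rewrite hE big_ord0 add0r expr0 mulr1.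
apply: (hmin e (delta h)) => //.
pose r' i := if i == e.+1 then c else r i.
have Sr' i : S' (r' i) by rewrite /r'; case: ifP.
have hE' : h = \sum_(i < e.+2) r' i * z ^+ i.
  rewrite hE [RHS]big_ord_recr /= /r' eqxx; congr (_ + _); apply: eq_bigr => i _.
  by rewrite ltn_eqF.
exists (e.+1%:R * c), (fun i => i.+1%:R * r' i.+1); split.
- by apply: (subM hS') => //; exact: (subn hS').
- by move=> /(prime_nat hS hP (SS' Sc)).
- by move=> i; apply: (subM hS') => //; exact: (subn hS').
- by rewrite {1}hE' delta_pol // big_ord_recr /= {2}/r' eqxx.
Qed.

Lemma contract_ideal P : isideal S P -> isideal S' (P `&` S').
Proof.
move=> hP; split=> [x []//| |x y [Px Sx] [Py Sy]|a x Sa [Px Sx]].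
- by split; [exact: (id0 hP)|exact: (sub0 hS')].
- by split; [exact: (idD hP)|exact: (subD hS')].
- by split; [apply: (idM hP) => //; exact: SS'|exact: (subM hS')].
Qed.

Lemma contract_prime P : isprime S P -> isprime S' (P `&` S').
Proof.
move=> [hP P1 PM]; split; [exact: contract_ideal|by case|].
by move=> x y Sx Sy [Pxy _]; case: (PM x y (SS' Sx) (SS' Sy) Pxy); [left|right].
Qed.

(** Incomparability in an integral extension. An equation of integral dependence of [h] over S'
    modulo [I], of least degree, has its constant term in [P] because [h] is in [P], but not in [I]
    because otherwise [h] could be cancelled. *)
Lemma contract_lt I P : noeth S' -> isprime S I -> isprime S P -> I `<=` P -> I W ->
  (exists2 h, P h & ~ I h) -> exists2 h, (P `&` S') h & ~ (I `&` S') h.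
Proof.
move=> nS hI hP IP IW [h Ph Ih].
have iI := prime_id hI; have iP := prime_id hP.
have Sh := idS iP Ph.
pose inN N x := exists2 a : nat -> O, (forall i, S' (a i)) & I (x - \sum_(i < N) a i * h ^+ i).
have inN_le N N' x : (N <= N')%N -> inN N x -> inN N' x.
  move=> NN [a Sa Ia]; exists (fun i => if (i < N)%N then a i else 0).
    by move=> i; case: ifP => // _; exact: (sub0 hS').
  rewrite (big_ord_widen_cond N' xpredT (fun i => a i * h ^+ i) NN) big_mkcond /= in Ia.
  congr (I (_ - _)): Ia; apply: eq_bigr => i _; by case: ifP => // _; rewrite mul0r.
have inN_comb N x y a : S' a -> inN N x -> inN N y -> inN N (x - a * y).
  move=> Sa [b Sb Ib] [c Sc Ic]; exists (fun i => b i - a * c i).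
    by move=> i; apply: (subB hS') => //; exact: (subM hS').
  have -> : \sum_(i < N) (b i - a * c i) * h ^+ i =
     \sum_(i < N) b i * h ^+ i - a * \sum_(i < N) c i * h ^+ i.
    by rewrite mulr_sumr -sumrB; apply: eq_bigr => i _; ring.
  rewrite (_ : _ - _ = (x - \sum_(i < N) b i * h ^+ i) - a * (y - \sum_(i < N) c i * h ^+ i)); last by ring.
  by apply: (idB hS iI) => //; apply: (idM iI) => //; exact: SS'.
have inN0 N : inN N 0.
  exists (fun=> 0); first by move=> _; exact: (sub0 hS').
  by rewrite big1 ?subr0; [exact: (id0 iI)|move=> i _; rewrite mul0r].
pose N := [set x | exists n, inN n x].
have [||s sN hs] := pol_noeth hS' z d (N := N) nS.
- move=> x y a Sa [n nx] [n' ny]; exists (maxn n n').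
  by apply: inN_comb => //; [apply: inN_le nx; exact: leq_maxl|apply: inN_le ny; exact: leq_maxr].
- by exists 0%N.
have [n hn] : exists n, {in s, forall x, inN n x}.
  elim: s sN {hs} => [|x s ih] sN; first by exists 0%N.
  have [n hn] := ih (fun y ys => sN y (mem_behead (s := x :: s) ys)).
  have [n' hn'] := sN x (mem_head _ _); exists (maxn n n') => y; rewrite inE => /orP[/eqP ->|/hn].
    by apply: inN_le hn'; exact: leq_maxr.
  by apply: inN_le; exact: leq_maxl.
(* Modulo [I] every element is a polynomial in [z] of degree less than d, so the polynomials in [h]
   form a finitely generated module over S', and some power of [h] is a combination of lower
   ones. *)
have rel : exists n, inN n (h ^+ n).
  exists n; have [q [r [Sq Sr hE]]] := divW (subX hS n Sh).
  have Iq : I (q * W) by exact: (idM iI).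
  have [a Sa Ia] : inN n (\sum_(i < d) r i * z ^+ i).
    have Nr : N (\sum_(i < d) r i * z ^+ i).
      exists n.+1; exists (fun i => if i == n then 1 else 0).
        by move=> i; case: ifP => _; [exact: (sub1 hS')|exact: (sub0 hS')].
      rewrite big_ord_recr /= eqxx mul1r [X in _ - (X + _)]big1 ?add0r => [|i _]; last by rewrite ifF ?mul0r // ltn_eqF.
      by rewrite hE opprD addrCA subrr addr0; apply: (idN hS iI).
    have := hs _ Nr (ex_intro2 _ _ r Sr erefl).
    elim: (s) hn (\sum_(i < d) _) => [|x s' ih] hn' w /=; first by move=> ->; exact: inN0.
    move=> [c Sc /(ih (fun y ys => hn' y (mem_behead (s := x :: s') ys)))] h1.
    have := inN_comb _ _ _ _ (subN hS' Sc) h1 (hn' x (mem_head _ _)).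
    by rewrite mulNr opprK subrK.
  exists a => //; rewrite hE -addrA; exact: (idD iI).
pose ok n := `[< inN n (h ^+ n) >].
have ex : exists n, ok n by have [n' hn'] := rel; exists n'; apply/asboolP.
case: (ex_minnP ex) => -[|e] /asboolP[a Sa Ia] emin.
  by have [_ I1 _] := hI; case: I1; move: Ia; rewrite big_ord0 subr0 expr0.
rewrite big_ord_recl expr0 mulr1 in Ia.
pose y := h ^+ e - \sum_(i < e) a i.+1 * h ^+ i.
have yE : h ^+ e.+1 - (a 0%N + \sum_(i < e) a (bump 0 i) * h ^+ bump 0 i) = h * y - a 0%N.
  rewrite /y mulrBr mulr_sumr -exprS opprD addrA addrAC; congr (_ - _ - _).
  by apply: eq_bigr => i _; rewrite /bump /= add1n exprS; ring.
rewrite /= in Ia; rewrite yE in Ia.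
have Sy : S y.
  apply: (subB hS); first exact: (subX hS).
  by apply: (sub_sum hS) => i _; apply: (subM hS); [exact: SS'|exact: (subX hS)].
exists (a 0%N).
  split=> //; rewrite -[a _](subKr (h * y)); apply: (idB hS iP); first exact: (idMr iP).
  exact: IP.
move=> [Ia0 _]; have [_ _ hM] := hI.
have /hM : I (h * y) by apply: (idBr hS iI Ia0 Ia).
case=> // Iy; have : (e.+1 <= e)%N by apply: emin; apply/asboolP; exists (fun i => a i.+1).
by rewrite ltnn.
Qed.

(** Pseudodivision by the minimal polynomial [h] lowers the degree in [z]. Hence, up to a factor
    outside [I], the gradient of an element of [I] combines those of [h] and of elements of the
    contraction, and [minor_drop] removes the row of [h]. *)
Lemma minors_contract I k : isprime S I -> I W -> minors I I k.+1 -> minors (I `&` S') (I `&` S') k.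
Proof.
move=> hI IW hm; have iI := prime_id hI; have [_ I1 IM] := hI.
have [e [h [Ih [c [r0 [Sc Ic Sr0 hE]]] hmin]]] := min_lead hI IW.
have Sh := idS iI Ih.
pose A k (dd : 'I_k -> O -> O) := [set r | exists2 x, x = h \/ (I `&` S') x & r = grad dd x].
pose good F := exists2 a, S a /\ ~ I a & forall k (dd : 'I_k -> O -> O),
     (forall j, D (dd j)) -> comb S I (A k dd) (a *: grad dd F).
have gradD k0 (dd : 'I_k0 -> O -> O) x y : (forall j, D (dd j)) -> grad dd (x + y) = grad dd x + grad dd y.
  by move=> Dd; apply/rowP => j; rewrite !mxE; case: (hD (Dd j)).
have gradM k0 (dd : 'I_k0 -> O -> O) x y : (forall j, D (dd j)) -> grad dd (x * y) = x *: grad dd y + y *: grad dd x.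
  by move=> Dd; apply/rowP => j; rewrite !mxE; case: (hD (Dd j)) => _ ->.
have combI k0 (dd : 'I_k0 -> O -> O) x y : (forall j, D (dd j)) -> I x -> S y -> comb S I (A k0 dd) (x *: grad dd y).
  by move=> Dd Ix Sy; apply: comb0 => j; rewrite !mxE; apply: (idMr iI) => //; exact: SD.
have goodP n (r : nat -> O) : (forall i, S' (r i)) -> I (\sum_(i < n) r i * z ^+ i) ->
    good (\sum_(i < n) r i * z ^+ i).
  elim: n r => [|n ih] r Sr.
    rewrite big_ord0 => _; exists 1; first by split=> //; exact: (sub1 hS).
    move=> k0 dd Dd; apply: comb0 => j; rewrite !mxE der0 // mulr0; exact: (id0 iI).
  move=> If; have [Ir|Ir] := pselect (I (r n)).
    have If' : I (\sum_(i < n) r i * z ^+ i).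
      move: If; rewrite big_ord_recr /=; apply: (idDr hS iI); apply: (idMr iI) => //; exact: (subX hS).
    have [a [Sa Ia] ha] := ih r Sr If'; exists a => // k0 dd Dd.
    rewrite big_ord_recr /= gradD // gradM // !scalerDr.
    apply: (comb_add hI); first exact: ha.
    apply: (comb_add hI); apply: (comb_scale hS hI) => //.
      by apply: combI => //; exact: (subX hS).
    apply: (comb_scale hS hI); first exact: (subX hS).
    by apply: (comb_mem hS hI); exists (r n) => //; right.
  have en : (e <= n)%N.
    rewrite leqNgt; apply/negP => ne; apply: (hmin n _ ne If).
    by exists (r n), r; split=> //; rewrite big_ord_recr.
  (* The coefficients of z^(n - e) times the part of [h] below its leading term, aligned for the
     subtraction that cancels the term of degree n. *)
  pose r0' i := if (n - e <= i)%N && (i < n)%N then r0 (i - (n - e))%N else 0.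
  have Sr0' i : S' (r0' i) by rewrite /r0'; case: ifP => // _; exact: (sub0 hS').
  have shift : \sum_(i < n) r0' i * z ^+ i = z ^+ (n - e) * \sum_(i < e) r0 i * z ^+ i.
    rewrite mulr_sumr -(big_mkord xpredT (fun i => r0' i * z ^+ i)) (@big_cat_nat _ _ _ (n - e)) ?leq_subr //=.
    rewrite big_nat big1 ?add0r => [|i /andP[_ ine]]; last by rewrite /r0' leqNgt ine mul0r.
    rewrite -[X in \sum_(X <= _ < _) _](add0n (n - e)%N) big_addn subKn // big_mkord; apply: eq_bigr => i _.
    rewrite /r0' leq_addl addnK /= addnC -ltn_subRL subKn // ltn_ord exprD; ring.
  pose r' i := c * r i - r n * r0' i.
  have Sr' i : S' (r' i) by apply: (subB hS'); exact: (subM hS').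
  have fE : \sum_(i < n) r' i * z ^+ i = c * (\sum_(i < n.+1) r i * z ^+ i) - r n * z ^+ (n - e) * h.
    rewrite big_ord_recr /= hE.
    transitivity (c * (\sum_(i < n) r i * z ^+ i) - r n * \sum_(i < n) r0' i * z ^+ i).
      by rewrite !mulr_sumr -sumrB; apply: eq_bigr => i _; rewrite /r'; ring.
    have -> : z ^+ n = z ^+ (n - e) * z ^+ e by rewrite -exprD subnK.
    rewrite shift; ring.
  have If' : I (\sum_(i < n) r' i * z ^+ i).
    rewrite fE; apply: (idB hS iI); apply: (idM iI) => //; first exact: SS'.
    by apply: (subM hS); [exact: SS'|exact: (subX hS)].
  have [a [Sa Ia] ha] := ih r' Sr' If'; exists (a * c).
    split; first by apply: (subM hS) => //; exact: SS'.
    by move=> /IM[] //; exact: SS'.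
  move=> k0 dd Dd; set f := \sum_(i < n.+1) _.
  have E : c *: grad dd f = grad dd (\sum_(i < n) r' i * z ^+ i) + ((r n * z ^+ (n - e)) *: grad dd h
       + (h *: grad dd (r n * z ^+ (n - e)) + (- f) *: grad dd c)).
    have -> : \sum_(i < n) r' i * z ^+ i = c * f + (- (r n * z ^+ (n - e))) * h by rewrite fE mulNr.
    rewrite gradD // (gradM _ _ c) // (gradM _ _ _ h) //.
    have -> : grad dd (- (r n * z ^+ (n - e))) = - grad dd (r n * z ^+ (n - e)).
      by apply/rowP => j; rewrite !mxE derN.
    by apply/rowP => j; rewrite !mxE; ring.
  rewrite -scalerA E !scalerDr; apply: (comb_add hI); first exact: ha.
  have Srz : S (r n * z ^+ (n - e)) by apply: (subM hS); [exact: SS'|exact: (subX hS)].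
  apply: (comb_add hI).
    apply: (comb_scale hS hI) => //.
    by apply: (comb_scale hS hI) => //; apply: (comb_mem hS hI); exists h => //; left.
  apply: (comb_add hI); apply: (comb_scale hS hI) => //; first exact: combI.
  by apply: combI => //; [exact: (idN hS iI)|exact: SS'].
have goodW : good W.
  pose r i := if i == d then 1 else - rho i.
  have Sr i : S' (r i) by rewrite /r; case: ifP => _; [exact: (sub1 hS')|exact: (subN hS')].
  have WE : W = \sum_(i < d.+1) r i * z ^+ i.
    rewrite big_ord_recr /= /r eqxx mul1r addrC /W -sumrN; congr (_ + _).
    by apply: eq_bigr => i _; rewrite ltn_eqF // mulNr.
  by rewrite WE; apply: goodP => //; rewrite -WE.
have goodI F : I F -> good F.
  move=> IF; have [q [r [Sq Sr FE]]] := divW (idS iI IF).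
  have If : I (\sum_(i < d) r i * z ^+ i).
    by apply: (idDl hS iI (x := q * W)); [exact: (idM iI)|rewrite -FE].
  have [a1 [Sa1 Ia1] h1] := goodW; have [a2 [Sa2 Ia2] h2] := goodP _ _ Sr If.
  exists (a1 * a2); first by split; [exact: (subM hS)|move=> /IM[]].
  move=> k0 dd Dd; rewrite FE gradD // gradM // !scalerDr -!addrA.
  have e1 : (a1 * a2) *: (q *: grad dd W) = (a2 * q) *: (a1 *: grad dd W).
    by rewrite !scalerA; congr (_ *: _); ring.
  rewrite e1; apply: (comb_add hI); first by apply: (comb_scale hS hI); [exact: (subM hS)|exact: h1].
  apply: (comb_add hI); first by apply: (comb_scale hS hI); [exact: (subM hS)|exact: combI].
  by rewrite -scalerA; apply: (comb_scale hS hI) => //; exact: h2.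
have [F [dd [XF Dd nq]]] : minors (I `&` S') I k.
  apply: (minor_drop hS hI _ Sh _ SD goodI hm) => [x [_]|x]; first exact: SS'.
  exact: (idS iI).
by exists F, dd; split=> // -[/nq].
Qed.

(** [delta] kills S', so the matrix enlarged by the row of [h] and the column of [delta] is block
    triangular with last entry delta h. *)
Lemma minors_extend P h k : isprime S P -> P h -> ~ P (delta h) ->
  minors (P `&` S') (P `&` S') k -> minors P P k.+1.
Proof.
move=> hP Ph Pdh [F [dd [XF Dd nq]]]; have iP := prime_id hP.
rewrite -addn1.
exists (fun i : ordinal (addn k 1) => match @fintype.split k 1 i with inl i => F i | inr _ => h end),
  (fun j : ordinal (addn k 1) => match @fintype.split k 1 j with inl j => dd j | inr _ => delta end).
split=> [i|j|].
- by case: splitP => // j _; case: (XF j).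
- by case: splitP => // j _.
have SF i : S' (F i) by case: (XF i).
rewrite (_ : \matrix_(i, j) _ = block_mx (\matrix_(i, j) dd j (F i)) 0 (\row_j dd j h) (delta h)%:M); last first.
  apply/matrixP => i j; rewrite !mxE; case: (fintype.split i) => i'; rewrite ?mxE; case: (fintype.split j) => j'; rewrite ?mxE //.
    exact: dS'.
  by rewrite !ord1 eqxx.
rewrite det_lblock det_scalar1; have [_ _ hM] := hP.
have Sd : S' (\det (\matrix_(i, j) dd j (F i))) by apply: (sub_det hS') => i j; rewrite mxE; exact: SD'.
by move=> /hM[||q|//]; [exact: SS'|apply: SD => //; exact: (idS iP)|apply: nq; split].
Qed.
End Step.

(** Induction down the tower, with the Weierstrass polynomial of a nonzero element of [I]. The size
    of the minors goes down by one with the contraction of [I] ([minors_contract]) and comes back up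
    with [P] ([minors_extend]), while [contract_lt] keeps the inclusion strict. *)
Theorem minors_increase n S I P k : wtower D n S -> isprime S I -> isprime S P ->
  I `<=` P -> (exists2 h, P h & ~ I h) -> minors I I k -> minors P P k.+1.
Proof.
elim: n S I P k => [|n ih] S I P k hT hI hP IP [h Ph Ih] hm.
  have h0 : h != 0 by apply: contra_notN Ih => /eqP ->; exact: (id0 (prime_id hI)).
  have [_ [_ /(_ h (idS (prime_id hP) Ph) h0)[y Sy yh]]] := hT.
  by have [_ P1 _] := hP; case: P1; rewrite -yh; apply: (idM (prime_id hP)).
have hS := wtower_sub hT; have SD := fun d x => wtower_der (d := d) (x := x) hT.
have iI := prime_id hI; have iP := prime_id hP.
case: k hm => [_|k hm].
  have h0 : h != 0 by apply: contra_notN Ih => /eqP ->; exact: (id0 iI).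
  have [_ [_ /(_ h (idS iP Ph) h0)]] := hT.
  move=> [S' [z [delta [d [rho [hT' SS' Sz Dd [dz dS' Srho [q0 Sq0 hW] hF]]]]]]].
  have PW : P (z ^+ d - \sum_(i < d) rho i * z ^+ i) by rewrite hW; exact: (idM iP).
  have [w Pw Pdw] := delta_out hS (wtower_sub hT') SS' Dd dz dS' Srho hP PW.
  exists (fun=> w), (fun=> delta); split=> //.
  by rewrite det_mx11 mxE.
have [[g Ig g0]|nz] := pselect (exists2 g, I g & g != 0); last first.
  have [F [dd [IF Dd nq]]] := hm; case: nq.
  rewrite (expand_det_row _ ord0) big1 => [|j _]; first exact: (id0 iI).
  have F0 : F ord0 = 0 by apply/eqP; apply: contrapT => /negP F0; apply: nz; exists (F ord0).
  by rewrite mxE F0 der0 // mul0r.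
have [_ [_ /(_ g (idS iI Ig) g0)]] := hT.
move=> [S' [z [delta [d [rho [hT' SS' Sz Dd [dz dS' Srho [q0 Sq0 hW] hF]]]]]]].
have IW : I (z ^+ d - \sum_(i < d) rho i * z ^+ i) by rewrite hW; exact: (idM iI).
have hS' := wtower_sub hT'; have SD' := fun d x => wtower_der (d := d) (x := x) hT'.
have [w Pw Pdw] := delta_out hS hS' SS' Dd dz dS' Srho hP (IP _ IW).
apply: (minors_extend hS' SS' SD SD' Dd dS' hP Pw Pdw).
apply: (ih _ _ _ _ hT' (contract_prime hS' SS' hI) (contract_prime hS' SS' hP)).
- by move=> x [Ix Sx]; split=> //; exact: IP.
- apply: (contract_lt hS hS' SS' hF (wtower_noeth hT') hI hP IP IW); by exists h.
- exact: (minors_contract hS hS' SS' SD Sz Srho hF hI IW hm).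
Qed.
End Minors.

(** * Normality and t-adic arguments in Noetherian rings *)

Section Noetherian.
Hypotheses (hO : subring setT) (nO : noeth setT).
Let T := @setT O.

Lemma acc (J : nat -> set O) : (forall n, isideal T (J n)) ->
  (forall n, J n `<=` J n.+1) -> exists n, J n.+1 `<=` J n.
Proof.
move=> iJ mJ; have le n n' : (n <= n')%N -> J n `<=` J n'.
  by move=> /subnK <-; elim: (n' - n)%N => // k ih x /ih/mJ.
have iU : isideal T [set x | exists n, J n x].
  split=> [x //| |x y [n Jx] [n' Jy]|a x _ [n Jx]]; first by exists 0%N; exact: (id0 (iJ 0%N)).
    exists (maxn n n'); apply: (idD (iJ _)); first exact: (le n _ (leq_maxl _ _)).
    exact: (le n' _ (leq_maxr _ _)).
  by exists n; exact: (idM (iJ n)).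
have [s sU hs] := nO iU.
have [n hn] : exists n, {in s, forall x, J n x}.
  elim: s sU {hs} => [|x s ih] sU; first by exists 0%N.
  have [n hn] := ih (fun y ys => sU y (mem_behead (s := x :: s) ys)).
  have [n' hn'] := sU x (mem_head _ _); exists (maxn n n') => y; rewrite inE => /orP[/eqP ->|/hn].
    exact: (le n' _ (leq_maxr _ _)).
  exact: (le n _ (leq_maxl _ _)).
by exists n => x Jx; apply: (span_id hO (iJ n) hn); apply: hs; exists n.+1.
Qed.

Lemma max_ideal (F : set (set O)) I0 : F I0 -> (forall I, F I -> isideal T I) ->
  exists2 P, F P & forall I, F I -> P `<=` I -> I `<=` P.
Proof.
move=> F0 Fi; apply: contrapT => hn.
have h (P : {P | F P}) : exists I : {P | F P}, sval P `<=` sval I /\ ~ (sval I `<=` sval P).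
  apply: contrapT => hP; apply: hn; exists (sval P); first exact: (svalP P).
  move=> I FI PI; apply: contrapT => nIP; apply: hP; by exists (exist _ I FI).
have [f hf] := choice h.
pose J n := sval (iter n f (exist _ I0 F0)).
have [n /=] : exists n, J n.+1 `<=` J n.
  apply: acc => n; first by apply: Fi; exact: (svalP (iter n f _)).
  by case: (hf (iter n f (exist _ I0 F0))).
by case: (hf (iter n f (exist _ I0 F0))).
Qed.

(** An instance of Krull's intersection theorem. Modulo [J0] one has d = y_0 and y_n = t y_(n+1);
    the ideals J0 + (y_n) increase, so y_(n+1) = c y_n = c t y_(n+1) for some n. As 1 - c t is a
    unit, y_(n+1) is in [J0], and with it all earlier y_i. *)
Lemma chain_closure t J0 (Q : set O) : isideal T J0 -> (forall y, exists u, (1 - y * t) * u = 1) ->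
  (forall d, Q d -> exists2 d', Q d' & J0 (d - t * d')) -> forall d, Q d -> J0 d.
Proof.
move=> iJ ht hQ d Qd.
have /choice[f hf] : forall d, exists d', Q d -> Q d' /\ J0 (d - t * d').
  move=> x; have [/hQ[x' Qx' Jx]|nQ] := pselect (Q x); last by exists 0.
  by exists x'.
pose y n := iter n f d.
have Qy n : Q (y n) by elim: n => //= n /hf[].
have Jy n : J0 (y n - t * y n.+1) by case: (hf _ (Qy n)).
pose J n := [set x | exists c, J0 (x - c * y n)].
have [n hn] : exists n, J n.+1 `<=` J n.
  apply: acc => n; last first.
    move=> x [c Jc]; exists (c * t).
    have -> : x - c * t * y n.+1 = (x - c * y n) + c * (y n - t * y n.+1) by ring.
    by apply: (idD iJ) => //; apply: (idM iJ).
  split=> [//| |x1 x2 [c1 h1] [c2 h2]|a x _ [c h]].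
  - by exists 0; rewrite mul0r subr0; exact: (id0 iJ).
  - exists (c1 + c2); rewrite (_ : _ - _ = (x1 - c1 * y n) + (x2 - c2 * y n)); last by ring.
    exact: (idD iJ).
  - exists (a * c); rewrite (_ : _ - _ = a * (x - c * y n)); last by ring.
    exact: (idM iJ).
have [c Jc] : J n (y n.+1) by apply: hn; exists 1; rewrite mul1r subrr; exact: (id0 iJ).
have [u hu] := ht c.
have J1 : J0 (y n.+1).
  rewrite -[y _]mul1r -hu (_ : _ * _ * _ = u * (y n.+1 - c * t * y n.+1)); last by ring.
  apply: (idM iJ) => //.
  rewrite (_ : _ - _ = (y n.+1 - c * y n) + c * (y n - t * y n.+1)); last by ring.
  by apply: (idD iJ) => //; apply: (idM iJ).
have : J0 (y n.+1) -> J0 (y 0%N); last exact.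
elim: n.+1 => // k ih Jk; apply: ih.
rewrite -(subrK (t * y k.+1) (y k)); apply: (idD iJ) => //; exact: (idM iJ).
Qed.

Definition icl J := forall a b, (forall c, J (b * c) -> J c) ->
  (exists n (r : 'I_n -> O), J (a ^+ n + \sum_(i < n) r i * a ^+ i * b ^+ (n - i))) ->
  exists c, J (a - c * b).

(** Modulo [J]: if a b = 0 and a + b is a nonzerodivisor, the fraction a / (a + b) is idempotent,
    hence integral, hence in the ring, where 0 and 1 are the only idempotents; so a or b vanishes.
    The work consists in enlarging b until a + b is a nonzerodivisor. *)
Lemma normal_local_prime J : isideal T J -> ~ J 1 -> (forall x, J (x * x) -> J x) ->
  (forall e, J (e * e - e) -> J e \/ J (1 - e)) -> icl J -> isprime T J.
Proof.
move=> iJ J1 rad loc cl; split=> // a b0 _ _ Jab0.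
apply: contrapT => /not_orP[Ja Jb0].
have JM x y : J y -> J (x * y) by move=> ?; apply: (idM iJ).
(* The annihilator of all that kills both [a] and [b]. When it is maximal, only 0 kills both, since
   any other such element could be added to [b]. *)
pose U b := [set y | forall x, J (x * a) -> J (x * b) -> J (x * y)].
pose F := [set U' | exists b, [/\ U' = U b, J (a * b) & ~ J b]].
have iU b : isideal T (U b).
  split=> [//|x _ _|y1 y2 h1 h2 x xa xb|c y _ h x xa xb]; first by rewrite mulr0; exact: (id0 iJ).
    by rewrite mulrDr; apply: (idD iJ); [apply: h1|apply: h2].
  by rewrite mulrCA; apply: JM; exact: h.
have F0 : F (U b0) by exists b0.
have [|_ [b [-> Jab Jb]] bmax] := max_ideal F0; first by move=> I [b [-> _ _]].
have sq x y w : J (x * (y + w)) -> J (w * y) -> J (x * y).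
  move=> h1 h2; apply: rad.
  rewrite (_ : _ * _ = (x * y) * (x * (y + w)) - (x * x) * (w * y)); last by ring.
  by apply: (idB hO iJ); exact: JM.
have ann x : J (x * a) -> J (x * b) -> J x.
  move=> xa xb; apply: contrapT => Jx.
  have Fb : F (U (b + x)).
    exists (b + x); split=> //; first by rewrite mulrDr; apply: (idD iJ) => //; rewrite mulrC.
    by move=> h; apply/Jx/rad; apply: (idDl hO iJ xb); rewrite -mulrDr; exact: JM.
  have UU : U b `<=` U (b + x).
    by move=> y Uy w wa wbx; apply: Uy => //; exact: (sq _ _ x).
  apply/Jx/rad; apply: (bmax _ Fb UU x) => // w wa wbx.
  have wb : J (w * b) by exact: (sq _ _ x).
  by apply: (idDl hO iJ wb); rewrite -mulrDr.
pose c := a + b.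
have cnz y : J (c * y) -> J y.
  move=> h; have h' : J (y * (a + b)) by rewrite mulrC.
  apply: ann; first by apply: (sq _ _ b) => //; rewrite mulrC.
  by apply: (sq _ _ a) => //; rewrite addrC.
have [|d Jd] := cl a c cnz.
  exists 2%N, (fun i : 'I_2 => if i == ord0 then 0 else -1).
  rewrite big_ord_recl big_ord1 /= !mul0r add0r expr1 /bump /= expr1.
  rewrite (_ : _ + _ = -1 * (a * b)); last by rewrite /c; ring.
  exact: JM.
have : J (d * d - d).
  apply: (cnz); apply: (cnz).
  rewrite (_ : _ * _ = - (a * b) - (d * c + a) * (a - d * c) + c * (a - d * c)); last by rewrite /c; ring.
  by apply: (idD iJ); [apply: (idB hO iJ); [exact: (idN hO iJ)|exact: JM]|exact: JM].
case/loc => h.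
  by apply: Ja; apply: (idBr hO iJ _ Jd); rewrite mulrC; exact: JM.
apply: Jb; rewrite (_ : b = c * (1 - d) - (a - d * c)); last by rewrite /c; ring.
by apply: (idB hO iJ) => //; exact: JM.
Qed.

Section Extension.
Variables (D : set (O -> O)) (hD : forall d, D d -> isder d) (n : nat).
Hypothesis hT : wtower D n T.
Variables (I : set O) (hI : isprime T I).
Hypothesis cl : icl I.

(* In a normal ring the ideal of denominators of a non-integral fraction lies in a prime [P] at which
   the ring is a discrete valuation ring, so that the Jacobian criterion holds at [P]. *)
Theorem normal_extension (K : set O) b e k0 : ~ I b -> K b ->
  (forall b', K b' -> exists x, I (e * b' - x * b)) -> minors D I I k0 ->
  (forall P, isprime T P -> I `<=` P -> minors D I P k0 -> exists2 b', K b' & ~ P b') ->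
  exists x, I (e - x * b).
Proof.
move=> Ib Kb hK hm hP; apply: contrapT => ne.
have iI := prime_id hI; have [_ I1 IM] := hI.
have IMl x y : I y -> I (x * y) by move=> ?; apply: (idM iI).
have bnz c : I (b * c) -> I c by move=> /IM[].
(* The denominators of the fraction w / b modulo [I]. A maximal one among the proper ideals of this
   form containing [K] is prime: for x outside it, the denominators of x w / b form a proper ideal
   that contains it. *)
pose Den w := [set c | exists x, I (c * w - x * b)].
pose F := [set U | exists w, [/\ U = Den w, ~ Den w 1 & K `<=` Den w]].
have iDen w : isideal T (Den w).
  split=> [//| |c c' [x h] [x' h']|a c _ [x h]].
  - by exists 0; rewrite !mul0r subr0; exact: (id0 iI).
  - exists (x + x'); rewrite (_ : _ - _ = (c * w - x * b) + (c' * w - x' * b)); last by ring.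
    exact: (idD iI).
  - exists (a * x); rewrite (_ : _ - _ = a * (c * w - x * b)); last by ring.
    exact: IMl.
have Fe : F (Den e).
  exists e; split=> //; first by move=> [x]; rewrite mul1r => h; apply: ne; exists x.
  by move=> b' /hK[x h]; exists x; rewrite mulrC.
have [|_ [w [-> nw Kw]] wmax] := max_ideal Fe; first by move=> U [w [-> _ _]].
set P := Den w in nw Kw wmax.
have pP : isprime T P.
  split; [exact: iDen|exact: nw|].
  move=> x y _ _ [c Pxy]; apply: contrapT => /not_orP[Px Py].
  apply: Py; apply: (wmax (Den (x * w))) => //; last by exists c; rewrite mulrA [y * x]mulrC.
    exists (x * w); split=> //; first by move=> [z]; rewrite mul1r => h; apply: Px; exists z.
    move=> b' /Kw[z h]; exists (x * z); rewrite (_ : _ - _ = x * (b' * w - z * b)); last by ring.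
    exact: IMl.
  move=> a [z h]; exists (x * z); rewrite (_ : _ - _ = x * (a * w - z * b)); last by ring.
  exact: IMl.
have iP := prime_id pP.
have IP : I `<=` P by move=> x Ix; exists 0; rewrite mul0r subr0 mulrC; exact: IMl.
have Pb : P b by exact: Kw.
(* Either multiplication by w / b preserves [P], and then w / b is integral; or some p in [P]
   satisfies w p = g b with g outside [P], and then p generates [P] locally. *)
have [hc|] := pselect (forall p, P p -> exists2 p', P p' & I (w * p - b * p')).
  have /choice[f hf] : forall p, exists p', P p -> P p' /\ I (w * p - b * p').
    move=> p; have [/hc[p' Pp' hp]|np] := pselect (P p); last by exists 0.
    by exists p'.
  pose y k := iter k f b.
  have Py k : P (y k) by elim: k => //= k /hf[].
  have Iy k : I (w * y k - b * y k.+1) by case: (hf _ (Py k)).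
  (* In place of the determinant trick: y_i stands for b (w / b)^i, and the increasing ideals
     spanned by y_0, ..., y_(k-1) become stationary, which is an equation of integral dependence for
     w / b. *)
  pose J k := [set x | exists c : nat -> O, I (x - \sum_(i < k) c i * y i)].
  have [N hN] : exists k, J k.+1 `<=` J k.
    apply: acc => k; last first.
      move=> x [c hc']; exists (fun i => if (i < k)%N then c i else 0).
      rewrite big_ord_recr /= ltnn mul0r addr0.
      by congr (I (_ - _)): hc'; apply: eq_bigr => i _; rewrite ltn_ord.
    split=> [//| |x1 x2 [c1 h1] [c2 h2]|a x _ [c h]].
    - by exists (fun=> 0); rewrite big1 ?subr0; [exact: (id0 iI)|move=> i _; rewrite mul0r].
    - exists (fun i => c1 i + c2 i).
      have -> : \sum_(i < k) (c1 i + c2 i) * y i = \sum_(i < k) c1 i * y i + \sum_(i < k) c2 i * y i.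
        by rewrite -big_split; apply: eq_bigr => i _; rewrite mulrDl.
      rewrite opprD addrACA; exact: (idD iI).
    - exists (fun i => a * c i).
      have -> : \sum_(i < k) (a * c i) * y i = a * \sum_(i < k) c i * y i.
        by rewrite mulr_sumr; apply: eq_bigr => i _; rewrite mulrA.
      by rewrite -mulrBr; exact: IMl.
  have [c Ic] : J N (y N).
    apply: hN; exists (fun i => if i == N then 1 else 0).
    rewrite big_ord_recr /= eqxx mul1r big1 ?add0r ?subrr; first exact: (id0 iI).
    by move=> i _; rewrite ifF ?mul0r // ltn_eqF.
  have by_ k : I (b ^+ k * y k - w ^+ k * b).
    elim: k => [|k ih]; first by rewrite !expr0 !mul1r subrr; exact: (id0 iI).
    rewrite (_ : _ - _ = w * (b ^+ k * y k - w ^+ k * b) - b ^+ k * (w * y k - b * y k.+1)).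
      by apply: (idB hO iI); exact: IMl.
    by rewrite !exprS; ring.
  have [||x hx] := cl (a := w) (b := b); first exact: bnz.
    exists N, (fun i => - c i); apply: bnz.
    rewrite (_ : _ * _ = - (b ^+ N * y N - w ^+ N * b) + b ^+ N * (y N - \sum_(i < N) c i * y i) +
       \sum_(i < N) c i * b ^+ (N - i) * (b ^+ i * y i - w ^+ i * b)).
      apply: (idD iI); last by apply: (id_sum iI) => i _; exact: IMl.
      by apply: (idD iI); [exact: (idN hO iI)|exact: IMl].
    have -> : \sum_(i < N) c i * b ^+ (N - i) * (b ^+ i * y i - w ^+ i * b) =
       b ^+ N * (\sum_(i < N) c i * y i) + b * \sum_(i < N) (- c i) * w ^+ i * b ^+ (N - i).
      rewrite !mulr_sumr -big_split; apply: eq_bigr => i _ /=.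
      have -> : b ^+ N = b ^+ (N - i) * b ^+ i by rewrite -exprD subnK // ltnW.
      by ring.
    by ring.
  by apply: nw; exists x; rewrite mul1r.
move=> /existsNP[p /not_implyP[Pp hp]].
have [g Ig] := Pp.
have Pg : ~ P g by move=> Pg; apply: hp; exists g => //; rewrite mulrC [b * g]mulrC.
have Iw : ~ I w.
  by move=> Iw; apply: nw; exists 0; rewrite mul1r mul0r subr0.
have hF f : P f -> exists gf, I (g * f - p * gf).
  move=> [gf If]; exists gf; have [//|] : I w \/ I (g * f - p * gf); last by [].
  apply: IM => //.
  rewrite (_ : _ * _ = g * (f * w - gf * b) - gf * (p * w - g * b)); last by ring.
  by apply: (idB hO iI); exact: IMl.
have mP : minors D P P k0.+1.
  by apply: (minors_increase hD hT hI pP IP _ hm); exists b.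
have [|b' Kb' nb'] := hP P pP IP; last exact: nb' (Kw _ Kb').
apply: (minor_drop (S := T) (Y := P) (h := p) hO pP) => // f Pf.
have [gf Igf] := hF f Pf.
exists g => // k d Dd.
(* The relation g f = p gf modulo [I], differentiated: up to the factor [g] outside [P], and modulo
   [P], the gradient of f combines that of p and one of an element of [I]. *)
have E : g *: grad d f = gf *: grad d p + (grad d (g * f - p * gf) + (p *: grad d gf + (- f) *: grad d g)).
  apply/rowP => j; rewrite !mxE; have [da dm] := hD (Dd j).
  rewrite (derB hD) // !dm; ring.
rewrite E; apply: (comb_add pP).
  by apply: (comb_scale hO pP) => //; apply: (comb_mem hO pP); exists p => //; left.
apply: (comb_add pP); first by apply: (comb_mem hO pP); exists (g * f - p * gf) => //; right.
apply: comb0 => j; rewrite !mxE; apply: (idD iP); apply: (idMr iP) => //; exact: (idN hO iP).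
Qed.
End Extension.

Section Adic.
Variables (J It : set O) (tau : O).
Hypotheses (iJ : isideal T J) (pI : isprime T It).
Hypothesis JI : J `<=` It.
Hypothesis It_dec : forall x, It x -> exists x', J (x - tau * x').
Hypothesis It_tau : forall x, It (tau * x).
Hypothesis Jtau : forall x, J (tau * x) -> J x.
Hypothesis tau_small : forall y, exists u, (1 - y * tau) * u = 1.

(** Since [It] is prime, x lies in it, so x = tau x' modulo [J]; cancelling tau shows that x'
    satisfies the same condition as x. *)
Lemma adic_regular b x : ~ It b -> J (b * x) -> J x.
Proof.
move=> nb; have [_ _ IM] := pI.
apply: (chain_closure (Q := fun x => J (b * x)) iJ tau_small) => d Jbd.
have [//|/It_dec[d' h]] := IM _ _ I I (JI Jbd).
exists d' => //; apply: Jtau.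
rewrite (_ : _ * _ = b * d - b * (d - tau * d')); last by ring.
by apply: (idB hO iJ) => //; exact: (idM iJ).
Qed.

(** The quotient a / b is found modulo tau by [normal_extension]. The error is tau d', and d'
    inherits the condition on denominators because tau can be cancelled modulo [J], and b modulo
    [It]; so the correction can be repeated. *)
Theorem adic_extension (D : set (O -> O)) n (K : set O) a b k0 : (forall d, D d -> isder d) ->
  wtower D n T -> icl It -> ~ It b -> K b ->
  (forall b', K b' -> exists x, J (a * b' - x * b)) -> minors D It It k0 ->
  (forall P, isprime T P -> It `<=` P -> minors D It P k0 -> exists2 b', K b' & ~ P b') ->
  exists s, J (a - s * b).
Proof.
move=> hD hT cl nb Kb ha hm hP; have iI := prime_id pI; have [_ _ IM] := pI.
pose J0 := [set c | exists x, J (c - x * b)].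
have iJ0 : isideal T J0.
  split=> [//| |c c' [x h] [x' h']|u c _ [x h]].
  - by exists 0; rewrite mul0r subr0; exact: (id0 iJ).
  - exists (x + x'); rewrite (_ : _ - _ = (c - x * b) + (c' - x' * b)); last by ring.
    exact: (idD iJ).
  - exists (u * x); rewrite (_ : _ - _ = u * (c - x * b)); last by ring.
    exact: (idM iJ).
pose Q d := forall b', K b' -> exists x, J (d * b' - x * b).
apply: (chain_closure (Q := Q) iJ0 tau_small) => // d Qd.
have [x Ix] : exists x, It (d - x * b).
  apply: (normal_extension hD hT pI cl nb Kb _ hm hP).
  by move=> b' /Qd[x h]; exists x; exact: JI.
have [d' Jd'] := It_dec Ix; exists d'; last by exists x; rewrite addrAC.
move=> b' Kb'; have [y Jy] := Qd b' Kb'.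
have h1 : J ((y - x * b') * b - tau * (d' * b')).
  rewrite (_ : _ - _ = b' * (d - x * b - tau * d') - (d * b' - y * b)); last by ring.
  by apply: (idB hO iJ) => //; exact: (idM iJ).
have : It ((y - x * b') * b) by apply: (idBr hO iI (It_tau (d' * b'))); exact: JI.
move=> /(IM _ _ I I)[/It_dec[y' Jy']|//].
exists y'; apply: Jtau.
rewrite (_ : _ * _ = b * (y - x * b' - tau * y') - ((y - x * b') * b - tau * (d' * b'))); last by ring.
by apply: (idB hO iJ) => //; exact: (idM iJ).
Qed.
End Adic.
End Noetherian.
End Algebra.

(** * Germs of holomorphic functions *)

Section Germs.
Variable R : realType.
Notation K := (Cplx R).
Local Notation "r %:K" := ((r%:C)%C : K) (at level 2, format "r %:K").

Lemma near_comp (U V : normedModType K) (f : U -> V) x (P : set V) :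
  hol f x -> (\forall y \near f x, P y) -> \forall y \near x, P (f y).
Proof. by move=> hf; exact: (differentiable_continuous (hol_dif hf)). Qed.

Lemma hol_ddK (V : normedModType K) (f : V -> K) x w : hol f x -> hol (fun y => dd f y w) x.
Proof. exact: (hol_dd (nice_K R)). Qed.

Section Ring.
Variables (V : normedModType K) (a : V).
Notation O := (@germ K V (vect_manifold V) a).
Implicit Types f g : V -> K.

Lemma holo_funE f (q : V) : holo_fun (X := vect_manifold V) f q <-> differentiable f q.
Proof. by split=> [h|h c ->] //; exact: (h (id_chart V)). Qed.

Lemma near_holo_fun f : hol f a <-> \forall q \near a, holo_fun (X := vect_manifold V) f q.
Proof. by split; apply: filterS => q /holo_funE. Qed.

Definition gm f : O := @germ_of K V (vect_manifold V) a f.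
Definition gv (x : O) : V -> K := @germ_val K V (vect_manifold V) a x.

Lemma gv_hol x : hol (gv x) a.
Proof. by have h := @germ_val_holo K V (vect_manifold V) a x; apply/near_holo_fun. Qed.
Lemma gvK x : gm (gv x) = x. Proof. exact: germ_valK. Qed.
Lemma gmP f g : hol f a -> hol g a -> gm f = gm g <-> \forall q \near a, f q = g q.
Proof. by move=> /near_holo_fun hf /near_holo_fun hg; exact: germ_ofP. Qed.
Lemma gm_eq f g : hol f a -> (\forall q \near a, f q = g q) -> gm f = gm g.
Proof. by move=> hf e; apply/gmP => //; exact: hol_eq e hf. Qed.
Lemma gmE f : hol f a -> \forall q \near a, gv (gm f) q = f q.
Proof. by move=> hf; apply/gmP => //; [exact: gv_hol|exact: gvK]. Qed.

Lemma gmM f g : hol f a -> hol g a -> gm f * gm g = gm (fun y => f y * g y).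
Proof.
move=> hf hg; rewrite -[LHS]gvK; apply/esym/gm_eq; first exact: hol_mul.
apply: filterS3 (gmE hf) (gmE hg) (germ_valM (gm f) (gm g)) => q e1 e2.
by rewrite -/(gv (gm f)) -/(gv (gm g)) e1 e2.
Qed.
Lemma gmB f g : hol f a -> hol g a -> gm f - gm g = gm (fun y => f y - g y).
Proof.
move=> hf hg; rewrite -[LHS]gvK; apply/esym/gm_eq; first exact: hol_sub.
apply: filterS3 (gmE hf) (gmE hg) (germ_valB (gm f) (gm g)) => q e1 e2.
by rewrite -/(gv (gm f)) -/(gv (gm g)) e1 e2.
Qed.
Lemma gm1 : 1 = gm (fun=> 1).
Proof.
rewrite -[LHS]gvK; apply/esym/gm_eq; first exact: hol_cst.
by apply: filterS (@germ_val1 K V (vect_manifold V) a) => q h; exact/esym.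
Qed.
Lemma gm0 : 0 = gm (fun=> 0).
Proof.
rewrite -(subrr (1 : O)) {1 2}gm1 gmB; try exact: hol_cst.
by apply: gm_eq; [exact: (hol_sub (hol_cst _ _) (hol_cst _ _))|apply: filterE => q; rewrite subrr].
Qed.
Lemma gmD f g : hol f a -> hol g a -> gm f + gm g = gm (fun y => f y + g y).
Proof.
move=> hf hg; rewrite -[gm g]opprK -[- gm g]sub0r {1}gm0 gmB //; last exact: hol_cst.
rewrite gmB //; last exact: (hol_sub (hol_cst _ _)).
by congr gm; apply/funext => q; rewrite sub0r opprK.
Qed.
Lemma gmX f n : hol f a -> gm f ^+ n = gm (fun y => f y ^+ n).
Proof.
move=> hf; elim: n => [|n ih].
  by rewrite expr0 gm1; congr gm; apply/funext => q; rewrite expr0.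
rewrite exprS ih gmM //; last exact: hol_exp.
by congr gm; apply/funext => q; rewrite exprS.
Qed.
Lemma gm_sum (I : Type) (s : seq I) (P : pred I) (F : I -> V -> K) : (forall i, P i -> hol (F i) a) ->
  \sum_(i <- s | P i) gm (F i) = gm (fun y => \sum_(i <- s | P i) F i y).
Proof.
move=> h; elim: s => [|i s ih].
  by rewrite big_nil gm0; congr gm; apply/funext => q; rewrite big_nil.
rewrite big_cons ih; case: ifP => Pi; last by congr gm; apply/funext => q; rewrite big_cons Pi.
rewrite gmD; first by congr gm; apply/funext => q; rewrite big_cons Pi.
  exact: h.
exact: hol_sum.
Qed.
Lemma gm_poly d (r : nat -> V -> K) u : (forall i, hol (r i) a) -> hol u a ->
  \sum_(i < d) gm (r i) * gm u ^+ i = gm (fun y => \sum_(i < d) r i y * u y ^+ i).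
Proof.
move=> hr hu; rewrite -gm_sum; last by move=> i _; apply: hol_mul => //; exact: hol_exp.
by apply: eq_bigr => i _; rewrite gmX // gmM //; exact: hol_exp.
Qed.
Lemma gm_nat n : n%:R = gm (fun=> n%:R).
Proof.
elim: n => [|n ih]; first exact: gm0.
rewrite -addn1 natrD ih {1}gm1 gmD; try exact: hol_cst.
by congr gm; apply/funext => q; rewrite natrD.
Qed.

Lemma gm_unit f : hol f a -> f a != 0 -> exists y : O, gm f * y = 1.
Proof.
move=> hf fa; exists (gm (fun y => (f y)^-1)); rewrite gmM //; last exact: hol_inv.
rewrite gm1; apply/esym/gm_eq; first exact: hol_cst.
have : \forall q \near f a, q != 0.
  apply/near_nmP; exists (nm (f a)); first exact: nm_gt0.
  by move=> y h; apply: contraTneq h => ->; rewrite sub0r nmN ltxx.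
by move=> /(near_comp hf); apply: filterS => q fq; rewrite mulfV.
Qed.

Definition der (w : V) (x : O) : O := gm (fun y => dd (gv x) y w).

Lemma der_gm f w : hol f a -> der w (gm f) = gm (fun y => dd f y w).
Proof.
move=> hf; apply: gm_eq; first by apply: hol_ddK; exact: gv_hol.
have /near_join e := gmE hf; apply: filterS2 (gv_hol (gm f)) e => q dq eq.
apply/esym; exact: (dd_near_eq w eq dq).
Qed.

Definition ders : set (O -> O) := [set d | exists w, d = der w].

Lemma ders_der d : ders d -> isder d.
Proof.
move=> [w ->]; split=> x y; rewrite -[x]gvK -[y]gvK.
  have hx := gv_hol x; have hy := gv_hol y.
  rewrite gmD // !der_gm //; last exact: hol_add.
  rewrite gmD; try exact: hol_ddK.
  apply: gm_eq; first by apply: hol_ddK; exact: hol_add.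
  by apply: filterS2 hx hy => q d1 d2; rewrite dd_add.
have hx := gv_hol x; have hy := gv_hol y.
rewrite gmM // !der_gm //; last exact: hol_mul.
rewrite !gmM //; try exact: hol_ddK.
rewrite gmD; try by apply: hol_mul => //; exact: hol_ddK.
apply: gm_eq; first by apply: hol_ddK; exact: hol_mul.
by apply: filterS2 hx hy => q d1 d2; rewrite dd_mul //; ring.
Qed.

(** A basis of a k-dimensional subspace with dual functionals on the whole space; the bound stands
    for continuity. *)
Definition biorth k (e : 'I_k -> V) (l : 'I_k -> V -> K) :=
  [/\ forall i (c : K) x y, l i (c *: x + y) = c * l i x + l i y,
   exists2 B : R, 0 <= B & forall i x, nm (l i x) <= B * nm x &
   forall i j, l i (e j) = (i == j)%:R].

Definition span_proj k (e : 'I_k -> V) (l : 'I_k -> V -> K) (x : V) : V := \sum_i l i x *: e i.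

Section System.
Variables (k : nat) (e : 'I_k -> V) (l : 'I_k -> V -> K).
Hypothesis hel : biorth e l.
Local Notation pr := (span_proj e l).
Let l_lin i c x y : l i (c *: x + y) = c * l i x + l i y. Proof. by case: hel. Qed.
Let l_e i j : l i (e j) = (i == j)%:R. Proof. by case: hel. Qed.

Lemma span_proj_lin : linear pr.
Proof.
move=> c x y; rewrite /span_proj scaler_sumr -big_split /=; apply: eq_bigr => i _.
by rewrite l_lin scalerDl scalerA.
Qed.
Lemma span_projB x y : pr (x - y) = pr x - pr y.
Proof. by have := span_proj_lin (-1) y x; rewrite !scaleN1r [- y + x]addrC [- pr y + _]addrC. Qed.
Lemma span_proj0 : pr 0 = 0.
Proof. by have := span_projB 0 0; rewrite !subrr. Qed.
Lemma span_projZ c x : pr (c *: x) = c *: pr x.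
Proof. by have := span_proj_lin c x 0; rewrite !addr0 span_proj0 addr0. Qed.

Lemma span_proj_bound : exists2 B : R, 0 <= B & forall x, nm (pr x) <= B * nm x.
Proof.
have [_ [B B0 hB] _] := hel; exists (\sum_i B * nm (e i)).
  by apply: sumr_ge0 => i _; rewrite mulr_ge0 // nm_ge0.
move=> x; apply: le_trans (nm_sum _ _ _) _; rewrite mulr_suml; apply: ler_sum => i _.
by rewrite nmZ mulrAC; apply: ler_wpM2r => //; exact: nm_ge0.
Qed.

Lemma span_proj_hol x : hol pr x /\ forall w, dd pr x w = pr w.
Proof. by have [B _ hB] := span_proj_bound; exact: (bounded_linear_hol x span_proj_lin hB). Qed.

Lemma l_proj i x : l i (pr x) = l i x.
Proof.
have lZ := ellZ (l_lin i).
rewrite /span_proj (big_morph (l i) (ellD (l_lin i)) (ell0 (l_lin i))) (bigD1 i) //= lZ l_e eqxx mulr1 big1 ?addr0 // => j ji.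
by rewrite lZ l_e eq_sym (negPf ji) mulr0.
Qed.

Lemma span_projK x : pr (pr x) = pr x.
Proof. by apply: eq_bigr => i _; rewrite l_proj. Qed.

Definition sigma (y : V) := a + pr (y - a).
Lemma sigma_a : sigma a = a. Proof. by rewrite /sigma subrr span_proj0 addr0. Qed.
Lemma sigmaK y : sigma (sigma y) = sigma y.
Proof. by rewrite /sigma addrAC subrr add0r span_projK. Qed.

Lemma shift_hol (W : normedModType K) (f : V -> W) (b : V) y : hol f (y - b) -> hol (fun z => f (z - b)) y.
Proof.
move=> hf; apply: (hol_comp (f := fun z => z - b)) => //.
by apply: hol_sub; [exact: hol_id|exact: hol_cst].
Qed.

Lemma dd_shift (W : normedModType K) (f : V -> W) (b : V) y w : differentiable f (y - b) ->
  dd (fun z => f (z - b)) y w = dd f (y - b) w.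
Proof. by move=> df; rewrite (dd_translate w df). Qed.

Lemma sigma_hol y : hol sigma y /\ forall w, dd sigma y w = pr w.
Proof.
have hp := span_proj_hol (y - a).
have hs : hol (fun z => pr (z - a)) y by apply: shift_hol; case: hp.
split=> [|w]; first by apply: hol_add => //; exact: hol_cst.
rewrite dd_add ?dd_cst ?add0r; [|exact: dif_cst|exact: hol_dif].
by rewrite dd_shift; [case: hp|apply: hol_dif; case: hp].
Qed.

(** The germs that depend only on the coordinates [l]: the ring of germs in k variables, realized
    inside the ring of germs on the whole space so that the tower has one ambient ring. *)
Definition invariant : set O :=
  [set x | exists2 f, hol f a /\ (forall y, f (sigma y) = f y) & x = gm f].

Lemma invariant_comp f : hol f a -> invariant (gm (fun y => f (sigma y))).
Proof.
move=> hf; exists (fun y => f (sigma y)) => //; split; last by move=> y; rewrite sigmaK.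
by apply: (hol_comp (f := sigma)); [case: (sigma_hol a)|rewrite sigma_a].
Qed.

Lemma invariant_near f : hol f a -> (\forall y \near a, f (sigma y) = f y) -> invariant (gm f).
Proof.
move=> hf e0; have -> : gm f = gm (fun y => f (sigma y)); last exact: invariant_comp.
by apply: gm_eq => //; apply: filterS e0 => y ->.
Qed.

Lemma invariant_subring : subring invariant.
Proof.
split.
- by rewrite gm1; exists (fun=> 1) => //; split=> //; exact: hol_cst.
- move=> _ _ [f [hf ef] ->] [g [hg eg] ->]; rewrite gmB //; exists (fun y => f y - g y) => //.
  by split; [exact: hol_sub|move=> y; rewrite ef eg].
- move=> _ _ [f [hf ef] ->] [g [hg eg] ->]; rewrite gmM //; exists (fun y => f y * g y) => //.
  by split; [exact: hol_mul|move=> y; rewrite ef eg].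
- move=> n; exists (gm (fun=> n.+1%:R^-1)).
    by exists (fun=> n.+1%:R^-1) => //; split=> //; exact: hol_cst.
  rewrite gm_nat gmM; try exact: hol_cst.
  by rewrite gm1; congr gm; apply/funext => q; rewrite mulfV // pnatr_eq0.
Qed.

Lemma invariant_dd f w : hol f a -> (forall y, f (sigma y) = f y) ->
  \forall y \near a, dd f y w = dd f (sigma y) (pr w).
Proof.
move=> hf ef.
have hs : \forall y \near a, differentiable f (sigma y).
  by apply: (near_comp (f := sigma) (P := fun y => differentiable f y)); [case: (sigma_hol a)|rewrite sigma_a].
apply: filterS hs => y ds; have [/hol_dif d1 d2] := sigma_hol y.
rewrite (dd_ext (g := fun y => f (sigma y))); last by apply/funext => z; rewrite ef.
by rewrite (dd_comp _ d1 ds) d2.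
Qed.

Lemma invariant_der d x : ders d -> invariant x -> invariant (d x).
Proof.
move=> [w ->] [f [hf ef] ->]; rewrite der_gm //.
apply: invariant_near; first exact: hol_ddK.
have h1 := invariant_dd w hf ef.
have h2 : \forall y \near a, dd f (sigma y) w = dd f (sigma (sigma y)) (pr w).
  apply: (near_comp (f := sigma) (P := fun y => dd f y w = dd f (sigma y) (pr w))).
    by case: (sigma_hol a).
  by rewrite sigma_a.
by apply: filterS2 h1 h2 => y -> ->; rewrite sigmaK.
Qed.
End System.

Section Direction.
Variables (k : nat) (e : 'I_k.+1 -> V) (l : 'I_k.+1 -> V -> K).
Hypothesis hel : biorth e l.
Local Notation pr := (span_proj e l).
Variables (v : V) (j : 'I_k.+1).
Hypotheses (prv : pr v = v) (vj : l j v != 0).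
Let l_lin i c x y : l i (c *: x + y) = c * l i x + l i y. Proof. by case: hel. Qed.
Let l_e i i' : l i (e i') = (i == i')%:R. Proof. by case: hel. Qed.

(** The vector [v] takes the place of e_j in the basis: [dir_ell] is its dual functional, and
    [drop_l] are the functionals dual to the remaining vectors, corrected so as to vanish at [v]. *)
Definition dir_ell (x : V) : K := l j x / l j v.
Definition drop_e (i : 'I_k) := e (lift j i).
Definition drop_l (i : 'I_k) (x : V) : K := l (lift j i) x - l (lift j i) v * dir_ell x.

Lemma dir_ell_lin (c : K) x y : dir_ell (c *: x + y) = c * dir_ell x + dir_ell y.
Proof. by rewrite /dir_ell l_lin; ring. Qed.
Lemma dir_ell_v : dir_ell v = 1. Proof. by rewrite /dir_ell mulfV. Qed.
Lemma dir_ell_bound : exists2 B : R, 0 <= B & forall x, nm (dir_ell x) <= B * nm x.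
Proof.
have [_ [B B0 hB] _] := hel; exists (B * nm (l j v)^-1); first by rewrite mulr_ge0 ?nm_ge0.
by move=> x; rewrite /dir_ell nmM mulrAC; apply: ler_wpM2r; [exact: nm_ge0|exact: hB].
Qed.
Lemma dir_ell_pr x : dir_ell (pr x) = dir_ell x. Proof. by rewrite /dir_ell (l_proj hel). Qed.

Lemma drop_biorth : biorth drop_e drop_l.
Proof.
split=> [i c x y| |i i']; first by rewrite /drop_l l_lin dir_ell_lin; ring.
  have [_ [B B0 hB] _] := hel; have [B' B'0 hB'] := dir_ell_bound.
  pose C := \sum_i nm (l i v); have C0 : 0 <= C by apply: sumr_ge0 => i _; exact: nm_ge0.
  exists (B + C * B'); first by rewrite addr_ge0 // mulr_ge0.
  move=> i x; apply: le_trans (nmD _ _) _; rewrite nmN nmM mulrDl -mulrA; apply: lerD => //.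
  apply: ler_pM; rewrite ?nm_ge0 //.
  by rewrite /C (bigD1 (lift j i)) //= lerDl; apply: sumr_ge0 => ? _; exact: nm_ge0.
rewrite /drop_l /drop_e l_e /dir_ell l_e (negPf (neq_lift _ _)) mul0r mulr0 subr0.
by rewrite (inj_eq lift_inj).
Qed.

Lemma drop_proj x : span_proj drop_e drop_l x = pr x - dir_ell x *: v.
Proof.
rewrite -[in RHS]prv /span_proj [X in _ = X - _](bigD1_ord j) // [X in _ = _ - _ *: X](bigD1_ord j) //=.
rewrite scalerDr scalerA {2}/dir_ell divfK // opprD addrACA subrr add0r scaler_sumr -sumrB.
by apply: eq_bigr => i _; rewrite /drop_e /drop_l scalerA -scalerBl [_ * l _ v]mulrC.
Qed.

Lemma drop_proj_v : span_proj drop_e drop_l v = 0.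
Proof. by rewrite drop_proj prv dir_ell_v scale1r subrr. Qed.
Lemma drop_proj_pr x : span_proj drop_e drop_l (pr x) = span_proj drop_e drop_l x.
Proof. by rewrite !drop_proj dir_ell_pr (span_projK hel). Qed.
Lemma pr_drop_proj x : pr (span_proj drop_e drop_l x) = span_proj drop_e drop_l x.
Proof. by rewrite !drop_proj (span_projB hel) (span_projK hel) (span_projZ hel) prv. Qed.
Lemma proj_pr x : proj v dir_ell (pr x) = span_proj drop_e drop_l x.
Proof. by rewrite /proj dir_ell_pr drop_proj. Qed.
End Direction.

(** If all quotients in all directions vanished at 0, [order_line] would make G vanish on a disc of
    uniform radius in each direction, hence near 0. For directions of norm 1 the domain has radii r
    / 2, and r / 128 is a 64th part of this. *)
Lemma good_direction k (e : 'I_k.+1 -> V) (l : 'I_k.+1 -> V -> K) (G : V -> K) : biorth e l ->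
  hol G 0 -> (forall y, G (span_proj e l y) = G y) -> ~ (\forall y \near 0, G y = 0) ->
  exists v j, [/\ span_proj e l v = v, l j v != 0 &
    exists i, iter i (hq v (dir_ell l v j)) G 0 != 0].
Proof.
move=> hel hG GE nG; apply: contrapT => hn.
have bad v j i : span_proj e l v = v -> l j v != 0 -> iter i (hq v (dir_ell l v j)) G 0 = 0.
  by move=> h1 h2; apply/eqP; apply: contrapT => /negP h3; apply: hn; exists v, j; split=> //; exists i.
have [r [M [r0 dG MG]]] := hol_ball hG.
have [B B0 hB] := span_proj_bound hel.
have G0 : G 0 = 0.
  have h1 : span_proj e l (e ord0) = e ord0.
    rewrite /span_proj (bigD1 ord0) //= big1 => [|i ne].
      by have [_ _ ->] := hel; rewrite eqxx scale1r addr0.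
    by have [_ _ ->] := hel; rewrite (negPf ne) scale0r.
  by apply: (bad (e ord0) ord0 0%N h1); have [_ _ ->] := hel; rewrite eqxx oner_eq0.
apply: nG; apply/near_nmP; exists (r / 128 / (B + 1)); first by rewrite !divr_gt0 //; lra.
move=> y; rewrite subr0 => yr; rewrite -GE; set p := span_proj e l y.
have [->//|p0] := eqVneq p 0.
have pp : span_proj e l p = p by rewrite /p (span_projK hel).
have [j pj] : exists j, l j p != 0.
  apply: contrapT => hj; case/eqP: p0; rewrite -pp /span_proj big1 // => i _.
  have [->|h] := eqVneq (l i p) 0; first by rewrite scale0r.
  by case: hj; exists i.
have np := nm_gt0 p0.
pose v := (nm p)^-1%:K *: p.
have lin i (c : K) x : l i (c *: x) = c * l i x.
  by have [hl _ _] := hel; rewrite (ellZ (hl i)).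
have vv : span_proj e l v = v by rewrite /v (span_projZ hel) pp.
have np0 : (nm p)%:K != 0 by rewrite fmorph_eq0 gt_eqF.
have vj : l j v != 0 by rewrite /v lin mulf_neq0 // realKV invr_eq0.
have nv : nm v = 1 by rewrite /v nmZ nm_real ger0_norm ?invr_ge0 ?nm_ge0 // mulVf // gt_eqF.
have -> : p = (nm p)%:K *: v by rewrite /v scalerA -realKM mulfV ?gt_eqF // rmorph1 scale1r.
have e0 : 0 < r / 2 by lra.
have ge : good v (dir_ell l v j) (r / 2) (r / 2) G M.
  move=> x Dx; have xr : nm (x - 0) < r.
    by rewrite subr0; apply: (@dom_ballE R V v (dir_ell l v j)) => //; rewrite nv.
  by split; [apply: dG|apply: MG].
have [B' B'0 hB'] := dir_ell_bound hel v j.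
apply: (order_line (dir_ell_lin hel v j) hB' B'0 (dir_ell_v vj) e0 ge).
  by move=> i; exact: bad.
rewrite nm_real ger0_norm ?nm_ge0 //; apply: le_lt_trans (hB y) _.
move: yr; rewrite ltr_pdivlMr; last by lra.
have := nm_ge0 y; nra.
Qed.

(** The direction depends on the germ: after a change of basis that contains a direction in which
    the germ has finite order, Weierstrass division eliminates this direction and leaves germs in
    one variable less. *)
Theorem invariant_wtower k (e : 'I_k -> V) (l : 'I_k -> V -> K) : biorth e l ->
  wtower ders k (invariant e l).
Proof.
elim: k e l => [|k ih] e l hel; split; try exact: invariant_subring;
  (split; first by move=> d x; exact: invariant_der).
  move=> _ [f [hf ef] ->] f0.
  have s0 y : sigma e l y = a by rewrite /sigma /span_proj big_ord0 addr0.
  have fE y : f y = f a by rewrite -ef s0.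
  have fa : f a != 0.
    apply: contraNneq f0 => fa; apply/eqP; rewrite gm0; apply: gm_eq => //.
    by apply: filterE => y; rewrite fE.
  exists (gm (fun=> (f a)^-1)); first by exists (fun=> (f a)^-1) => //; split=> //; exact: hol_cst.
  rewrite gmM //; last exact: hol_cst.
  by rewrite gm1; congr gm; apply/funext => q; rewrite fE mulVf.
move=> _ [f [hf ef] ->] f0.
pose G y := f (a + y).
have hol_G (g : V -> K) : hol g a -> hol (fun y => g (a + y)) 0.
  move=> hg; apply: (hol_comp (f := fun y => a + y)); last by rewrite addr0.
  by apply: hol_add; [exact: hol_cst|exact: hol_id].
have hG : hol G 0 by exact: hol_G.
have GE y : G (span_proj e l y) = G y.
  by rewrite /G -[in RHS]ef /sigma addrAC subrr add0r.
have nG : ~ (\forall y \near 0, G y = 0).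
  move=> n0; case/eqP: f0; rewrite gm0; apply: gm_eq => //.
  have h : hol (fun y : V => y - a) a by apply: hol_sub; [exact: hol_id|exact: hol_cst].
  have := near_comp (P := fun y => G y = 0) h; rewrite subrr => /(_ n0).
  by apply: filterS => y; rewrite /G addrC subrK.
have [v [j [prv vj hk]]] := good_direction hel hG GE nG.
pose ell := dir_ell l v j; pose e' := drop_e e j; pose l' := drop_l l v j.
have hel' : biorth e' l' by exact: (drop_biorth hel).
have [B B0 hB] := dir_ell_bound hel v j.
have [d [[q0 [rho [[hq0 q00] hrho rhoE eq0]]] hdiv]] :=
  weierstrass_unit (dir_ell_lin hel v j) hB B0 (dir_ell_v vj) hG hk.
have near_pr (P : set V) : (\forall y \near 0, P y) -> \forall y \near a, P (span_proj e l (y - a)).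
  move=> hP; apply: (near_comp (f := fun y => span_proj e l (y - a))).
    by apply: shift_hol; case: (span_proj_hol hel (a - a)).
  by rewrite subrr (span_proj0 hel).
have inv_pr (q : V -> K) : hol q 0 -> hol (fun y => q (span_proj e l (y - a))) a.
  move=> hq; apply: (hol_comp (f := fun y => span_proj e l (y - a))).
    by apply: shift_hol; case: (span_proj_hol hel (a - a)).
  by rewrite subrr (span_proj0 hel).
have inv_S q : hol q 0 -> invariant e l (gm (fun y => q (span_proj e l (y - a)))).
  move=> hq; exists (fun y => q (span_proj e l (y - a))) => //; split; first exact: inv_pr.
  by move=> y; rewrite /sigma addrAC subrr add0r (span_projK hel).
have inv_S' q : hol q 0 -> (forall x, q (proj v ell x) = q x) ->
    invariant e' l' (gm (fun y => q (span_proj e l (y - a)))).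
  move=> hq qE; exists (fun y => q (span_proj e l (y - a))) => //; split; first exact: inv_pr.
  move=> y; rewrite /sigma addrAC subrr add0r (pr_drop_proj hel prv vj).
  by rewrite -(proj_pr hel prv vj) -/ell qE.
have hell y : hol (fun y => ell (y - a)) y.
  apply: (shift_hol (f := ell)).
  by case: (@bounded_linear_hol R V K ell B (y - a) (dir_ell_lin hel v j) hB).
pose z : O := gm (fun y => ell (y - a)).
(* The division theorem controls coefficients of index below d only; the others are set to 0, so
   that the whole sequence consists of holomorphic functions. *)
pose coef (r : nat -> V -> K) i : V -> K := if (i < d)%N then r i else fun=> 0.
have coefP (r : nat -> V -> K) : (forall i, (i < d)%N -> hol (r i) 0) ->
    (forall i x, r i (proj v ell x) = r i x) ->
    [/\ forall i, invariant e' l' (gm (fun y => coef r i (span_proj e l (y - a)))) &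
     \sum_(i < d) gm (fun y => coef r i (span_proj e l (y - a))) * z ^+ i =
     gm (fun y => \sum_(i < d) r i (span_proj e l (y - a)) * ell (y - a) ^+ i)].
  move=> hr rE.
  have hc i : hol (coef r i) 0 by rewrite /coef; case: ifP => [/hr//|_]; exact: hol_cst.
  have cE i x : coef r i (proj v ell x) = coef r i x by rewrite /coef; case: ifP.
  split=> [i|]; first exact: inv_S'.
  have := @gm_poly d (fun i y => coef r i (span_proj e l (y - a))) (fun y => ell (y - a)).
  move=> -> //; last by move=> i; exact: inv_pr.
  by congr gm; apply/funext => y; apply: eq_bigr => i _; rewrite /coef ltn_ord.
have hsum (r : nat -> V -> K) : (forall i, (i < d)%N -> hol (r i) 0) ->
    hol (fun y => \sum_(i < d) r i (span_proj e l (y - a)) * ell (y - a) ^+ i) a.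
  move=> hr; apply: hol_sum => i _; apply: hol_mul; last exact: hol_exp.
  by apply: inv_pr; exact: hr.
have fE y : G (span_proj e l (y - a)) = f y by rewrite GE /G addrC subrK.
have ellE y : ell (span_proj e l (y - a)) = ell (y - a) by exact: dir_ell_pr.
have [Srho sumrho] := coefP rho hrho rhoE.
pose rhog i : O := gm (fun y => coef rho i (span_proj e l (y - a))).
have WE : z ^+ d - \sum_(i < d) rhog i * z ^+ i =
    gm (fun y => q0 (span_proj e l (y - a)) * f y).
  rewrite sumrho /z gmX // gmB; [|exact: hol_exp|exact: hsum].
  apply: gm_eq; first by apply: hol_sub; [exact: hol_exp|exact: hsum].
  apply: filterS (near_pr _ eq0) => y; rewrite fE (dir_ell_pr hel) -/ell => ->.
  by rewrite addrK.
exists (invariant e' l'), z, (der v), d, rhog; split.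
- exact: ih.
- move=> _ [g [hg eg] ->]; exists g => //; split=> // y.
  rewrite -eg -[RHS]eg; congr g; rewrite /sigma addrAC subrr add0r.
  by rewrite (drop_proj_pr hel prv vj).
- exists (fun y => ell (y - a)) => //; split=> // y.
  by rewrite /sigma addrAC subrr add0r ellE.
- by exists v.
split=> //.
- rewrite /z der_gm // gm1; apply: gm_eq; first exact: hol_ddK.
  have hb y := @bounded_linear_hol R V K ell B y (dir_ell_lin hel v j) hB.
  apply: filterE => y; rewrite (dd_shift (f := ell)); last by apply: hol_dif; case: (hb (y - a)).
  by case: (hb (y - a)) => _ ->; exact: dir_ell_v.
- move=> _ [g [hg eg] ->]; rewrite der_gm // gm0; apply: gm_eq; first exact: hol_ddK.
  by apply: filterS (invariant_dd hel' v hg eg) => y ->; rewrite (drop_proj_v prv vj) dd_zeror.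
- rewrite WE; exists (gm (fun y => q0 (span_proj e l (y - a)))); first exact: inv_S.
  by rewrite gmM //; exact: inv_pr.
move=> _ [F [hF eF] ->].
have [q [r [hq hr rE qE]]] := hdiv _ (hol_G _ hF).
have [Sr sumr] := coefP r hr rE.
have hqq : hol (fun y => q y / q0 y) 0 by apply: hol_mul => //; exact: hol_inv.
exists (gm (fun y => q (span_proj e l (y - a)) / q0 (span_proj e l (y - a)))), (fun i => gm (fun y => coef r i (span_proj e l (y - a)))).
split=> //; first exact: (inv_S _ hqq).
rewrite WE sumr gmM; last 2 first.
- exact: (inv_pr _ hqq).
- by apply: hol_mul => //; exact: inv_pr.
rewrite gmD; last 2 first.
- apply: hol_mul; first exact: (inv_pr _ hqq).
  by apply: hol_mul => //; exact: inv_pr.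
- exact: hsum.
apply: gm_eq => //.
have n0 : \forall y \near 0, q0 y != 0.
  apply: (near_comp hq0 (P := fun c => c != 0)).
  apply/near_nmP; exists (nm (q0 0)); first exact: nm_gt0.
  by move=> y h; apply: contraTneq h => ->; rewrite sub0r nmN ltxx.
apply: filterS2 (near_pr _ qE) (near_pr _ n0) => y e1 e2.
have -> : F y = F (a + span_proj e l (y - a)) by rewrite -[LHS]eF.
by rewrite e1 fE (dir_ell_pr hel) mulrA divfK.
Qed.
End Ring.
End Germs.

(** * Submersions *)

Section Straighten.
Variable R : realType.
Notation K := (Cplx R).
Local Notation "r %:K" := ((r%:C)%C : K) (at level 2, format "r %:K").

Section Space.
Variables (U : normedModType K).
Hypothesis nU : nice U.

Lemma dd_lin_arg (f : U -> K) q (c : K) x y : dd f q (c *: x + y) = c * dd f q x + dd f q y.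
Proof. by rewrite dd_addr dd_scaler. Qed.

Lemma dd_bound (f : U -> K) q : hol f q -> exists2 C : R, 0 <= C & forall w, nm (dd f q w) <= C * nm w.
Proof.
move=> /hol_ball[r [M [r0 df fM]]]; exists (16 * M / r); last by move=> w; exact: (dd_le (nice_K R) r0 df fM).
have M0 : 0 <= M by apply: le_trans (fM q _); rewrite ?nm_ge0 // subrr nm0.
by rewrite !mulr_ge0 // invr_ge0 ltW.
Qed.

Lemma small_lipschitz (h : U -> U) q : hol h q -> (forall w, dd h q w = 0) ->
  exists r : R, [/\ 0 < r, forall x, nm (x - q) < r -> differentiable h x &
    forall x y, nm (x - q) < r -> nm (y - q) < r -> nm (h x - h y) <= 2^-1 * nm (x - y)].
Proof.
move=> /hol_ball[r [M [r0 dh hM]]] h0.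
have M0 : 0 <= M by apply: le_trans (hM q _); rewrite ?nm_ge0 // subrr nm0.
pose C := 16 * 16 * 16 * M / r ^+ 2.
have C0 : 0 <= C by rewrite !mulr_ge0 // invr_ge0 exprn_ge0 // ltW.
pose r' := Num.min (r / 8) (2^-1 / (C + 1)).
have C1 : 0 < C + 1 by lra.
have r'0 : 0 < r' by rewrite lt_min; apply/andP; split; apply: divr_gt0.
have r'8 : r' <= r / 8 by rewrite ge_min lexx.
have r'C : C * r' <= 2^-1.
  have : r' <= 2^-1 / (C + 1) by rewrite ge_min lexx orbT.
  rewrite ler_pdivlMr // => hh; apply: le_trans hh; rewrite mulrC; apply: ler_wpM2l; lra.
exists r'; split=> // [x xr|]; first by apply: dh; lra.
apply: (@lipschitz_ball R U U h q r' 2^-1) => [|x xr|x w xr]; first by rewrite invr_ge0.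
  by apply: dh; lra.
have := deriv_lipschitz nU r0 dh hM (x := x) (y := q) w.
rewrite -!ddE h0 subr0 subrr nm0 -/C => /(_ (lt_le_trans xr r'8)) hh.
apply: le_trans (hh _) _; first by rewrite divr_gt0.
rewrite mulrAC; apply: ler_wpM2r; first exact: nm_ge0.
apply: le_trans r'C; apply: ler_wpM2l => //; exact: ltW.
Qed.

Section Straight.
Variables (k : nat) (F : 'I_k -> U -> K) (q : U) (b : 'I_k -> U).
Hypothesis hF : forall i, hol (F i) q.
Hypothesis Fb : forall i j, dd (F i) q (b j) = (i == j)%:R.
Hypothesis Fq : forall i, F i q = 0.

(** A coordinate change centered at [q] that turns the functions F_i into their differentials. Its
    difference from the identity has derivative zero at [q], so [inverse_function] applies. *)
Definition straight (x : U) : U := x - q + \sum_i (F i x - dd (F i) q (x - q)) *: b i.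

Lemma dd_straight i x : dd (F i) q (straight x) = F i x.
Proof.
rewrite /straight dd_addr dd_sumr (bigD1 i) //= dd_scaler Fb eqxx big1 ?addr0.
  by rewrite -[_ *: _]/(_ * _) mulr1 addrC subrK.
by move=> j ji; rewrite dd_scaler Fb eq_sym (negPf ji) scaler0.
Qed.

Lemma straight_q : straight q = 0.
Proof. by rewrite /straight subrr add0r big1 // => i _; rewrite Fq dd_zeror subrr scale0r. Qed.

Let h (x : U) : U := - q + \sum_i (F i x - dd (F i) q (x - q)) *: b i.
Let straightE x : straight x = x + h x. Proof. by rewrite /straight /h addrA. Qed.

Let hol_c i : hol (fun x => dd (F i) q (x - q)) q /\ forall w, dd (fun x => dd (F i) q (x - q)) q w = dd (F i) q w.
Proof.
have [C C0 hC] := dd_bound (hF i).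
have hl y := @bounded_linear_hol R U K (dd (F i) q) C y (dd_lin_arg (F i) q) hC.
split; first by apply: (@shift_hol R U K (dd (F i) q) q q); case: (hl (q - q)).
move=> w; rewrite (@dd_shift R U K (dd (F i) q)); last by apply: hol_dif; case: (hl (q - q)).
by case: (hl (q - q)).
Qed.

Let hol_h : hol h q.
Proof.
apply: hol_add; first exact: hol_cst.
apply: hol_sum => i _; apply: hol_scalev; last exact: hol_cst.
by apply: hol_sub => //; case: (hol_c i).
Qed.

Let dd_h w : dd h q w = 0.
Proof.
have dt i : differentiable (fun x => (F i x - dd (F i) q (x - q)) *: b i) q /\
    dd (fun x => (F i x - dd (F i) q (x - q)) *: b i) q w = 0.
  have [d1 d2] := hol_c i.
  have ds : differentiable (fun x => F i x - dd (F i) q (x - q)) q.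
    by apply: dif_sub; apply: hol_dif.
  have [h1 h2] := dif_scalev ds (dif_cst (b i) q); split=> //.
  rewrite h2 dd_cst scaler0 add0r dd_sub ?d2 ?subrr ?scale0r //; exact: hol_dif.
rewrite /h dd_add; [|exact: dif_cst|by apply: dif_sum => i _; case: (dt i)].
rewrite dd_cst add0r dd_sum; last by move=> i _; case: (dt i).
by apply: big1 => i _; case: (dt i).
Qed.

Lemma straight_hol : hol straight q.
Proof.
rewrite (_ : straight = fun x => x + h x); last by apply/funext => x; rewrite straightE.
by apply: hol_add => //; exact: hol_id.
Qed.

Lemma straighten : exists psi : U -> U,
  [/\ hol psi 0, psi 0 = q, forall w, dd psi 0 w = w,
      \forall y \near 0, straight (psi y) = y &
      \forall x \near q, psi (straight x) = x].
Proof.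
have [r [r0 dh lh]] := small_lipschitz hol_h dd_h.
have [g [hg gE inj]] := inverse_function nU r0 dh lh.
have b0 : q + h q = 0 by rewrite -straightE straight_q.
have gE' y : nm y < r / 4 -> nm (g y - q) <= 2 * nm y /\ straight (g y) = y.
  by rewrite -{1}[y]subr0 -{1}b0 => /gE; rewrite straightE b0 subr0.
have r4 : 0 < r / 4 by rewrite divr_gt0.
have z4 : nm (0 : U) < r / 4 by rewrite nm0.
have hg0 : hol g 0 by apply: hg; rewrite b0 subrr nm0.
have g0 : g 0 = q.
  have [] := gE' 0 z4; rewrite nm0 mulr0 => e _; apply/eqP; rewrite -subr_eq0; apply/eqP/nm_eq0.
  by apply/eqP; rewrite eq_le e nm_ge0.
have nsg : \forall y \near 0, straight (g y) = y.
  by apply/near_nmP; exists (r / 4) => // y; rewrite subr0 => /gE'[].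
exists g; split=> //.
  move=> w; have hs : hol straight (g 0) by rewrite g0; exact: straight_hol.
  have := dd_comp w (hol_dif hg0) (hol_dif hs).
  rewrite (dd_near_eq (f := id)); last 2 first.
  - by apply: filterS nsg => y.
  - by exact: dif_id.
  rewrite dd_id g0 => {2}->.
  rewrite (dd_ext (f := straight) (g := fun x => x + h x)); last by apply/funext => x; rewrite straightE.
  by rewrite dd_add; [rewrite dd_id dd_h addr0|exact: dif_id|exact: hol_dif].
have n4 : \forall y \near (0 : U), nm y < r / 8.
  by apply/near_nmP; exists (r / 8); [rewrite divr_gt0|move=> y; rewrite subr0].
have := near_comp (P := fun y => nm y < r / 8) straight_hol; rewrite straight_q => /(_ n4).
have nr : \forall x \near q, nm (x - q) < r by apply/near_nmP; exists r.
move=> ns; apply: filterS2 nr ns => x xr sx.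
have sx4 : nm (straight x) < r / 4 by lra.
have [e1 e2] := gE' (straight x) sx4.
apply: inj => //; first by apply: le_lt_trans e1 _; lra.
by rewrite -!straightE e2.
Qed.
End Straight.

Section Hadamard.
Variables (k : nat) (l : 'I_k -> U -> K) (b : 'I_k -> U).
Hypothesis l_lin : forall i (c : K) x y, l i (c *: x + y) = c * l i x + l i y.
Hypothesis l_bound : forall i, exists2 B : R, 0 <= B & forall x, nm (l i x) <= B * nm x.
Hypothesis l_b : forall i j, l i (b j) = (i == j)%:R.

(** The coordinates l_i are set to zero one at a time by the projections [P s]; each step
    contributes the Hadamard quotient along b_i as a coefficient. *)
Lemma hadamard_linear (g : U -> K) : hol g 0 ->
  (\forall y \near 0, (forall i, l i y = 0) -> g y = 0) ->
  exists c : 'I_k -> U -> K, (forall i, hol (c i) 0) /\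
    \forall y \near 0, g y = \sum_i c i y * l i y.
Proof.
move=> hg g0.
pose P s y := y - \sum_(i <- s) l i y *: b i.
have hP s : hol (P s) 0 /\ P s 0 = 0.
  split; last by rewrite /P big1 ?subr0 // => i _; rewrite (ell0 (l_lin i)) scale0r.
  apply: hol_sub; first exact: hol_id.
  apply: hol_sum => i _; apply: hol_scalev; last exact: hol_cst.
  by have [B B0 hB] := l_bound i; exact: (hol_ell (l_lin i) hB).
suff claim s : uniq s -> exists c : 'I_k -> U -> K, (forall i, hol (c i) 0) /\
    \forall y \near 0, g y = \sum_(i <- s) c i y * l i y + g (P s y).
  have [c [hc e]] := claim _ (index_enum_uniq _); exists c; split=> //.
  have h : \forall y \near 0, (forall i, l i (P (index_enum 'I_k) y) = 0) -> g (P (index_enum 'I_k) y) = 0.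
    have [h1 h2] := hP (index_enum 'I_k).
    by apply: (near_comp (P := fun y => (forall i, l i y = 0) -> g y = 0) h1); rewrite h2.
  apply: filterS2 e h => y -> ->; first by rewrite addr0.
  move=> i; rewrite /P (ellB (l_lin i)) (big_morph (l i) (ellD (l_lin i)) (ell0 (l_lin i))).
  rewrite (bigD1 i) //= (ellZ (l_lin i)) l_b eqxx mulr1 big1 ?addr0 ?subrr // => j ji.
  by rewrite (ellZ (l_lin i)) l_b eq_sym (negPf ji) mulr0.
elim: s => [_|i s ih /= /andP[iNs /ih[c [hc e]]]].
  exists (fun _ _ => 0); split=> [i|]; first exact: hol_cst.
  by apply: filterE => y; rewrite big_nil add0r /P big_nil subr0.
pose f y := g (P s y).
have hf : hol f 0.
  have [h1 h2] := hP s; apply: (hol_comp (f := P s)) => //; by rewrite h2.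
have [B B0 hB] := l_bound i.
have lii : l i (b i) = 1 by rewrite l_b eqxx.
have [e1 [M [e10 ge]]] := hol_dom (b i) (l i) hf.
have ghq := good_hq (l_lin i) hB B0 lii e10 e10 ge.
have hq0 : hol (hq (b i) (l i) f) 0.
  have := dom_open (l_lin i) hB B0 (eps := e1) (rho := e1) (dom0 (b i) (l_lin i) e10 e10).
  by move=> [r r0 hr]; apply/near_nmP; exists r => // y /hr/ghq[].
exists (fun j => if j == i then hq (b i) (l i) f else c j); split=> [j|]; first by case: ifP.
apply: filterS e => y ->; rewrite big_cons eqxx -addrA [RHS]addrC -!addrA; congr (_ + _).
  rewrite !big_seq; apply: eq_bigr => j js; case: eqP => // ji; by rewrite -ji js in iNs.
rewrite -/(f y) (hqE (b i) (l i) f y) mulrC; congr (_ + _).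
rewrite /f /P /proj big_cons; congr g; rewrite -addrA -opprD; congr (_ - (_ + _)).
rewrite !big_seq; apply: eq_bigr => j js; congr (_ *: _).
rewrite (ellB (l_lin j)) (ellZ (l_lin j)) l_b; case: eqP => [ji|_]; last by rewrite mulr0 subr0.
by rewrite -ji js in iNs.
Qed.
End Hadamard.

Lemma hadamard_submersion k (F : 'I_k -> U -> K) q (b : 'I_k -> U) (g : U -> K) :
  (forall i, hol (F i) q) -> (forall i j, dd (F i) q (b j) = (i == j)%:R) -> (forall i, F i q = 0) ->
  hol g q -> (\forall x \near q, (forall i, F i x = 0) -> g x = 0) ->
  exists c : 'I_k -> U -> K, (forall i, hol (c i) q) /\ \forall x \near q, g x = \sum_i c i x * F i x.
Proof.
move=> hF Fb Fq hg g0.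
have [psi [hpsi psi0 _ e1 e2]] := straighten b hF Fq.
have hgp : hol (fun y => g (psi y)) 0 by apply: (hol_comp (f := psi)) => //; rewrite psi0.
have [|c [hc e]] := hadamard_linear (fun i => dd_lin_arg (F i) q) (fun i => dd_bound (hF i)) Fb hgp.
  have h : \forall y \near 0, (forall i, F i (psi y) = 0) -> g (psi y) = 0.
    by apply: (near_comp (P := fun x => (forall i, F i x = 0) -> g x = 0) hpsi); rewrite psi0.
  apply: filterS2 h e1 => y h1 h2 ly; apply: h1 => i.
  by rewrite -(dd_straight Fb i (psi y)) h2.
have hs := straight_hol b hF.
exists (fun i x => c i (straight F q b x)); split=> [i|].
  by apply: (hol_comp (f := straight F q b)) => //; rewrite straight_q.
have h : \forall x \near q, g (psi (straight F q b x)) =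
    \sum_i c i (straight F q b x) * dd (F i) q (straight F q b x).
  apply: (near_comp (P := fun y => g (psi y) = \sum_i c i y * dd (F i) q y) hs).
  by rewrite straight_q.
apply: filterS2 h e2 => x h1 h2; rewrite -{1}h2 h1; apply: eq_bigr => i _.
by rewrite dd_straight.
Qed.
End Space.

Section Coordinates.
Variable n : nat.
Local Notation E := 'rV[K]_n.
Local Notation V := (E * K)%type.

Definition cvec (i : 'I_(n + 1)%N) : V :=
  match fintype.split i with inl j => (delta_mx 0 j, 0) | inr _ => (0, 1) end.
Definition ccoord (i : 'I_(n + 1)%N) (x : V) : K :=
  match fintype.split i with inl j => x.1 0 j | inr _ => x.2 end.

Lemma coord_biorth : biorth cvec ccoord.
Proof.
split=> [i c x y| |i j].
- by rewrite /ccoord; case: (fintype.split i) => [j|_] /=; rewrite ?mxE.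
- exists 1 => // i x; rewrite mul1r /ccoord; case: (fintype.split i) => [j|_].
    apply: le_trans (nm_entry _ _ _) _; have := lexx (nm x); by rewrite {1}nm_pairP => /andP[].
  by have := lexx (nm x); rewrite {1}nm_pairP => /andP[].
- rewrite /ccoord /cvec -(can_eq (@splitK n 1)).
  by case: (fintype.split i) => [i'|i']; case: (fintype.split j) => [j'|j'] //=;
    rewrite ?mxE ?eqxx // !ord1 eqxx.
Qed.

Lemma coord_proj x : span_proj cvec ccoord x = x.
Proof.
rewrite /span_proj big_split_ord /= big_ord1 /cvec /ccoord.
under eq_bigr do rewrite (unsplitK (inl _)).
rewrite (unsplitK (inr _)) /=.
case: x => x t /=; apply/eqP; rewrite xpair_eqE; apply/andP; split.
  rewrite /= (big_morph (fst : V -> E) (fun _ _ => erefl) erefl) /= scaler0 addr0.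
  by rewrite [X in _ == X]row_sum_delta.
rewrite /= (big_morph (snd : V -> K) (fun _ _ => erefl) erefl).
rewrite big1 => [|i _]; last by rewrite /= scaler0.
by rewrite add0r -[_%:A]/(t * 1) mulr1.
Qed.

Lemma top_wtower (a : V) : wtower (@ders R V a) (n + 1) setT.
Proof.
have -> : setT = @invariant R V a _ cvec ccoord; last exact: invariant_wtower coord_biorth.
apply/seteqP; split=> // x _; exists (gv x); last by rewrite gvK.
by split; [exact: gv_hol|move=> y; rewrite /sigma coord_proj addrC subrK].
Qed.
End Coordinates.
End Straighten.

(** * Flat families *)

Section Ideals.
Variable R : realType.
Notation K := (Cplx R).
Variable n : nat.
Local Notation E := 'rV[K]_n.
Local Notation V := (E * K)%type.

Lemma near_forall (U : normedModType K) (T : finType) (P : T -> set U) (x : U) :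
  (forall i, \forall y \near x, P i y) -> \forall y \near x, forall i, P i y.
Proof. exact: filter_forall. Qed.

Lemma nice_V : nice V. Proof. exact: (nice_pair (nice_mx R 1 n) (nice_K R)). Qed.
Lemma nice_E : nice E. Proof. exact: nice_mx. Qed.

Definition slice (t : K) (x : E) : V := (x, t).
Lemma slice_hol t x : hol (slice t) x /\ forall w, dd (slice t) x w = (w, 0).
Proof.
split; first by apply: hol_pair; [exact: hol_id|exact: hol_cst].
by move=> w; rewrite dd_pair ?dd_id ?dd_cst.
Qed.

Lemma near_slice (P : set V) (q : V) : (\forall y \near q, P y) -> \forall x \near q.1, P (x, q.2).
Proof.
case: q => x t /= h; apply: (near_comp (f := slice t) (P := P)) => //.
by case: (slice_hol t x).
Qed.

Lemma dd_slice (f : V -> K) (x : E) (t : K) w : differentiable f (x, t) ->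
  dd (fun y : E => f (y, t)) x w = dd f (x, t) (w, 0).
Proof.
by move=> df; have [/hol_dif h1 h2] := slice_hol t x; rewrite (dd_comp (f := slice t) _ h1 df) h2.
Qed.

Lemma hol_slice (f : V -> K) (q : V) : hol f q -> hol (fun y : E => f (y, q.2)) q.1.
Proof.
case: q => x t /= hf; have [h1 _] := slice_hol t x.
exact: (hol_comp (f := slice t)).
Qed.

Lemma hol_fstc (c : E -> K) (q : V) : hol c q.1 -> hol (fun y : V => c y.1) q.
Proof. by move=> hc; apply: (hol_comp (f := fst)) => //; exact: hol_fst. Qed.

Lemma top_subring (q : V) : subring (@setT (@germ K V (vect_manifold V) q)).
Proof. exact: (wtower_sub (top_wtower q)). Qed.
Lemma top_noeth (q : V) : noeth (@setT (@germ K V (vect_manifold V) q)).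
Proof. exact: (wtower_noeth (top_wtower q)). Qed.

Definition tau (q : V) := gm q (fun y => y.2 - q.2).
Lemma tau_hol (q y : V) : hol (fun y : V => y.2 - q.2) y.
Proof. by apply: hol_sub; [exact: hol_snd|exact: hol_cst]. Qed.

Lemma tau_unit q x : exists u, (1 - x * tau q) * u = 1.
Proof.
rewrite -[x]gvK; have hx := gv_hol x; have ht := tau_hol q q.
have hm : hol (fun y => gv x y * (y.2 - q.2)) q by exact: hol_mul.
rewrite gmM // {1}gm1 gmB; [|exact: hol_cst|exact: hm].
apply: gm_unit; first by apply: hol_sub => //; exact: hol_cst.
by rewrite subrr mulr0 subr0 oner_eq0.
Qed.

Lemma chain_tau q J0 (Q : set (@germ K V (vect_manifold V) q)) : isideal setT J0 ->
  (forall d, Q d -> exists2 d', Q d' & J0 (d - tau q * d')) -> forall d, Q d -> J0 d.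
Proof. move=> iJ hQ; by have := chain_closure (top_subring q) (@top_noeth q) iJ (@tau_unit q) hQ. Qed.

(** The case of a single submersion, the time coordinate. *)
Lemma div_tau (q : V) (H : V -> K) : hol H q -> (\forall y \near q.1, H (y, q.2) = 0) ->
  exists H', hol H' q /\ \forall y \near q, H y = (y.2 - q.2) * H' y.
Proof.
move=> hH H0.
have dt i (j : 'I_1) : dd ((fun _ y => y.2 - q.2) i : V -> K) q (0, 1) = (i == j :> 'I_1)%:R.
  rewrite !ord1 eqxx dd_sub; first by rewrite dd_cst subr0 dd_snd.
    by apply: hol_dif; exact: hol_snd.
  exact: dif_cst.
have [| | |c [hc e]] := @hadamard_submersion R V nice_V 1 (fun _ y => y.2 - q.2) q (fun _ => (0, 1)) H _ dt _ hH.
- by move=> _; exact: tau_hol.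
- by move=> _; rewrite subrr.
- move: H0 => /near_nmP[r r0 hr]; apply/near_nmP; exists r => // y.
  rewrite nm_pair_ltP /= => /andP[y1 _] /(_ ord0)/eqP; rewrite subr_eq0 => /eqP y2.
  by have := hr _ y1; rewrite -y2; case: (y).
by exists (c ord0); split=> //; apply: filterS e => y ->; rewrite big_ord1 mulrC.
Qed.

(** Membership in the ideal generated by [f] at [q], for functions instead of germs: germs at
    different points belong to different rings, while [inI_near] carries the same function to nearby
    points. *)
Definition inI N (f : 'I_N -> V -> K) (q : V) (H : V -> K) :=
  exists c : 'I_N -> V -> K, (forall i, hol (c i) q) /\ \forall y \near q, H y = \sum_i c i y * f i y.

Section Gen.
Variables (N : nat) (f : 'I_N -> V -> K) (q : V).
Hypothesis hf : forall i, hol (f i) q.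

Lemma inI_hol H : inI f q H -> hol H q.
Proof.
move=> [c [hc e]]; apply: hol_eq (_ : hol (fun y => \sum_i c i y * f i y) q).
  by apply: filterS e => y ->.
by apply: hol_sum => i _; exact: hol_mul.
Qed.

Lemma inI_eq H H' : inI f q H -> (\forall y \near q, H y = H' y) -> inI f q H'.
Proof. by move=> [c [hc e]] e'; exists c; split=> //; apply: filterS2 e e' => y <- <-. Qed.

Lemma inI_gen i : inI f q (f i).
Proof.
exists (fun j _ => if j == i then 1 else 0); split=> [j|]; first exact: hol_cst.
apply: filterE => y; rewrite (bigD1 i) //= eqxx mul1r big1 ?addr0 // => j ji.
by rewrite (negPf ji) mul0r.
Qed.
Lemma inI0 : inI f q (fun=> 0).
Proof.
exists (fun _ _ => 0); split=> [i|]; first exact: hol_cst.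
by apply: filterE => y; rewrite big1 // => i _; rewrite mul0r.
Qed.
Lemma inI_add H H' : inI f q H -> inI f q H' -> inI f q (fun y => H y + H' y).
Proof.
move=> [c [hc e]] [c' [hc' e']]; exists (fun i y => c i y + c' i y); split=> [i|].
  exact: hol_add.
by apply: filterS2 e e' => y -> ->; rewrite -big_split; apply: eq_bigr => i _; rewrite mulrDl.
Qed.
Lemma inI_mul (a : V -> K) H : hol a q -> inI f q H -> inI f q (fun y => a y * H y).
Proof.
move=> ha [c [hc e]]; exists (fun i y => a y * c i y); split=> [i|]; first exact: hol_mul.
by apply: filterS e => y ->; rewrite mulr_sumr; apply: eq_bigr => i _; rewrite mulrA.
Qed.
Lemma inI_opp H : inI f q H -> inI f q (fun y => - H y).
Proof.
move=> h; apply: (inI_eq (H := fun y => -1 * H y)); last by apply: filterE => y; rewrite mulN1r.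
by apply: inI_mul => //; exact: hol_cst.
Qed.
Lemma inI_sub H H' : inI f q H -> inI f q H' -> inI f q (fun y => H y - H' y).
Proof. by move=> h h'; apply: inI_add => //; exact: inI_opp. Qed.
Lemma inI_sum (T : Type) (s : seq T) (P : pred T) (F : T -> V -> K) :
  (forall i, P i -> inI f q (F i)) -> inI f q (fun y => \sum_(i <- s | P i) F i y).
Proof.
move=> h; elim: s => [|i s ih].
  by apply: (inI_eq inI0); apply: filterE => y; rewrite big_nil.
apply: (inI_eq (H := fun y => (if P i then F i y else 0) + \sum_(j <- s | P j) F j y)).
  apply: (inI_add _ ih); case Pi: (P i); [exact: h|exact: inI0].
by apply: filterE => y; rewrite big_cons; case: ifP => // _; rewrite add0r.
Qed.

Definition Iset : set (@germ K V (vect_manifold V) q) := [set x | exists2 H, inI f q H & x = gm q H].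

Lemma IsetP H : hol H q -> Iset (gm q H) <-> inI f q H.
Proof.
move=> hH; split=> [[H' hI /gmP e]|h]; last by exists H.
by apply: (inI_eq hI); apply: filterS (e hH (inI_hol hI)) => y ->.
Qed.

Lemma Iset_ideal : isideal setT Iset.
Proof.
split=> [//| |_ _ [H h ->] [H' h' ->]|a _ _ [H h ->]].
- by exists (fun=> 0); [exact: inI0|exact: gm0].
- by rewrite gmD; try exact: inI_hol; exists (fun y => H y + H' y) => //; exact: inI_add.
- rewrite -[a]gvK gmM; [|exact: gv_hol|exact: inI_hol].
  by exists (fun y => gv a y * H y) => //; apply: inI_mul => //; exact: gv_hol.
Qed.
End Gen.
Arguments Iset {N} f q _.

Lemma inI_near N (f : 'I_N -> V -> K) q H : inI f q H -> \forall y \near q, inI f y H.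
Proof.
move=> [c [hc e]].
have hc' : \forall y \near q, forall i, hol (c i) y.
  by apply: near_forall => i; exact: hol_near.
by apply: filterS2 hc' (near_join e) => y h1 h2; exists c.
Qed.

Lemma inI_zero N (f : 'I_N -> V -> K) q H : inI f q H -> (forall i, f i q = 0) -> H q = 0.
Proof.
move=> [c [hc e]] f0; rewrite (nbhs_singleton e) big1 // => i _; by rewrite f0 mulr0.
Qed.

(** * Smooth points of a flat family *)

Section Local.
Variables (k : nat) (z0 : E) (rad : R) (N : nat) (f : 'I_N -> V -> K) (Zt : K -> set E).
Let p0 : V := (z0, 0).
Local Notation inW q := (nm (q - p0) < rad).
Hypothesis rad0 : 0 < rad.
Hypothesis f_hol : forall q, inW q -> forall i, hol (f i) q.
Hypothesis support : forall x t, inW (x, t) -> Zt t x <-> forall i, f i (x, t) = 0.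
Hypothesis flat : forall (q : V) H, inW q -> Zt q.2 q.1 -> hol H q ->
  inI f q (fun y => (y.2 - q.2) * H y) -> inI f q H.
Hypothesis fiber : forall x t (g : E -> K), inW (x, t) -> hol g x ->
  (\forall y \near x, Zt t y -> g y = 0) ->
  exists H, inI f (x, t) H /\ \forall y \near x, H (y, t) = g y.

(** The vectors [b] witness that the differentials of the equations are independent. *)
Definition smooth_at t (z : E) (F : 'I_k -> E -> K) (b : 'I_k -> E) :=
  [/\ forall i, hol (F i) z, (\matrix_(i, j) dd (F i) z (b j)) \in unitmx,
   \forall x \near z, Zt t x <-> forall i, F i x = 0 & Zt t z].

Definition smooth t z := exists F b, smooth_at t z F b.

Lemma smooth_zero t z F b i : smooth_at t z F b -> F i z = 0.
Proof. by move=> [_ _ /nbhs_singleton/= h /h]; exact. Qed.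

Lemma smooth_dual t z F b : smooth_at t z F b ->
  exists b', smooth_at t z F b' /\ forall i j, dd (F i) z (b' j) = (i == j)%:R.
Proof.
move=> [hF u nZ Zz]; set M := \matrix_(i, j) _ in u.
pose b' j := \sum_l invmx M l j *: b l.
have h i j : dd (F i) z (b' j) = (i == j)%:R.
  have := congr1 (fun A : 'M[K]_k => A i j) (mulmxV u); rewrite !mxE => <-.
  rewrite dd_sumr; apply: eq_bigr => l _; by rewrite dd_scaler mxE mulrC.
exists b'; split; last exact: h.
split; [exact: hF| |exact: nZ|exact: Zz].
rewrite (_ : \matrix_(i, j) _ = 1%:M) ?unitmx1 //.
by apply/matrixP => i j; rewrite !mxE h.
Qed.

Lemma inW_open (q : V) : inW q -> \forall y \near q, inW y.
Proof. by move=> h; exact: (ball_near (P := fun y => inW y) _ h). Qed.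

Lemma inW_slice x t : inW (x, t) -> \forall y \near x, inW (y, t).
Proof. by move=> /inW_open/near_slice. Qed.

Lemma inJ_Z x t H : inW (x, t) -> Zt t x -> inI f (x, t) H -> H (x, t) = 0.
Proof. by move=> xW /(support xW) f0 /inI_zero ->. Qed.

Lemma inJ_slice x t H : inW (x, t) -> inI f (x, t) H -> \forall y \near x, Zt t y -> H (y, t) = 0.
Proof.
move=> xW /inI_near/near_slice h; apply: filterS2 (inW_slice xW) h => y yW hy Zy.
exact: (inJ_Z yW Zy hy).
Qed.

Definition lifts t z (F : 'I_k -> E -> K) (G : 'I_k -> V -> K) :=
  [/\ forall i, inI f (z, t) (G i), \forall y \near z, forall i, G i (y, t) = F i y &
   forall H, inI f (z, t) H -> inI G (z, t) H].

(** [F] lifts to elements of the ideal because the fiber is reduced. An element of the ideal is, on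
    the fiber, a combination of the F_i; subtracting the same combination of the G_i leaves a
    multiple of the time coordinate, whose cofactor is in the ideal by flatness. [chain_tau]
    concludes that the G_i generate the ideal. *)
Lemma smooth_lifts t z F b : inW (z, t) -> smooth_at t z F b -> exists G, lifts t z F G.
Proof.
move=> zW sm; have [b' [[hF u nZ Zz] Fb]] := smooth_dual sm.
have F0 i := smooth_zero i sm.
have /choice[G hG] : forall i, exists G, inI f (z, t) G /\ \forall y \near z, G (y, t) = F i y.
  move=> i; apply: fiber => //; apply: filterS nZ => y [h _] /h; exact.
have hGh i : hol (G i) (z, t) by apply: (inI_hol (f_hol zW)); case: (hG i).
have GF : \forall y \near z, forall i, G i (y, t) = F i y.
  by apply: near_forall => i; case: (hG i).
exists G; split=> // [i|H hH]; first by case: (hG i).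
have hHh := inI_hol (f_hol zW) hH.
apply/(IsetP hGh hHh).
have CT := @chain_tau (z, t) (Iset G (z, t)) (Iset f (z, t)) (Iset_ideal hGh).
apply: CT; last by exists H.
move=> _ [H1 hH1 ->]; have hol1 := inI_hol (f_hol zW) hH1.
have [|c [hc e]] := hadamard_submersion nice_E hF Fb F0 (hol_slice hol1).
  apply: filterS2 nZ (inJ_slice zW hH1) => y [_ h1] h2 Fy; apply: h2; exact: h1.
pose S (y : V) := \sum_i c i y.1 * G i y.
have hS : inI G (z, t) S.
  exists (fun i y => c i y.1); split=> [i|]; first exact: (hol_fstc (q := (z, t))).
  exact: filterE.
have hSh := inI_hol hGh hS.
have [|H' [hH' eH']] := div_tau (q := (z, t)) (H := fun y => H1 y - S y) (hol_sub hol1 hSh).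
  apply: filterS2 e GF => y; rewrite /= => e1 e2; rewrite e1 /S /=.
  by apply/eqP; rewrite subr_eq0; apply/eqP; apply: eq_bigr => i _; rewrite e2.
have htH := hol_mul (tau_hol (z, t) (z, t)) hH'.
have hJ' : inI f (z, t) H'.
  apply: flat => //; apply: (inI_eq (H := fun y => H1 y - S y)) => //.
  apply: inI_sub => //; apply: inI_sum => i _; apply: inI_mul; last by case: (hG i).
  exact: (hol_fstc (q := (z, t))).
exists (gm (z, t) H'); first by exists H'.
rewrite /tau gmM // ?gmB //; last exact: tau_hol.
apply/(IsetP hGh); first exact: hol_sub.
apply: (inI_eq hS); apply: filterS eH' => y <-; by rewrite subKr.
Qed.

(** The total space is smooth at a smooth point of a fiber. [psi] straightens the G_i, so it maps
    the kernel of their differentials into the total space, and it respects time because the vectors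
    (b', 0) have no time component. Nearby points are smooth points of their own fibers. *)
Lemma smooth_param t z F b : inW (z, t) -> smooth_at t z F b ->
  exists (G : 'I_k -> V -> K) (psi : V -> V) (b' : 'I_k -> E),
  [/\ lifts t z F G, forall i j, dd (G i) (z, t) (b' j, 0) = (i == j)%:R,
    [/\ hol psi 0, psi 0 = (z, t) & forall w, dd psi 0 w = w],
    \forall y \near (0 : V), (psi y).2 = t + y.2 &
    \forall y \near (0 : V), (forall i, dd (G i) (z, t) y = 0) ->
      [/\ inW (psi y), Zt (psi y).2 (psi y).1 &
       smooth_at (psi y).2 (psi y).1 (fun i x => G i (x, (psi y).2)) b']].
Proof.
move=> zW sm; have [b' [sm' Fb]] := smooth_dual sm.
have [G lG] := smooth_lifts zW sm'; have [GJ GF JG] := lG.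
have [hF u nZ Zz] := sm'.
have hG i : hol (G i) (z, t) by apply: (inI_hol (f_hol zW)).
have Gb i j : dd (G i) (z, t) (b' j, 0) = (i == j)%:R.
  rewrite -Fb -dd_slice; last exact: hol_dif.
  apply/esym/dd_near_eq; first by apply: filterS GF => y ->.
  exact: (hol_dif (hol_slice (hG i))).
have G0 i : G i (z, t) = 0 by rewrite (nbhs_singleton GF) (smooth_zero i sm).
have [psi [hpsi psi0 dpsi e1 e2]] := straighten nice_V (fun j => (b' j, 0)) hG G0.
have nW : \forall q \near (z, t), inW q by exact: inW_open.
have npsi P : (\forall q \near (z, t), P q) -> \forall y \near (0 : V), P (psi y).
  by move=> h; apply: (near_comp (P := P) hpsi); rewrite psi0.
have t2 : \forall y \near (0 : V), (psi y).2 = t + y.2.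
  apply: filterS e1 => y; move=> {2}<-; rewrite /straight /=.
  rewrite (big_morph (snd : V -> K) (fun _ _ => erefl) erefl) big1 ?addr0 => [|i _].
    by rewrite addrC subrK.
  by rewrite /= scaler0.
exists G, psi, b'; split=> //.
have nG : \forall q \near (z, t), forall i, inI f q (G i) by apply: near_forall => i; exact: inI_near.
have nf : \forall q \near (z, t), forall i, inI G q (f i).
  by apply: near_forall => i; apply: inI_near; apply: JG; exact: inI_gen.
have nZG : \forall q \near (z, t), Zt q.2 q.1 <-> forall i, G i q = 0.
  apply: filterS3 nW nG nf => -[x s] qW h1 h2; rewrite (support qW); split=> h i.
    exact: (inI_zero (h1 i)).
  exact: (inI_zero (h2 i)).
have nhG : \forall q \near (z, t), forall i, hol (G i) q.
  by apply: near_forall => i; exact: hol_near.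
have nu : \forall q \near (z, t), \det (\matrix_(i, j) dd (G i) q (b' j, 0)) != 0.
  pose D q := \det (\matrix_(i, j) dd (G i) q (b' j, 0)).
  have hD : hol D (z, t).
    rewrite /D /determinant; apply: hol_sum => s _; apply: hol_mul; first exact: hol_cst.
    apply: hol_prod => i _.
    have hh j : hol (fun q => (\matrix_(i, j) dd (G i) q (b' j, 0)) i j) (z, t).
      rewrite (_ : (fun q => _) = fun q => dd (G i) q (b' j, 0)); first exact: hol_ddK.
      by apply/funext => q; rewrite mxE.
    exact: hh.
  apply: (near_comp (P := fun c => c != 0) hD).
  have D1 : D (z, t) = 1.
    rewrite /D (_ : \matrix_(i, j) _ = 1%:M) ?det1 //.
    by apply/matrixP => i j; rewrite !mxE Gb.
  rewrite D1; apply/near_nmP; exists 1 => // y h; apply: contraTneq h => ->.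
  by rewrite sub0r nmN nm1 ltxx.
have all1 : \forall q \near (z, t), [/\ inW q, Zt q.2 q.1 <-> forall i, G i q = 0 &
    (forall i, G i q = 0) -> smooth_at q.2 q.1 (fun i x => G i (x, q.2)) b'].
  have nj := near_join nZG.
  near=> q; have qW : inW q by near: q.
  have qZ : Zt q.2 q.1 <-> forall i, G i q = 0 by near: q.
  have qh : forall i, hol (G i) q by near: q.
  split=> // Gq; split; last exact/qZ.
  - by move=> i; exact: hol_slice.
  - rewrite unitmxE unitfE.
    have -> : \matrix_(i, j) dd (fun x => G i (x, q.2)) q.1 (b' j) =
        \matrix_(i, j) dd (G i) q (b' j, 0).
      apply/matrixP => i j; rewrite !mxE dd_slice; first by case: (q).
      by have := hol_dif (qh i); case: (q).
    by near: q.
  - have nq : \forall y \near q, Zt y.2 y.1 <-> forall i, G i y = 0 by near: q.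
    exact: (near_slice nq).
apply: filterS2 (npsi _ all1) e1 => y [h1 h2 h3] e Gy.
have Gp i : G i (psi y) = 0 by rewrite -(dd_straight Gb i (psi y)) e Gy.
by split=> //; [exact/h2|exact: h3].
Unshelve. all: by end_near.
Qed.

Hypothesis dense : forall x, inW (x, 0) -> Zt 0 x -> forall r : R, 0 < r ->
  exists y, nm (y - x) < r /\ smooth 0 y.

Lemma smooth_Z t z : smooth t z -> Zt t z.
Proof. by move=> [F [b []]]. Qed.

Lemma zero_limit (U : normedModType K) (H : U -> K) x : differentiable H x ->
  (forall r : R, 0 < r -> exists2 y, nm (y - x) < r & H y = 0) -> H x = 0.
Proof.
move=> dH h; apply/eqP; apply: contrapT => /negP Hx.
have [r r0 hr] := differentiable_nm_continuous dH (nm_gt0 Hx).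
by have [y /hr] := h r r0; move=> h1 h2; rewrite h2 sub0r nmN ltxx in h1.
Qed.

Lemma vanish_Z0 (H : V -> K) : hol H p0 ->
  (\forall q \near p0, smooth q.2 q.1 -> H q = 0) -> \forall x \near z0, Zt 0 x -> H (x, 0) = 0.
Proof.
move=> hH h.
have hW : inW p0 by rewrite subrr nm0.
have h1 := near_slice (near_join h); have h2 := near_slice (hol_near hH).
apply: filterS3 (inW_slice hW) h1 h2 => x xW nx hx Zx.
apply: (zero_limit (H := fun y => H (y, 0))); first exact: (hol_dif (hol_slice hx)).
move=> r r0; move: (near_slice nx) => /near_nmP[r' r'0 hr'].
have [|y [yr sy]] := dense xW Zx (r := Num.min r r'); first by rewrite lt_min r0.
move: yr; rewrite lt_min => /andP[y1 y2]; exists y => //.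
exact: hr'.
Qed.

(** By density of smooth points [H] vanishes on the central fiber, so it is t H' up to an element of
    the ideal. At smooth points with t nonzero H' vanishes as well; at those with t = 0 it vanishes
    as a limit along a curve in the total space transversal to the fiber. So the argument repeats
    with H'. *)
Lemma vanish_inJ (H : V -> K) : hol H p0 ->
  (\forall q \near p0, smooth q.2 q.1 -> H q = 0) -> inI f p0 H.
Proof.
move=> hH hv; have hW : inW p0 by rewrite subrr nm0.
have hf := f_hol hW.
apply/(IsetP hf hH).
pose Q := [set d | exists H, [/\ hol H p0, d = gm p0 H & \forall q \near p0, smooth q.2 q.1 -> H q = 0]].
have CT := @chain_tau p0 (Iset f p0) Q (Iset_ideal hf).
apply: CT; last by exists H.
move=> _ [H1 [h1 -> v1]].
have [G [GJ Ge]] := fiber hW (hol_slice h1) (vanish_Z0 h1 v1).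
have hG := inI_hol hf GJ.
have [|H' [hH' eH']] := div_tau (q := p0) (H := fun y => H1 y - G y) (hol_sub h1 hG).
  by apply: filterS Ge => y /= ->; rewrite subrr.
have htH := hol_mul (tau_hol p0 p0) hH'.
exists (gm p0 H'); last first.
  rewrite /tau gmM // ?gmB //; last exact: tau_hol.
  apply/(IsetP hf); first exact: hol_sub.
  by apply: (inI_eq GJ); apply: filterS eH' => y <-; rewrite subKr.
exists H'; split=> //.
have nz : \forall q \near p0, smooth q.2 q.1 -> q.2 != 0 -> H' q = 0.
  apply: filterS3 (inW_open hW) (inI_near GJ) (filterI v1 eH') => -[x t] qW qG [v2 e] sq t0.
  have := e; rewrite v2 // (inJ_Z qW (smooth_Z sq) qG) subrr /= subr0 => /esym/eqP.
  by rewrite mulf_eq0 (negPf t0) => /eqP.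
apply: filterS3 (inW_open hW) (near_join nz) (hol_near hH') => -[z t] qW nzq hq sq.
have [t0|t0] := eqVneq t 0; last exact: (nbhs_singleton nzq).
move: sq => [F [b sm]]; have [G1 [psi [b' [lG Gb [hpsi psi0 dpsi] e2 e3]]]] := smooth_param qW sm.
(* A vector tangent to the total space with time component 1. On the curve psi (s nu) the time is t
   + s, so for t = 0 its points with small nonzero s are off the central fiber. *)
pose nu : V := (0, 1) - \sum_i dd (G1 i) (z, t) (0, 1) *: (b' i, 0).
have nu2 : nu.2 = 1.
  rewrite /nu /= (big_morph (snd : V -> K) (fun _ _ => erefl) erefl) big1 ?subr0 // => i _.
  by rewrite /= scaler0.
have Gnu i (s : K) : dd (G1 i) (z, t) (s *: nu) = 0.
  rewrite dd_scaler /nu dd_addr dd_oppr dd_sumr (bigD1 i) //= dd_scaler Gb eqxx big1.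
    by rewrite addr0 -[X in _ - X]/(_ * 1) mulr1 subrr scaler0.
  by move=> j ji; rewrite dd_scaler Gb eq_sym (negPf ji) scaler0.
have [dl _] := hasd_diff (line_hasd (0 : V) nu 0).
have hline : hol (fun s : K => 0 + s *: nu) 0.
  by apply: filterE => s; case: (hasd_diff (line_hasd (0 : V) nu s)).
have nl P : (\forall y \near (0 : V), P y) -> \forall s \near (0 : K), P (0 + s *: nu).
  by move=> h; apply: (near_comp (P := P) hline); rewrite scale0r addr0.
have dpl : differentiable (fun s : K => psi (0 + s *: nu)) 0.
  by apply: dif_comp dl _; rewrite scale0r addr0; exact: hol_dif.
have dHp : differentiable (fun s : K => H' (psi (0 + s *: nu))) 0.
  by apply: dif_comp dpl _; rewrite scale0r addr0 psi0; exact: hol_dif.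
have := zero_limit dHp; rewrite scale0r addr0 psi0; apply=> r r0.
have np : \forall y \near (0 : V), smooth (psi y).2 (psi y).1 -> (psi y).2 != 0 -> H' (psi y) = 0.
  by apply: (near_comp (P := fun q => smooth q.2 q.1 -> q.2 != 0 -> H' q = 0) hpsi); rewrite psi0.
have [d d0 hd] : exists2 d : R, 0 < d & forall s : K, nm (s - 0) < d ->
   [/\ (psi (0 + s *: nu)).2 = t + s, smooth (psi (0 + s *: nu)).2 (psi (0 + s *: nu)).1 &
    smooth (psi (0 + s *: nu)).2 (psi (0 + s *: nu)).1 -> (psi (0 + s *: nu)).2 != 0 -> H' (psi (0 + s *: nu)) = 0].
  apply/near_nmP; apply: filterS3 (nl _ e2) (nl _ e3) (nl _ np) => s a1 a2 a3.
  split=> //; first by rewrite a1 add0r; congr (t + _); rewrite -[LHS]/(s * nu.2) nu2 mulr1.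
  have [|_ _ sa] := a2; first by move=> i; rewrite add0r.
  by exists (fun i x => G1 i (x, (psi (0 + s *: nu)).2)), b'.
pose s : K := ((Num.min r d / 2)%:C)%C.
have m0 : 0 < Num.min r d by rewrite lt_min r0.
have ns : nm s = Num.min r d / 2 by rewrite nm_real ger0_norm // divr_ge0 // ltW.
have mr : Num.min r d <= r by rewrite ge_min lexx.
have md : Num.min r d <= d by rewrite ge_min lexx orbT.
have [|a1 a2 a3] := hd s; first by rewrite subr0 ns; lra.
exists s; first by rewrite subr0 ns; lra.
apply: a3 => //; rewrite a1 t0 add0r.
by apply: contraTneq (divr_gt0 m0 (ltr0Sn R 1)) => s0; rewrite -ns s0 nm0 ltxx.
Qed.
End Local.
End Ideals.

(** * The Hamiltonian function *)

Arguments Iset {R n N} f q _.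

Lemma comb_sum (O : comPzRingType) (S Q : set O) (hS : subring S) (hQ : isprime S Q) k
  (A : set 'rV[O]_k) (T : Type) (s : seq T) (c : T -> O) (r : T -> 'rV[O]_k) :
  (forall i, S (c i)) -> (forall i, A (r i)) -> comb S Q A (\sum_(i <- s) c i *: r i).
Proof.
move=> Sc Ar; elim: s => [|i s ih]; last by rewrite big_cons; apply: combD.
by rewrite big_nil; apply: comb0 => j; rewrite mxE; exact: (id0 (prime_id hQ)).
Qed.

Section Extension.
Variable R : realType.
Notation K := (Cplx R).
Variable n : nat.
Local Notation E := 'rV[K]_n.
Local Notation V := (E * K)%type.

Lemma hol_det (U : normedModType K) k (a : 'I_k -> 'I_k -> U -> K) q : (forall i j, hol (a i j) q) ->
  hol (fun y => \det (\matrix_(i, j) a i j y)) q.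
Proof.
move=> h; rewrite /determinant; apply: hol_sum => s _; apply: hol_mul; first exact: hol_cst.
apply: hol_prod => i _.
have hh j : hol (fun y => (\matrix_(i, j) a i j y) i j) q.
  by rewrite (_ : (fun y => _) = a i j) //; apply/funext => y; rewrite mxE.
exact: hh.
Qed.

Lemma gm_det (U : normedModType K) k (a : 'I_k -> 'I_k -> U -> K) (q : U) : (forall i j, hol (a i j) q) ->
  \det (\matrix_(i, j) gm q (a i j)) = gm q (fun y => \det (\matrix_(i, j) a i j y)).
Proof.
move=> h; rewrite /determinant -gm_sum; last first.
  move=> s _; apply: hol_mul; first exact: hol_cst.
  apply: hol_prod => i _.
  have hh j : hol (fun y => (\matrix_(i, j) a i j y) i j) q.
    by rewrite (_ : (fun y => _) = a i j) //; apply/funext => y; rewrite mxE.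
  exact: hh.
apply: eq_bigr => s _.
pose b i y := a i (s i) y.
have hb i : hol (b i) q by exact: h.
have pE : \prod_i (\matrix_(i, j) gm q (a i j)) i (s i) = gm q (fun y => \prod_i b i y).
  transitivity (\prod_i gm q (b i)); first by apply: eq_bigr => i _; rewrite mxE.
  elim: (index_enum _) => [|i r ih].
    by rewrite big_nil gm1; congr gm; apply/funext => y; rewrite big_nil.
  rewrite big_cons ih gmM //; last by apply: hol_prod.
  by congr gm; apply/funext => y; rewrite big_cons.
rewrite pE.
have sE : (-1) ^+ odd_perm s = gm q (fun=> (-1) ^+ odd_perm s).
  case: (odd_perm s); rewrite ?expr0 ?expr1 ?gm1 //.
  rewrite -[LHS]sub0r gm0 gmB; try exact: hol_cst.
  by congr gm; apply/funext => y; rewrite sub0r.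
rewrite sE gmM; [|exact: hol_cst|exact: hol_prod].
congr gm; apply/funext => y; congr (_ * _); apply: eq_bigr => i _; by rewrite mxE.
Qed.

Lemma row_pair_sum (w : E) : (w, 0) = \sum_j w 0 j *: (delta_mx 0 j, 0) :> V.
Proof.
rewrite [RHS]surjective_pairing (big_morph (fst : V -> E) (fun _ _ => erefl) erefl).
rewrite (big_morph (snd : V -> K) (fun _ _ => erefl) erefl) /= -row_sum_delta big1 //= => j _.
by rewrite scaler0.
Qed.

Definition covec (th : 'I_n -> E -> K) (x w : E) : K := \sum_j th j x * w 0 j.

Lemma covec_hol th (x w : E) : (forall j, hol (th j) x) -> hol (fun x => covec th x w) x.
Proof. by move=> h; apply: hol_sum => j _; apply: hol_mul => //; exact: hol_cst. Qed.

Lemma covec_lin th x (c : K) (v w : E) : covec th x (c *: v + w) = c * covec th x v + covec th x w.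
Proof. by rewrite /covec mulr_sumr -big_split; apply: eq_bigr => j _; rewrite !mxE /=; ring. Qed.

Record local_family (k : nat) (z0 : E) (rad : R) (N : nat) (f : 'I_N -> V -> K) (Zt : K -> set E)
    (th : 'I_n -> E -> K) : Prop := LocalFamily {
  lf_rad : 0 < rad;
  lf_hol : forall q : V, nm (q - (z0, 0)) < rad -> forall i, hol (f i) q;
  lf_support : forall x t, nm ((x, t) - (z0, 0) : V) < rad -> Zt t x <-> forall i, f i (x, t) = 0;
  lf_flat : forall (q : V) H, nm (q - (z0, 0)) < rad -> Zt q.2 q.1 -> hol H q ->
    inI f q (fun y => (y.2 - q.2) * H y) -> inI f q H;
  lf_fiber : forall x t (g : E -> K), nm ((x, t) - (z0, 0) : V) < rad -> hol g x ->
    (\forall y \near x, Zt t y -> g y = 0) ->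
    exists H, inI f (x, t) H /\ \forall y \near x, H (y, t) = g y;
  lf_dense : forall x, nm ((x, 0) - (z0, 0) : V) < rad -> Zt 0 x -> forall r : R, 0 < r ->
    exists y, nm (y - x) < r /\ smooth k Zt 0 y;
  lf_base : Zt 0 z0;
  lf_th : forall j, hol (th j) z0;
  lf_leg : forall t z (F : 'I_k -> E -> K) b w, nm ((z, t) - (z0, 0) : V) < rad ->
    smooth_at Zt t z F b -> (forall i, dd (F i) z w = 0) -> covec th z w = 0;
  lf_normal : forall a b : E -> K, hol a z0 -> hol b z0 ->
    (forall c : E -> K, hol c z0 -> (\forall x \near z0, Zt 0 x -> b x * c x = 0) ->
       \forall x \near z0, Zt 0 x -> c x = 0) ->
    (exists d (r : 'I_d -> E -> K), (forall i, hol (r i) z0) /\ \forall x \near z0, Zt 0 x ->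
       a x ^+ d + \sum_(i < d) r i x * a x ^+ i * b x ^+ (d - i) = 0) ->
    exists c : E -> K, hol c z0 /\ \forall x \near z0, Zt 0 x -> a x = c x * b x }.

Lemma dd_inI k (G : 'I_k -> V -> K) q H : (forall i, hol (G i) q) -> (forall i, G i q = 0) ->
  inI G q H -> exists c : 'I_k -> K, forall v, dd H q v = \sum_i c i * dd (G i) q v.
Proof.
move=> hG G0 [c [hc e]]; exists (fun i => c i q) => v.
have hs : hol (fun y => \sum_i c i y * G i y) q by apply: hol_sum => i _; exact: hol_mul.
have dh i : differentiable (fun y => c i y * G i y) q by apply: hol_dif; exact: hol_mul.
rewrite (dd_near_eq (f := fun y => \sum_i c i y * G i y)); last 2 first.
- by apply: filterS e => y ->.
- exact: hol_dif.
rewrite dd_sum //; apply: eq_bigr => i _.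
by rewrite dd_mul ?G0 ?mul0r ?addr0 //; exact: hol_dif.
Qed.

Section Family.
Variables (k : nat) (z0 : E) (rad : R) (N : nat) (f : 'I_N -> V -> K) (Zt : K -> set E).
Variable th : 'I_n -> E -> K.
Hypothesis L : local_family k z0 rad f Zt th.
Let p0 : V := (z0, 0).
Local Notation inW q := (nm (q - p0) < rad).
Local Notation O := (@germ K V (vect_manifold V) p0).
Let rad0 := lf_rad L. Let f_hol := lf_hol L. Let support := lf_support L.
Let flat := lf_flat L. Let fiber := lf_fiber L. Let dense := lf_dense L.
Let W0 : inW p0. Proof. by rewrite subrr nm0. Qed.
Let f0 : forall i, hol (f i) p0. Proof. exact: f_hol. Qed.
Let J : set O := Iset f p0.

Lemma lf_vanish (H : V -> K) : hol H p0 ->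
  (\forall q \near p0, smooth k Zt q.2 q.1 -> H q = 0) -> inI f p0 H.
Proof. exact: (vanish_inJ rad0 f_hol support flat fiber dense). Qed.

(* The ideal J + t O of the central fiber. *)
Definition zero_fiber : set O := [set g | exists2 H, hol H p0 /\
  (\forall x \near z0, Zt 0 x -> H (x, 0) = 0) & g = gm p0 H].
Local Notation It := zero_fiber.

Lemma zero_fiberP H : hol H p0 -> It (gm p0 H) <-> \forall x \near z0, Zt 0 x -> H (x, 0) = 0.
Proof.
move=> hH; split=> [[H' [hH' h] /gmP e]|h]; last by exists H.
by have := near_slice (e hH hH'); apply: filterS2 h => x h1 /= ->.
Qed.

Lemma zero_fiber_dec H : hol H p0 -> It (gm p0 H) ->
  exists G H', [/\ inI f p0 G, hol H' p0 & \forall y \near p0, H y = G y + (y.2 - p0.2) * H' y].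
Proof.
move=> hH /(zero_fiberP hH) h.
have [G [GJ Ge]] := fiber W0 (hol_slice hH) h; have hG := inI_hol f0 GJ.
have [|H' [hH' e]] := div_tau (q := p0) (H := fun y => H y - G y) (hol_sub hH hG).
  by apply: filterS Ge => y /= ->; rewrite subrr.
exists G, H'; split=> //; apply: filterS e => y <-; by rewrite addrC subrK.
Qed.

Lemma zero_fiberJ H : inI f p0 H -> It (gm p0 H).
Proof. by move=> h; apply/(zero_fiberP (inI_hol f0 h)); exact: (inJ_slice support). Qed.

Lemma zero_fiber_ideal : isideal setT It.
Proof.
split=> [//| |_ _ [H [h v] ->] [H' [h' v'] ->]|a _ _ [H [h v] ->]].
- by exists (fun=> 0); [split; [exact: hol_cst|exact: filterE]|exact: gm0].
- rewrite gmD //; exists (fun y => H y + H' y) => //; split; first exact: hol_add.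
  by apply: filterS2 v v' => x v v' Zx; rewrite v // v' // addr0.
- rewrite -[a]gvK gmM //; last exact: gv_hol.
  exists (fun y => gv a y * H y) => //; split; first by apply: hol_mul => //; exact: gv_hol.
  by apply: filterS v => x v Zx; rewrite v // mulr0.
Qed.

Lemma zero_fiber1 : ~ It 1.
Proof.
rewrite gm1 => /(zero_fiberP (hol_cst _ _))/nbhs_singleton/(_ (lf_base L))/eqP.
by rewrite oner_eq0.
Qed.

Lemma zero_fiber_icl : icl It.
Proof.
move=> a b; rewrite -[a]gvK -[b]gvK; have ha := gv_hol a; have hb := gv_hol b.
move: (gv a) (gv b) ha hb => {}a {}b ha hb hreg [d [r hr]].
have [||c [hc e]] := lf_normal L (hol_slice ha) (hol_slice hb).
- move=> c hc bc.
  have hc' : hol (fun y : V => c y.1) p0 by exact: (hol_fstc (q := p0)).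
  have := hreg (gm p0 (fun y => c y.1)); rewrite gmM // => h.
  have /(zero_fiberP hc') : It (gm p0 (fun y => c y.1)).
    by apply: h; apply/(zero_fiberP (hol_mul hb hc')).
  exact.
- exists d, (fun i x => gv (r i) (x, 0)); split=> [i|]; first exact: (hol_slice (gv_hol (r i))).
  pose S (y : V) := a y ^+ d + \sum_(i < d) gv (r i) y * a y ^+ i * b y ^+ (d - i).
  have ht i : hol (fun y => gv (r i) y * a y ^+ i * b y ^+ (d - i)) p0.
    by apply: hol_mul; [apply: hol_mul; [exact: gv_hol|exact: hol_exp]|exact: hol_exp].
  have hS : hol S p0 by apply: hol_add; [exact: hol_exp|apply: hol_sum => i _; exact: ht].
  suff : It (gm p0 S) by move=> /(zero_fiberP hS).
  rewrite (_ : gm p0 S = gm p0 a ^+ d + \sum_(i < d) r i * gm p0 a ^+ i * gm p0 b ^+ (d - i)) //.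
  rewrite /S -gmD; [|exact: hol_exp|by apply: hol_sum => i _; exact: ht].
  rewrite gmX // -gm_sum //; congr (_ + _); apply: eq_bigr => i _.
  rewrite -[in RHS](gvK (r i)) !gmX // !gmM //; try exact: gv_hol; try exact: hol_exp.
  by apply: hol_mul; [exact: gv_hol|exact: hol_exp].
have hc' : hol (fun y : V => c y.1) p0 by exact: (hol_fstc (q := p0)).
exists (gm p0 (fun y => c y.1)); rewrite gmM // gmB //; last exact: hol_mul.
apply/zero_fiberP; first by apply: hol_sub => //; exact: hol_mul.
by apply: filterS e => x e Zx; rewrite /= e // subrr.
Qed.

Lemma zero_fiber_prime : isprime setT It.
Proof.
apply: (normal_local_prime (@top_subring R n p0) (@top_noeth R n p0) zero_fiber_ideal zero_fiber1 _ _ zero_fiber_icl).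
- move=> x; rewrite -[x]gvK; have hx := gv_hol x; move: (gv x) hx => {}x hx.
  rewrite gmM // => /(zero_fiberP (hol_mul hx hx)) h; apply/(zero_fiberP hx).
  by apply: filterS h => y h /h/eqP; rewrite mulf_eq0 orbb => /eqP.
- move=> e; rewrite -[e]gvK; have hx := gv_hol e; move: (gv e) hx => {}e hx He.
  have iI := zero_fiber_ideal; have sT := @top_subring R n p0.
  have He' : It (gm p0 (fun y => e y * e y - e y)) by rewrite -gmB // -?gmM //; exact: hol_mul.
  have /eqP : e p0 * e p0 - e p0 = 0.
    move: He' => /(zero_fiberP (hol_sub (hol_mul hx hx) hx))/nbhs_singleton; apply.
    exact: (lf_base L).
  rewrite -{3}[e p0]mulr1 -mulrBr mulf_eq0 => /orP[/eqP e0|e1].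
    left; have [u hu] : exists u, (1 - gm p0 e) * u = 1.
      rewrite {1}gm1 gmB //; last exact: hol_cst.
      by apply: gm_unit; [apply: hol_sub => //; exact: hol_cst|rewrite e0 subr0 oner_eq0].
    have -> : gm p0 e = - u * (gm p0 e * gm p0 e - gm p0 e).
      by rewrite -{1}[gm p0 e]mulr1 -hu; ring.
    exact: (idM iI).
  have e1' : e p0 != 0 by move: e1; rewrite subr_eq0 => /eqP ->; exact: oner_neq0.
  right; have [u hu] := gm_unit hx e1'.
  have -> : 1 - gm p0 e = - u * (gm p0 e * gm p0 e - gm p0 e).
    by rewrite -{1}hu -{2}[gm p0 e]mulr1 -{1}hu; ring.
  exact: (idM iI).
Qed.

Lemma sum_lift (G : 'I_k -> V -> K) q (b : 'I_k -> E) (phi : E -> K) :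
  (forall (c : K) v w, phi (c *: v + w) = c * phi v + phi w) ->
  (forall i j, dd (G i) q (b j, 0) = (i == j)%:R) ->
  (forall w, (forall i, dd (G i) q (w, 0) = 0) -> phi w = 0) ->
  forall w, phi w = \sum_i phi (b i) * dd (G i) q (w, 0).
Proof.
move=> lin Gb h w; apply/eqP; rewrite -subr_eq0; apply/eqP.
pose w' := w - \sum_i dd (G i) q (w, 0) *: b i.
have pB := ellB lin; have pZ := ellZ lin.
have <- : phi w' = phi w - \sum_i phi (b i) * dd (G i) q (w, 0).
  rewrite /w' pB (big_morph phi (ellD lin) (ell0 lin)); congr (_ - _).
  by apply: eq_bigr => i _; rewrite pZ mulrC.
apply: h => i.
have -> : (w', 0) = (w, 0) - \sum_j dd (G j) q (w, 0) *: (b j, 0) :> V.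
  apply/eqP; rewrite xpair_eqE /= (big_morph (fst : V -> E) (fun _ _ => erefl) erefl) eqxx /=.
  by rewrite (big_morph (snd : V -> K) (fun _ _ => erefl) erefl) big1 ?subr0 //= => j _; rewrite scaler0.
rewrite dd_addr dd_oppr dd_sumr (bigD1 i) //= dd_scaler Gb eqxx big1; last first.
  by move=> j ji; rewrite dd_scaler Gb eq_sym (negPf ji) scaler0.
by rewrite addr0 -[X in _ - X]/(_ * 1) mulr1 subrr.
Qed.

Lemma smooth_frame (q : V) : inW q -> smooth k Zt q.2 q.1 -> exists (G : 'I_k -> V -> K) (b : 'I_k -> E),
  [/\ forall i, hol (G i) q, forall i, G i q = 0, forall i j, dd (G i) q (b j, 0) = (i == j)%:R,
    forall H, inI f q H -> inI G q H &
    forall w, covec th q.1 w = \sum_i covec th q.1 (b i) * dd (G i) q (w, 0)] /\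
    forall i, inI f q (G i).
Proof.
case: q => z t qW [F [b0 sm]].
have [G [psi [b [[GJ GF JG] Gb _ _ _]]]] := smooth_param f_hol support flat fiber qW sm.
have hG i : hol (G i) (z, t) by apply: (inI_hol (f_hol qW)).
have G0 i : G i (z, t) = 0 by rewrite (nbhs_singleton GF) (smooth_zero i sm).
exists G, b; split=> //; split=> // w.
apply: (@sum_lift G (z, t) b (covec th z)) => // [c v v'|v hv]; first exact: covec_lin.
apply: (lf_leg L qW sm) => i; rewrite -(hv i) -dd_slice; last exact: hol_dif.
by apply: dd_near_eq; [apply: filterS GF => y ->|exact: (hol_dif (hol_slice (hG i)))].
Qed.

(* dF = B (theta - s dt) modulo J: thus B is a denominator of s. *)
Definition conormal (B F : V -> K) := [/\ hol B p0, inI f p0 F &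
  forall w, inI f p0 (fun y => dd F y (w, 0) - B y * covec th y.1 w)].

Let th_hol (q : V) w : (forall j, hol (th j) q.1) -> hol (fun y : V => covec th y.1 w) q.
Proof. by move=> h; apply: (@hol_fstc R n (fun x => covec th x w)); exact: covec_hol. Qed.
Let th0 w : hol (fun y : V => covec th y.1 w) p0.
Proof. by apply: th_hol => j; exact: (lf_th L). Qed.

Lemma inJ_smooth q H : inW q -> smooth k Zt q.2 q.1 -> inI f q H -> H q = 0.
Proof. by case: q => x t qW /smooth_Z Zx; exact: (inJ_Z support). Qed.

(** Both time derivatives should be -s times B and B'. Without s: at a smooth point the differential
    of B' F - B F' vanishes along M; it is a combination of the dG_i, which are independent along M,
    so it vanishes in the direction of time as well. *)
Lemma conormal_rel B F B' F' : conormal B F -> conormal B' F' ->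
  inI f p0 (fun y => B' y * dd F y (0, 1) - B y * dd F' y (0, 1)).
Proof.
move=> [hB FJ hF] [hB' FJ' hF'].
have F_hol := inI_hol f0 FJ; have F'_hol := inI_hol f0 FJ'.
apply: lf_vanish.
  by apply: hol_sub; apply: hol_mul => //; exact: hol_ddK.
pose e j : E := delta_mx 0 j.
have n1 : \forall q \near p0, forall j : 'I_n, inI f q (fun y => dd F y (e j, 0) - B y * covec th y.1 (e j)).
  by apply: near_forall => j; apply: inI_near.
have n2 : \forall q \near p0, forall j : 'I_n, inI f q (fun y => dd F' y (e j, 0) - B' y * covec th y.1 (e j)).
  by apply: near_forall => j; apply: inI_near.
have n3 : \forall q \near p0, hol B q /\ hol B' q by exact: (filterI (hol_near hB) (hol_near hB')).
have n4 : \forall q \near p0, inI f q F /\ inI f q F' by near=> q; split; near: q; exact: inI_near.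
have n5 : \forall q \near p0, (hol B q /\ hol B' q) /\ (inI f q F /\ inI f q F').
  by near=> q; split; near: q.
have nW := inW_open W0.
near=> q => sq.
have qW : inW q by near: q.
have [[hBq hB'q] [Fq F'q]] : (hol B q /\ hol B' q) /\ (inI f q F /\ inI f q F') by near: q.
have m1 : forall j : 'I_n, inI f q (fun y => dd F y (e j, 0) - B y * covec th y.1 (e j)) by near: q.
have m2 : forall j : 'I_n, inI f q (fun y => dd F' y (e j, 0) - B' y * covec th y.1 (e j)) by near: q.
have [G [b [[hG G0 Gb JG thG] _]]] := smooth_frame qW sq.
have zF H : inI f q H -> H q = 0 by exact: inJ_smooth.
pose Phi y := B' y * F y - B y * F' y.
have PJ : inI f q Phi by apply: inI_sub; exact: inI_mul.
have [c cE] := dd_inI hG G0 (JG _ PJ).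
have [hFq hF'q] : hol F q /\ hol F' q by split; apply: (inI_hol (f_hol qW)).
have dPhi v : dd Phi q v = B' q * dd F q v - B q * dd F' q v.
  rewrite dd_sub; [|by apply: hol_dif; exact: hol_mul..].
  rewrite !dd_mul; try exact: hol_dif.
  by rewrite (zF F) // (zF F') // !mul0r !addr0.
have ej j : dd Phi q (e j, 0) = 0.
  rewrite dPhi; have /eqP := zF _ (m1 j); rewrite subr_eq0 => /eqP ->.
  by have /eqP := zF _ (m2 j); rewrite subr_eq0 => /eqP ->; ring.
have ew w : dd Phi q (w, 0) = 0.
  by rewrite (row_pair_sum w) dd_sumr big1 // => j _; rewrite dd_scaler ej scaler0.
have c0 i : c i = 0.
  rewrite -(ew (b i)) cE (bigD1 i) //= Gb eqxx mulr1 big1 ?addr0 // => j ji.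
  by rewrite Gb (negPf ji) mulr0.
by rewrite -dPhi cE big1 // => i _; rewrite c0 mul0r.
Unshelve. all: by end_near.
Qed.

Definition conormal_set : set O := [set g | exists B F, conormal B F /\ g = gm p0 B].

(* If the minor Delta of k elements of J does not vanish, Cramer's rule expresses Delta times
   the contact form by their differentials. *)
Lemma conormal_minor (G : 'I_k -> V -> K) (w : 'I_k -> E) : (forall i, inI f p0 (G i)) ->
  exists F, conormal (fun y => \det (\matrix_(i, j) dd (G i) y (w j, 0)) ^+ 2) F.
Proof.
move=> GJ; pose M y : 'M[K]_k := \matrix_(i, j) dd (G i) y (w j, 0).
pose mu i y := \sum_j covec th y.1 (w j) * cofactor (M y) i j.
(* With the cofactors alone the relation would carry one determinant and could fail where it
   vanishes; the additional factor makes both sides vanish there. *)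
pose F y := \det (M y) * \sum_i mu i y * G i y.
have hG i := inI_hol f0 (GJ i).
have hD (q : V) : (forall i, hol (G i) q) -> hol (fun y => \det (M y)) q.
  by move=> h; apply: hol_det => i j; exact: hol_ddK.
have hmu i (q : V) : (forall j, hol (th j) q.1) -> (forall i, hol (G i) q) -> hol (mu i) q.
  move=> ht h; apply: hol_sum => j _; apply: hol_mul; first exact: th_hol.
  rewrite /cofactor; apply: hol_mul; first exact: hol_cst.
  rewrite (_ : (fun y => _) = fun y => \det (\matrix_(i', j') dd (G (lift i i')) y (w (lift j j'), 0))).
    by apply: hol_det => i' j'; exact: hol_ddK.
  by apply/funext => y; congr (\det _); apply/matrixP => i' j'; rewrite !mxE.
have hT j : hol (th j) p0.1 by exact: (lf_th L).
have FJ : inI f p0 F.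
  by apply: inI_mul; [exact: hD|apply: inI_sum => i _; apply: inI_mul => //; exact: hmu].
have hF := inI_hol f0 FJ.
exists F; split=> // [|v]; first by apply: hol_exp; exact: hD.
apply: lf_vanish.
  apply: hol_sub; first exact: hol_ddK.
  by apply: hol_mul => //; apply: hol_exp; exact: hD.
have n1 : \forall q \near p0, forall i, inI f q (G i) by apply: near_forall => i; exact: inI_near.
have n2 : \forall q \near p0, forall j, hol (th j) q.1.
  apply: near_forall => j; apply: (near_comp (f := fst) (P := fun x => hol (th j) x)); first exact: hol_fst.
  by apply: hol_near.
apply: filterS3 (inW_open W0) n1 n2 => q qW GJq htq sq.
have hGq i := inI_hol (f_hol qW) (GJq i).
have [Gs [b [[hGs Gs0 Gsb JGs thG] _]]] := smooth_frame qW sq.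
have G0 i : G i q = 0 by exact: inJ_smooth.
have hS : hol (fun y => \sum_i mu i y * G i y) q.
  by apply: hol_sum => i _; apply: hol_mul => //; exact: hmu.
have dF u : dd F q u = \det (M q) * \sum_i mu i q * dd (G i) q u.
  rewrite dd_mul; [|apply: hol_dif; exact: hD|exact: hol_dif].
  rewrite [X in _ + X * _]big1 ?mul0r ?addr0; last by move=> i _; rewrite G0 mulr0.
  rewrite dd_sum; last by move=> i _; apply: hol_dif; apply: hol_mul => //; exact: hmu.
  congr (_ * _); apply: eq_bigr => i _.
  rewrite dd_mul; [|apply: hol_dif; exact: hmu|exact: hol_dif].
  by rewrite G0 mul0r addr0.
rewrite dF -/(M q) expr2 -mulrA -mulrBr; have [->|D0] := eqVneq (\det (M q)) 0; first by rewrite mul0r.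
apply/eqP; rewrite mulf_eq0 (negPf D0) /= subr_eq0; apply/eqP.
have /choice[c cE] : forall i, exists c : 'I_k -> K, forall u, dd (G i) q u = \sum_l c l * dd (Gs l) q u.
  by move=> i; apply: (dd_inI hGs Gs0); exact: JGs.
pose C : 'M[K]_k := \matrix_(i, l) c i l.
pose X : 'M[K]_k := \matrix_(l, j) dd (Gs l) q (w j, 0).
pose y : 'cV[K]_k := \col_l dd (Gs l) q (v, 0).
pose tt : 'rV[K]_k := \row_l covec th q.1 (b l).
have ME : M q = C *m X by apply/matrixP => i j; rewrite !mxE cE; apply: eq_bigr => l _; rewrite !mxE.
have uM : M q \in unitmx by rewrite unitmxE unitfE.
have muE : \row_i mu i q = tt *m X *m \adj (M q).
  apply/rowP => i; rewrite !mxE; apply: eq_bigr => j _; rewrite !mxE; congr (_ * _).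
  by rewrite thG; apply: eq_bigr => l _; rewrite !mxE.
have -> : \sum_i mu i q * dd (G i) q (v, 0) = ((\row_i mu i q) *m (C *m y)) 0 0.
  rewrite mxE; apply: eq_bigr => i _; rewrite !mxE cE; congr (_ * _).
  by apply: eq_bigr => l _; rewrite !mxE.
have adjE : \adj (M q) = \det (M q) *: invmx (M q).
  by rewrite /invmx uM scalerA divff // scale1r.
have XC : X *m invmx (M q) *m C = 1%:M by apply: mulmx1C; rewrite mulmxA -ME mulmxV.
rewrite muE adjE -scalemxAr -scalemxAl -!mulmxA [X in tt *m X]mulmxA [X in tt *m X]mulmxA XC mul1mx.
rewrite mxE; congr (_ * _); rewrite mxE thG; apply: eq_bigr => l _; by rewrite !mxE.
Qed.

Let iI := zero_fiber_ideal.
Let sT := @top_subring R n p0.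

Lemma tau_in_It g : It (tau p0 * g).
Proof.
rewrite -[g]gvK /tau gmM; [|exact: tau_hol|exact: gv_hol].
apply/zero_fiberP; first by apply: hol_mul; [exact: tau_hol|exact: gv_hol].
by apply: filterE => x _; rewrite subrr mul0r.
Qed.

(** Dropping the derivation along t leaves a k by k minor of elements of [It], formed along M. Up to
    multiples of t, whose derivatives along M stay in [It], these elements may be taken in [J], and
    [conormal_minor] provides the square of the minor. *)
Lemma conormal_avoids P : isprime setT P -> It `<=` P -> minors (@ders R V p0) It P k.+1 ->
  exists2 b, conormal_set b & ~ P b.
Proof.
move=> hP IP hm; have iP := prime_id hP.
pose Dx : set (O -> O) := [set d | exists w : E, d = der (w, 0)].
have [|F [d [IF Dd nP]]] := minors_cols (Dx := Dx) (delta := der ((0, 1) : V)) sT hP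
  (fun _ _ => I) (fun _ _ _ _ => I) (fun _ _ _ _ => I) (fun _ _ => I) _ hm.
  move=> _ [[w s] ->]; exists (der (w, 0)), (gm p0 (fun=> s)); split=> // [|x]; first by exists w.
  rewrite /der gmM; [|exact: hol_cst|apply: hol_ddK; exact: gv_hol].
  rewrite gmD; [|apply: hol_ddK; exact: gv_hol|apply: hol_mul; [exact: hol_cst|apply: hol_ddK; exact: gv_hol]].
  congr gm; apply/funext => y; rewrite -[s * _]/(s *: _) -dd_scaler -dd_addr; congr (dd _ _ _).
  by apply/eqP; rewrite xpair_eqE /= scaler0 addr0 add0r -[s *: _]/(s * 1) mulr1 !eqxx.
have /choice[w wE] : forall j, exists w : E, d j = der (w, 0) by move=> j; exact: Dd.
pose A := [set r : 'rV[O]_k | exists2 G, inI f p0 G & r = \row_j gm p0 (fun y => dd G y (w j, 0))].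
have [|||M' AM' nM'] := @choose_rows O setT P sT hP k _ A _ _ _ nP => //.
  move=> i; exists 1; first by split=> //; case: hP.
  have [H [hH vH] FE] := IF i.
  have [G [H' [GJ hH' e]]] : exists G H', [/\ inI f p0 G, hol H' p0 &
      \forall y \near p0, H y = G y + (y.2 - p0.2) * H' y].
    by apply: zero_fiber_dec => //; rewrite -FE.
  have hG := inI_hol f0 GJ.
  rewrite (_ : 1 *: _ = \row_j gm p0 (fun y => dd G y (w j, 0)) +
     \row_j (tau p0 * gm p0 (fun y => dd H' y (w j, 0)))).
    apply: (comb_add hP); first by apply: (comb_mem sT hP); exists G.
    by apply: comb0 => j; rewrite mxE; apply: IP; exact: tau_in_It.
  apply/rowP => j; rewrite !mxE mul1r wE FE der_gm // /tau gmM; [|exact: tau_hol|exact: hol_ddK].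
  rewrite gmD; [|exact: hol_ddK|apply: hol_mul; [exact: tau_hol|exact: hol_ddK]].
  apply: gm_eq; first exact: hol_ddK.
  apply: filterS3 (near_join e) hG hH' => y ey dG dH'.
  have dt : differentiable (fun y : V => y.2 - p0.2) y by apply: hol_dif; exact: tau_hol.
  rewrite (dd_near_eq (f := fun y => G y + (y.2 - p0.2) * H' y)); last 2 first.
  - by apply: filterS ey => y' ->.
  - by apply: dif_add => //; exact: dif_mul.
  rewrite dd_add //; last exact: dif_mul.
  rewrite dd_mul // dd_sub; [|by apply: hol_dif; exact: hol_snd|exact: dif_cst].
  by rewrite dd_cst dd_snd /= subrr mulr0 addr0.
have /choice[G hG] : forall i, exists G, inI f p0 G /\ row i M' = \row_j gm p0 (fun y => dd G y (w j, 0)).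
  by move=> i; have [G GJ e] := AM' i; exists G.
have [FK cF] := conormal_minor w (fun i => (hG i).1).
have ha i j : hol (fun y => dd (G i) y (w j, 0)) p0.
  by apply: hol_ddK; apply: (inI_hol f0); case: (hG i).
exists (gm p0 (fun y => \det (\matrix_(i, j) dd (G i) y (w j, 0)) ^+ 2)).
  by exists (fun y => \det (\matrix_(i, j) dd (G i) y (w j, 0)) ^+ 2), FK.
rewrite -gmX; last exact: hol_det.
rewrite -(gm_det ha) => /(primeX sT hP (I : setT _)) q; apply: nM'.
rewrite (_ : M' = \matrix_(i, j) gm p0 (fun y => dd (G i) y (w j, 0))) //.
by apply/matrixP => i j; have [_ /rowP/(_ j)] := hG i; rewrite !mxE.
Qed.

(** The function t and the derivation along t supply one row and one column. If all k by k minors of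
    the generators along M were in [It], they would vanish on the central fiber near z0; but at a
    smooth point k of the generators have independent differentials along M. *)
Lemma zero_fiber_minors : minors (@ders R V p0) It It k.+1.
Proof.
apply: contrapT => hn.
pose Mi (i : {ffun 'I_k -> 'I_N}) (w : {ffun 'I_k -> 'I_n}) (y : V) : 'M[K]_k :=
  \matrix_(a, c) dd (f (i a)) y (delta_mx 0 (w c), 0).
have hd i (w : {ffun 'I_k -> 'I_n}) a c : hol (fun y => dd (f (i a)) y (delta_mx 0 (w c) : E, 0)) p0.
  exact: hol_ddK.
have hM i w : hol (fun y => \det (Mi i w y)) p0 by apply: hol_det => a c; exact: hd.
have hI i w : It (gm p0 (fun y => \det (Mi i w y))).
  apply: contrapT => nI; apply: hn; rewrite -(addn1 k).
  exists (fun a : 'I_(k + 1)%N => match fintype.split a with inl a => gm p0 (f (i a)) | inr _ => tau p0 end),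
    (fun c : 'I_(k + 1)%N => match fintype.split c with inl c => der ((delta_mx 0 (w c), 0) : V) | inr _ => der ((0, 1) : V) end).
  split=> [a|c|].
  - case: (fintype.split a) => [a'|_]; first by apply: zero_fiberJ; exact: inI_gen.
    by rewrite -[tau p0]mulr1; exact: tau_in_It.
  - by case: (fintype.split c) => [c'|_]; eexists.
  have dtau u : der u (tau p0) = gm p0 (fun=> u.2).
    rewrite /tau der_gm; last exact: tau_hol.
    congr gm; apply/funext => y; rewrite dd_sub; [|by apply: hol_dif; exact: hol_snd|exact: dif_cst].
    by rewrite dd_cst dd_snd subr0.
  rewrite (_ : \matrix_(_, _) _ = block_mx (\matrix_(a, c) gm p0 (fun y => dd (f (i a)) y (delta_mx 0 (w c), 0)))
     (\col_a der ((0, 1) : V) (gm p0 (f (i a)))) 0 1%:M); last first.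
    apply/matrixP => a c; rewrite !mxE; case: (fintype.split a) => a'; rewrite ?mxE;
      case: (fintype.split c) => c'; rewrite ?mxE //.
    - by rewrite der_gm.
    - by rewrite dtau /= gm0.
    - by rewrite dtau /= !ord1 eqxx gm1.
  by rewrite det_ublock det1 mulr1 gm_det //; move=> a c; exact: hd.
have n1 : \forall x \near z0, forall iw : {ffun 'I_k -> 'I_N} * {ffun 'I_k -> 'I_n},
    Zt 0 x -> \det (Mi iw.1 iw.2 (x, 0)) = 0.
  by apply: near_forall => -[i w]; have /(zero_fiberP (hM i w)) := hI i w.
move: n1 => /near_nmP[r r0 hr].
have W0' : nm ((z0, 0) - (z0, 0) : V) < rad by exact: W0.
have [|y [yr sy]] := dense W0' (lf_base L) (r := Num.min r rad); first by rewrite lt_min r0 rad0.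
move: yr; rewrite lt_min => /andP[yr yrad].
have qW : inW (y, 0) by rewrite nm_pair_ltP /= subrr nm0 yrad rad0.
have Zy := smooth_Z sy.
have [G [b [[hG G0 Gb JG _] GJ]]] := smooth_frame (q := (y, 0)) qW sy.
have /choice[c cE] : forall l, exists c : 'I_N -> K, forall u, dd (G l) (y, 0) u = \sum_i c i * dd (f i) (y, 0) u.
  move=> l; apply: (dd_inI (f_hol qW)) (GJ l) => i.
  by apply: (inJ_Z support qW Zy); exact: inI_gen.
(* [choose_rows] is used over the field [K] with the prime ideal 0, for rows and again for columns:
   from the equations G to generators of the ideal, and from the vectors b to coordinate
   directions. *)
have sK : subring (@setT K).
  by split=> // d; exists (d.+1%:R^-1) => //; rewrite mulfV // pnatr_eq0.
have pK : isprime setT [set 0 : K].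
  split=> [|/eqP|u v _ _ /= /eqP]; first 1 last.
  - by rewrite oner_eq0.
  - by rewrite mulf_eq0 => /orP[]/eqP; [left|right].
  by split=> //= [u v -> ->|u v _ ->]; rewrite ?addr0 ?mulr0.
have d1 : ~ [set 0 : K] (\det (1%:M : 'M[K]_k)) by rewrite /= det1; apply/eqP; exact: oner_neq0.
have one : setT (1 : K) /\ ~ [set 0 : K] 1 by split=> //=; apply/eqP; exact: oner_neq0.
pose A1 := [set rr : 'rV[K]_k | exists i, rr = \row_j dd (f i) (y, 0) (b j, 0)].
have [|||M1 AM1 nM1] := @choose_rows K setT [set 0] sK pK k _ A1 _ _ _ d1 => //.
  move=> l; exists 1 => //; rewrite scale1r.
  rewrite (_ : row l 1%:M = \sum_i c l i *: \row_j dd (f i) (y, 0) (b j, 0)).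
    by apply: comb_sum => // i; exists i.
  apply/rowP => j; rewrite summxE !mxE -Gb cE; apply: eq_bigr => i _; by rewrite !mxE.
have /choice[i iE] := AM1.
rewrite -det_tr in nM1.
pose A2 := [set rr : 'rV[K]_k | exists a, rr = \row_l dd (f (i l)) (y, 0) (delta_mx 0 a : E, 0)].
have [|||M2 AM2 nM2] := @choose_rows K setT [set 0] sK pK k _ A2 _ _ _ nM1 => //.
  move=> j; exists 1 => //; rewrite scale1r.
  rewrite (_ : row j M1^T = \sum_a b j 0 a *: \row_l dd (f (i l)) (y, 0) (delta_mx 0 a : E, 0)).
    by apply: comb_sum => // a; exists a.
  apply/rowP => l; rewrite summxE !mxE; have /rowP/(_ j) := iE l; rewrite !mxE => ->.
  by rewrite (row_pair_sum (b j)) dd_sumr; apply: eq_bigr => a _; rewrite dd_scaler !mxE.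
have /choice[w wE] := AM2.
apply: nM2 => /=; rewrite -det_tr.
have := hr y yr ([ffun l => i l], [ffun l => w l]) Zy; rewrite /= => <-; congr (\det _).
apply/matrixP => a d; rewrite !mxE !ffunE; have /rowP/(_ a) := wE d; by rewrite !mxE.
Qed.

Let iJ := Iset_ideal f0.

Lemma Iset_sub_zero : J `<=` It.
Proof. by move=> _ [H hH ->]; exact: zero_fiberJ. Qed.

Lemma Iset_tau x : J (tau p0 * x) -> J x.
Proof.
rewrite -[x]gvK; have hx := gv_hol x; move: (gv x) hx => {}x hx.
rewrite /tau gmM //; last exact: tau_hol.
move=> /(IsetP f0 (hol_mul (tau_hol p0 p0) hx)) h; apply/(IsetP f0 hx).
by apply: (flat W0) => //; exact: (lf_base L).
Qed.

Lemma zero_fiber_tau x : It x -> exists x', J (x - tau p0 * x').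
Proof.
rewrite -[x]gvK; have hx := gv_hol x; move: (gv x) hx => {}x hx.
move=> /(zero_fiber_dec hx)[G [x' [GJ hx' e]]]; exists (gm p0 x').
have ht := tau_hol p0 p0; have hm := hol_mul ht hx'.
rewrite /tau gmM // gmB //; apply/(IsetP f0); first exact: hol_sub.
by apply: (inI_eq GJ); apply: filterS e => y ->; rewrite addrK.
Qed.

Lemma conormal_regular B H : hol B p0 -> ~ It (gm p0 B) -> hol H p0 -> inI f p0 (fun y => B y * H y) -> inI f p0 H.
Proof.
move=> hB nB hH hBH; apply/(IsetP f0 hH).
apply: (adic_regular sT (@top_noeth R n p0) iJ zero_fiber_prime Iset_sub_zero zero_fiber_tau Iset_tau (@tau_unit R n p0) nB).
by rewrite gmM //; apply/(IsetP f0 (hol_mul hB hH)).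
Qed.

(* On the smooth part of the total space, theta = s dt. *)
Theorem normal_section : exists s : V -> K, [/\ hol s p0, exists B F, conormal B F /\ ~ It (gm p0 B) &
  forall B F, conormal B F -> inI f p0 (fun y => dd F y (0, 1) + s y * B y)].
Proof.
have hP := zero_fiber_prime.
have [_ [B [F [cBF ->]]] nB] := conormal_avoids hP (@subset_refl _ _) zero_fiber_minors.
have [hB FJ hF] := cBF; have F_hol := inI_hol f0 FJ.
pose av (F : V -> K) y := - dd F y (0, 1).
have hav F' : hol F' p0 -> hol (av F') p0.
  move=> h; apply: (hol_eq (f := fun y => 0 - dd F' y (0, 1))).
    by apply: filterE => y; rewrite sub0r.
  by apply: hol_sub; [exact: hol_cst|exact: hol_ddK].
have ha := hav _ F_hol.
have KB : conormal_set (gm p0 B) by exists B, F.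
have Qa b' : conormal_set b' -> exists x, J (gm p0 (av F) * b' - x * gm p0 B).
  move=> [B' [F' [cBF' ->]]]; have [hB' FJ' _] := cBF'; have F'_hol := inI_hol f0 FJ'.
  have ha' := hav _ F'_hol.
  exists (gm p0 (av F')); rewrite !gmM // gmB; try exact: hol_mul.
  apply/(IsetP f0); first by apply: hol_sub; exact: hol_mul.
  apply: (inI_eq (inI_opp (conormal_rel cBF cBF'))).
  by apply: filterE => y; rewrite /av; ring.
have [s hs] : exists s, J (gm p0 (av F) - s * gm p0 B).
  exact: (adic_extension sT (@top_noeth R n p0) iJ hP Iset_sub_zero zero_fiber_tau tau_in_It
    Iset_tau (@tau_unit R n p0) (@ders_der R V p0) (top_wtower p0) zero_fiber_icl nB KB Qa zero_fiber_minors
    conormal_avoids).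
rewrite -[s]gvK in hs; have hsh := gv_hol s; move: (gv s) hsh hs => {}s hsh hs.
exists s; split=> //; first by exists B, F.
move=> B' F' cBF'; have [hB' FJ' hF'] := cBF'; have F'_hol := inI_hol f0 FJ'.
have hsB' : hol (fun y => dd F' y (0, 1) + s y * B' y) p0.
  by apply: hol_add; [exact: hol_ddK|exact: hol_mul].
apply: (conormal_regular hB nB hsB').
have hs' : inI f p0 (fun y => av F y - s y * B y).
  move: hs; rewrite gmM // gmB //; last exact: hol_mul.
  by move=> /(IsetP f0 (hol_sub ha (hol_mul hsh hB))).
apply: (inI_eq (inI_opp (inI_add (inI_mul hB' hs') (conormal_rel cBF cBF')))).
by apply: filterE => y; rewrite /av; ring.
Qed.
End Family.
End Extension.

(** * The contact field *)

(* If z did not lie in W = ker D, then W + z plus a hyperbolic summand would be an isotropic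
   subspace of dimension more than half of n + 1. *)
Lemma lagrangian_max (F : fieldType) n k (Om : 'M[F]_n) (th z : 'rV[F]_n) (D : 'M[F]_(n, k)) :
  n.+1 = k.*2 -> block_mx Om (th^T) th (0 : 'M[F]_1) \in unitmx ->
  kermx D *m Om *m (kermx D)^T = 0 -> kermx D *m th^T = 0 -> z *m th^T = 0 ->
  z *m Om *m (kermx D)^T = 0 -> kermx D *m Om *m z^T = 0 -> z *m Om *m z^T = 0 -> z *m D = 0.
Proof.
move=> nk uA i1 i2 i3 i4 i5 i6; set A := block_mx _ _ _ _ in uA.
apply/sub_kermxP/negPn/negP => nz.
pose U := col_mx (kermx D) z; pose Uh := block_mx U 0 0 (1%:M : 'M[F]_1).
have rU : (\rank U > n - k)%N.
  apply: (@leq_ltn_trans (\rank (kermx D))); first by rewrite mxrank_ker leq_sub2l // rank_leq_col.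
  rewrite -addsmxE rank_ltmx //; rewrite ltmxE addsmxSl /=; apply: contra nz => h.
  exact: submx_trans (addsmxSr _ _) h.
have iso : Uh *m A *m Uh^T = 0.
  rewrite tr_block_mx !mulmx_block !trmx0 !trmx1 !mulmx0 !mul0mx !mulmx1 !mul1mx !addr0 !add0r.
  rewrite tr_col_mx mul_col_mx mul_mx_row !mul_col_mx i1 i4 i5 i6 i2 i3 mul_mx_row.
  have -> : th *m (kermx D)^T = 0 by rewrite -[LHS]trmxK trmx_mul !trmxK i2 trmx0.
  have -> : th *m z^T = 0 by rewrite -[LHS]trmxK trmx_mul !trmxK i3 trmx0.
  by rewrite !row_mx0 !col_mx0 row_mx0 block_mx0.
have := mulmx0_rank_max iso; rewrite mxrankMfree ?row_free_unit // mxrank_tr rank_diag_block_mx mxrank1.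
by lia.
Qed.

Lemma near_and (R : realType) (U : normedModType (Cplx R)) (x : U) (A B : set U) :
  (\forall y \near x, A y) -> (\forall y \near x, B y) -> \forall y \near x, A y /\ B y.
Proof. exact: filterI. Qed.

Section ContactField.
Variable R : realType.
Notation K := (Cplx R).
Variable n : nat.
Local Notation E := 'rV[K]_n.
Local Notation V := (E * K)%type.
Variable th : 'I_n -> E -> K.

(** The exterior derivative of theta, the form with coefficients [th]. *)
Definition om (x u w : E) : K := \sum_j dd (th j) x u * w 0 j - \sum_j dd (th j) x w * u 0 j.
Definition ommx x : 'M[K]_n :=
  \matrix_(i, j) (dd (th j) x (delta_mx 0 i) - dd (th i) x (delta_mx 0 j)).
Definition throw x : 'rV[K]_n := \row_j th j x.
(** The matrix of d theta bordered by theta: its invertibility expresses the contact condition, and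
    solving with it produces Hamiltonian fields. *)
Definition contact_mx x : 'M[K]_(n + 1) := block_mx (ommx x) (throw x)^T (throw x) 0.

Lemma dd_row (g : E -> K) x (u : E) : dd g x u = \sum_i u 0 i * dd g x (delta_mx 0 i).
Proof. by rewrite {1}(row_sum_delta u) dd_sumr; apply: eq_bigr => i _; rewrite dd_scaler. Qed.

Lemma omE x u w : om x u w = (u *m ommx x *m w^T) 0 0.
Proof.
rewrite mxE; under eq_bigr do rewrite !mxE.
under eq_bigr do under eq_bigr do rewrite !mxE mulrBr.
under eq_bigr do rewrite sumrB mulrBl; rewrite sumrB /om; congr (_ - _).
  by apply: eq_bigr => j _; rewrite dd_row.
under [RHS]eq_bigr do rewrite mulr_suml.
rewrite exchange_big /=; apply: eq_bigr => j _; rewrite dd_row mulr_suml.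
by apply: eq_bigr => i _; ring.
Qed.

Lemma om_alt x u : om x u u = 0. Proof. exact: subrr. Qed.

Lemma omBl x u v w : om x (u - v) w = om x u w - om x v w.
Proof. by rewrite !omE !mulmxBl !mxE. Qed.

Lemma covec_mx x w : covec th x w = (w *m (throw x)^T) 0 0.
Proof. by rewrite mxE; apply: eq_bigr => j _; rewrite !mxE mulrC. Qed.

(** A kernel vector (u, c) satisfies theta (u) = 0 and d theta (u, w) = - c theta (w); so u is in
    the radical of d theta on the hyperplane, hence 0, and then c = 0 because theta is nonzero. *)
Lemma contact_mx_unit x : (exists w, covec th x w != 0) ->
  (forall u, covec th x u = 0 -> (forall w, covec th x w = 0 -> om x u w = 0) -> u = 0) ->
  contact_mx x \in unitmx.
Proof.
move=> [w0 tw0] nd; rewrite -row_free_unit -kermx_eq0; apply/eqP/row_matrixP => i; rewrite row0.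
have : row i (kermx (contact_mx x)) *m contact_mx x = 0 by rewrite -row_mul mulmx_ker row0.
rewrite -[row i _]hsubmxK; move: (lsubmx _) (rsubmx _) => u c.
rewrite mul_row_block mulmx0 addr0 -[RHS]row_mx0 => /eq_row_mx[e1 e2].
have tu : covec th x u = 0 by rewrite covec_mx e2 mxE.
have ou w : om x u w = - (c 0 0 * covec th x w).
  apply/eqP; rewrite omE covec_mx -addr_eq0 -[w *m _]trmxK trmx_mul trmxK [X in _ * X]mxE.
  have -> : c 0 0 * (throw x *m w^T) 0 0 = (c *m throw x *m w^T) 0 0.
    by rewrite -mulmxA [RHS]mxE big_ord1.
  have -> (a b : 'M[K]_1) : a 0 0 + b 0 0 = (a + b) 0 0 by rewrite mxE.
  by rewrite -mulmxDl e1 mul0mx mxE.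
have u0 : u = 0 by apply: nd => // w tw; rewrite ou tw mulr0 oppr0.
have /eqP : om x u w0 = 0 by rewrite u0 omE !mul0mx mxE.
rewrite ou oppr_eq0 mulf_eq0 (negPf tw0) orbF => /eqP c0.
by rewrite u0 (_ : c = 0) ?row_mx0 //; apply/matrixP => a b; rewrite !ord1 c0 mxE.
Qed.

Lemma hol_contact_mx x i j : (forall l, hol (th l) x) -> hol (fun y => contact_mx y i j) x.
Proof.
move=> ht; have [i1 ->|i1 ->] := split_ordP i; have [j1 ->|j1 ->] := split_ordP j.
- rewrite (_ : (fun y => _) = fun y => dd (th j1) y (delta_mx 0 i1) - dd (th i1) y (delta_mx 0 j1)).
    by apply: hol_sub; exact: hol_ddK.
  by apply/funext => y; rewrite block_mxEul mxE.
- rewrite (_ : (fun y => _) = th i1) //; by apply/funext => y; rewrite block_mxEur !mxE.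
- rewrite (_ : (fun y => _) = th j1) //; by apply/funext => y; rewrite block_mxEdl !mxE.
- rewrite (_ : (fun y => _) = fun=> 0); first exact: hol_cst.
  by apply/funext => y; rewrite block_mxEdr !mxE.
Qed.

(* The contact Hamiltonian field of s. *)
Lemma contact_solve (p0 : V) (s : V -> K) : (forall j, hol (th j) p0.1) -> hol s p0 ->
  contact_mx p0.1 \in unitmx -> exists (X : V -> E) (mu : V -> K), [/\ hol X p0, hol mu p0 &
   \forall y \near p0, contact_mx y.1 \in unitmx /\ covec th y.1 (X y) = s y /\
     forall w, om y.1 (X y) w + mu y * covec th y.1 w = - dd s y (w, 0)].
Proof.
move=> ht hs u0.
pose rhs y : 'rV[K]_(n + 1) := row_mx (\row_j - dd s y (delta_mx 0 j, 0)) (s y)%:M.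
pose v y := rhs y *m invmx (contact_mx y.1).
have hA i j : hol (fun y : V => contact_mx y.1 i j) p0.
  by apply: (@hol_fstc R n (fun x => contact_mx x i j)); exact: hol_contact_mx.
have AE : (fun y : V => contact_mx y.1) = fun y => \matrix_(i, j) contact_mx y.1 i j.
  by apply/funext => y; apply/matrixP => i j; rewrite mxE.
have hdet : hol (fun y : V => \det (contact_mx y.1)) p0.
  rewrite (_ : (fun y => _) = fun y => \det (\matrix_(i, j) contact_mx y.1 i j)); first exact: hol_det.
  by apply/funext => y; congr (\det _); apply/matrixP => i j; rewrite [RHS]mxE.
have nu : \forall y \near p0, contact_mx y.1 \in unitmx.
  have : \forall y \near p0, \det (contact_mx y.1) != 0.
    apply: (near_comp (P := fun c : K => c != 0) hdet); apply/near_nmP.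
    have d0 : 0 < nm (\det (contact_mx p0.1)) by rewrite nm_gt0 // -unitfE -unitmxE.
    exists (nm (\det (contact_mx p0.1))) => // c; apply: contraTneq => ->.
    by rewrite sub0r nmN ltxx.
  by apply: filterS => y; rewrite unitmxE unitfE.
have hadj i j : hol (fun y : V => (\adj (contact_mx y.1)) i j) p0.
  rewrite (_ : (fun y => _) = fun y => (-1) ^+ (j + i) *
     \det (\matrix_(i', j') contact_mx y.1 (lift j i') (lift i j'))).
    by apply: hol_mul; [exact: hol_cst|apply: hol_det].
  by apply/funext => y; rewrite mxE; congr (_ * \det _); apply/matrixP => i' j'; rewrite !mxE.
have hrhs i : hol (fun y => rhs y 0 i) p0.
  have [i1 ->|i1 ->] := split_ordP i.
    rewrite (_ : (fun y => _) = fun y => - dd s y (delta_mx 0 i1, 0)); first by apply: hol_opp; exact: hol_ddK.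
    by apply/funext => y; rewrite row_mxEl mxE.
  rewrite (_ : (fun y => _) = s) //; by apply/funext => y; rewrite row_mxEr mxE !ord1 eqxx.
have hv i : hol (fun y => v y 0 i) p0.
  apply: (hol_eq (f := fun y => \sum_j rhs y 0 j * ((\det (contact_mx y.1))^-1 * (\adj (contact_mx y.1)) j i))).
    apply: filterS nu => y uy; rewrite [RHS]mxE; apply: eq_bigr => j _.
    by rewrite /invmx uy [X in _ = _ * X]mxE.
  apply: hol_sum => j _; apply: hol_mul => //; apply: hol_mul => //.
  by apply: hol_inv => //; rewrite -unitfE -unitmxE.
exists (fun y => lsubmx (v y)), (fun y => rsubmx (v y) 0 0); split.
- apply: hol_mx => i j; rewrite (_ : (fun y => _) = fun y => v y 0 (lshift 1 j)) //.
  by apply/funext => y; rewrite !mxE ord1.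
- rewrite (_ : (fun y => _) = fun y => v y 0 (rshift n 0)) //.
  by apply/funext => y; rewrite !mxE.
apply: filterS nu => y uy; split=> //.
have : v y *m contact_mx y.1 = rhs y by rewrite /v -mulmxA mulVmx // mulmx1.
rewrite -[X in X *m _]hsubmxK; move: (lsubmx _) (rsubmx _) => X c.
rewrite mul_row_block mulmx0 addr0 => /eq_row_mx[e1 e2]; split.
  by rewrite covec_mx e2 mxE eqxx.
move=> w; rewrite omE covec_mx -[w *m _]trmxK trmx_mul trmxK [X in _ * X]mxE.
have -> : c 0 0 * (throw y.1 *m w^T) 0 0 = (c *m throw y.1 *m w^T) 0 0.
  by rewrite -mulmxA [RHS]mxE big_ord1.
have -> (a b : 'M[K]_1) : a 0 0 + b 0 0 = (a + b) 0 0 by rewrite mxE.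
rewrite -mulmxDl e1 mxE row_pair_sum dd_sumr -sumrN; apply: eq_bigr => j _.
by rewrite !mxE dd_scaler mulNr mulrC.
Qed.

(** The line through y in the direction eta stays in the common kernel of the functionals, where g
    vanishes near y. *)
Lemma kernel_dd (I : Type) (l : I -> V -> K) (g : V -> K) y eta :
  (forall i (c : K) v w, l i (c *: v + w) = c * l i v + l i w) ->
  (\forall x \near y, (forall i, l i x = 0) -> g x = 0) -> differentiable g y ->
  (forall i, l i y = 0) -> (forall i, l i eta = 0) -> dd g y eta = 0.
Proof.
move=> lin g0 dg ly le; have [dl Dl] := hasd_dd (line_hasd y eta 0).
have y0 : y + 0 *: eta = y by rewrite scale0r addr0.
have dg' : differentiable g (y + (0 : K) *: eta) by rewrite y0.
have e := dd_comp (f := fun t : K => y + t *: eta) (1 : K) dl dg'.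
rewrite Dl scale1r y0 in e; rewrite -e.
transitivity (dd (fun _ : K => 0 : K) 0 (1 : K)); last exact: dd_cst.
apply: dd_near_eq; last exact: dif_cst.
have hl : hol (fun t : K => y + t *: eta) 0.
  by apply: filterE => t; case: (hasd_dd (line_hasd y eta t)).
have : \forall x \near y + (0 : K) *: eta, (forall i, l i x = 0) -> g x = 0 by rewrite y0.
move=> /(near_comp hl); apply: filterS => t h; apply/esym/h => i.
by rewrite addrC lin le ly mulr0 addr0.
Qed.

Section Tangency.
Variables (k : nat) (z0 : E) (rad : R) (N : nat) (f : 'I_N -> V -> K) (Zt : K -> set E).
Hypothesis L : local_family k z0 rad f Zt th.
Hypothesis nk : n.+1 = k.*2.
Let p0 : V := (z0, 0).
Local Notation inW q := (nm (q - p0) < rad).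

(* The condition theta = s dt cutting out the total space of the family is differentiated
   along a parametrization of that space. *)
Lemma smooth_tangent (q : V) (s B F : V -> K) (X : V -> E) (mu : V -> K) : inW q -> smooth k Zt q.2 q.1 ->
  (forall j, hol (th j) q.1) -> hol s q -> hol F q ->
  (\forall y \near q, Zt y.2 y.1 -> [/\ F y = 0, B y != 0, dd F y (0, 1) = - (s y * B y) &
      forall w, dd F y (w, 0) = B y * covec th y.1 w]) ->
  contact_mx q.1 \in unitmx -> covec th q.1 (X q) = s q ->
  (forall w, om q.1 (X q) w + mu q * covec th q.1 w = - dd s q (w, 0)) ->
  forall H, inI f q H -> dd H q (X q, 1) = 0.
Proof.
case: q => z t qW [F0 [b0 sm]] ht hs hF nF uA sX eX H HJ.
have [G [psi [b [[GJ GF JG] Gb [hpsi psi0 dpsi] psi2 psiZ]]]] :=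
  smooth_param (lf_hol L) (lf_support L) (lf_flat L) (lf_fiber L) qW sm.
have hG i : hol (G i) (z, t) by apply: (inI_hol (lf_hol L qW)).
have G0 i : G i (z, t) = 0 by rewrite (nbhs_singleton GF) (smooth_zero i sm).
pose l i y := dd (G i) (z, t) y.
have lin i (c : K) v w : l i (c *: v + w) = c * l i v + l i w by rewrite /l dd_addr dd_scaler.
pose KL y := forall i, l i y = 0.
have KL0 : KL 0 by move=> i; rewrite /l -(scale0r (0 : V)) dd_scaler scale0r.
have hpsi' : hol psi (0 : V) by [].
pose P j y := (psi y).1 0 j.
have hP j : hol (P j) 0.
  by apply: (hol_comp (g := fun x : E => x 0 j : K)); [apply: (hol_comp hpsi); exact: hol_fst|exact: hol_coord].
have dP j y v : differentiable psi y -> dd (P j) y v = (dd psi y v).1 0 j.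
  move=> dy; have d1 : differentiable (fun y => (psi y).1) y.
    by apply: (dif_comp (f := psi) (g := (fst : V -> E)) dy); apply: hol_dif; exact: hol_fst.
  rewrite (dd_comp (f := fun y => (psi y).1) (g := fun x : E => x 0 j : K) _ d1); last by apply: hol_dif; exact: hol_coord.
  rewrite dd_coord (dd_comp (f := psi) (g := (fst : V -> E)) _ dy) ?dd_fst; [by []|apply: hol_dif; exact: hol_fst].
have nq (Q : set V) : (\forall y \near (z, t), Q y) -> \forall y \near (0 : V), Q (psi y).
  by move=> h; apply: (near_comp hpsi); rewrite psi0.
(* The relation theta = s dt pulled back by [psi] to the linear space [KL] that parametrizes the
   total space. It follows by differentiating F = 0, since dF = B (theta - s dt) there and B is
   nonzero. *)
have E1 : \forall y \near (0 : V), KL y -> forall eta, KL eta ->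
    \sum_j th j (psi y).1 * dd (P j) y eta - s (psi y) * eta.2 = 0.
  have m1 := nq _ nF; have m2 := nq _ hF.
  have m3 : \forall y \near (0 : V), KL y -> F (psi y) = 0.
    by apply: filterS2 m1 psiZ => y h1 h2 /h2[_ /h1[]].
  have := near_and (near_and m1 psiZ) (near_and (near_and (near_join m3) (near_join psi2)) (near_and m2 hpsi)).
  apply: filterS => y [[n1 n2] [[n3 n4] [dF dy]]] ky eta ke.
  have [_ /n1[F0' B0 Ft Fw] _] := n2 ky.
  have e0 : dd (fun y => F (psi y)) y eta = 0.
    by apply: (kernel_dd lin n3 _ ky ke); apply: (dif_comp (f := psi) (g := F) dy dF).
  have e2 : (dd psi y eta).2 = eta.2.
    transitivity (dd (fun y => (psi y).2) y eta).
      by rewrite (dd_comp (f := psi) (g := (snd : V -> K)) _ dy) ?dd_snd; [by []|apply: hol_dif; exact: hol_snd].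
    have ds : differentiable (fun y : V => y.2) y by apply: hol_dif; exact: hol_snd.
    have dts : differentiable (fun y : V => t + y.2) y by apply: dif_add; [exact: dif_cst|exact: ds].
    rewrite (dd_near_eq _ _ dts); last by apply: filterS n4 => y' ->.
    by rewrite dd_add; [rewrite dd_cst dd_snd add0r|exact: dif_cst|exact: ds].
  move: e0; rewrite (dd_comp (f := psi) (g := F) _ dy dF); under [\sum_j _]eq_bigr do rewrite dP //.
  case: (dd psi y eta) e2 => a c /= ->.
  have -> : (a, eta.2) = (a, 0) + eta.2 *: ((0, 1) : V) :> V.
    by apply/eqP; rewrite xpair_eqE /= scaler0 addr0 add0r -[eta.2 *: _]/(eta.2 * 1) mulr1 !eqxx.
  rewrite dd_addr dd_scaler Fw Ft -[_ *: _]/(_ * _) => e.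
  apply: (mulfI B0); rewrite mulr0; apply: etrans e; rewrite -/(covec th (psi y).1 a); ring.
have E2 zeta eta : KL zeta -> KL eta ->
   \sum_j (th j z * dd (fun y => dd (P j) y eta) 0 zeta + eta.1 0 j * dd (th j) z zeta.1) - dd s (z, t) zeta * eta.2 = 0.
  move=> kz ke; pose g y := \sum_j th j (psi y).1 * dd (P j) y eta - s (psi y) * eta.2.
  have ht' j : hol (fun y => th j (psi y).1) (0 : V).
    apply: (hol_comp (f := fun y => (psi y).1) (g := th j)).
      by apply: (hol_comp hpsi); exact: hol_fst.
    by rewrite psi0.
  have hsp : hol (fun y => s (psi y)) (0 : V) by apply: (hol_comp (f := psi) (g := s) hpsi); rewrite psi0.
  have hd j : hol (fun y => dd (P j) y eta) (0 : V) by exact: hol_ddK.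
  have h1 : hol (fun y => \sum_j th j (psi y).1 * dd (P j) y eta) (0 : V).
    by apply: hol_sum => j _; exact: hol_mul.
  have h2 : hol (fun y => s (psi y) * eta.2) (0 : V) by apply: hol_mul => //; exact: hol_cst.
  have g0 : dd g 0 zeta = 0.
    apply: (kernel_dd lin _ _ KL0 kz); last by apply: hol_dif; exact: hol_sub.
    by apply: filterS E1 => y h ky; exact: h.
  have dif (a : V -> K) : hol a (0 : V) -> differentiable a (0 : V) by exact: hol_dif.
  rewrite -[RHS]g0 /g dd_sub; [|exact: dif..]; rewrite dd_sum; last by move=> j _; apply: dif; exact: hol_mul.
  rewrite (dd_mul (a := fun y => s (psi y))); [|exact: dif|exact: dif_cst].
  rewrite dd_cst mulr0 add0r (dd_comp (f := psi) (g := s)); [|exact: hol_dif|by rewrite psi0; exact: hol_dif].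
  rewrite dpsi psi0; congr (_ - _); last by rewrite mulrC.
  apply: eq_bigr => j _; rewrite dd_mul; [|exact: dif..].
  rewrite psi0 /= dP; last exact: hol_dif.
  rewrite dpsi; congr (_ + _ * _).
  have d1 : differentiable (fun y => (psi y).1) (0 : V).
    by apply: hol_dif; apply: (hol_comp hpsi); exact: hol_fst.
  rewrite (dd_comp (f := fun y => (psi y).1) (g := th j) _ d1); last by rewrite psi0; exact: hol_dif.
  rewrite psi0 (dd_comp (f := psi) (g := (fst : V -> E))); [|exact: hol_dif|by apply: hol_dif; exact: hol_fst].
  by rewrite dd_fst dpsi.
(* Antisymmetrizing the derivative of the relation removes the second derivatives of [psi] and
   leaves d theta = ds wedge dt on tangent vectors of the total space. *)
have E3 zeta eta : KL zeta -> KL eta ->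
   om z zeta.1 eta.1 = dd s (z, t) zeta * eta.2 - dd s (z, t) eta * zeta.2.
  move=> kz ke; have /eqP := E2 _ _ kz ke; have /eqP := E2 _ _ ke kz.
  rewrite !subr_eq0 => /eqP <- /eqP <-; rewrite -sumrB /om -sumrB; apply: eq_bigr => j _.
  by rewrite (dd_sym (nice_K R) _ _ (hP j)); ring.
have E4 eta : KL eta -> covec th z eta.1 = s (z, t) * eta.2.
  move=> ke; have /eqP := nbhs_singleton E1 KL0 _ ke; rewrite psi0 subr_eq0 => /eqP <-.
  by apply: eq_bigr => j _; rewrite dP; [rewrite dpsi|exact: hol_dif].
(* The space component of the tangent vector to the total space obtained from d/dt by projection
   along the vectors (b i, 0). *)
pose xi : E := - \sum_i l i (0, 1) *: b i.
have knu : KL (xi, 1).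
  move=> i; have -> : (xi, 1) = (0, 1) - \sum_j l j (0, 1) *: (b j, 0) :> V.
    rewrite [RHS]surjective_pairing /= (big_morph (fst : V -> E) (fun _ _ => erefl) erefl).
    rewrite (big_morph (snd : V -> K) (fun _ _ => erefl) erefl) /= sub0r [X in (_, _ - X)]big1 ?subr0 // => j _.
    by rewrite scaler0.
  rewrite /l dd_addr dd_oppr dd_sumr (bigD1 i) //= dd_scaler Gb eqxx big1; last first.
    by move=> j ji; rewrite dd_scaler Gb eq_sym (negPf ji) scaler0.
  by rewrite addr0 -[X in _ - X]/(_ * 1) mulr1 subrr.
pose D : 'M[K]_(n, k) := \matrix_(j, i) l i (delta_mx 0 j, 0).
have DE (u : E) : u *m D = \row_i l i (u, 0).
  apply/rowP => i; rewrite !mxE /l row_pair_sum dd_sumr; apply: eq_bigr => j _.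
  by rewrite mxE dd_scaler.
have kW a : KL (row a (kermx D), 0).
  move=> i; have : row a (kermx D) *m D = 0 by rewrite -row_mul mulmx_ker row0.
  by rewrite DE => /rowP/(_ i); rewrite !mxE.
(* This vector is in the contact hyperplane and d theta-orthogonal to the tangent space of the
   fiber, so by maximality it belongs to that tangent space; hence (X, 1) is tangent to the total
   space. *)
pose ze := X (z, t) - xi.
have tze : covec th z ze = 0.
  rewrite covec_mx mulmxBl mxE [X in _ + X]mxE -!covec_mx sX (E4 _ knu) /= mulr1 subrr.
  by [].
have oze (u : E) : KL (u, 0) -> om z ze u = 0.
  move=> ku; rewrite omBl (E3 _ _ knu ku) /= mulr0 mulr1 sub0r.
  have := eX u; rewrite (E4 _ ku) mulr0 mulr0 addr0 => ->; by rewrite subrr.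
have ze0 : ze *m D = 0.
  apply: (lagrangian_max (Om := ommx z) (th := throw z) nk uA).
  - apply/matrixP => a c; rewrite [RHS]mxE.
    have -> : (kermx D *m ommx z *m (kermx D)^T) a c = (row a (kermx D) *m ommx z *m (row c (kermx D))^T) 0 0.
      rewrite -row_mul [LHS]mxE [RHS]mxE; apply: eq_bigr => e _; congr (_ * _); by rewrite !mxE.
    by rewrite -omE (E3 _ _ (kW a) (kW c)) /= !mulr0 subrr.
  - apply/row_matrixP => a; rewrite row_mul row0; apply/matrixP => i j; rewrite !ord1 -covec_mx mxE.
    by rewrite (E4 _ (kW a)) mulr0.
  - by apply/matrixP => i j; rewrite !ord1 -covec_mx mxE.
  - apply/matrixP => a c; rewrite !ord1 [RHS]mxE.
    have -> : (ze *m ommx z *m (kermx D)^T) 0 c = (ze *m ommx z *m (row c (kermx D))^T) 0 0.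
      rewrite [LHS]mxE [RHS]mxE; apply: eq_bigr => e _; congr (_ * _); by rewrite !mxE.
    by rewrite -omE oze.
  - apply/row_matrixP => a; rewrite (row_mul a (kermx D *m ommx z)) (row_mul a (kermx D)) row0; apply/matrixP => i j.
    by rewrite !ord1 -omE [RHS]mxE -[LHS]opprK /om opprB -/(om z ze _) oze ?oppr0.
  - by apply/matrixP => i j; rewrite !ord1 -omE om_alt mxE.
have [c cE] := dd_inI hG G0 (JG _ HJ).
rewrite cE big1 // => i _.
have -> : (X (z, t), 1) = (xi, 1) + (ze, 0) :> V.
  by apply/eqP; rewrite xpair_eqE /= /ze addrC subrK addr0 !eqxx.
rewrite dd_addr -/(l i _) knu add0r.
by move: ze0; rewrite DE => /rowP/(_ i); rewrite !mxE /l => ->; rewrite mulr0.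
Qed.
Lemma covec_delta x j : covec th x (delta_mx 0 j) = th j x.
Proof.
rewrite /covec (bigD1 j) //= mxE !eqxx mulr1 big1 ?addr0 // => i ij.
by rewrite mxE (negPf ij) andbF mulr0.
Qed.

Lemma hol_dd_field (g : V -> K) (X : V -> E) (q : V) : hol g q -> hol X q ->
  hol (fun y => dd g y (X y, 1)) q.
Proof.
move=> hg hX; apply: (hol_eq (f := fun y => \sum_j X y 0 j * dd g y (delta_mx 0 j, 0) + dd g y (0, 1))).
  apply: filterE => y; have -> : (X y, 1) = (X y, 0) + (0, 1) :> V.
    by apply/eqP; rewrite xpair_eqE /= addr0 add0r !eqxx.
  rewrite dd_addr (row_pair_sum (X y)) dd_sumr; congr (_ + _).
  by apply: eq_bigr => j _; rewrite dd_scaler.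
apply: hol_add; last exact: hol_ddK.
apply: hol_sum => j _; apply: hol_mul; last exact: hol_ddK.
by apply: (hol_comp (f := X) (g := fun x : E => x 0 j : K) hX); exact: hol_coord.
Qed.

Theorem contact_field : contact_mx z0 \in unitmx -> exists (X : V -> E) (mu s : V -> K),
  [/\ hol X p0, hol mu p0, hol s p0,
   \forall y \near p0, covec th y.1 (X y) = s y /\
     forall w, om y.1 (X y) w + mu y * covec th y.1 w = - dd s y (w, 0) &
   forall i, inI f p0 (fun y => dd (f i) y (X y, 1))].
Proof.
move=> uA; have [s [hs [B [F [cBF nB]]] sall]] := normal_section L.
have sF := sall _ _ cBF; have [hB FJ hF] := cBF.
have W0 : inW p0 by rewrite subrr nm0 (lf_rad L).
have hth : forall j, hol (th j) p0.1 by exact: (lf_th L).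
have [X [mu [hX hmu XE]]] := contact_solve hth hs uA.
exists X, mu, s; split=> // [|i]; first by apply: filterS XE => y [].
have hf i' : hol (f i') p0 by apply: (lf_hol L).
have hH : hol (fun y => dd (f i) y (X y, 1)) p0 by exact: hol_dd_field.
(* Membership is proved after multiplication by [B]: smooth points with B = 0 are then harmless, at
   the others [smooth_tangent] applies, and [B] cancels because it is not in the ideal of the
   central fiber. *)
apply: (conormal_regular L hB nB hH); apply: (lf_vanish L); first exact: hol_mul.
have n1 : \forall q \near p0, forall j : 'I_n,
    inI f q (fun y => dd F y (delta_mx 0 j : E, 0) - B y * covec th y.1 (delta_mx 0 j)).
  by apply: near_forall => j; apply: inI_near.
have n2 : \forall q \near p0, forall j, hol (th j) q.1.
  apply: near_forall => j; apply: (near_comp (f := fst) (P := fun x => hol (th j) x)); first exact: hol_fst.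
  by apply: hol_near.
have n3 := near_and (inI_near FJ) (inI_near sF).
have n4 := near_and (hol_near hB) (hol_near hs).
have nZ := near_and (inW_open W0) (near_and n1 n3).
have := near_and (near_and (near_join nZ) n2) (near_and n4 XE).
apply: filterS => q [[nq thq] [[hBq hsq] [uAq [X1 X2]]]] sq.
have [-> |Bq] := eqVneq (B q) 0; first by rewrite mul0r.
have [qW [_ [Fq _]]] := nbhs_singleton nq.
have hFq := inI_hol (lf_hol L qW) Fq.
rewrite (smooth_tangent qW sq thq hsq hFq (B := B) _ uAq X1 X2 (inI_gen f q i)) ?mulr0 //.
have nB0 : \forall y \near q, B y != 0.
  apply: (near_comp (P := fun c : K => c != 0) hBq); apply/near_nmP.
  exists (nm (B q)); first exact: nm_gt0.
  by move=> c; apply: contraTneq => ->; rewrite sub0r nmN ltxx.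
apply: filterS (near_and nq nB0) => y [[yW [m1 [m2 m3]]] By] Zy.
have zF : forall H, inI f y H -> H y = 0.
  by clear -L yW Zy; case: y yW Zy => x t yW Zy H; exact: (inJ_Z (lf_support L) yW Zy).
split=> //; first exact: zF.
  by apply/eqP; rewrite -addr_eq0; apply/eqP; exact: (zF _ m3).
move=> w; rewrite (row_pair_sum w) dd_sumr mulr_sumr; apply: eq_bigr => j _.
have /eqP := zF _ (m1 j); rewrite subr_eq0 covec_delta dd_scaler => /eqP ->.
by rewrite -[_ *: _]/(_ * _); ring.
Qed.
End Tangency.
End ContactField.

(** * The flow of the contact field *)

Section Ode.
Variable R : realType.
Notation K := (Cplx R).

(** A Gronwall argument by halving: a bound B for u on the disc improves to 2 r C B, at most B / 2,
    by the mean value inequality starting from [t1]. The zero may be at any time, so vanishing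
    propagates both ways. *)
Lemma ode_zero (W : normedModType K) (u : K -> W) (r C M : R) t1 : 0 <= C -> C * (2 * r) <= 2^-1 ->
  (forall t, nm t < r -> [/\ differentiable u t, nm (u t) <= M & nm (dd u t 1) <= C * nm (u t)]) ->
  nm t1 < r -> u t1 = 0 -> forall t, nm t < r -> u t = 0.
Proof.
move=> C0 Cr hu t1r u1.
have r0 : 0 <= r by apply: le_trans (nm_ge0 t1) (ltW t1r).
suff h k t : nm t < r -> nm (u t) <= M * 2^-1 ^+ k.
  by move=> t tr; apply: (small_eq0 (half_lt1 R)) => k; exact: h.
elim: k t => [|k ih] t tr; first by rewrite expr0 mulr1; case: (hu t tr).
rewrite -[u t]subr0 -u1.
rewrite exprSr mulrA; move: ih; set B := M * _ => ih.
have M0 : 0 <= B by apply: le_trans (ih t1 t1r); exact: nm_ge0.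
have L0 : 0 <= C * B * (2 * r) by apply: mulr_ge0; apply: mulr_ge0.
apply: (@le_trans _ _ (C * B * (2 * r))); last first.
  by rewrite mulrAC mulrC; apply: ler_wpM2l.
apply: mean_value => // s s01.
have pr : nm (t1 + (s%:C)%C *: (t - t1)) < r.
  by rewrite -[_ + _]subr0; apply: ball_segment; rewrite ?subr0.
have [d _ du] := hu _ pr; split=> //.
rewrite -ddE; set p := t1 + _ in d du pr *.
have -> : dd u p (t - t1) = (t - t1) *: dd u p 1.
  by rewrite -dd_scaler; congr (dd _ _ _); rewrite -[RHS]/((t - t1) * 1) mulr1.
rewrite nmZ mulrC; apply: ler_pM; rewrite ?nm_ge0 //.
  by apply: le_trans du _; apply: ler_wpM2l => //; exact: ih.
by apply: le_trans (nmD _ _) _; rewrite nmN; lra.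
Qed.

Variable n : nat.
Local Notation E := 'rV[K]_n.
Local Notation V := (E * K)%type.

Lemma inI_bound N (f : 'I_N -> V -> K) q H : inI f q H ->
  exists2 C : R, 0 <= C & \forall y \near q, nm (H y) <= C * nm (\row_j f j y).
Proof.
move=> [c [hc e]].
have /choice[M hM] j : exists M : R, \forall y \near q, nm (c j y) <= M.
  have [r [M [r0 _ h]]] := hol_ball (hc j); exists M; apply/near_nmP; by exists r.
have M0 j : 0 <= M j by apply: le_trans (nm_ge0 _) (nbhs_singleton (hM j)).
exists (\sum_j M j); first by apply: sumr_ge0.
apply: filterS2 e (near_forall hM) => y -> h.
apply: le_trans (nm_sum _ _ _) _; rewrite mulr_suml; apply: ler_sum => j _.
rewrite nmM; apply: ler_pM; rewrite ?nm_ge0 // ?h //.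
have -> : f j y = (\row_j f j y) 0 j by rewrite mxE.
exact: nm_entry.
Qed.

Lemma time_slice (W : normedModType K) (g : V -> W) x t : differentiable g (x, t) ->
  differentiable (fun t => g (x, t)) t /\ dd (fun t => g (x, t)) t 1 = dd g (x, t) (0, 1).
Proof.
move=> dg; have d1 : differentiable (fun t : K => (x, t) : V) t.
  by apply: hol_dif; apply: hol_pair; [exact: hol_cst|exact: hol_id].
split; first exact: (dif_comp (f := fun t : K => (x, t) : V) d1 dg).
rewrite (dd_comp (f := fun t : K => (x, t) : V) (1 : K) d1 dg); congr (dd g _ _).
rewrite (dd_pair (f := fun _ : K => x) (g := fun t : K => t) (1 : K)).
- by rewrite dd_cst dd_id.
- exact: dif_cst.
- by apply: hol_dif; exact: hol_id.
Qed.

Lemma space_slice (W : normedModType K) (g : V -> W) x t w : differentiable g (x, t) ->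
  differentiable (fun x : E => g (x, t)) x /\ dd (fun x : E => g (x, t)) x w = dd g (x, t) (w, 0).
Proof.
move=> dg; have [/hol_dif h1 h2] := slice_hol t x.
split; first exact: (dif_comp (f := fun x : E => (x, t) : V) h1 dg).
by rewrite (dd_comp (f := fun x : E => (x, t) : V) _ h1 dg) h2.
Qed.

Lemma dd_entry (U : normedModType K) m (g : U -> 'rV[K]_m) y v j : differentiable g y ->
  dd (fun z => g z 0 j) y v = dd g y v 0 j.
Proof.
move=> h; have d1 : differentiable (fun x : 'rV[K]_m => x 0 j : K) (g y) by apply: hol_dif; exact: hol_coord.
by rewrite (dd_comp (f := g) (g := fun x : 'rV[K]_m => x 0 j : K) _ h d1) dd_coord.
Qed.

Section Flow.
Variable Phi : V -> E.
Let T (y : V) : V := (Phi y, y.2).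

Lemma hol_T y : hol Phi y -> hol T y.
Proof. by move=> h; apply: hol_pair => //; exact: hol_snd. Qed.

Lemma dd_T y v : hol Phi y -> dd T y v = (dd Phi y v, v.2).
Proof.
move=> h; rewrite (dd_pair (f := Phi) (g := (snd : V -> K))) ?dd_snd //; first exact: hol_dif.
by apply: hol_dif; exact: hol_snd.
Qed.

Variable th : 'I_n -> E -> K.

(* Cartan's formula along the flow of a contact field: L_X theta = - mu theta. *)
Lemma flow_covec (X : V -> E) (mu s : V -> K) y : hol Phi y -> (forall j, hol (th j) (Phi y)) ->
  hol s (T y) -> hol X (T y) -> (\forall z \near y, dd Phi z (0, 1) = X (T z)) ->
  (\forall z \near y, covec th (Phi z) (X (T z)) = s (T z)) ->
  (forall w, om th (Phi y) (X (T y)) w + mu (T y) * covec th (Phi y) w = - dd s (T y) (w, 0)) ->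
  forall w, hol (fun z => covec th (Phi z) (dd Phi z (w, 0))) y /\
    dd (fun z => covec th (Phi z) (dd Phi z (w, 0))) y (0, 1) =
     - (mu (T y) * covec th (Phi y) (dd Phi y (w, 0))).
Proof.
move=> hP ht hs hX flow tX omX w.
pose P j z := Phi z 0 j.
have hPj j : hol (P j) y by apply: (hol_comp (f := Phi) (g := fun x : E => x 0 j : K)); [exact: hP|exact: hol_coord].
pose g z := \sum_j th j (Phi z) * dd (P j) z (w, 0).
have ge : \forall z \near y, g z = covec th (Phi z) (dd Phi z (w, 0)).
  by apply: filterS (hol_near hP) => z hz; apply: eq_bigr => j _; rewrite (dd_entry _ _ (hol_dif hz)).
have htP j : hol (fun z => th j (Phi z)) y by apply: (hol_comp (f := Phi) (g := th j)).
have hg : hol g y by apply: hol_sum => j _; apply: hol_mul; [exact: htP|exact: hol_ddK].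
split; first exact: (hol_eq ge hg).
have om' := omX (dd Phi y (w, 0)).
rewrite (dd_near_eq _ _ (hol_dif hg)); last by apply: filterS ge => z ->.
have dth j v : dd (fun z => th j (Phi z)) y v = dd (th j) (Phi y) (dd Phi y v).
  by rewrite (dd_comp (f := Phi) (g := th j)) //; exact: hol_dif.
pose X' j z := X (T z) 0 j.
have hX' j : hol (X' j) y.
  apply: (hol_comp (f := fun z => X (T z)) (g := fun x : E => x 0 j : K)); last exact: hol_coord.
  by apply: (hol_comp (f := T) (g := X)); [exact: hol_T|].
have dPX j : dd (fun z => dd (P j) z (w, 0)) y (0, 1) = dd (X' j) y (w, 0).
  rewrite (dd_sym (nice_K R) _ _ (hPj j)); apply: dd_near_eq; last exact: (hol_dif (hX' j)).
  by apply: filterS2 flow (hol_near hP) => z e hz; rewrite (dd_entry _ _ (hol_dif hz)) e.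
have dg : dd g y (0, 1) = \sum_j (th j (Phi y) * dd (X' j) y (w, 0) +
    (dd Phi y (w, 0)) 0 j * dd (th j) (Phi y) (X (T y))).
  rewrite /g dd_sum; last by move=> j _; apply: hol_dif; apply: hol_mul; [exact: htP|exact: hol_ddK].
  apply: eq_bigr => j _; rewrite dd_mul; [|exact: hol_dif|by apply: hol_dif; exact: hol_ddK].
  by rewrite dPX dth (dd_entry _ _ (hol_dif hP)) (nbhs_singleton flow).
have ds : dd s (T y) (dd Phi y (w, 0), 0) = \sum_j (th j (Phi y) * dd (X' j) y (w, 0) +
    X (T y) 0 j * dd (th j) (Phi y) (dd Phi y (w, 0))).
  have -> : (dd Phi y (w, 0), 0) = dd T y (w, 0) by rewrite dd_T.
  have dT := hol_dif (hol_T hP).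
  rewrite -(dd_comp (f := T) (g := s) _ dT (hol_dif hs)).
  have hm j : hol (fun z => th j (Phi z) * X' j z) y by apply: hol_mul; [exact: htP|exact: hX'].
  rewrite (dd_near_eq (f := fun z => \sum_j th j (Phi z) * X' j z)); last 2 first.
  - by apply: filterS tX => z <-.
  - by apply: hol_dif; apply: hol_sum => j _; exact: hm.
  rewrite dd_sum; last by move=> j _; apply: hol_dif; exact: hm.
  apply: eq_bigr => j _; rewrite dd_mul; [|exact: hol_dif..].
  by rewrite dth.
move: om'; rewrite ds dg !big_split /=; set m := mu _ * _; set A := \sum_(j < n) th j _ * _.
have -> : om th (Phi y) (X (T y)) (dd Phi y (w, 0)) =
    \sum_j dd Phi y (w, 0) 0 j * dd (th j) (Phi y) (X (T y)) -
    \sum_j X (T y) 0 j * dd (th j) (Phi y) (dd Phi y (w, 0)).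
  by rewrite /om; congr (_ - _); apply: eq_bigr => j _; rewrite mulrC.
set B1 := \sum_j _; set B2 := \sum_j _ => e.
have -> : A + B1 = (B1 - B2 + m) + (A + B2) - m by ring.
by rewrite e addNr sub0r.
Qed.

End Flow.

Section Transport.
Variables (k : nat) (z0 : E) (rad : R) (N : nat) (f : 'I_N -> V -> K) (Zt : K -> set E) (th : 'I_n -> E -> K).
Hypothesis L : local_family k z0 rad f Zt th.
Hypothesis nk : n.+1 = k.*2.
Hypothesis uA : contact_mx th z0 \in unitmx.
Let p0 : V := (z0, 0).

(** Along the flow the generators of the ideal, and the values of theta on transported vectors,
    satisfy linear differential inequalities. They vanish at all times as soon as at one, which
    gives the two equivalences, for points of the fibers and for vectors of the distribution. *)
Theorem contact_flow : exists (Phi : V -> E) (r : R), 0 < r /\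
  (forall x t, nm (x - z0) < r -> nm t < r -> [/\ hol Phi (x, t), Phi (x, 0) = x,
    nm ((Phi (x, t), t) - p0) < rad, Zt 0 x <-> Zt t (Phi (x, t)) &
    forall w, covec th x w = 0 <-> covec th (Phi (x, t)) (dd Phi (x, t) (w, 0)) = 0]) /\
  forall t, nm t < r -> exists g : E -> E, (forall y, nm (y - Phi (z0, t)) < r / 4 ->
      [/\ hol g y, nm (g y - z0) < r & Phi (g y, t) = y]) /\
    forall x, nm (x - z0) < r -> nm (Phi (x, t) - Phi (z0, t)) < r / 4 -> g (Phi (x, t)) = x.
Proof.
have [X [mu [s [hX hmu hs XE tX]]]] := contact_field L nk uA.
have [Phi [r0 [r00 flow]]] := flow_exists (nice_mx R 1 n) hX.
pose T (y : V) : V := (Phi y, y.2).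
have hPhi0 : hol Phi p0 by case: (flow z0 0) => //; rewrite ?subrr nm0.
have Phi0 x : nm (x - z0) < r0 -> Phi (x, 0) = x by move=> xr; case: (flow x 0 xr) => //; rewrite nm0.
have Tp0 : T p0 = p0 by rewrite /T /= Phi0 // subrr nm0.
have nT (P : set V) : (\forall y \near p0, P y) -> \forall y \near p0, P (T y).
  by move=> h; apply: (near_comp (f := T)); [exact: hol_T|rewrite Tp0].
have hf i : hol (f i) p0 by apply: (lf_hol L); rewrite subrr nm0 (lf_rad L).
have hth : \forall y \near p0, forall j, hol (th j) y.1.
  apply: near_forall => j; apply: (near_comp (f := fst) (P := fun x => hol (th j) x)); first exact: hol_fst.
  by apply: hol_near; exact: (lf_th L).
have [C C0 hC] : exists2 C : R, 0 <= C & \forall y \near p0, forall i, nm (dd (f i) y (X y, 1)) <= C * nm (\row_j f j y).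
  have /choice[Ci hCi] i : exists C : R, 0 <= C /\ \forall y \near p0, nm (dd (f i) y (X y, 1)) <= C * nm (\row_j f j y).
    by have [C C0 h] := inI_bound (tX i); exists C.
  exists (\sum_i Ci i); first by apply: sumr_ge0 => i _; case: (hCi i).
  have := near_forall (fun i => (hCi i).2); apply: filterS => y h i; apply: le_trans (h i) _.
  apply: ler_wpM2r; first exact: nm_ge0.
  by rewrite (bigD1 i) //= lerDl sumr_ge0 // => j _; case: (hCi j).
have bound (W : normedModType K) (F : V -> W) : hol F p0 -> exists M : R, \forall y \near p0, nm (F y) <= M.
  by move=> /hol_ball[r [M [r_gt0 _ h]]]; exists M; apply/near_nmP; exists r.
have [Mm hMm] := bound _ _ hmu.
have Mm0 : 0 <= Mm by apply: le_trans (nm_ge0 _) (nbhs_singleton hMm).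
have hrow : hol (fun y => \row_j f j y) p0.
  apply: hol_mx => i j; rewrite (_ : (fun y => _) = f j) //; by apply/funext => y; rewrite mxE.
have [Mf hMf] := bound _ _ hrow.
pose G w (y : V) := covec th (Phi y) (dd Phi y (w, 0)).
pose good (y : V) := [/\ nm (T y - p0) < rad, hol Phi y /\ hol s (T y) /\ hol X (T y), forall j, hol (th j) (Phi y) &
   dd Phi y (0, 1) = X (T y) /\ (covec th (Phi y) (X (T y)) = s (T y) /\
   (forall w, om th (Phi y) (X (T y)) w + mu (T y) * covec th (Phi y) w = - dd s (T y) (w, 0)))].
have ngood : \forall y \near p0, good y.
  have n1 : \forall y \near p0, hol Phi y /\ dd Phi y (0, 1) = X (T y).
    apply/near_nmP; exists r0; [exact: r00|move=> [x t]]; rewrite nm_pair_ltP /= subr0 => /andP[h1 h2].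
    by case: (flow x t h1 h2).
  have n2 := nT _ (inW_open (z0 := z0) (rad := rad) (q := p0) _).
  have n3 := near_and (nT _ (near_and (hol_near hs) (hol_near hX))) (nT _ (near_and hth XE)).
  have := near_and n1 (near_and (n2 _) n3).
  rewrite subrr nm0 => /(_ (lf_rad L)); apply: filterS => y [[a b] [c [[d e] [g h]]]].
  by split.
have hG w : hol (G w) p0.
  have [_ [a [b c]] d [_ [e g]]] := nbhs_singleton ngood.
  have [] := @flow_covec Phi th X mu s p0 a d b c _ _ g w => //.
    by apply: filterS ngood => y [_ _ _ []].
  by apply: filterS ngood => y [_ _ _ [_ []]].
have hGr : hol (fun y => \row_j G (delta_mx 0 j) y) p0.
  apply: hol_mx => i j; rewrite (_ : (fun y => _) = G (delta_mx 0 j)) //; by apply/funext => y; rewrite mxE.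
have [MG hMG] := bound _ _ hGr.
(* The flow minus its first order part has derivative zero at the base point, hence Lipschitz
   constant 1 / 2 nearby. For fixed t it differs from Phi (x, t) - x by a constant, so
   [inverse_function] applies at time t on a ball whose radius does not depend on t. The zero
   component makes [hh] an endomorphism, as [small_lipschitz] expects. *)
pose hh (y : V) : V := (Phi y - y.1 - y.2 *: X p0, 0).
have hhh : hol hh p0.
  apply: hol_pair; last exact: hol_cst.
  apply: hol_sub; first by apply: hol_sub; [exact: hPhi0|exact: hol_fst].
  by apply: hol_scalev; [exact: hol_snd|exact: hol_cst].
have slice0 x : nm (x - z0) < r0 -> hol Phi (x, 0) -> forall w, dd Phi (x, 0) (w, 0) = w.
  move=> xr hx w; have [_ <-] := space_slice w (hol_dif hx).
  transitivity (dd (fun x : E => x) x w); last exact: dd_id.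
  apply: dd_near_eq; last by apply: hol_dif; exact: hol_id.
  by apply: (ball_near (P := fun x => x = Phi (x, 0)) _ xr) => y /Phi0.
have flow0 : dd Phi p0 (0, 1) = X p0.
  have zz : nm (z0 - z0) < r0 by rewrite subrr nm0.
  have tt : nm (0 : K) < r0 by rewrite nm0.
  by have [_ _ ->] := flow z0 0 zz tt; rewrite Phi0.
have [|r1 [r10 _ lh]] := small_lipschitz (nice_V R n) hhh.
  move=> [w c].
  have d1 : differentiable (fun y : V => Phi y - y.1) p0.
    by apply: hol_dif; apply: hol_sub; [exact: hPhi0|exact: hol_fst].
  have [d2 e2] := dif_scalev (hol_dif (hol_snd p0)) (dif_cst (X p0) p0).
  rewrite /hh (dd_pair (f := fun y : V => Phi y - y.1 - y.2 *: X p0) (g := fun=> 0 : K)); last exact: dif_cst.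
    rewrite dd_cst; apply/eqP; rewrite xpair_eqE eqxx andbT; apply/eqP.
    rewrite (dd_sub _ d1 d2) e2 dd_cst scaler0 add0r dd_snd (dd_sub _ (hol_dif hPhi0) (hol_dif (hol_fst p0))) dd_fst.
    have -> : (w, c) = (w, 0) + c *: (0, 1) :> V.
      by apply/eqP; rewrite xpair_eqE /= scaler0 addr0 add0r -[c *: _]/(c * 1) mulr1 !eqxx.
    rewrite dd_addr dd_scaler slice0 ?subrr ?nm0 // flow0 /= scaler0 addr0 add0r -[c *: (1 : K)]/(c * 1) mulr1.
    by rewrite (addrC w) addrK subrr.
  exact: (dif_sub d1 d2).
have [r2 r20 hr2] : exists2 r : R, 0 < r & forall y, nm (y - p0) < r -> [/\ \forall z \near y, good z,
     forall i, nm (dd (f i) (T y) (X (T y), 1)) <= C * nm (\row_j f j (T y)),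
     nm (mu (T y)) <= Mm, nm (\row_j f j (T y)) <= Mf & nm (\row_j G (delta_mx 0 j) y) <= MG].
  have := near_and (near_and (near_join ngood) (nT _ hC)) (near_and (nT _ hMm) (near_and (nT _ hMf) hMG)).
  move=> /near_nmP[r rr h]; exists r; first exact: rr.
  move=> y /h[[a b] [c [d e]]].
  by split; [exact: a|exact: b|exact: c|exact: d|exact: e].
(* The last two terms make 2 r C and 2 r Mm at most 1 / 2, as [ode_zero] demands. *)
pose r := Num.min (Num.min r0 r1) (Num.min r2 (Num.min (4^-1 / (C + 1)) (4^-1 / (Mm + 1)))).
have [r_0 r_1 r_2] : [/\ r <= r0, r <= r1 & r <= r2] by rewrite !ge_min !lexx !orbT.
have rp : 0 < r by rewrite !lt_min r00 r10 r20 !divr_gt0 ?invr_gt0 //; lra.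
have small (c : R) : 0 <= c -> r <= 4^-1 / (c + 1) -> c * (2 * r) <= 2^-1.
  move=> c0; rewrite ler_pdivlMr; last by lra.
  by move=> h; have := ler_wpM2l c0 (ltW rp); nra.
have Cr : C * (2 * r) <= 2^-1 by apply: small => //; rewrite !ge_min lexx !orbT.
have Mr : Mm * (2 * r) <= 2^-1 by apply: small => //; rewrite !ge_min lexx !orbT.
exists Phi, r; split; first exact: rp.
split=> [x t xr tr|t tr].
- have pt t' : nm t' < r -> nm ((x, t') - p0 : V) < r2.
    by move=> h; rewrite nm_pair_ltP /= subr0 !(lt_le_trans _ r_2).
  have gx t' : nm t' < r -> good (x, t') by move=> /pt/hr2[/nbhs_singleton].
  have r0' : nm (0 : K) < r by rewrite nm0.
  have Phix : Phi (x, 0) = x by apply: Phi0; exact: lt_le_trans xr r_0.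
  have hP t' : nm t' < r -> hol Phi (x, t') by move=> /gx[_ []].
  have inWT t' : nm t' < r -> nm ((Phi (x, t'), t') - p0) < rad by move=> /gx[].
  split; [exact: hP|exact: Phix|exact: inWT| |].
  - pose g (y : V) := \row_j f j (T y).
    have hg t' : nm t' < r -> hol g (x, t').
      move=> h; apply: hol_mx => i j; rewrite (_ : (fun y => _) = fun y => f j (T y)).
        apply: (hol_comp (f := T) (g := f j)); first exact: hol_T (hP _ h).
        exact: (lf_hol L (inWT _ h)).
      by apply/funext => y; rewrite mxE.
    have ode t1 t2 : nm t1 < r -> nm t2 < r -> g (x, t1) = 0 -> g (x, t2) = 0.
      move=> h1 h2 e; apply: (@ode_zero _ (fun t => g (x, t)) r C Mf t1 C0 Cr _ h1 e _ h2) => t' h.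
      have dg := hol_dif (hg _ h); have [dg' e'] := time_slice dg.
      have [_ b1 _ b2 _] := hr2 _ (pt _ h); split; [exact: dg'|exact: b2|rewrite e'].
      apply/nm_mxP => [|i j]; first by rewrite mulr_ge0 // nm_ge0.
      rewrite (ord1 i) -(dd_entry _ _ dg) (_ : (fun z => _) = fun z => f j (T z)); last first.
        by apply/funext => y; rewrite mxE.
      rewrite (dd_comp (f := T) (g := f j) _ (hol_dif (hol_T (hP _ h))) (hol_dif (lf_hol L (inWT _ h) j))).
      rewrite (dd_T _ (hP _ h)); have [_ _ _ [-> _]] := gx _ h.
      exact: b1.
    have gP t' : nm t' < r -> Zt t' (Phi (x, t')) <-> g (x, t') = 0.
      move=> h; rewrite (lf_support L (inWT _ h)); split=> [e|/rowP e i].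
        by apply/rowP => j; rewrite !mxE; exact: e.
      by have := e i; rewrite !mxE.
    have := gP 0 r0'; rewrite Phix => ->; rewrite gP //; split; exact: ode.
  - move=> w.
    have hGx t' : nm t' < r -> hol (G w) (x, t') /\ dd (G w) (x, t') (0, 1) = - (mu (T (x, t')) * G w (x, t')).
      move=> h; have [ng _ _ _ _] := hr2 _ (pt _ h).
      have [_ [a [b c]] d [_ [e1 e2]]] := nbhs_singleton ng.
      by apply: (@flow_covec Phi th X mu s (x, t') a d b c _ _ e2 w);
        apply: filterS ng => y [_ _ _ []] // _ [].
    have bw t' : nm t' < r -> nm (G w (x, t')) <= (\sum_j nm (w 0 j : K)) * MG.
      move=> h; have [_ _ _ _ b] := hr2 _ (pt _ h).
      have -> : G w (x, t') = \sum_j w 0 j * G (delta_mx 0 j) (x, t').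
        rewrite /G (row_pair_sum w) dd_sumr; have lin := covec_lin th (Phi (x, t')).
        rewrite (big_morph _ (ellD lin) (ell0 lin)); apply: eq_bigr => j _.
        by rewrite dd_scaler (ellZ lin).
      apply: le_trans (nm_sum _ _ _) _; rewrite mulr_suml; apply: ler_sum => j _.
      rewrite nmM; apply: ler_wpM2l; first exact: nm_ge0.
      apply: le_trans b; have -> : G (delta_mx 0 j) (x, t') = (\row_j G (delta_mx 0 j) (x, t')) 0 j by rewrite mxE.
      exact: nm_entry.
    have ode t1 t2 : nm t1 < r -> nm t2 < r -> G w (x, t1) = 0 -> G w (x, t2) = 0.
      move=> h1 h2 e; apply: (@ode_zero _ (fun t => G w (x, t)) r Mm _ t1 Mm0 Mr _ h1 e _ h2) => t' h.
      have [hGw eG] := hGx _ h; have [dg' e'] := time_slice (hol_dif hGw).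
      split; [exact: dg'|exact: bw|rewrite e' eG nmN nmM; apply: ler_wpM2r; first exact: nm_ge0].
      by have [_ _ b _ _] := hr2 _ (pt _ h).
    have G0 : G w (x, 0) = covec th x w by rewrite /G Phix (slice0 x (lt_le_trans xr r_0) (hP 0 r0')).
    by rewrite -G0; split; exact: ode.
pose h (x : E) := Phi (x, t) - x.
have pt' x' : nm (x' - z0) < r -> nm ((x', t) - p0 : V) < r2.
  by move=> h'; rewrite nm_pair_ltP /= subr0 !(lt_le_trans _ r_2).
have dh x' : nm (x' - z0) < r -> differentiable h x'.
  move=> /pt'/hr2[/nbhs_singleton[_ [a _] _ _] _ _ _ _]; apply: dif_sub.
    by have [] := space_slice 0 (hol_dif a).
  by apply: hol_dif; exact: hol_id.
have lh' x1 x2 : nm (x1 - z0) < r -> nm (x2 - z0) < r -> nm (h x1 - h x2) <= 2^-1 * nm (x1 - x2).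
  move=> h1 h2; have := lh (x1, t) (x2, t).
  rewrite !nm_pair_ltP /= subr0 !(lt_le_trans _ r_1) // => /(_ isT isT).
  have -> : hh (x1, t) - hh (x2, t) = (h x1 - h x2, 0) :> V.
    by apply/eqP; rewrite xpair_eqE /= subrr eqxx andbT opprB addrA subrK.
  have -> : (x1, t) - (x2, t) = (x1 - x2, 0) :> V by apply/eqP; rewrite xpair_eqE /= subrr !eqxx.
  by rewrite !nm_pair nm0 !max_l ?nm_ge0.
have [g [hg gE ginj]] := inverse_function (nice_mx R 1 n) rp dh lh'.
have e0 : z0 + h z0 = Phi (z0, t) by rewrite /h addrC subrK.
have gP y : nm (y - Phi (z0, t)) < r / 4 -> [/\ hol g y, nm (g y - z0) < r & Phi (g y, t) = y].
  rewrite -e0 => h1; have [b e] := gE _ h1; split; first exact: hg.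
    by apply: le_lt_trans b _; lra.
  by rewrite -[RHS]e /h addrC subrK.
exists g; split=> [y|x xr hx]; first exact: gP.
have [_ b e] := gP _ hx; apply: ginj => //.
by rewrite /h !(addrC _ (_ - _)) !subrK.
Qed.
End Transport.
End Ode.

(** * Charts and germs on manifolds *)

Section Charts.
Variable R : realType.
Notation K := (Cplx R).
Variables (V W : normedModType K) (X : manifold V) (c : chart X V).
Hypothesis Xc : atlas c.

Lemma chart_near (p : X) (P : set X) : cdom c p -> (\forall q \near p, P q) ->
  \forall z \near c p, P (cinv c z).
Proof. by move=> cp hP; apply: (cinv_continuous cp); rewrite cmapK. Qed.

Lemma near_chart (p : X) (P : set V) : cdom c p -> (\forall z \near c p, P z) -> \forall q \near p, P (c q).
Proof. by move=> cp hP; exact: (cmap_continuous cp). Qed.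

Lemma near_dom (p : X) : cdom c p -> \forall q \near p, cdom c q.
Proof. by move=> cp; apply: open_nbhs_nbhs; split => //; exact: cdom_open. Qed.

Lemma near_img (p : X) : cdom c p -> \forall z \near c p, cdom c (cinv c z) /\ c (cinv c z) = z.
Proof.
move=> cp; have : \forall z \near c p, (c @` cdom c) z.
  by apply: open_nbhs_nbhs; split; [exact: cimg_open|exists p].
by apply: filterS => _ [q cq <-]; rewrite cmapK.
Qed.

Lemma holo_chart (h : X -> W) p : cdom c p -> differentiable (fun z => h (cinv c z)) (c p) -> holo_fun h p.
Proof.
move=> cp dh c' Xc' c'p; have d1 := atlas_compatible Xc' Xc c'p cp.
have d2 : differentiable (fun z => h (cinv c z)) ((c \o cinv c') (c' p)) by rewrite /= cmapK.
have d12 := dif_comp (f := c \o cinv c') (g := fun z => h (cinv c z)) d1 d2.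
suff e : \forall z \near c' p, h (cinv c ((c \o cinv c') z)) = (h \o cinv c') z by have [] := dif_near_eq e d12.
have : \forall z \near c' p, cdom c (cinv c' z).
  have : \forall q \near cinv c' (c' p), cdom c q by rewrite cmapK //; exact: near_dom.
  exact: (cinv_continuous c'p).
by apply: filterS => z hz; rewrite /= cmapK.
Qed.

Lemma near_holo_chart (h : X -> W) p : cdom c p ->
  (\forall q \near p, holo_fun h q) <-> hol (fun z => h (cinv c z)) (c p).
Proof.
move=> cp; split=> H.
  apply: filterS2 (near_img cp) (chart_near cp H) => z [dz ez] hz.
  by have := hz c Xc dz; rewrite ez.
apply: filterS2 (near_dom cp) (near_chart cp H) => q cq dq; exact: holo_chart.
Qed.

Lemma hol_chart (g : V -> W) p : cdom c p -> hol g (c p) -> \forall q \near p, holo_fun (fun q => g (c q)) q.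
Proof.
move=> cp hg; apply/(near_holo_chart _ cp); apply: hol_eq hg.
by apply: filterS (near_img cp) => z [_ ->].
Qed.

End Charts.

Section GermSums.
Variable R : realType.
Notation K := (Cplx R).
Variables (V : normedModType K) (X : manifold V) (p : X).

Lemma germ_val_near (f : X -> K) (g : germ p) : (\forall q \near p, holo_fun f q) ->
  (\forall q \near p, germ_val g q = f q) -> g = germ_of p f.
Proof.
move=> hf e; rewrite -[g]germ_valK; apply/germ_ofP => //; exact: germ_val_holo.
Qed.

Lemma germ_val0 : \forall q \near p, germ_val (0 : germ p) q = 0.
Proof. by have := germ_valB (0 : germ p) 0; rewrite subr0; apply: filterS => q ->; rewrite subrr. Qed.

Lemma germ_valD (g h : germ p) : \forall q \near p, germ_val (g + h) q = germ_val g q + germ_val h q.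
Proof. by have := germ_valB (g + h) h; rewrite addrK; apply: filterS => q ->; rewrite subrK. Qed.

Lemma germ_val_sum N (a : 'I_N -> germ p) (f : 'I_N -> X -> K) :
  (forall i, \forall q \near p, holo_fun (f i) q) ->
  \forall q \near p, germ_val (\sum_i a i * germ_of p (f i)) q = \sum_i germ_val (a i) q * f i q.
Proof.
move=> hf; elim: (index_enum _) => [|i s ih].
  by rewrite big_nil; apply: filterS germ_val0 => q ->; rewrite big_nil.
have h1 := germ_valD (a i * germ_of p (f i)) (\sum_(j <- s) a j * germ_of p (f j)).
have h2 := germ_valM (a i) (germ_of p (f i)); have h3 := germ_of_val (hf i).
near=> q; rewrite !big_cons (near h1 q) // (near h2 q) // (near h3 q) //; congr (_ + _); near: q.
exact: ih.
Unshelve. all: by end_near.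
Qed.

End GermSums.

(** * Flatness over the parameter line *)

Section Flat.
Variables (A B : comPzRingType) (phi : {rmorphism A -> B}).

(** Multiplication by [a] on A is injective. Scalar multiplication from A x B to B is a tensor
    product, and through it the tensored map becomes multiplication by phi a, which is injective by
    flatness. *)
Lemma flat_regular (a : A) (b : B) : flat_morphism phi -> (forall x, a * x = 0 -> x = 0) ->
  phi a * b = 0 -> b = 0.
Proof.
move=> fl ha hb; pose M : lmodType A := restriction phi.
pose u (x : A^o) : A^o := a * x.
have lu : linear u by move=> k x y; rewrite /u mulrDr; congr (_ + _); rewrite -[_ *: _]/(_ * _) mulrCA.
have iu : injective u.
  by move=> x y e; apply/eqP; rewrite -subr_eq0; apply/eqP/ha; rewrite mulrBr; apply/eqP; rewrite subr_eq0; apply/eqP.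
pose bb (x : A^o) (m : M) : M := (x : A) *: m.
have tb : is_tensor_product bb.
  split; first split.
  - by move=> y k x x'; rewrite /bb scalerDl scalerA.
  - by move=> x k y y'; rewrite /bb scalerDr !scalerA mulrC.
  move=> P g [gl gr]; exists (g (1 : A)); split=> [|h [hl he]].
    split; first exact: gr.
    move=> x y; have lin1 := gl y x 1 0; have lin2 := gr 1 x y 0.
    have g0 : g 1 0 = 0 by have := gr 1 1 0 0; rewrite !scale1r addr0 -[X in X = _]addr0 => /addrI <-.
    have g0' : g 0 y = 0 by have := gl y 1 0 0; rewrite !scale1r addr0 -[X in X = _]addr0 => /addrI <-.
    have e1 : (x : A) *: (1 : A^o) + 0 = x by rewrite addr0; exact: mulr1.
    by move: lin1 lin2; rewrite e1 g0 g0' !addr0 => -> <-.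
  by apply/funext => m; rewrite -he /bb scale1r.
pose h (m : M) : M := a *: m.
have lh : linear h by move=> k x y; rewrite /h scalerDr !scalerA mulrC.
apply: (fl A^o A^o u lu iu M M bb bb tb tb h lh) => [x m|].
  by rewrite /h /bb /u scalerA.
by rewrite /h scaler0; exact: hb.
Qed.

End Flat.

Section ParameterLine.
Variable R : realType.
Notation K := (Cplx R).

Lemma parameter_regular (t : K) (x : @germ K K (vect_manifold K) t) :
  gm t (fun s => s - t) * x = 0 -> x = 0.
Proof.
have hx := gv_hol x; rewrite -{1 2}[x]gvK; move: (gv x) hx => g hg.
have ht : hol (fun s : K => s - t) t by apply: hol_sub; [exact: hol_id|exact: hol_cst].
rewrite gmM // gm0 => /gmP => /(_ (hol_mul ht hg) (hol_cst _ _)) e.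
apply/gmP => //; first exact: hol_cst.
have nz : \forall s \near t, s != t -> g s = 0.
  by apply: filterS e => s /eqP; rewrite mulf_eq0 subr_eq0 => /orP[->|/eqP].
have gt0 : g t = 0.
  apply: (zero_limit (hol_dif hg)) => r r0; move: nz => /near_nmP[r' r'0 hr].
  pose d : R := Num.min r r' / 2; have m0 : 0 < Num.min r r' by rewrite lt_min r0.
  have d0 : 0 < d by rewrite divr_gt0.
  have /andP[dr dr'] : (d < r) && (d < r') by rewrite -lt_min /d; lra.
  have nd : nm (t + (d%:C)%C - t) = d by rewrite addrC addKr nm_real gtr0_norm.
  exists (t + (d%:C)%C); first by rewrite nd.
  apply: hr; first by rewrite nd.
  by apply: contraTneq d0 => e1; rewrite -nd e1 subrr nm0 ltxx.
by apply: filterS nz => s h; have [->|/h] := eqVneq s t.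
Qed.

End ParameterLine.

(** * Contact forms *)

Section Frame.
Variable R : realType.
Notation K := (Cplx R).
Variable r : nat.
Local Notation E := 'rV[K]_r.+1.
Variable e : 'I_r -> E -> E.

(* The form w |-> det (e_1, .., e_r, w), whose kernel is spanned by the e_i. *)
Definition frame_form (j : 'I_r.+1) (v : E) : K := (-1) ^+ (@ord_max r + j) *
  \det (\matrix_(i < r, j' < r) e i v 0 (lift j j')).

Definition frame_mx (v w : E) : 'M[K]_r.+1 :=
  \matrix_(i, j) (if unlift ord_max i is Some i' then e i' v 0 j else w 0 j).

Lemma frame_formE v w : covec frame_form v w = \det (frame_mx v w).
Proof.
rewrite (expand_det_row _ ord_max); apply: eq_bigr => j _.
rewrite mxE unlift_none mulrC; congr (_ * (_ * \det _)).
by apply/matrixP => i j'; rewrite !mxE liftK.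
Qed.

Lemma hol_frame_form j z : (forall i, hol (e i) z) -> hol (frame_form j) z.
Proof.
move=> he; apply: hol_mul; first exact: hol_cst.
apply: (hol_det (a := fun i j' v => e i v 0 (lift j j'))) => i j'.
by apply: (hol_comp (f := e i) (g := fun x : E => x 0 (lift j j') : K) (he i)); exact: hol_coord.
Qed.

Lemma size_frame v : size [seq e i v | i : 'I_r] = r.
Proof. by rewrite size_image card_ord. Qed.

Lemma nth_frame v (i : 'I_r) : [seq e i v | i : 'I_r]`_i = e i v.
Proof. by rewrite /image_mem (nth_map i) ?nth_ord_enum // size_enum_ord. Qed.

Lemma mem_frame v (i : 'I_r) : e i v \in [seq e i v | i : 'I_r].
Proof. by apply: map_f; rewrite mem_enum. Qed.

Lemma frame_span v w : w \in <<[seq e i v | i : 'I_r]>>%VS -> exists a : 'I_r -> K, w = \sum_i a i *: e i v.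
Proof.
move=> h; have h' : w \in <<in_tuple [seq e i v | i : 'I_r]>>%VS by [].
pose c := cast_ord (esym (size_frame v)).
exists (fun i => coord (in_tuple [seq e i v | i : 'I_r]) (c i) w); rewrite {1}(coord_span h') (reindex c).
  by apply: eq_bigr => i _; rewrite -nth_frame.
by apply: onW_bij; exact: (Bijective (cast_ordK _) (cast_ordKV _)).
Qed.

Lemma frame_kernel v w : \dim <<[seq e i v | i : 'I_r]>>%VS = r ->
  (w \in <<[seq e i v | i : 'I_r]>>%VS) <-> covec frame_form v w = 0.
Proof.
move=> ds; split=> h.
  have lin := covec_lin frame_form v.
  have [a ->] := frame_span h.
  rewrite (big_morph _ (ellD lin) (ell0 lin)) big1 // => i _; rewrite (ellZ lin) frame_formE.
  rewrite (determinant_alternate (i1 := lift ord_max i) (i2 := ord_max)) ?mulr0 //.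
    by rewrite eq_sym neq_lift.
  by move=> j; rewrite !mxE liftK unlift_none.
move: h => /eqP; rewrite frame_formE => /det0P[u u0 uA].
have ue : \sum_i u 0 (lift ord_max i) *: e i v + u 0 ord_max *: w = 0.
  apply/rowP => j; move: uA => /rowP/(_ j); rewrite !mxE (bigD1_ord ord_max) //= !mxE unlift_none summxE => uj.
  apply: etrans uj; rewrite addrC; congr (_ + _); apply: eq_bigr => i _; by rewrite !mxE liftK.
have [um|um] := eqVneq (u 0 ord_max) 0.
  case/eqP: u0; apply/rowP => j; rewrite mxE; have [j' ->|->] := unliftP ord_max j; last by [].
  move: ue; rewrite um scale0r addr0 => ue.
  have /freeP : free (in_tuple [seq e i v | i : 'I_r]) by rewrite /free /= ds size_frame.
  rewrite /= size_frame => fr'; apply: (fr' (fun i => u 0 (lift ord_max i))).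
  by rewrite -[RHS]ue; apply: eq_bigr => i _; rewrite nth_frame.
have -> : w = - (u 0 ord_max)^-1 *: \sum_i u 0 (lift ord_max i) *: e i v.
  move: ue => /eqP; rewrite addrC addr_eq0 => /eqP ue.
  by rewrite scaleNr -scalerN -ue scalerA mulVf // scale1r.
by apply: memvZ; apply: memv_suml => i _; apply: memvZ; apply: memv_span; exact: mem_frame.
Qed.

Variables (D : E -> {vspace E}) (z0 : E).
Hypothesis he : \forall v \near z0, [/\ forall i, differentiable (e i) v,
  D v = <<[seq e i v | i : 'I_r]>>%VS & \dim (D v) = r].

Lemma hol_frame i : hol (e i) z0.
Proof. by apply: filterS he => v [h _ _]. Qed.

Lemma frame_form_kernel : \forall v \near z0, forall w, (w \in D v) <-> covec frame_form v w = 0.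
Proof. by apply: filterS he => v [_ -> d] w; exact: frame_kernel. Qed.

Lemma frame_section u : u \in D z0 -> exists xi : E -> E, [/\ hol xi z0, xi z0 = u &
  \forall v \near z0, xi v \in D v].
Proof.
have [_ -> _] := nbhs_singleton he; move=> /frame_span[a ->].
exists (fun v => \sum_i a i *: e i v); split=> //.
  by apply: hol_sum => i _; apply: hol_scale; exact: hol_frame.
apply: filterS he => v [_ -> _]; apply: memv_suml => i _; apply: memvZ; by apply: memv_span; exact: mem_frame.
Qed.

(** The identity theta (xi) = 0, differentiated. *)
Lemma section_derivative xi u : hol xi z0 -> (\forall v \near z0, xi v \in D v) ->
  covec frame_form z0 (dd xi z0 u) = - \sum_j dd (frame_form j) z0 u * xi z0 0 j.
Proof.
move=> hx xD; have ht j := hol_frame_form j hol_frame.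
have hxj j : hol (fun v => xi v 0 j) z0.
  by apply: (hol_comp (f := xi) (g := fun x : E => x 0 j : K) hx); exact: hol_coord.
have hm j : hol (fun v => frame_form j v * xi v 0 j) z0 by apply: hol_mul.
have e0 : dd (fun v => \sum_j frame_form j v * xi v 0 j) z0 u = 0.
  transitivity (dd (fun _ : E => 0 : K) z0 u); last exact: dd_cst.
  apply: dd_near_eq; last exact: dif_cst.
  by apply: filterS2 frame_form_kernel xD => v h /h.
apply/eqP; rewrite -addr_eq0 -[X in _ == X]e0; apply/eqP.
rewrite dd_sum; last by move=> j _; apply: hol_dif; exact: hm.
rewrite -big_split; apply: eq_bigr => j _ /=.
rewrite (dd_mul u (hol_dif (ht j)) (hol_dif (hxj j))) (dd_entry _ _ (hol_dif hx)).
by rewrite [X in _ + X]mulrC.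
Qed.

(** For sections of the distribution, d theta (xi, eta) = - theta ([xi, eta]); so the radical of d
    theta on the hyperplane is that of the Frobenius bracket. *)
Lemma frame_contact_unit :
  (forall u, u \in D z0 -> (forall w, w \in D z0 -> forall xi eta, hol xi z0 -> hol eta z0 ->
     (\forall v \near z0, xi v \in D v) -> (\forall v \near z0, eta v \in D v) ->
     xi z0 = u -> eta z0 = w -> dd eta z0 u - dd xi z0 w \in D z0) -> u = 0) ->
  contact_mx frame_form z0 \in unitmx.
Proof.
move=> nd; have kD := nbhs_singleton frame_form_kernel.
apply: contact_mx_unit.
  apply: contrapT => h; have [_ _] := nbhs_singleton he.
  have -> : D z0 = fullv.
    apply/vspaceP => w; rewrite memvf; apply/kD; apply: contrapT => hw; apply: h; exists w; exact/eqP.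
  by rewrite dimvf /dim /= mul1n => /eqP; rewrite eqn_leq ltnn.
move=> u /kD uD ou; apply: nd => // w /[dup] wD /kD tw xi eta hx hy xD yD xu yw.
apply/kD; have lin := covec_lin frame_form z0.
rewrite (ellB lin) !section_derivative // xu yw opprK addrC.
by have := ou w tw; rewrite /om => /eqP; rewrite subr_eq0 => /eqP ->; rewrite subrr.
Qed.

End Frame.

(** * The family in a chart *)

Lemma near_forallT (X : topologicalType) (T : finType) (P : T -> set X) (x : X) :
  (forall i, \forall y \near x, P i y) -> \forall y \near x, forall i, P i y.
Proof. exact: filter_forall. Qed.

Lemma near_and_top (X : topologicalType) (x : X) (A B : set X) :
  (\forall y \near x, A y) -> (\forall y \near x, B y) -> \forall y \near x, A y /\ B y.
Proof. exact: filterI. Qed.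

Section LocalData.
Variables (R : realType) (m : nat) (M : contact_manifold (Cplx R) m).
Notation K := (Cplx R).
Local Notation n := m.*2.+1.
Local Notation E := 'rV[K]_n.
Local Notation V := (E * K)%type.
Variables (Delta : set K) (Z : K -> set M).
Hypothesis hDelta0 : Delta 0.
Hypothesis hZ : forall t, Delta t -> legendrian (Z t).
Hypothesis hnormal : normal_subset (Z 0).
Variables (x0 : M) (c : chart M E).
Hypotheses (Xc : atlas c) (cx0 : cdom c x0) (hx0 : Z 0 x0).
Local Notation total := (prod_manifold M (vect_manifold K)).
Let cT : chart total V := prod_chart c (id_chart K).
Variable J : forall p : total, ideal (germ p).
Hypothesis J_flat : forall p : total, Delta p.2 -> ~ J p 1 -> flat_morphism (quot_pi (J p) \o @germ_snd _ _ _ _ _ p).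
Hypothesis J_fiber : forall t (x : M), Delta t -> @fiber_ideal _ _ _ J t x = [set g : germ x | vanishing (Z t) g].
Variables (U : set total) (N : nat) (f : 'I_N -> total -> K).
Hypotheses (U_open : open U) (Ux0 : U (x0, 0)) (UD : forall p, U p -> Delta p.2).
Hypothesis f_holo : forall i q, U q -> holo_fun (f i) q.
Hypothesis J_gen : forall q, U q -> forall g : germ q, J q g <-> exists a : 'I_N -> germ q, g = \sum_(i < N) a i * germ_of q (f i).

Let z0 := c x0.
Let p0 : V := (z0, 0).
Let Zt t : set E := [set z | Z t (cinv c z)].
Let ff i (q : V) : K := f i (cinv c q.1, q.2).
Let pt (q : V) : total := (cinv c q.1, q.2).
(** Points at which the chart inverse is genuine and the functions [f] generate the ideal. *)
Let ok (q : V) := [/\ cdom c (cinv c q.1), c (cinv c q.1) = q.1 & U (pt q)].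

Lemma total_atlas : atlas cT.
Proof. by exists c, (id_chart K). Qed.

Lemma near_ok : \forall q \near p0, ok q.
Proof.
have cT0 : cdom cT (x0, 0) by split.
have h1 := near_img cT0.
have h2 : \forall q \near cT (x0, 0), U (cinv cT q).
  by apply: chart_near => //; apply: open_nbhs_nbhs.
by apply: filterS2 h1 h2 => -[z t] [[h _] e] u; split; [exact: h|by case: e|exact: u].
Qed.

Section Point.
Variable q : V.
Hypothesis okq : ok q.
Let cq : cdom c (cinv c q.1). Proof. by case: okq. Qed.
Let eq1 : c (cinv c q.1) = q.1. Proof. by case: okq. Qed.
Let Uq : U (pt q). Proof. by case: okq. Qed.
Let cTq : cdom cT (pt q). Proof. by split. Qed.
Let cTE : cT (pt q) = q. Proof. by rewrite [RHS]surjective_pairing -[in RHS]eq1. Qed.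
Let Dq : Delta q.2. Proof. exact: (UD Uq). Qed.

Lemma near_pt (P : set total) : (\forall p \near pt q, P p) -> \forall y \near q, P (pt y).
Proof. by move=> h; have := chart_near cTq h; rewrite cTE. Qed.

Lemma near_cT (P : set V) : (\forall y \near q, P y) -> \forall p \near pt q, P (cT p).
Proof. by move=> h; apply: near_chart; rewrite ?cTE. Qed.

Lemma near_okq : \forall y \near q, ok y.
Proof.
have h1 := near_img cTq; rewrite cTE in h1.
have h2 : \forall y \near q, U (pt y) by apply: near_pt; apply: open_nbhs_nbhs.
by apply: filterS2 h1 h2 => -[z t] [[h _] e] u; split; [exact: h|by case: e|exact: u].
Qed.

Lemma holo_germ (H : V -> K) : hol H q -> \forall p \near pt q, holo_fun (fun p => H (cT p)) p.
Proof. by move=> hH; apply: (hol_chart total_atlas cTq); rewrite cTE. Qed.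

Lemma germ_hol (g : germ (pt q)) : hol (fun y => germ_val g (pt y)) q.
Proof. by have := germ_val_holo g => /(near_holo_chart total_atlas _ cTq); rewrite cTE. Qed.

Lemma near_f i : \forall p \near pt q, holo_fun (f i) p.
Proof.
have : \forall p \near pt q, U p by apply: open_nbhs_nbhs.
by apply: filterS => p; exact: f_holo.
Qed.

Lemma hol_f i : hol (ff i) q.
Proof. by have := near_f i => /(near_holo_chart total_atlas _ cTq); rewrite cTE. Qed.

Lemma J_germ (g : germ (pt q)) : J _ g <-> inI ff q (fun y => germ_val g (pt y)).
Proof.
split=> [/(J_gen Uq)[a ->]|[b [hb e]]].
  exists (fun i y => germ_val (a i) (pt y)); split=> [i|]; first exact: germ_hol.
  exact: (near_pt (germ_val_sum a near_f)).
apply/(J_gen Uq); exists (fun i => germ_of (pt q) (fun p => b i (cT p))).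
apply: germ_eqP.
have h1 := germ_val_sum (fun i => germ_of (pt q) (fun p => b i (cT p))) near_f.
have h2 : \forall p \near pt q, forall i, germ_val (germ_of (pt q) (fun p => b i (cT p))) p = b i (cT p).
  apply: near_forallT => i; apply: germ_of_val; exact: holo_germ.
have h3 := near_cT e; have h4 := near_dom cTq.
near=> p; rewrite (near h1 p) //.
have [cp _] : cdom cT p by near: p.
have ep : pt (cT p) = p by rewrite /pt /= cmapK // -surjective_pairing.
have : germ_val g (pt (cT p)) = \sum_i b i (cT p) * ff i (cT p) by near: p.
rewrite ep => ->; apply: eq_bigr => i _; rewrite (near h2 p) //; congr (_ * _).
by rewrite /ff -[(cinv c _, _)]/(pt (cT p)) ep.
Unshelve. all: by end_near.
Qed.

Lemma J_inI (H : V -> K) : hol H q -> J _ (germ_of (pt q) (fun p => H (cT p))) <-> inI ff q H.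
Proof.
move=> hH; rewrite J_germ.
have e : \forall y \near q, germ_val (germ_of (pt q) (fun p => H (cT p))) (pt y) = H y.
  have h1 := near_pt (germ_of_val (holo_germ hH)).
  by apply: filterS2 h1 near_okq => y -> [_ e _]; rewrite /= e -surjective_pairing.
by split=> h; apply: (inI_eq h); apply: filterS e => y ->.
Qed.

Lemma pullback_val (g : germ (pt q)) : \forall y \near cinv c q.1,
  germ_val (@germ_pullback _ _ _ _ _ (fun y : M => (y, q.2) : total) (cinv c q.1) g) y = germ_val g (y, q.2).
Proof.
apply: germ_of_val; apply/(near_holo_chart Xc _ cq); rewrite eq1.
exact: (hol_slice (germ_hol g)).
Qed.

Lemma J_vanish (g : germ (pt q)) : J _ g -> \forall y \near cinv c q.1, Z q.2 y -> germ_val g (y, q.2) = 0.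
Proof.
move=> Jg; have : @fiber_ideal _ _ _ J q.2 (cinv c q.1) (@germ_pullback _ _ _ _ _ (fun y : M => (y, q.2) : total) (cinv c q.1) g).
  by exists g.
rewrite J_fiber // /vanishing /=; apply: filterS2 (pullback_val g) => y e h /h; by rewrite e.
Qed.

Lemma J_lift (g : E -> K) : hol g q.1 -> (\forall y \near q.1, Zt q.2 y -> g y = 0) ->
  exists H, inI ff q H /\ \forall y \near q.1, H (y, q.2) = g y.
Proof.
move=> hg g0; pose g' := germ_of (cinv c q.1) (fun p => g (c p)).
have hg' : \forall p \near cinv c q.1, holo_fun (fun p => g (c p)) p.
  by apply: (hol_chart Xc cq); rewrite eq1.
have : [set g : germ (cinv c q.1) | vanishing (Z q.2) g] g'.
  have h : \forall p \near cinv c q.1, Zt q.2 (c p) -> g (c p) = 0.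
    by apply: (near_chart (P := fun y => Zt q.2 y -> g y = 0) cq); rewrite eq1.
  have h2 := near_dom cq; have h3 := germ_of_val hg'; rewrite /= /vanishing.
  near=> p; move=> Zp; rewrite (near h3 p) //; have cp : cdom c p by near: p.
  have : Zt q.2 (c p) -> g (c p) = 0 by near: p.
  by apply; rewrite /Zt /= cmapK.
rewrite -J_fiber // => -[G JG eG]; exists (fun y => germ_val G (pt y)); split; first by apply/J_germ.
have h1 := pullback_val G; rewrite eG in h1.
have h2 : \forall p \near cinv c q.1, germ_val G (p, q.2) = g (c p).
  by apply: filterS2 h1 (germ_of_val hg') => p <- ->.
have := chart_near cq h2; rewrite eq1 => h3; have h4 := near_img cq; rewrite eq1 in h4.
by apply: filterS2 h3 h4 => y e [_ ey]; rewrite /pt /= e ey.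
Unshelve. all: by end_near.
Qed.

(** At a point outside the closed set Z_t, the constant 1 vanishes on Z_t nearby for lack of points;
    it lifts to an element of the ideal with value 1, so not all generators vanish at the point. *)
Lemma J_support : Z q.2 (cinv c q.1) <-> forall i, ff i q = 0.
Proof.
split=> [Zq i|f0].
  have Jf : J _ (germ_of (pt q) (f i)).
    apply/(J_gen Uq); exists (fun j => if j == i then 1 else 0).
    by rewrite (bigD1 i) //= eqxx mul1r big1 ?addr0 // => j /negPf ->; rewrite mul0r.
  have e := nbhs_singleton (J_vanish Jf) Zq.
  by rewrite -e; apply/esym; exact: (nbhs_singleton (germ_of_val (near_f i))).
apply: contrapT => nZ.
have [[cl _] _ _] := hZ Dq.
have h : \forall y \near q.1, Zt q.2 y -> (1 : K) = 0.
  have : \forall p \near cinv c q.1, ~ Z q.2 p by apply: open_nbhs_nbhs; split=> //; exact: closed_openC.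
  by move=> /(chart_near cq); rewrite eq1; apply: filterS.
have [H [HJ e]] := J_lift (hol_cst (1 : K) q.1) h.
have := nbhs_singleton e; rewrite -surjective_pairing (inI_zero HJ f0) => /eqP.
by rewrite eq_sym oner_eq0.
Qed.

(** The centered coordinate is a nonzerodivisor in the ring of germs of the parameter line, so by
    flatness its pullback is a nonzerodivisor in the local ring of the total space. *)
Lemma J_regular (H : V -> K) : Z q.2 (cinv c q.1) -> hol H q ->
  inI ff q (fun y => (y.2 - q.2) * H y) -> inI ff q H.
Proof.
move=> Zq hH hin.
have J1 : ~ J _ (1 : germ (pt q)).
  move=> /J_vanish/nbhs_singleton/(_ Zq).
  by rewrite (nbhs_singleton (germ_val1 (pt q))) => /eqP; rewrite oner_eq0.
pose b := germ_of (pt q) (fun p => H (cT p)).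
have := flat_regular (b := quot_pi (J (pt q)) b) (J_flat (p := pt q) Dq J1) (@parameter_regular R q.2).
set a := gm q.2 _ => hb.
have ht : hol (fun y : V => y.2 - q.2) q by exact: tau_hol.
have ha : \forall s \near q.2, holo_fun (X := vect_manifold K) (fun s => s - q.2) s.
  by apply/near_holo_fun; apply: hol_sub; [exact: hol_id|exact: hol_cst].
have ab : @germ_snd _ _ _ M (vect_manifold K) (pt q) a * b = germ_of (pt q) (fun p => ((cT p).2 - q.2) * H (cT p)).
  apply: germ_val_near; first exact: (holo_germ (hol_mul ht hH)).
  have h1 := germ_valM (@germ_snd _ _ _ M (vect_manifold K) (pt q) a) b; have h2 := germ_sndE (p := pt q) a; have h3 := germ_of_val (holo_germ hH).
  have h4 := near_snd (p := pt q) (@germ_of_val K K (vect_manifold K) q.2 _ ha).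
  near=> p; rewrite (near h1 p) // (near h2 p) // (near h3 p) //; congr (_ * _).
  by near: p.
apply/(J_inI hH); rewrite -[germ_of _ _]subr0; apply/quot_piP; rewrite rmorph0; apply: hb => /=.
rewrite -rmorphM -(rmorph0 (quot_pi (J (pt q)))); apply/quot_piP; rewrite subr0 ab.
exact/(J_inI (hol_mul ht hH)).
Unshelve. all: by end_near.
Qed.

Lemma regular_smooth k (F : M -> 'rV[K]_k) : Z q.2 (cinv c q.1) ->
  regular_equations (Z q.2) (cinv c q.1) F -> smooth k Zt q.2 q.1.
Proof.
move=> Zq [W [oW Wq hF ZF sF]].
have nW : \forall p \near cinv c q.1, W p by apply: open_nbhs_nbhs.
have hFc : hol (fun z => F (cinv c z)) q.1.
  rewrite -[in hol _ _]eq1; apply/(near_holo_chart Xc _ cq).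
  by apply: filterS nW => p; exact: hF.
have sF' := sF c Xc cq; rewrite eq1 in sF'.
have /choice[b hb] : forall j : 'I_k, exists v, dd (fun z => F (cinv c z)) q.1 v = delta_mx 0 j.
  by move=> j; have [v hv] := sF' (delta_mx 0 j); exists v; rewrite ddE.
exists (fun i z => F (cinv c z) 0 i), b; split=> //.
- move=> i; apply: (hol_comp (f := fun z => F (cinv c z)) (g := fun x : 'rV[K]_k => x 0 i : K) hFc).
  exact: hol_coord.
- rewrite (_ : \matrix_(_, _) _ = 1%:M) ?unitmx1 //; apply/matrixP => i j.
  by rewrite !mxE (dd_entry _ _ (hol_dif hFc)) hb mxE eqxx.
have := chart_near cq nW; rewrite eq1; apply: filterS => z Wz.
rewrite /Zt /= ZF //; split=> [-> i|h]; first by rewrite mxE.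
by apply/rowP => i; rewrite mxE.
Qed.

(** Regularity is required in every chart of the atlas, hence the passage through the transition
    maps. *)
Lemma smooth_regular k (F : 'I_k -> E -> K) b : smooth_at Zt q.2 q.1 F b ->
  regular_equations (Z q.2) (cinv c q.1) (fun p => \row_i F i (c p)).
Proof.
move=> [hF ub ZF Zq].
have hrow : hol (fun z => \row_i F i z) q.1.
  apply: hol_mx => i j; rewrite (_ : (fun y => _) = F j) //; by apply/funext => y; rewrite mxE.
pose P p := [/\ holo_fun (fun p => \row_i F i (c p)) p & Z q.2 p <-> \row_i F i (c p) = 0].
have nP : \forall p \near cinv c q.1, P p.
  have h1 : \forall p \near cinv c q.1, holo_fun (fun p => \row_i F i (c p)) p.
    by apply: (hol_chart (g := fun z => \row_i F i z) Xc cq); rewrite eq1.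
  have h2 : \forall p \near cinv c q.1, Zt q.2 (c p) <-> forall i, F i (c p) = 0.
    by apply: (near_chart (P := fun x => Zt q.2 x <-> forall i, F i x = 0) cq); rewrite eq1.
  apply: filterS3 h1 h2 (near_dom cq) => p e1 e2 cp; split=> //.
  move: e2; rewrite /Zt /= cmapK // => ->; split=> [h|/rowP h i]; first by apply/rowP => i; rewrite !mxE.
  by have := h i; rewrite !mxE.
exists (interior P); split; [exact: open_interior|exact: nP|by move=> p /interior_subset[]|by move=> p /interior_subset[]|].
move=> c' Xc' c'q w.
have dr : differentiable (fun z => \row_i F i z) ((c \o cinv c') (c' (cinv c q.1))).
  by rewrite /= cmapK // eq1; exact: hol_dif.
have d1 := atlas_compatible Xc' Xc c'q cq.
have d2 := atlas_compatible Xc Xc' cq c'q; rewrite eq1 in d2.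
have [u hu] : exists u, dd (fun z => \row_i F i z) q.1 u = w.
  exists (\sum_j ((invmx (\matrix_(i, j) dd (F i) q.1 (b j)) *m w^T) j 0) *: b j).
  rewrite dd_sumr; apply/rowP => i; rewrite summxE.
  under eq_bigr do rewrite dd_scaler mxE -(dd_entry _ _ (hol_dif hrow)).
  have -> : w 0 i = ((\matrix_(i, j) dd (F i) q.1 (b j)) *m (invmx (\matrix_(i, j) dd (F i) q.1 (b j)) *m w^T)) i 0.
    by rewrite mulmxA mulmxV // mul1mx mxE.
  rewrite [RHS]mxE; apply: eq_bigr => j _; rewrite mulrC; congr (_ * _); rewrite mxE.
  congr (dd _ _ _); by apply/funext => z; rewrite mxE.
exists (dd (c' \o cinv c) q.1 u); rewrite -ddE.
rewrite (dd_comp (f := c \o cinv c') (g := fun z => \row_i F i z) _ d1 dr) /= cmapK // eq1 -[RHS]hu; congr (dd _ _ _).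
have d1' : differentiable (c \o cinv c') ((c' \o cinv c) q.1) := d1.
apply: (etrans (esym (dd_comp (f := c' \o cinv c) (g := c \o cinv c') u d2 d1'))).
transitivity (dd (fun x : E => x) q.1 u); last exact: dd_id.
apply: dd_near_eq; last by apply: hol_dif; exact: hol_id.
have h1 := near_img cq; rewrite eq1 in h1.
have h2 : \forall p \near cinv c q.1, cdom c' p by exact: near_dom.
have h3 := chart_near cq h2; rewrite eq1 in h3.
by apply: filterS2 h1 h3 => x [_ e] cx; rewrite /= cmapK.
Qed.

Lemma smooth_leg k (F : 'I_k -> E -> K) b w : smooth_at Zt q.2 q.1 F b ->
  (forall i, dd (F i) q.1 w = 0) -> w \in contact_D c (cinv c q.1).
Proof.
move=> sm dF; have [hF _ _ Zq] := sm; have [_ _ hL] := hZ Dq.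
apply: (hL _ _ _ Zq (smooth_regular sm) c w Xc cq).
have hrow : hol (fun z => \row_i F i z) q.1.
  apply: hol_mx => i j; rewrite (_ : (fun y => _) = F j) //; by apply/funext => y; rewrite mxE.
rewrite -ddE eq1.
rewrite (dd_near_eq (f := fun z => \row_i F i z)); last 2 first.
- have h1 := near_img cq; rewrite eq1 in h1.
  by apply: filterS h1 => x [_ e]; rewrite /= e.
- exact: hol_dif.
apply/rowP => i; rewrite mxE -(dd_entry _ _ (hol_dif hrow)) -(dF i).
congr (dd _ _ _); by apply/funext => z; rewrite mxE.
Qed.

End Point.

Lemma smooth_dense x (r : R) : ok (x, 0) -> Zt 0 x -> 0 < r ->
  exists y, nm (y - x) < r /\ smooth m.+1 Zt 0 y.
Proof.
move=> okx Zx r0; have [cx ex _] := okx; have [_ [cl dm] _] := hZ hDelta0.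
have nr : \forall p \near cinv c x, nm (c p - x) < r /\ ok (c p, 0).
  have h : \forall y \near (x : E), nm (y - x) < r /\ ok (y, 0).
    apply: near_and; last by have := near_slice (near_okq okx).
    by apply/near_nmP; exists r.
  by apply: (near_chart (P := fun y => nm (y - x) < r /\ ok (y, 0)) cx); rewrite /= ex.
have h := near_and_top nr (near_dom cx).
have [p [sp [[pr okp] cp]]] := cl _ Zx _ h.
exists (c p); split=> //; have := dm p _ _; move: sp => /[dup] nsp [Zp [k [F [hk rF]]]] _.
have e : k = m.+1 by apply: (@addnI m); rewrite hk addnS addnn.
move: F rF; rewrite e => F rF; apply: (regular_smooth okp (F := F)); rewrite /= cmapK //.
Qed.

Let G (a : E -> K) : germ x0 := germ_of x0 (fun p => a (c p)).
Let holG (a : E -> K) : hol a z0 -> \forall p \near x0, holo_fun (fun p : M => a (c p)) p.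
Proof. by move=> ha; apply: (hol_chart Xc cx0). Qed.

Lemma chart_germM a b : hol a z0 -> hol b z0 -> G a * G b = G (fun x => a x * b x).
Proof.
move=> ha hb; apply: germ_val_near; first exact: (holG (hol_mul ha hb)).
by apply: filterS3 (germ_valM (G a) (G b)) (germ_of_val (holG ha)) (germ_of_val (holG hb)) => p -> -> ->.
Qed.

Lemma chart_germD a b : hol a z0 -> hol b z0 -> G a + G b = G (fun x => a x + b x).
Proof.
move=> ha hb; apply: germ_val_near; first exact: (holG (hol_add ha hb)).
by apply: filterS3 (germ_valD (G a) (G b)) (germ_of_val (holG ha)) (germ_of_val (holG hb)) => p -> -> ->.
Qed.

Lemma chart_germX a d : hol a z0 -> G a ^+ d = G (fun x => a x ^+ d).
Proof.
move=> ha; elim: d => [|d ih]; last first.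
  rewrite exprS ih chart_germM; [|exact: ha|exact: hol_exp].
  by congr germ_of; apply/funext => p; rewrite exprS.
by rewrite expr0; apply: germ_val_near; [exact: (holG (hol_cst (1 : K) z0))|exact: germ_val1].
Qed.

Lemma chart_germ_sum (I : Type) (s : seq I) (a : I -> E -> K) : (forall i, hol (a i) z0) ->
  \sum_(i <- s) G (a i) = G (fun x => \sum_(i <- s) a i x).
Proof.
move=> ha; elim: s => [|i s ih].
  rewrite big_nil; apply: germ_val_near; first by apply: filterE => q ? _ _; under eq_fun do rewrite /= big_nil; exact: dif_cst.
  by apply: filterS (germ_val0 x0) => p ->; rewrite big_nil.
rewrite big_cons ih chart_germD //; last by apply: hol_sum.
by congr germ_of; apply/funext => p; rewrite big_cons.
Qed.

Lemma chart_germ_repr (g : germ x0) : exists2 a, hol a z0 & g = G a.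
Proof.
have hg := (near_holo_chart Xc _ cx0).1 (germ_val_holo g).
exists (fun z => germ_val g (cinv c z)); first exact: hg.
apply: germ_val_near; first exact: (holG hg).
by apply: filterS (near_dom cx0) => p cp; rewrite cmapK.
Qed.

Lemma chart_vanishing a : hol a z0 -> vanishing (Z 0) (G a) <-> \forall x \near z0, Zt 0 x -> a x = 0.
Proof.
move=> ha; have e := germ_of_val (holG ha); split=> h.
  have := chart_near cx0 (near_and_top e h); apply: filterS2 (near_img cx0) => x [_ ex] [/= e' h'] /h'.
  by rewrite e' ex.
apply: filterS3 e (near_chart cx0 h) (near_dom cx0) => p -> h' cp Zp; apply: h'.
by rewrite /Zt /= cmapK.
Qed.

Lemma normal_slice (a b : E -> K) : hol a z0 -> hol b z0 ->
  (forall d : E -> K, hol d z0 -> (\forall x \near z0, Zt 0 x -> b x * d x = 0) ->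
     \forall x \near z0, Zt 0 x -> d x = 0) ->
  (exists d (r : 'I_d -> E -> K), (forall i, hol (r i) z0) /\ \forall x \near z0, Zt 0 x ->
     a x ^+ d + \sum_(i < d) r i x * a x ^+ i * b x ^+ (d - i) = 0) ->
  exists d : E -> K, hol d z0 /\ \forall x \near z0, Zt 0 x -> a x = d x * b x.
Proof.
move=> ha hb breg [d [r [hr e]]]; pose VI := vanishing_ideal (Z 0) x0; pose pi := quot_pi VI.
have piP g : pi g = 0 <-> vanishing (Z 0) g.
  by rewrite -(rmorph0 (quot_pi VI)); split=> [/quot_piP|h]; [|apply/quot_piP]; rewrite subr0.
have pi_repr (y : local_ring (Z 0) x0) : exists2 a, hol a z0 & y = pi (G a).
  have [a' ha' e'] := chart_germ_repr (repr y); exists a' => //.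
  by rewrite /pi -e' quot_reprK.
have [||y] := hnormal hx0 (a := pi (G a)) (b := pi (G b)).
- move=> y; have [d' hd' ->] := pi_repr y; rewrite -rmorphM => /piP.
  rewrite chart_germM // => /(chart_vanishing (hol_mul hb hd')) h; apply/piP/(chart_vanishing hd').
  exact: breg.
- exists d, (fun i => pi (G (r i))).
  pose T i x := r i x * a x ^+ i * b x ^+ (d - i).
  have hT (i : 'I_d) : hol (T i) z0.
    by apply: hol_mul; [apply: hol_mul; [exact: hr|exact: hol_exp]|exact: hol_exp].
  have hS : hol (fun x => \sum_(i < d) T i x) z0 by apply: hol_sum => i _; exact: hT.
  rewrite (_ : _ + _ = pi (G (fun x => a x ^+ d + \sum_(i < d) T i x))).
    by apply/piP/chart_vanishing; [apply: hol_add; [exact: hol_exp|exact: hS]|exact: e].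
  rewrite -chart_germD //; last exact: hol_exp.
  rewrite -chart_germ_sum // /pi rmorphD /= rmorph_sum -chart_germX // rmorphXn; congr (_ + _).
  apply: eq_bigr => i _; rewrite /T -chart_germM; [|by apply: hol_mul; [exact: hr|exact: hol_exp]|exact: hol_exp].
  by rewrite -chart_germM; [|exact: hr|exact: hol_exp]; rewrite -!chart_germX // !rmorphM /= !rmorphXn.
have [d' hd' ->] := pi_repr y; rewrite -rmorphM chart_germM // => /quot_piP h.
exists d'; split=> //.
have hm := hol_mul hd' hb; have hs : hol (fun x => a x - d' x * b x) z0 by exact: hol_sub.
have : vanishing (Z 0) (G (fun x => a x - d' x * b x)).
  rewrite (_ : G _ = G a - G (fun x => d' x * b x)) //; apply/esym/germ_val_near; first exact: (holG hs).
  by apply: filterS3 (germ_valB (G a) (G (fun x => d' x * b x))) (germ_of_val (holG ha)) (germ_of_val (holG hm)) => p -> -> ->.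
move=> /(chart_vanishing hs); apply: filterS => x h' /h'/eqP; by rewrite subr_eq0 => /eqP.
Qed.
(** The contact form is the determinant form of a local frame of the distribution; the radius is
    such that throughout the ball the points are [ok] and the distribution is the kernel of this
    form. *)
Theorem local_data : exists (rad : R) (th : 'I_n -> E -> K),
  [/\ local_family m.+1 z0 rad ff Zt th, contact_mx th z0 \in unitmx &
    forall q, nm (q - p0) < rad -> ok q /\ forall w, w \in contact_D c (cinv c q.1) <-> covec th q.1 w = 0].
Proof.
have [_ sub] := contact_subbundle M; have [e he] := sub c x0 Xc cx0.
pose D v := contact_D c (cinv c v).
have he' : \forall v \near z0, [/\ forall i, differentiable (e i) v,
  D v = <<[seq e i v | i : 'I_m.*2]>>%VS & \dim (D v) = m.*2] by exact: he.
pose th := frame_form e.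
have hD := frame_form_kernel he'.
have nD : \forall q \near p0, forall w, w \in D q.1 <-> covec th q.1 w = 0.
  by apply: (near_comp (f := fst) (P := fun x => forall w, w \in D x <-> covec th x w = 0)); [exact: hol_fst|].
have /near_nmP[rad rad0 hrad] := near_and near_ok nD.
exists rad, th; split; last exact: hrad; last first.
  apply: (frame_contact_unit he') => u uD h.
  have D0 : D z0 = contact_D c x0 by rewrite /D cmapK.
  have nd := @contact_nondegenerate _ _ M c x0 Xc cx0 u.
  rewrite -D0 in nd; apply: (nd uD) => w wD.
  have [xi [hx xu xD]] := frame_section he' uD.
  have [eta [hy yw yD]] := frame_section he' wD.
  exists xi, eta; split=> //.
  - by apply: filterS2 hx xD => v d1 d2; split.
  - by apply: filterS2 hy yD => v d1 d2; split.
  - have hb := h w wD xi eta hx hy xD yD xu yw; rewrite D0 2!ddE in hb.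
    have -> : 0 - lie_bracket xi eta (c x0) = - ('d eta z0 u - 'd xi z0 w).
      by rewrite sub0r -xu -yw.
    by rewrite memvN; exact: hb.
have okr q : nm (q - p0) < rad -> ok q by move=> /hrad[].
split.
- exact: rad0.
- by move=> q /okr okq i; exact: hol_f.
- by move=> x t /okr okq; have := J_support okq.
- by move=> q H /okr okq Zq hH; exact: (J_regular okq Zq hH).
- by move=> x t g /okr okq hg g0; have := J_lift okq hg g0.
- by move=> x /okr okx Zx r r0; exact: smooth_dense.
- by rewrite /Zt /= cmapK.
- by move=> j; apply: hol_frame_form; exact: (hol_frame he').
- move=> t z F b w zr sm dF; have [okz hw] := hrad _ zr.
  by apply/hw; exact: (smooth_leg okz sm dF).
- exact: normal_slice.
Qed.

End LocalData.

(** * Contactomorphisms *)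

Section ChartMaps.
Variables (R : realType) (m : nat) (M : contact_manifold (Cplx R) m).
Notation K := (Cplx R).
Local Notation E := 'rV[K]_m.*2.+1.
Variable c : chart M E.
Hypothesis Xc : atlas c.

Lemma chart_map_dif (S : E -> E) (p : M) c1 c2 : cdom c p -> hol S (c p) ->
  cdom c (cinv c (S (c p))) -> c (cinv c (S (c p))) = S (c p) -> atlas c1 -> atlas c2 -> cdom c1 p ->
  cdom c2 (cinv c (S (c p))) ->
  let F := fun v => c2 (cinv c (S (c (cinv c1 v)))) in
  differentiable F (c1 p) /\
  forall v, dd F (c1 p) v = dd (c2 \o cinv c) (S (c p)) (dd S (c p) (dd (c \o cinv c1) (c1 p) v)).
Proof.
move=> cp hS cS eS X1 X2 c1p c2p F.
have d1 := atlas_compatible X1 Xc c1p cp.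
have d2 : differentiable S ((c \o cinv c1) (c1 p)) by rewrite /= (cmapK c1p); exact: hol_dif.
have d3 := atlas_compatible Xc X2 cS c2p; rewrite eS in d3.
have d12 := dif_comp (f := c \o cinv c1) (g := S) d1 d2.
have d3' : differentiable (c2 \o cinv c) (S ((c \o cinv c1) (c1 p))) by rewrite /= (cmapK c1p); exact: d3.
split; first exact: (dif_comp (f := fun v => S ((c \o cinv c1) v)) (g := c2 \o cinv c) d12 d3').
move=> v; rewrite (dd_comp (f := fun v => S ((c \o cinv c1) v)) (g := c2 \o cinv c) v d12 d3').
by rewrite (dd_comp (f := c \o cinv c1) (g := S) v d1 d2) /= (cmapK c1p).
Qed.

Lemma chart_map_holo (S : E -> E) (p : M) : cdom c p -> hol S (c p) ->
  cdom c (cinv c (S (c p))) -> c (cinv c (S (c p))) = S (c p) ->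
  holo_map (fun p : M => cinv c (S (c p))) p.
Proof.
move=> cp hS cS eS; split.
  have c1 := cmap_continuous cp; have c2 := differentiable_continuous (hol_dif hS).
  have c3 := cinv_continuous cS; rewrite eS in c3.
  by apply: (@continuous_comp _ _ _ (fun p => S (c p)) (cinv c) p _ c3); exact: continuous_comp c1 c2.
by move=> c1 c2 X1 X2 c1p c2p; case: (chart_map_dif cp hS cS eS X1 X2 c1p c2p).
Qed.

Variables (x0 : M) (T g : E -> E) (r r' : R) (Z1 Z2 : set M).
Let z0 := c x0.
Hypotheses (cx0 : cdom c x0) (r0 : 0 < r) (r'0 : 0 < r').
Hypothesis hT : forall x, nm (x - z0) < r -> [/\ hol T x, cdom c (cinv c x) /\ c (cinv c x) = x,
  cdom c (cinv c (T x)) /\ c (cinv c (T x)) = T x, Z1 (cinv c x) <-> Z2 (cinv c (T x)) &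
  forall w, w \in contact_D c (cinv c x) <-> dd T x w \in contact_D c (cinv c (T x))].
Hypothesis hg : forall y, nm (y - T z0) < r' -> [/\ hol g y, nm (g y - z0) < r & T (g y) = y].
Hypothesis gT : forall x, nm (x - z0) < r -> nm (T x - T z0) < r' -> g (T x) = x.

(** The neighborhoods are cut out by the balls on which [T] and its local inverse [g] are
    controlled. The compatibility of the distribution with transition maps carries the statement
    from the chart [c] to all charts. *)
Lemma chart_contactomorphic : contactomorphic Z1 x0 Z2 (cinv c (T z0)).
Proof.
pose U1 : set M := [set p | cdom c p /\ (nm (c p - z0) < r /\ nm (T (c p) - T z0) < r')].
pose U2 : set M := [set q | cdom c q /\ nm (c q - T z0) < r'].
pose phi (p : M) := cinv c (T (c p)); pose psi (q : M) := cinv c (g (c q)).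
have zz : nm (z0 - z0) < r by rewrite subrr nm0.
have [hol0 _ [cT0 eT0] _ _] := hT zz.
have oU1 : open U1.
  rewrite openE => p [cp [p1 p2]]; apply: (near_and_top (near_dom cp)).
  apply: (near_chart (P := fun x => nm (x - z0) < r /\ nm (T x - T z0) < r') cp).
  apply: near_and; first exact: (ball_near (P := fun x => nm (x - z0) < r) _ p1).
  have [hTp _ _ _ _] := hT p1.
  apply: (near_comp (P := fun y => nm (y - T z0) < r') hTp).
  exact: (ball_near (P := fun y => nm (y - T z0) < r') _ p2).
have oU2 : open U2.
  rewrite openE => p [cp p2]; apply: (near_and_top (near_dom cp)).
  apply: (near_chart (P := fun x => nm (x - T z0) < r') cp).
  exact: (ball_near (P := fun y => nm (y - T z0) < r') _ p2).
have phi12 p : U1 p -> U2 (phi p) /\ psi (phi p) = p.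
  move=> [cp [p1 p2]]; have [_ _ [cT eT] _ _] := hT p1.
  by split; [split=> //; rewrite /phi eT|rewrite /psi /phi eT gT // cmapK].
have psi21 q : U2 q -> U1 (psi q) /\ phi (psi q) = q.
  move=> [cq q2]; have [_ g1 Tg] := hg q2; have [_ [cg eg] _ _ _] := hT g1.
  by split; [split=> //; rewrite /psi eg Tg|rewrite /psi /phi eg Tg cmapK].
exists U1, U2, phi; split.
- by split=> //; split=> //; rewrite !subrr !nm0.
- by split=> //; split=> //; rewrite eT0 subrr nm0.
- split.
    exists psi; split=> //.
    + move=> p [cp [p1 p2]]; have [hTp _ [cT eT] _ _] := hT p1; exact: chart_map_holo.
    + move=> q [cq q2]; have [hgq g1 Tg] := hg q2; have [_ [cg eg] _ _ _] := hT g1.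
      exact: chart_map_holo.
  move=> p c1 c2 [cp [p1 p2]] X1 X2 c1p c2p; have [hTp _ [cT eT] _ hD] := hT p1.
  have [comp _] := contact_subbundle M.
  have D1 := comp _ _ _ X1 Xc c1p cp; have D2 := comp _ _ _ Xc X2 cT c2p.
  have [_ eF] := chart_map_dif cp hTp cT eT X1 X2 c1p c2p.
  have hD' w : w \in contact_D c p <-> dd T (c p) w \in contact_D c (phi p).
    by have := hD w; rewrite cmapK.
  have [hgq g1 Tg] := hg p2.
  have Tgd v : dd T (c p) (dd g (T (c p)) v) = v.
    have dT' : differentiable T (g (T (c p))) by rewrite gT //; exact: hol_dif.
    have e := dd_comp (f := g) (g := T) v (hol_dif hgq) dT'; rewrite gT // in e.
    rewrite -e; transitivity (dd (fun x : E => x) (T (c p)) v); last exact: dd_id.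
    apply: dd_near_eq; last by apply: hol_dif; exact: hol_id.
    by apply: (ball_near (P := fun y => y = T (g y)) _ p2) => y /hg[].
  apply/seteqP; split=> y /=.
    move=> [u uD <-]; rewrite -ddE.
    have uD' : dd (c \o cinv c1) (c1 p) u \in contact_D c p.
      by change ([set` contact_D c p] (dd (c \o cinv c1) (c1 p) u)); rewrite D1; exists u => //; rewrite ddE.
    change ([set` contact_D c2 (phi p)] (dd (fun v => c2 (cinv c (T (c (cinv c1 v))))) (c1 p) u)).
    rewrite D2 eF; exists (dd T (c p) (dd (c \o cinv c1) (c1 p) u)); first exact/hD'.
    by rewrite -ddE eT.
  move=> yD; have : [set` contact_D c2 (phi p)] y by [].
  rewrite D2 => -[v vD <-].
  have : [set` contact_D c p] (dd g (T (c p)) v) by apply/hD'; rewrite Tgd.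
  rewrite D1 => -[u uD eu]; exists u => //.
  have eu' : dd (c \o cinv c1) (c1 p) u = dd g (T (c p)) v by rewrite ddE.
  have := eF u; rewrite eu' Tgd ddE => e; apply: (etrans e).
  by rewrite eT ddE.
- by [].
apply/seteqP; split=> q /=.
  move=> [p [Zp U1p] <-]; split; last by case: (phi12 _ U1p).
  have [cp [p1 p2]] := U1p; have [_ _ _ h _] := hT p1.
  by rewrite /phi -h cmapK.
move=> [Zq U2q]; have [U1p ep] := psi21 _ U2q; exists (psi q) => //; split=> //.
have [cq q2] := U2q; have [_ g1 Tg] := hg q2; have [_ _ _ h _] := hT g1.
by rewrite /psi h Tg cmapK.
Qed.

End ChartMaps.

Theorem theorem1p5 (R : realType) (m : nat) (hm : (0 < m)%N)
  (Delta : set (Cplx R)) (hDelta : open Delta) (hDelta0 : Delta 0)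
  (M : contact_manifold (Cplx R) m) (Z : Cplx R -> set M)
  (hZ : forall t, Delta t -> legendrian (Z t))
  (hfam : holomorphic_family Delta Z)
  (hnormal : forall t, Delta t -> normal_subset (Z t))
  (x0 : M) (hx0 : Z 0 x0) :
  exists (Delta' : set (Cplx R)) (x : Cplx R -> M),
    [/\ [/\ open Delta', Delta' 0 & Delta' `<=` Delta],
        forall t, Delta' t ->
          holo_map (x : vect_manifold (Cplx R) -> M) t,
        x 0 = x0,
        forall t, Delta' t -> Z t (x t) &
        forall t, Delta' t -> contactomorphic (Z 0) x0 (Z t) (x t)].
Proof.
have [c Xc cx0] := atlas_cover x0.
have [J [J_sub J_flat J_fib]] := hfam.
have [U [N [f [[oU Ux UD] f_holo J_gen]]]] := J_sub (x0, 0) hDelta0.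
have [rad [th [L uA hok]]] := local_data hDelta0 hZ (hnormal 0 hDelta0) Xc cx0 hx0 J_flat J_fib oU Ux UD f_holo J_gen.
(* The codimension m + 1 of a Legendrian subvariety is half of n + 1, where n = 2 m + 1 is the
   dimension of [M]. *)
have [Phi [r [r0 [flow inverse]]]] := contact_flow L (esym (doubleS m)) uA.
pose z0 := c x0.
have zz : nm (z0 - z0) < r by rewrite subrr nm0.
have tt : nm (0 : Cplx R) < r by rewrite nm0.
exists [set t | nm t < r], (fun t => cinv c (Phi (z0, t))).
have P0 : Phi (z0, 0) = z0 by case: (flow z0 0 zz tt).
have okP x t : nm (x - z0) < r -> nm t < r ->
    [/\ cdom c (cinv c (Phi (x, t))), c (cinv c (Phi (x, t))) = Phi (x, t), U (cinv c (Phi (x, t)), t) &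
     forall w, w \in contact_D c (cinv c (Phi (x, t))) <-> covec th (Phi (x, t)) w = 0].
  by move=> xr tr; have [_ _ /hok[[a b d] h] _ _] := flow x t xr tr.
split=> [|t /= tr||t /= tr|t /= tr].
- split=> //= [|t tr]; last by have [_ _ /UD] := okP z0 t zz tr.
  rewrite openE => t tr; apply: (ball_near (x := 0 : Cplx R) (P := fun s => nm s < r) (r := r)); last by rewrite subr0.
  by move=> s; rewrite subr0.
- have [hP _ _ _ _] := flow z0 t zz tr; have [cP eP _ _] := okP z0 t zz tr.
  have [dP _] := time_slice (hol_dif hP).
  split.
    have c3 := cinv_continuous cP; rewrite eP in c3.
    apply: (@continuous_comp _ _ _ (fun t => Phi (z0, t)) (cinv c) t _ c3).
    exact: differentiable_continuous.
  move=> _ d -> Xd _ dx; have d3 := atlas_compatible Xc Xd cP dx; rewrite eP in d3.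
  exact: (dif_comp (f := fun t => Phi (z0, t)) (g := d \o cinv c) dP d3).
- by rewrite P0 cmapK.
- by have [_ _ _ [h _] _] := flow z0 t zz tr; apply: h; rewrite /= cmapK.
have [g [hg gT]] := inverse t tr.
have rr : 0 < r / 4 by rewrite divr_gt0.
apply: (@chart_contactomorphic R m M c Xc x0 (fun x => Phi (x, t)) g r (r / 4)) => //.
- move=> x xr; have [hP P0x inW ZZ cw] := flow x t xr tr.
  have [cP eP _ kP] := okP x t xr tr; have [c0 e0 _ k0] := okP x 0 xr tt; rewrite P0x in c0 e0 k0.
  split=> //; first exact: (hol_comp (f := fun x => (x, t)) (slice_hol t x).1 hP).
  by move=> w; rewrite k0 kP cw; have [_ ->] := space_slice w (hol_dif hP).
Qed.
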